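(* Consider the linear problem ($F=0$) and its semi-discrete HDG approximation described in the context, and suppose that the exact solution satisfies $$(u,q,p)\in W^{2,\infty}((0,T];H^{k+1}(\mathcal T_h))\times W^{1,\infty}((0,T];H^{k+1}(\mathcal T_h))\times W^{1,\infty}((0,T];H^{k+1}(\mathcal T_h)).$$ Suppose the stabilization function satisfies $$\tau_{qu}^->0,\qquad \tau_{qu}^-\tau_{qp}^-=1,\qquad \tau_{qu}^+\in[0,1],\qquad \tau_{pu}^+\in\Big[-1-\sqrt{1-(\tau_{qu}^+)^2},\ -\tfrac12-\tfrac12(\tau_{qu}^+)^2\Big],$$ and that $k>0$ and $h$ is small enough. Then the errors $e_u=u-u_h$, $e_q=q-q_h$, $e_p=p-p_h$, $e_{u_t}=(u-u_h)_t$ satisfy $$\|e_u(t)\|+\|e_q(t)\|+\|e_p(t)\|+\|e_{u_t}(t)\|\le C\,h^{k+1}\qquad\text{for }0\le t\le T,$$ where $C$ is independent of $h$.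
   Context: **Problem.** $\Omega=(a,b)$, $T>0$; $u_t+u_{xxx}=f$ in $\Omega\times(0,T]$, $u=u_0$ at $t=0$, $u=u_D$ on $\partial\Omega=\{a,b\}$, $u_x=q_N$ on $\partial\Omega_N=\{b\}$. Set $q=u_x$, $p=q_x$, so $u_t+p_x=f$. **Mesh and notation.** $a=x_0<\dots<x_N=b$, $I_i=(x_{i-1},x_i)$, $h_i=x_i-x_{i-1}$, $h=\max_ih_i$, $\mathcal T_h=\{I_i\}_{i=1}^N$, $\mathscr E_h=\{x_i\}_{i=0}^N$, and $\partial\mathcal T_h$ is the collection of the boundaries $\partial I_i=\{x_{i-1}^+,x_i^-\}$. $H^s(\mathcal T_h)$ is the space of functions whose restriction to each $I_i$ is in $H^s(I_i)$. A superscript $+$ (resp. $-$) denotes values at the points $x_{i-1}^+$ (resp. $x_i^-$), $i=1,\dots,N$; for element-wise functions these are one-sided traces from inside $I_i$. Functions on $\mathscr E_h$ are single-valued at nodes. The normal is $n(x_{i-1}^+)=-1$, $n(x_i^-)=1$. $(\varphi,v)=\sum_i\int_{I_i}\varphi v\,dx$, with element-wise derivatives, and $\langle\varphi,vn\rangle=\sum_{i=1}^N[\varphi(x_i^-)v(x_i^-)-\varphi(x_{i-1}^+)v(x_{i-1}^+)]$. $\|\cdot\|$ is the $L^2(\Omega)$ norm. **Spaces.** $W_h^k=\{w\in L^2(\Omega):w|_{I_i}\in P_k(I_i)\ \forall i\}$; $M_h(g)$ is the set of functions on $\mathscr E_h$ equal to $g$ on $\{a,b\}$; $\tilde M_h$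 is the set of functions on $\mathscr E_h\setminus\{a\}$. **HDG method (semi-discrete in time).** At each time $t$, $(u_h,q_h,p_h,\widehat u_h,\widehat p_h^{\,-})\in W_h^k\times W_h^k\times W_h^k\times M_h(u_D)\times\tilde M_h$ satisfies, for all $v,z,w\in W_h^k$, $\mu\in\tilde M_h$, $\chi\in M_h(0)$, $$(q_h,v)+(u_h,v_x)-\langle\widehat u_h,vn\rangle=0,\quad (p_h,z)+(q_h,z_x)-\langle\widehat q_h,zn\rangle=0,\quad ((u_h)_t,w)-(p_h,w_x)+\langle\widehat p_h,wn\rangle=(f,w),$$ $$\langle\widehat q_h,\mu n\rangle=q_N\mu(b)\ (\text{point }x_0^+\text{ omitted}),\qquad\langle\widehat p_h,\chi n\rangle=0,$$ with $\widehat p_h(x_i^-)=\widehat p_h^{\,-}(x_i)$ and numerical traces $$\widehat p_h^{\,+}=p_h^++\tau_{pu}^+(\widehat u_h-u_h^+)n^+,\quad \widehat q_h^{\,+}=q_h^++\tau_{qu}^+(\widehat u_h-u_h^+)n^+,\quad \widehat q_h^{\,-}=q_h^-+\tau_{qu}^-(\widehat u_h-u_h^-)n^-+\tau_{qp}^-(\widehat p_h^{\,-}-p_h^-)n^-.$$ The components $\tau_{qu}^+,\tau_{pu}^+,\tau_{qu}^-,\tau_{qp}^-$ of the stabilization function are real constants. **Initial approximation.** At $t=0$, $(u_h,q_h,p_h,\widehat u_h,\widehat p_h^{\,-})$ is the HDG solution of the stationary problem $v+v_{xxx}=g$ with $g=u_0+(u_0)_{xxx}$: it satisfies the same equations with boundary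 data at $t=0$ and the same numerical traces, except that the third equation is replaced by $(u_h,w)-(p_h,w_x)+\langle\widehat p_h,wn\rangle=(g,w)$. *)

(* Defs.v *)
From HB Require Import structures.
From mathcomp Require Import all_boot all_order all_algebra.
From mathcomp Require Import all_classical all_reals all_analysis.

Set Implicit Arguments.
Unset Strict Implicit.
Unset Printing Implicit Defensive.

Import Order.TTheory GRing.Theory Num.Theory.
Import numFieldNormedType.Exports.
Local Open Scope classical_set_scope.
Local Open Scope ring_scope.

Section FunctionSpaces.
Context {R : realType}.
Local Notation mu := (@lebesgue_measure R).

(* The norm of L^2(c, d), with value +oo when v is not square integrable. *)
Definition L2norm (c d : R) (v : R -> R) : \bar R :=
  ('N[mu]_2%:E[EFin \o (v \_ `]c, d[)])%E.

(* phi belongs to C^1_c((c, d)), extended by zero to the line. *)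
Definition test_function (c d : R) (phi : R -> R) : Prop :=
  [/\ forall x, derivable phi x 1,
      continuous (derive1 phi) &
      exists c' d', [/\ c < c', d' < d &
        forall x, x \notin `[c', d'] -> phi x = 0]].

(* w is the weak derivative of v on (c, d). *)
Definition weak_deriv (c d : R) (v w : R -> R) : Prop :=
  [/\ mu.-integrable `]c, d[ (EFin \o v),
      mu.-integrable `]c, d[ (EFin \o w) &
      forall phi, test_function c d phi ->
        \int[mu]_(x in `]c, d[) (v x * derive1 phi x) =
        - \int[mu]_(x in `]c, d[) (w x * phi x)].

(* v belongs to H^s(c, d), with norm at most K. *)
Definition sobolev_le (c d : R) (s : nat) (K : R) (v : R -> R) : Prop :=
  exists D : nat -> R -> R,
    [/\ D 0%N = v,
        forall j, (j <= s)%N -> measurable_fun `]c, d[ (D j),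
        forall j, (j < s)%N -> weak_deriv c d (D j) (D j.+1) &
        (0 <= K) /\
        (\sum_(j < s.+1) L2norm c d (D j) ^+ 2 <= (K ^+ 2)%:E)%E].

(* l is the derivative of v at t relative to D; it is one-sided at the end
   points when D is an interval. *)
Definition deriv_within (D : set R) (v : R -> R) (t l : R) : Prop :=
  (v s - v t) / (s - t) @[s --> within D (t^')] --> l.

End FunctionSpaces.

Record mesh (R : realType) (a b : R) := Mesh {
  nelt : nat;
  node : nat -> R; (* only the values at 0, ..., nelt matter *)
  node_first : node 0 = a;
  node_last : node nelt = b;
  node_lt : forall i, (i < nelt)%N -> node i < node i.+1
}.

(* Elements are numbered from 0: element i is (node i, node i.+1). *)
Definition mesh_size (R : realType) (a b : R) (m : mesh a b) : R :=
  \big[Num.max/0]_(i < nelt m) (node m i.+1 - node m i).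

Section BochnerSpaces.
Context {R : realType} {a b : R}.
Local Notation mu := (@lebesgue_measure R).

(* v belongs to L^oo((0, T]; H^s(T_h)).  The function v is written v t x.
   Strongly measurable maps into the separable space H^s(T_h) are the maps that
   have a jointly measurable representative, and since there are finitely many
   elements the broken norm is essentially bounded in time iff the norms on the
   elements are. *)
Definition bochner_Linfty (m : mesh a b) (T : R) (s : nat) (v : R -> R -> R) :
    Prop :=
  measurable_fun (`]0, T] `*` `]a, b[) (fun z : R * R => v z.1 z.2) /\
  exists K : R, {ae mu, forall t : R, t \in `]0, T] ->
    forall i : 'I_(nelt m), sobolev_le (node m i) (node m i.+1) s K (v t)}.

(* g is the weak time derivative of v: the Bochner integrals of v * phi' and
   - g * phi over (0, T) are the same element of L^2(a, b). *)
Definition weak_tderiv (T : R) (v g : R -> R -> R) : Prop :=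
  forall phi, test_function 0 T phi ->
    {ae mu, forall x, x \in `]a, b[ ->
      \int[mu]_(t in `]0, T[) (v t x * derive1 phi t) =
      - \int[mu]_(t in `]0, T[) (g t x * phi t)}.

(* v belongs to W^{r,oo}((0, T]; H^s(T_h)). *)
Definition bochner_Winfty (m : mesh a b) (T : R) (r s : nat)
    (v : R -> R -> R) : Prop :=
  exists V : nat -> R -> R -> R,
    [/\ V 0%N = v,
        forall j, (j <= r)%N -> bochner_Linfty m T s (V j) &
        forall j, (j < r)%N -> weak_tderiv T (V j) (V j.+1)].

(* u solves u_t + u_xxx = f with its initial and boundary data; q = u_x,
   p = q_x, px = p_x and ut = u_t.  The x-derivatives are weak derivatives on
   the whole of (a, b), and u, q, p are the representatives that are continuous
   in x, so that their values at the boundary make sense. *)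
Definition exact_solution (T : R) (f : R -> R -> R) (u0 : R -> R)
    (uD : R -> R -> R) (qN : R -> R) (u q p ut px : R -> R -> R) : Prop :=
  [/\ forall t : R, t \in `[0, T] ->
        [/\ {within `[a, b], continuous (u t)},
            {within `[a, b], continuous (q t)} &
            {within `[a, b], continuous (p t)}],
      forall t : R, t \in `[0, T] ->
        [/\ weak_deriv a b (u t) (q t),
            weak_deriv a b (q t) (p t) &
            weak_deriv a b (p t) (px t)],
      forall (t x : R), t \in `[0, T] -> x \in `]a, b[ ->
        deriv_within `[0, T] (fun s => u s x) t (ut t x),
      forall t : R, t \in `]0, T] ->
        {ae mu, forall x, x \in `]a, b[ -> ut t x + px t x = f t x} &
      (forall x, x \in `[a, b] -> u 0 x = u0 x) /\
      (forall t : R, t \in `[0, T] ->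
        [/\ u t a = uD t a, u t b = uD t b & q t b = qN t])].

End BochnerSpaces.

Record stabilization (R : realType) := Stabilization {
  tau_qu_p : R; (* tau_qu^+ *)
  tau_pu_p : R; (* tau_pu^+ *)
  tau_qu_m : R; (* tau_qu^- *)
  tau_qp_m : R  (* tau_qp^- *)
}.

(* The two end points of an element seen from inside: Plus is x_{i-1}^+ (left
   end), Minus is x_i^- (right end). *)
Inductive side := Plus | Minus.

Definition normal (R : realType) (s : side) : R :=
  match s with Plus => -1 | Minus => 1 end.

(* A discrete function is given by its polynomial on each element. *)
Record hdg_state (R : realType) (N : nat) := HdgState {
  uh : 'I_N -> {poly R};
  qh : 'I_N -> {poly R};
  ph : 'I_N -> {poly R};
  uhat : nat -> R;  (* indexed by the nodes 0, ..., N *)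
  phatm : nat -> R  (* indexed by the nodes 1, ..., N; phatm 0 is never used *)
}.

Section HDG.
Context {R : realType} {a b : R} (m : mesh a b) (k : nat).
Context (tau : stabilization R).
Local Notation mu := (@lebesgue_measure R).
Local Notation N := (nelt m).

Definition Wh (w : 'I_N -> {poly R}) : Prop :=
  forall i, (size (w i) <= k.+1)%N.

Definition pwfun (w : 'I_N -> {poly R}) (x : R) : R :=
  \sum_(i < N) (w i).[x] * \1_(`]node m i, node m i.+1[) x.

Definition dpw (w : 'I_N -> {poly R}) : 'I_N -> {poly R} := fun i => deriv (w i).

(* (phi, v) for an elementwise function phi and a discrete function v. *)
Definition ip (phi : 'I_N -> R -> R) (v : 'I_N -> {poly R}) : R :=
  \sum_(i < N) \int[mu]_(x in `]node m i, node m i.+1[) (phi i x * (v i).[x]).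

Definition ipp (phi v : 'I_N -> {poly R}) : R := ip (fun i => horner (phi i)) v.

Definition node_idx (i : nat) (s : side) : nat :=
  match s with Plus => i | Minus => i.+1 end.

Definition trace (w : 'I_N -> {poly R}) (i : 'I_N) (s : side) : R :=
  (w i).[node m (node_idx i s)].

(* A function on the nodes, seen on the boundaries of the elements. *)
Definition nodal (g : nat -> R) (i : 'I_N) (s : side) : R := g (node_idx i s).

(* <phi, v n> *)
Definition bip (phi v : 'I_N -> side -> R) : R :=
  \sum_(i < N) (phi i Minus * v i Minus * normal R Minus +
                phi i Plus * v i Plus * normal R Plus).

(* <phi, v n> with the point x_0^+ omitted. *)
Definition bip_omit0 (phi v : 'I_N -> side -> R) : R :=
  \sum_(i < N) phi i Minus * v i Minus * normal R Minus +
  \sum_(i < N | (0 < i)%N) phi i Plus * v i Plus * normal R Plus.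

Definition phat (S : hdg_state R N) (i : 'I_N) (s : side) : R :=
  match s with
  | Plus => trace (ph S) i Plus +
      tau_pu_p tau * (nodal (uhat S) i Plus - trace (uh S) i Plus)
        * normal R Plus
  | Minus => nodal (phatm S) i Minus
  end.

Definition qhat (S : hdg_state R N) (i : 'I_N) (s : side) : R :=
  match s with
  | Plus => trace (qh S) i Plus +
      tau_qu_p tau * (nodal (uhat S) i Plus - trace (uh S) i Plus)
        * normal R Plus
  | Minus => trace (qh S) i Minus +
      tau_qu_m tau * (nodal (uhat S) i Minus - trace (uh S) i Minus)
        * normal R Minus +
      tau_qp_m tau * (nodal (phatm S) i Minus - trace (ph S) i Minus)
        * normal R Minus
  end.

(* The HDG equations at a fixed time, with z as the first term of the third
   equation: z = (u_h)_t for the evolution problem, z = u_h for the stationary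
   problem v + v_xxx = F. *)
Definition hdg_equations (z : 'I_N -> {poly R}) (F : R -> R) (uD : R -> R)
    (qN : R) (S : hdg_state R N) : Prop :=
  [/\ Wh (uh S) /\ Wh (qh S) /\ Wh (ph S),
      uhat S 0%N = uD a /\ uhat S N = uD b,
      forall v, Wh v ->
        ipp (qh S) v + ipp (uh S) (dpw v)
          - bip (nodal (uhat S)) (trace v) = 0,
      forall v, Wh v ->
        ipp (ph S) v + ipp (qh S) (dpw v) - bip (qhat S) (trace v) = 0 &
      [/\ forall w, Wh w ->
            ipp z w - ipp (ph S) (dpw w) + bip (phat S) (trace w)
              = ip (fun=> F) w,
          forall lam : nat -> R,
            bip_omit0 (qhat S) (nodal lam) = qN * lam N &
          forall chi : nat -> R, chi 0%N = 0 -> chi N = 0 ->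
            bip (phat S) (nodal chi) = 0]].

(* Semi-discrete solution S on [0, T], with uht = (u_h)_t.  The state at t = 0
   is the HDG solution of v + v_xxx = g. *)
Definition hdg_solution (T : R) (f : R -> R -> R) (g : R -> R)
    (uD : R -> R -> R) (qN : R -> R)
    (S : R -> hdg_state R N) (uht : R -> 'I_N -> {poly R}) : Prop :=
  [/\ forall (t : R) i (x : R), t \in `[0, T] ->
        deriv_within `[0, T] (fun s => (uh (S s) i).[x]) t (uht t i).[x],
      forall t : R, t \in `]0, T] ->
        hdg_equations (uht t) (f t) (uD t) (qN t) (S t) &
      hdg_equations (uh (S 0)) g (uD 0) (qN 0) (S 0)].

End HDG.

(* Main.v *)
Require Import Defs.
From HB Require Import structures.
From mathcomp Require Import all_boot all_order all_algebra.
From mathcomp Require Import ring lra.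
From mathcomp Require Import all_classical all_reals all_analysis.
From mathcomp Require Import measurable_realfun.
From mathcomp Require qpoly.

Set Implicit Arguments.
Unset Strict Implicit.
Unset Printing Implicit Defensive.

Import Order.TTheory GRing.Theory Num.Theory.
Import numFieldNormedType.Exports.
Local Open Scope classical_set_scope.
Local Open Scope ring_scope.

(** The L^2 projections P of u, q and p on the elements satisfy the equations of
    the method up to point values: in the volume the projection errors are
    orthogonal to all the test functions, and only their values at the end points
    of the elements remain.  The differences between P u, P q, P p and the
    discrete solution therefore solve the same linear system, with these point
    values as the only data.  For degree k their squares sum to order h^(2k+1)
    ([proj_error_bound]), half a power of h less than the theorem needs.

    The half power is recovered by a gauge.  Adding to each projection a multiple
    of the Legendre polynomial of top degree does not change the derivative terms
    of the equations.  The multiples for q and p are chosen so that the relations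
    for the traces of q hold exactly; what remains in the trace of p is balanced
    by letting the multiple for u depend on time, which is an ordinary
    differential equation on each element ([alpha_ex]), relaxing at a rate of
    order 1/h ([relaxation_bound]).  The data have then moved from the traces
    into the volume, where they carry a factor h ([mk_err_eqs]).

    The transformed system is stable.  Testing with the projections of w u, w q
    and w p for an increasing affine weight w, as in Kato's smoothing argument,
    turns the third derivative into the coercive term of q, while the conditions
    on the stabilization make the jumps dissipative ([energy_identity],
    [global_energy]).  The remaining unknown p is recovered from its mean value,
    which is a boundary trace of q ([system_bound]).  In time this becomes an
    energy inequality for the Dini derivative ([evolution]).  The bounds on p and
    on the time derivative of u need the time derivative of the system; it is
    replaced by time differences, which solve the same system.  Their initial
    value is estimated by [evolution] on a short interval, starting from the
    stationary problem that defines the discrete state at time 0 ([window_bound],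
    [difference_bound]).  The outcome is [discrete_error].

    The data must be bounded at every time and with a constant that does not
    depend on the mesh, together with their first, and some second, time
    differences.  The hypotheses give bounds at almost every time, for weak time
    derivatives that may a priori depend on the mesh.  Weak derivatives are unique,
    which makes the constants independent of the mesh ([uniform_regularity]);
    and point values of projection errors are limits of integrals against bounded
    kernels, which are Lipschitz functions of time, so that bounds at almost every
    time pass to every time and to time differences ([functionals_bound],
    [functionals_lipschitz], [functionals_second_difference]).  The last of these
    applies to u only; the second differences of the trace of q = u_x are
    estimated through u, which costs one power of h that the corresponding term of
    the energy provides ([proj_error_derivative]). *)

(** * Polynomials on the reference element [0, 1] *)

Section Reference.
Context {R : realType}.
Implicit Types p q v w : {poly R}.

Definition prim p : {poly R} := \poly_(i < (size p).+1) (p`_i.-1 / i%:R).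

(** Integrals of polynomials are kept algebraic: the discrete part of the
    argument then needs no measure theory. *)
Definition intp p : R := (prim p).[1].

Definition dotp p q : R := intp (p * q).
Definition normp p : R := Num.sqrt (dotp p p).

Lemma coef_prim p i : (prim p)`_i = p`_i.-1 / i%:R.
Proof.
rewrite coef_poly; case: ltnP => // hi.
by case: i hi => // i hi; rewrite nth_default ?mul0r.
Qed.

Lemma prim_horner0 p : (prim p).[0] = 0.
Proof. by rewrite horner_coef0 coef_prim invr0 mulr0. Qed.

Lemma deriv_prim p : (prim p)^`() = p.
Proof.
apply/polyP => i; by rewrite coef_deriv coef_prim /= -[LHS]mulr_natr divfK ?pnatr_eq0.
Qed.

Lemma prim_deriv p : prim p^`() = p - (p`_0)%:P.
Proof.
apply/polyP => -[|i]; rewrite coef_prim coefB coefC /=.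
  by rewrite invr0 mulr0 subrr.
by rewrite coef_deriv subr0 -[X in X / _]mulr_natr mulfK // pnatr_eq0.
Qed.

Lemma intp_deriv p : intp p^`() = p.[1] - p.[0].
Proof. by rewrite /intp prim_deriv hornerD hornerN hornerC horner_coef0. Qed.

Lemma primD p q : prim (p + q) = prim p + prim q.
Proof. by apply/polyP => i; rewrite coefD !coef_prim coefD mulrDl. Qed.
Lemma primZ c p : prim (c *: p) = c *: prim p.
Proof. by apply/polyP => i; rewrite coefZ !coef_prim coefZ mulrA. Qed.
Lemma intpD p q : intp (p + q) = intp p + intp q.
Proof. by rewrite /intp primD hornerD. Qed.
Lemma intpZ c p : intp (c *: p) = c * intp p.
Proof. by rewrite /intp primZ hornerZ. Qed.

Lemma dotpC p q : dotp p q = dotp q p. Proof. by rewrite /dotp mulrC. Qed.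
Lemma dotpDl p q v : dotp (p + q) v = dotp p v + dotp q v.
Proof. by rewrite /dotp mulrDl intpD. Qed.
Lemma dotpZl c p v : dotp (c *: p) v = c * dotp p v.
Proof. by rewrite /dotp -scalerAl intpZ. Qed.
Lemma dotpDr p q v : dotp v (p + q) = dotp v p + dotp v q.
Proof. by rewrite dotpC dotpDl !(dotpC v). Qed.
Lemma dotpZr c p v : dotp v (c *: p) = c * dotp v p.
Proof. by rewrite dotpC dotpZl (dotpC v). Qed.
Lemma dotpNl p v : dotp (- p) v = - dotp p v.
Proof. by rewrite -scaleN1r dotpZl mulN1r. Qed.
Lemma dotpNr p v : dotp v (- p) = - dotp v p.
Proof. by rewrite dotpC dotpNl dotpC. Qed.
Lemma dotpBl p q v : dotp (p - q) v = dotp p v - dotp q v.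
Proof. by rewrite dotpDl dotpNl. Qed.
Lemma dotpBr p q v : dotp v (p - q) = dotp v p - dotp v q.
Proof. by rewrite dotpDr dotpNr. Qed.
Lemma dot0p v : dotp 0 v = 0.
Proof. by rewrite -(scale0r 0) dotpZl mul0r. Qed.
Lemma dotp0 v : dotp v 0 = 0.
Proof. by rewrite dotpC dot0p. Qed.
Lemma dotp_suml I (r : seq I) (P : pred I) (F : I -> {poly R}) v :
  dotp (\sum_(i <- r | P i) F i) v = \sum_(i <- r | P i) dotp (F i) v.
Proof.
by elim/big_rec2: _ => [|i y z _ <-]; rewrite ?dot0p // dotpDl.
Qed.
Lemma dotpM p q v : dotp (p * q) v = dotp p (q * v).
Proof. by rewrite /dotp mulrA. Qed.

Lemma dotp_deriv p q :
  dotp p^`() q = p.[1] * q.[1] - p.[0] * q.[0] - dotp p q^`().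
Proof.
have := intp_deriv (p * q); rewrite derivM intpD !hornerM -/(dotp _ _) => <-.
by rewrite -/(dotp _ _) addrK.
Qed.

Lemma horner_ndecr p x y : (forall z, 0 < z < 1 -> 0 <= p^`().[z]) ->
  0 <= x -> x <= y -> y <= 1 -> p.[x] <= p.[y].
Proof.
move=> p0 x0 xy y1.
apply: (@ger0_derive1_ndecr R (horner p) 0 1) => //.
- by move=> z; rewrite in_itv/= => hz; rewrite -derivE; exact: p0.
- by apply: continuous_subspaceT => z; exact: continuous_horner.
Qed.

Lemma intp_ge0 p : (forall x, 0 < x < 1 -> 0 <= p.[x]) -> 0 <= intp p.
Proof.
move=> p0; rewrite /intp -(prim_horner0 p).
by apply: horner_ndecr => // z; rewrite deriv_prim; exact: p0.
Qed.

Lemma dotp_ge0 p : 0 <= dotp p p.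
Proof. by apply: intp_ge0 => x _; rewrite hornerM -expr2 sqr_ge0. Qed.

Lemma CauchySchwarz p q : `|dotp p q| <= normp p * normp q.
Proof.
rewrite /normp -sqrtrM ?dotp_ge0 // -sqrtr_sqr ler_sqrt; last first.
  by rewrite mulr_ge0 ?dotp_ge0.
have H t : 0 <= dotp p p + 2 * t * dotp p q + t ^+ 2 * dotp q q.
  have := dotp_ge0 (p + t *: q).
  by rewrite !(dotpDl, dotpDr, dotpZl, dotpZr) (dotpC q p); lra.
have [q0|q0] := eqVneq (dotp q q) 0.
  have := H (- (dotp p p + 1) / (2 * dotp p q)).
  rewrite q0 mulr0 addr0 mulr0.
  have [->|z] := eqVneq (dotp p q) 0; first by rewrite expr0n.
  have -> : 2 * (- (dotp p p + 1) / (2 * dotp p q)) * dotp p q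
     = - (dotp p p + 1) by field; rewrite z.
  by lra.
have qp : 0 < dotp q q by rewrite lt_neqAle eq_sym q0 dotp_ge0.
have := H (- dotp p q / dotp q q).
have -> : dotp p p + 2 * (- dotp p q / dotp q q) * dotp p q +
  (- dotp p q / dotp q q) ^+ 2 * dotp q q
  = (dotp p p * dotp q q - dotp p q ^+ 2) / dotp q q by field; rewrite q0.
by rewrite pmulr_lge0 ?invr_gt0 // subr_ge0.
Qed.

Lemma normp_ge0 p : 0 <= normp p. Proof. exact: sqrtr_ge0. Qed.
Lemma normp_sqr p : normp p ^+ 2 = dotp p p.
Proof. by rewrite sqr_sqrtr ?dotp_ge0. Qed.
Lemma normpD p q : normp (p + q) <= normp p + normp q.
Proof.
rewrite -(@ler_pXn2r _ 2) ?nnegrE ?normp_ge0 ?addr_ge0 ?normp_ge0 //.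
rewrite normp_sqr sqrrD !normp_sqr !(dotpDl, dotpDr) (dotpC q p).
have := le_trans (ler_norm _) (CauchySchwarz p q); lra.
Qed.
Lemma normpZ c p : normp (c *: p) = `|c| * normp p.
Proof.
by rewrite /normp dotpZl dotpZr mulrA -expr2 sqrtrM ?sqr_ge0 // sqrtr_sqr.
Qed.
Lemma normpN p : normp (- p) = normp p.
Proof. by rewrite -scaleN1r normpZ normrN1 mul1r. Qed.
Lemma normpB p q : normp (p - q) <= normp p + normp q.
Proof. by rewrite -(normpN q) normpD. Qed.
Lemma normp0 : normp 0 = 0.
Proof. by rewrite /normp dot0p sqrtr0. Qed.
Lemma normp_sum I (r : seq I) (P : pred I) (F : I -> {poly R}) :
  normp (\sum_(i <- r | P i) F i) <= \sum_(i <- r | P i) normp (F i).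
Proof.
elim/big_rec2: _ => [|i y z _ h]; first by rewrite normp0.
by apply: le_trans (normpD _ _) _; rewrite lerD2l.
Qed.

Lemma dotp_eq0 p : dotp p p = 0 -> p = 0.
Proof.
move=> h; set P := prim (p * p).
have P1 : P.[1] = 0 by [].
have mono x y : 0 <= x -> y <= 1 -> x <= y -> P.[x] <= P.[y].
  move=> x0 y1 xy; apply: horner_ndecr => // z _.
  by rewrite deriv_prim hornerM -expr2 sqr_ge0.
have Pz (j : nat) : root P (j.+1%:R^-1).
  have j01 : 0 <= (j.+1%:R^-1 : R) <= 1.
    by rewrite invr_ge0 ler0n /= invf_le1 ?ltr0n // ler1n.
  case/andP: j01 => j0 j1.
  rewrite /root eq_le -{1}P1 mono //= -(prim_horner0 (p * p)) mono //.
have P0 : P = 0.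
  apply/eqP; apply: contraT => Pn0.
  have := max_poly_roots Pn0 (rs := [seq j.+1%:R^-1 | j <- iota 0 (size P)]).
  rewrite size_map size_iota ltnn; apply.
    by apply/allP => x /mapP[j _ ->]; exact: Pz.
  rewrite map_inj_uniq ?iota_uniq // => i j /invr_inj/eqP.
  by rewrite eqr_nat eqSS => /eqP.
have : p * p = 0 by rewrite -(deriv_prim (p * p)) -/P P0 deriv0.
by move/eqP; rewrite mulf_eq0 orbb => /eqP.
Qed.

(** ** Legendre polynomials *)

Definition wleg : {poly R} := 'X * ('X - 1%:P).

(** Rodrigues' formula, normalised by the value 1 at the right end point; locked,
    since conversion would otherwise unfold the iterated derivative. *)
Fact leg_key : unit. Proof. exact: tt. Qed.
Definition leg n : {poly R} :=
  locked_with leg_key (n`!%:R^-1 *: (wleg ^+ n)^`(n)).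
Lemma legE n : leg n = n`!%:R^-1 *: (wleg ^+ n)^`(n).
Proof. by rewrite /leg unlock. Qed.

Lemma wleg1 : wleg.[1] = 0.
Proof. by rewrite /wleg !hornerE subrr. Qed.
Lemma wleg0 : wleg.[0] = 0.
Proof. by rewrite /wleg !hornerE. Qed.

Lemma dwleg : wleg^`() = 2%:R *: 'X - 1%:P.
Proof. by rewrite /wleg derivM derivB derivX derivC mul1r subr0 mulr1 scaler_nat; ring. Qed.

Lemma derivn_wleg n j : (j <= n)%N -> exists S : {poly R},
  [/\ (wleg ^+ n)^`(j) = wleg ^+ (n - j) * S,
      S.[1] = (n ^_ j)%:R & S.[0] = (-1) ^+ j * (n ^_ j)%:R].
Proof.
elim: j => [|j IH] jn.
  by exists 1; rewrite subn0 mulr1 !hornerE.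
have [S [e S1 S0]] := IH (ltnW jn).
have nj : (n - j = (n - j.+1).+1)%N by rewrite subnSK.
exists ((wleg^`() * S) *+ (n - j) + wleg * S^`()); split.
- rewrite derivnS e derivM deriv_exp /= nj /= exprS.
  set A := wleg ^+ _; set B := wleg^`(); set C := S^`().
  by rewrite mulrDr !mulrnAr mulrnAl; congr (_ *+ _ + _); rewrite [RHS]mulrA (mulrC A).
- rewrite hornerD hornerMn (hornerM wleg^`()) (hornerM wleg) wleg1 S1 dwleg.
  by rewrite -[X in X + _]mulr_natr !hornerE ffactnSr natrM; ring.
- rewrite hornerD hornerMn (hornerM wleg^`()) (hornerM wleg) wleg0 S0 dwleg.
  have -> : (2 *: 'X - 1%:P).[0] = -1 :> R by rewrite !hornerE; ring.
  by rewrite mul0r addr0 -mulr_natr ffactnSr natrM exprS; ring.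
Qed.

Lemma leg_at1 n : (leg n).[1] = 1.
Proof.
have [S [e S1 S0]] := derivn_wleg (leqnn n).
by rewrite legE hornerZ e subnn mul1r S1 ffactnn mulVf // pnatr_eq0 -lt0n
  fact_gt0.
Qed.

Lemma leg_at0 n : (leg n).[0] = (-1) ^+ n.
Proof.
have [S [e S1 S0]] := derivn_wleg (leqnn n).
by rewrite legE hornerZ e subnn mul1r S0 ffactnn mulrCA mulVf ?mulr1 //
  pnatr_eq0 -lt0n fact_gt0.
Qed.

Lemma leg_orth n w : (size w <= n)%N -> dotp (leg n) w = 0.
Proof.
move=> sw; rewrite legE dotpZl.
suff H j v : (j <= n)%N -> (size v <= j)%N -> dotp (wleg ^+ n)^`(j) v = 0.
  by rewrite H ?mulr0.
elim: j v => [|j IH] v jn sv.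
  by move: sv; rewrite leqn0 size_poly_eq0 => /eqP ->; rewrite dotp0.
rewrite derivnS dotp_deriv.
have [S [eS _ _]] := derivn_wleg (ltnW jn); rewrite eS.
have bd c : wleg.[c] = 0 -> (wleg ^+ (n - j) * S).[c] = 0.
  by move=> h; rewrite hornerM horner_exp h -(subnSK jn) expr0n mul0r.
rewrite !bd ?wleg1 ?wleg0 // !mul0r subr0 sub0r -eS.
have [-> |v0] := eqVneq v 0; first by rewrite deriv0 dotp0 oppr0.
have sv' : (size v^`() <= j)%N.
  by rewrite -ltnS; apply: leq_trans sv; exact: lt_size_deriv.
by rewrite IH ?oppr0 // ltnW.
Qed.

Lemma size_wleg : size wleg = 3.
Proof. by rewrite /wleg mulrC size_mulX ?polyXsubC_eq0 // size_XsubC. Qed.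

Lemma leg_lead n : (leg n)`_n != 0.
Proof.
rewrite legE coefZ coef_derivn mulf_neq0 ?invr_eq0 //.
rewrite -mulr_natr mulf_neq0 //; last first.
  by rewrite pnatr_eq0 -lt0n ffact_gt0 leq_addr.
have mw : wleg \is monic by rewrite /wleg monicMl ?monicX ?monicXsubC.
have : wleg ^+ n \is monic by exact: monic_exp.
rewrite monicE lead_coefE size_exp size_wleg /= mul2n addnn => /eqP ->.
by rewrite oner_eq0.
Qed.

Lemma size_leg n : (size (leg n) <= n.+1)%N.
Proof.
rewrite legE; apply: leq_trans (size_scale_leq _ _) _.
apply/leq_sizeP => i ni; rewrite coef_derivn nth_default ?mul0rn //.
apply: leq_trans (size_poly_exp_leq _ _) _.
by rewrite size_wleg /= mul2n -addnn -addnS leq_add2l.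
Qed.

Definition legnu n : R := dotp (leg n) (leg n).
Definition legc n p : R := dotp p (leg n) / legnu n.

Lemma legnu_gt0 n : 0 < legnu n.
Proof.
rewrite lt_neqAle dotp_ge0 andbT eq_sym; apply/eqP => /dotp_eq0 h.
by have := leg_lead n; rewrite h coef0 eqxx.
Qed.
Lemma legnu_neq0 n : legnu n != 0. Proof. by rewrite gt_eqF ?legnu_gt0. Qed.

Lemma legcE n p : dotp p (leg n) = legnu n * legc n p.
Proof. by rewrite /legc mulrC divfK ?legnu_neq0. Qed.
Lemma legcD n p q : legc n (p + q) = legc n p + legc n q.
Proof. by rewrite /legc dotpDl mulrDl. Qed.
Lemma legcZ n c p : legc n (c *: p) = c * legc n p.
Proof. by rewrite /legc dotpZl mulrA. Qed.

(** The lower Legendre polynomials have lower degree, so that the component along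
    [leg n] is read off the coefficient of degree n. *)
Lemma leg_split n p : (size p <= n.+1)%N ->
  p`_n = legc n p * (leg n)`_n /\ (size (p - legc n p *: leg n)%R <= n)%N.
Proof.
move=> sp; pose t := p`_n / (leg n)`_n.
have st : (size (p - t *: leg n)%R <= n)%N.
  apply/leq_sizeP => i; rewrite leq_eqVlt => /predU1P[<-|ni].
    by rewrite coefB coefZ /t divfK ?subrr // leg_lead.
  rewrite coefB coefZ !nth_default ?mulr0 ?subrr //.
    exact: leq_trans (size_leg _) ni.
  exact: leq_trans sp ni.
have -> : legc n p = t.
  have := leg_orth st; rewrite dotpBr dotpZr => /eqP; rewrite subr_eq0.
  by rewrite dotpC => /eqP e; rewrite /legc e mulfK ?legnu_neq0.
by split=> //; rewrite /t divfK // leg_lead.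
Qed.

Lemma leg_expand n p : (size p <= n)%N ->
  p = \sum_(j < n) legc j p *: leg j.
Proof.
elim: n p => [|n IH] p sp.
  by move: sp; rewrite leqn0 size_poly_eq0 big_ord0 => /eqP.
have [_ /IH h] := leg_split sp; rewrite big_ord_recr /=.
rewrite -[LHS](subrK (legc n p *: leg n)) {1}h; congr (_ + _).
apply: eq_bigr => j _; congr (_ *: _).
rewrite -scaleNr legcD legcZ [legc j (leg n)]/legc leg_orth ?mul0r ?mulr0 ?addr0 //.
exact: leq_trans (size_leg _) (ltn_ord j).
Qed.

Lemma legc_le n p : `|legc n p| <= (Num.sqrt (legnu n))^-1 * normp p.
Proof.
rewrite /legc normrM normfV (gtr0_norm (legnu_gt0 n)).
rewrite ler_pdivrMr ?legnu_gt0 //; apply: le_trans (CauchySchwarz _ _) _.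
set t := Num.sqrt _; have t0 : 0 < t by rewrite sqrtr_gt0 legnu_gt0.
have -> : legnu n = t ^+ 2 by rewrite sqr_sqrtr // ltW // legnu_gt0.
rewrite [normp (leg n)]/normp -/(legnu n) -/t.
by have -> : t^-1 * normp p * t ^+ 2 = normp p * t by field; rewrite gt_eqF.
Qed.

Lemma horner_bounded p : exists2 K, 0 <= K &
  forall x, 0 <= x <= 1 -> `|p.[x]| <= K.
Proof.
exists (\sum_(i < size p) `|p`_i|); first by apply: sumr_ge0.
move=> x /andP[x0 x1]; rewrite horner_coef.
apply: le_trans (ler_norm_sum _ _ _) _; apply: ler_sum => i _.
rewrite normrM ler_piMr // normrX ger0_norm //; exact: exprn_ile1.
Qed.

(** On polynomials of bounded degree point values are controlled by the L2
    norm; with scaling this is the trace inequality on every element. *)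
Lemma horner_le_normp n : exists2 K, 0 <= K &
  forall p x, (size p <= n)%N -> 0 <= x <= 1 -> `|p.[x]| <= K * normp p.
Proof.
pose B j := projT1 (cid2 (horner_bounded (leg j))).
have B0 j : 0 <= B j by rewrite /B; case: cid2.
have HB j x : 0 <= x <= 1 -> `|(leg j).[x]| <= B j by rewrite /B; case: cid2 => ? ? /= h /h.
exists (\sum_(j < n) (Num.sqrt (legnu j))^-1 * B j).
  by apply: sumr_ge0 => j _; rewrite mulr_ge0 ?invr_ge0 ?sqrtr_ge0.
move=> p x sp hx; rewrite {1}(leg_expand sp).
rewrite horner_sum mulr_suml; apply: le_trans (ler_norm_sum _ _ _) _.
apply: ler_sum => j _; rewrite hornerZ normrM mulrAC.
by apply: ler_pM => //; [exact: legc_le|exact: HB].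
Qed.

Lemma deriv_le_normp n : exists2 K, 0 <= K &
  forall p, (size p <= n)%N -> normp p^`() <= K * normp p.
Proof.
exists (\sum_(j < n) (Num.sqrt (legnu j))^-1 * normp (leg j)^`()).
  by apply: sumr_ge0 => j _; rewrite mulr_ge0 ?invr_ge0 ?sqrtr_ge0 ?normp_ge0.
move=> p sp; rewrite {1}(leg_expand sp) linear_sum mulr_suml.
apply: le_trans (normp_sum _ _ _) _; apply: ler_sum => j _.
rewrite /= derivZ normpZ mulrAC ler_wpM2r ?normp_ge0 //; exact: legc_le.
Qed.

(** The Legendre expansion of p^`() is integrated term by term from the end point 1. *)
Lemma poincare_normp n : exists2 K, 0 <= K &
  forall p, (size p <= n.+1)%N -> normp (p - p.[1]%:P) <= K * normp p^`().
Proof.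
pose B j := prim (leg j) - (prim (leg j)).[1]%:P.
exists (\sum_(j < n) (Num.sqrt (legnu j))^-1 * normp (B j)).
  by apply: sumr_ge0 => j _; rewrite mulr_ge0 ?invr_ge0 ?sqrtr_ge0 ?normp_ge0.
move=> p sp; have sp' : (size p^`() <= n)%N.
  have [->|p0] := eqVneq p 0; first by rewrite deriv0 size_poly0.
  by rewrite -ltnS; apply: leq_trans sp; exact: lt_size_deriv.
pose V q : {poly R} := prim q - (prim q).[1]%:P.
have V0 : V 0 = 0.
  have p0 : prim 0 = 0 by apply/polyP => i; rewrite coef_prim !coef0 mul0r.
  by rewrite /V p0 horner0 subrr.
have VD q r : V (q + r) = V q + V r.
  by rewrite /V primD hornerD polyCD opprD addrACA.
have VZ c q : V (c *: q) = c *: V q.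
  by rewrite /V primZ hornerZ scalerBr polyCM mul_polyC.
have -> : p - p.[1]%:P = V p^`().
  by rewrite /V prim_deriv !hornerD hornerN hornerC polyCB opprB addrA subrK.
have -> : V p^`() = \sum_(j < n) legc j p^`() *: B j.
  rewrite {1}(leg_expand sp').
  elim/big_rec2: _ => [|j y z _ <-]; first exact: V0.
  by rewrite VD VZ.
rewrite mulr_suml; apply: le_trans (normp_sum _ _ _) _; apply: ler_sum => j _.
rewrite normpZ mulrAC ler_wpM2r ?normp_ge0 //; exact: legc_le.
Qed.

(** With this factor, [legth n * legc n p] is the component of x p along the
    Legendre polynomial of degree n + 1, for p of degree at most n. *)
Definition legth n : R := (leg n)`_n / (leg n.+1)`_n.+1.

Lemma size_projX n p : (size p <= n.+1)%N ->
  (size ('X * p - (legth n * legc n p) *: leg n.+1)%R <= n.+1)%N.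
Proof.
move=> sp; apply/leq_sizeP => i; rewrite leq_eqVlt => /predU1P[<-|ni].
  rewrite coefB coefZ coefXM /= (leg_split sp).1 /legth.
  by field; exact: leg_lead.
rewrite coefB coefZ !nth_default ?mulr0 ?subrr //.
  exact: leq_trans (size_leg _) ni.
by rewrite (leq_trans (size_polyMleq _ _)) // size_polyX /= (leq_ltn_trans sp).
Qed.

(** After an integration by parts only the boundary values of the component of
    degree n + 1 are left: 1 - (-1) = 2. *)
Lemma leg_deriv_dot n p : (size p <= n.+2)%N ->
  dotp p^`() (leg n) = 2 * legc n.+1 p.
Proof.
move=> sp; have [_ sr] := leg_split sp.
have sd q m : (size q <= m.+1)%N -> (size q^`() <= m)%N.
  have [->|q0] := eqVneq q 0; first by rewrite deriv0 size_poly0.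
  by move=> sq; rewrite -ltnS; apply: leq_trans sq; exact: lt_size_deriv.
rewrite -{1}(subrK (legc n.+1 p *: leg n.+1) p) derivD dotpDl dotpC.
rewrite leg_orth ?sd // add0r derivZ dotpZl dotp_deriv !leg_at1 !leg_at0.
rewrite leg_orth; last exact: leq_trans (sd _ _ (size_leg _)) _.
have sg : (-1) ^+ n * (-1) ^+ n = 1 :> R by rewrite -expr2 sqrr_sign.
by rewrite exprS -(mulrA (-1)) sg; ring.
Qed.

End Reference.

(** * The error equations on one element *)

(** The state of one element: the gauged errors of u, q, p and the right hand side
    in reference coordinates, the errors of the numerical traces at the left and
    right end points, and the gauge: [eal] is the time derivative of the multiple
    added to u, [ebe] and [ega] are the multiples added to q and p, and [ele] is the
    rest in the left trace of p. *)
Record errstate (R : realType) := Errstate {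
  eU : {poly R}; eQ : {poly R}; eP : {poly R}; eG : {poly R};
  eul : R; eur : R; eql : R; eqr : R; epl : R; epr : R;
  eal : R; ebe : R; ega : R; ele : R
}.

(** The bounds that [bndM] and [bndD] produce for the terms of [resid], one by one
    and in their order there. *)
Lemma resid_arith (R : realType) (k h d M U Q j : R) : 1 <= k -> 0 <= h -> h <= 1 ->
  1 <= M -> 0 <= d -> 0 <= U -> 0 <= Q -> 0 <= j ->
   M * (d * (h * ((Q + d * k) * k))) + 1 * (d * (k * (h * (k * U)))) +
  (h * (d * (M * (k * j))) + 2^-1 * (h * (d * (M * (1 * (d * k))))) +
  d * (h * (3 * k ^+ 2 * (h * d + Q + j)))) +
  h * (d * (M * (k * Q) + h * (k * Q))) +
   h * (d * (k * Q) + d * (k * U)) +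
   (j * (k * j + k * j) + k * (j * j)) +
   k * (j * (h * (k * U)) + j * (h * d + k * (k * j + k * j + 1 * (k * j)))
      + (k * j + k * j) * (h * (k * Q))) +
   k * (1 * ((d + k * j) * (h * (k * U)) + j * (h * d + k * (k * j + k * j + 1 * (k * j)))
      + k * (j * (h * (k * Q))))) <=
   50 * k ^+ 3 * (M * (h * d * (U + Q + d + j)) + j ^+ 2 + h * j * (U + Q)).
Proof.
move=> k1 h0 h1 M1 d0 U0 Q0 j0.
have k0 : 0 <= k by exact: le_trans ler01 k1.
have M0 : 0 <= M by exact: le_trans ler01 M1.
pose A : R := M * (h * d * (U + Q + d + j)).
pose B : R := j ^+ 2.
pose C : R := h * j * (U + Q).
have hd0 : 0 <= h * d by rewrite mulr_ge0.
have A0 : 0 <= A by rewrite !mulr_ge0 ?addr_ge0.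
have B00 : 0 <= B by exact: sqr_ge0.
have C0 : 0 <= C by rewrite !mulr_ge0 ?addr_ge0.
have MA (x : R) : 0 <= x -> x <= U + Q + d + j -> M * (h * d * x) <= A.
  by move=> x0 xs; rewrite /A ler_wpM2l // ler_wpM2l.
have hA (x : R) : 0 <= x -> x <= U + Q + d + j -> h * d * x <= A.
  move=> x0 xs; apply: le_trans (MA x x0 xs).
  by rewrite ler_peMl // mulr_ge0.
have hC (x : R) : 0 <= x -> x <= U + Q -> h * j * x <= C.
  by move=> x0 xs; rewrite /C ler_wpM2l // mulr_ge0.
pose K : R := k ^+ 3.
have kK : k <= K by rewrite /K exprS ler_peMr // exprn_ege1.
have kkK : k * k <= K by rewrite /K exprS ler_wpM2l // expr2 ler_peMl.
have kkkK : k * (k * k) <= K by rewrite /K exprS expr2.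
have K0 : 0 <= K by rewrite exprn_ge0.
have up (a x X : R) : 0 <= a -> a <= K -> 0 <= x -> x <= X -> a * x <= K * X.
  by move=> *; apply: ler_pM.
have kk0 : 0 <= k * k by rewrite mulr_ge0.
have kkk0 : 0 <= k * (k * k) by rewrite mulr_ge0.
have s1 : Q <= U + Q + d + j by clear -U0 Q0 d0 j0; lra.
have s2 : U <= U + Q + d + j by clear -U0 Q0 d0 j0; lra.
have s3 : d <= U + Q + d + j by clear -U0 Q0 d0 j0; lra.
have s4 : j <= U + Q + d + j by clear -U0 Q0 d0 j0; lra.
have s5 : Q <= U + Q by rewrite lerDr.
have s6 : U <= U + Q by rewrite lerDl.
have m1 := up _ _ _ k0 kK (mulr_ge0 M0 (mulr_ge0 hd0 Q0)) (MA _ Q0 s1).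
have m2 := up _ _ _ kk0 kkK (mulr_ge0 M0 (mulr_ge0 hd0 d0)) (MA _ d0 s3).
have m3 := up _ _ _ kk0 kkK (mulr_ge0 hd0 U0) (hA _ U0 s2).
have m4 := up _ _ _ k0 kK (mulr_ge0 M0 (mulr_ge0 hd0 j0)) (MA _ j0 s4).
have m5 := up _ _ _ k0 kK (mulr_ge0 M0 (mulr_ge0 hd0 d0)) (MA _ d0 s3).
have m6 := up _ _ _ kk0 kkK (mulr_ge0 hd0 d0) (hA _ d0 s3).
have m6' : k * k * (h * (h * d * d)) <= K * A.
  apply: le_trans m6; rewrite ler_wpM2l // ler_piMl // mulr_ge0 //.
have m7 := up _ _ _ kk0 kkK (mulr_ge0 hd0 Q0) (hA _ Q0 s1).
have m8 := up _ _ _ kk0 kkK (mulr_ge0 hd0 j0) (hA _ j0 s4).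
have m9 := up _ _ _ k0 kK (mulr_ge0 hd0 Q0) (hA _ Q0 s1).
have m9' : k * (h * (h * d * Q)) <= K * A.
  apply: le_trans m9; rewrite ler_wpM2l // ler_piMl // mulr_ge0 //.
have m10 := up _ _ _ k0 kK (mulr_ge0 hd0 U0) (hA _ U0 s2).
have m11 := up _ _ _ k0 kK (mulr_ge0 hd0 j0) (hA _ j0 s4).
have m12 := up _ _ _ kk0 kkK (mulr_ge0 M0 (mulr_ge0 hd0 Q0)) (MA _ Q0 s1).
have b1 := up _ _ _ k0 kK (sqr_ge0 j) (lexx (j ^+ 2)).
have b2 : k * (k * (k * (j * j))) <= K * B by rewrite /K /B !mulrA !exprS expr0; lra.
have hj0 : 0 <= h * j by rewrite mulr_ge0.
have c2 := up _ _ _ kk0 kkK (mulr_ge0 hj0 U0) (hC _ U0 s6).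
have c3 := up _ _ _ kkk0 kkkK (mulr_ge0 hj0 Q0) (hC _ Q0 s5).
have c4 := up _ _ _ kkk0 kkkK (mulr_ge0 hj0 U0) (hC _ U0 s6).
have KA : 0 <= K * A by rewrite mulr_ge0.
have KB : 0 <= K * B by rewrite mulr_ge0.
have KC : 0 <= K * C by rewrite mulr_ge0.
rewrite -/A -/B -/C -/K.
have -> : 50 * K * (A + B + C) = 50 * (K * A) + 50 * (K * B) + 50 * (K * C) by ring.
rewrite -/B in b1.
move: KA KB KC m1 m2 m3 m4 m5 m6 m6' m7 m8 m9 m9' m10 m11 m12 b1 b2 c2 c3 c4.
move: (K * A) (K * B) (K * C) => KA KB KC.
rewrite /B; clear; rewrite !expr2.
move=> KA0 KB0 KC0 m1 m2 m3 m4 m5 m6 m6' m7 m8 m9 m9' m10 m11 m12 b1 b2 c2 c3 c4; lra.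
Qed.

Lemma young_energy (R : realType) (K M h d U Q j : R) : 0 <= K -> 0 <= M ->
  0 <= h -> h <= 1 -> 0 <= d -> 0 <= U -> 0 <= Q -> 0 <= j ->
  K * (M * (h * d * (U + Q + d + j)) + j ^+ 2 + h * j * (U + Q)) <=
  h * U ^+ 2 + h * Q ^+ 2 / 2 + (K + 1 + 2 * K ^+ 2) * j ^+ 2 +
  (2 * K ^+ 2 * M ^+ 2 + K * M) * (h * d ^+ 2).
Proof.
move=> K0 M0 h0 h1 d0 U0 Q0 j0.
have s1 := mulr_ge0 h0 (sqr_ge0 (Q / 2 - K * M * d)).
have s2 := mulr_ge0 h0 (sqr_ge0 (U - K * M * d)).
have s3 := mulr_ge0 h0 (sqr_ge0 (2 * j - K * M * d)).
have s4 := mulr_ge0 h0 (sqr_ge0 (U - K * j)).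
have s5 := mulr_ge0 h0 (sqr_ge0 (Q / 2 - K * j)).
have h1' : 0 <= 1 - h by rewrite subr_ge0.
have t1 := mulr_ge0 h1' (sqr_ge0 (K * j)).
have t2 := mulr_ge0 h1' (sqr_ge0 j).
have t3 := mulr_ge0 h0 (sqr_ge0 (K * M * d)).
have t4 := sqr_ge0 (K * j).
move: s1 s2 s3 s4 s5 t1 t2 t3 t4; clear; rewrite !expr2 => *; lra.
Qed.

Section Element.
Context {R : realType} (n : nat) (sg tqu tpu : R).
Hypothesis sg_gt0 : 0 < sg.
Hypothesis tpu_le : tpu <= - 2^-1 - 2^-1 * tqu ^+ 2.
Implicit Types (h d phl : R) (E : errstate R) (p q v w z : {poly R}).
Local Notation hE := (hornerD, hornerN, hornerZ, hornerM, hornerX, hornerC).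

Local Notation L := (leg n.+1 : {poly R}).
Local Notation nu := (legnu n.+1 : R).
Local Notation s := ((-1) ^+ n.+1 : R).
Local Notation c_ := (legc n.+1).
Local Notation vp := (leg n + L).
Local Notation vm := (leg n - L).

(** In reference coordinates on an element of length h. The data occur in the
    volume, as multiples of L, except for [ele], which the last relation ties to
    [eal]. *)
Definition error_eqs h E : Prop :=
  [/\ [/\ (size (eU E) <= n.+2)%N, (size (eQ E) <= n.+2)%N,
        (size (eP E) <= n.+2)%N & (size (eG E) <= n.+2)%N],
      forall v, (size v <= n.+2)%N ->
        h * dotp (eQ E - ebe E *: L) v + dotp (eU E) v^`() =
        eur E * v.[1] - eul E * v.[0],
      forall z, (size z <= n.+2)%N ->
        h * dotp (eP E - ega E *: L) z + dotp (eQ E) z^`() =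
        eqr E * z.[1] - eql E * z.[0],
      forall w, (size w <= n.+2)%N ->
        h * dotp (eG E - eal E *: L) w - dotp (eP E) w^`() +
        epr E * w.[1] - epl E * w.[0] = 0 &
      [/\ epl E = (eP E).[0] - tpu * (eul E - (eU E).[0]) + ele E,
          eql E = (eQ E).[0] - tqu * (eul E - (eU E).[0]),
          eqr E = (eQ E).[1] + sg * (eur E - (eU E).[1]) +
                  sg^-1 * (epr E - (eP E).[1]) &
          h * nu * eal E = - s * ele E]].

Definition ja E := eul E - (eU E).[0].
Definition jb E := eur E - (eU E).[1].
Definition jc E := epr E - (eP E).[1].
Definition jumps E := ja E ^+ 2 + jb E ^+ 2 + jc E ^+ 2.

Definition flux_l (phl : R) E :=
  - phl * epl E * eul E + phl * eql E ^+ 2 / 2 + eul E * eql E.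
Definition flux_r (phr : R) E :=
  - phr * epr E * eur E + phr * eqr E ^+ 2 / 2 + eur E * eqr E.

(** The restriction of the increasing weight to an element. *)
Definition wt h (phl : R) : {poly R} := phl%:P + h *: 'X.

(** By [top_p_id] the residual contains a pairing of eG with vp that is not small
    enough. This additional test function cancels it. *)
Definition corr h (phl : R) E : {poly R} :=
  (- (h * ebe E * phl * nu / 2)) *: vp.

(** The terms of the energy identity without a sign. Those with [eal] and [ele] are
    not small one by one, but combine through [left_jump_id]. *)
Definition resid h (phl : R) E : R :=
  h * eal E * dotp L (wt h phl * eU E) - phl * ele E * ja E
  - h * ebe E * dotp L (wt h phl * eP E) + h * ega E * dotp L (wt h phl * eQ E)
  + h * (ebe E * dotp L (eQ E) + ega E * dotp L (eU E))
  - jb E * (sg * jb E + sg^-1 * jc E) - tqu * ja E ^+ 2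
  + legth n.+1 * h * (jc E * c_ (eU E) + jb E * c_ (eP E)
      - (sg * jb E + sg^-1 * jc E) * c_ (eQ E))
  + legth n.+1 * h * s * ((ele E - tpu * ja E) * c_ (eU E) + ja E * c_ (eP E)
      + tqu * ja E * c_ (eQ E)).

Lemma dotp_wt h phl p v :
  dotp v (wt h phl * p) = phl * dotp v p + h * dotp v ('X * p).
Proof. by rewrite /wt mulrDl mul_polyC -scalerAl dotpDr !dotpZr. Qed.

Lemma size_deriv_le m (p : {poly R}) : (size p <= m.+1)%N -> (size p^`() <= m)%N.
Proof.
have [->|p0] := eqVneq p 0; first by rewrite deriv0 size_poly0.
by move=> sp; rewrite -ltnS; apply: leq_trans sp; exact: lt_size_deriv.
Qed.

Let L2_orth p : (size p <= n.+2)%N -> dotp p (leg n.+2) = 0.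
Proof. by move=> sp; rewrite dotpC leg_orth. Qed.

(** The L^2 projection of the weight times p: the affine weight raises the degree by
    one, so that one Legendre component has to be removed. *)
Definition wtest h phl (p : {poly R}) : {poly R} :=
  phl *: p + h *: ('X * p - (legth n.+1 * c_ p) *: leg n.+2).

Lemma size_wtest h phl p : (size p <= n.+2)%N -> (size (wtest h phl p) <= n.+2)%N.
Proof.
move=> sp; rewrite /wtest (leq_trans (size_polyD _ _)) // geq_max.
rewrite (leq_trans (size_scale_leq _ _)) //=.
by rewrite (leq_trans (size_scale_leq _ _)) //= size_projX.
Qed.

Lemma dotp_wtest h phl p v : (size v <= n.+2)%N ->
  dotp v (wtest h phl p) = phl * dotp v p + h * dotp v ('X * p).
Proof.
move=> sv; rewrite /wtest dotpDr !dotpZr dotpBr dotpZr L2_orth //.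
by rewrite mulr0 subr0.
Qed.

Lemma wtest1 h phl p : (wtest h phl p).[1] =
  (phl + h) * p.[1] - h * legth n.+1 * c_ p.
Proof. by rewrite /wtest !hE leg_at1; ring. Qed.
Lemma wtest0 h phl p : (wtest h phl p).[0] =
  phl * p.[0] + s * h * legth n.+1 * c_ p.
Proof.
by rewrite /wtest !hE leg_at0 (exprS _ n.+1); ring.
Qed.

Lemma dotp_X_deriv (p q : {poly R}) :
  dotp p^`() ('X * q) + dotp q^`() ('X * p) = p.[1] * q.[1] - dotp p q.
Proof.
apply/eqP; rewrite -(inj_eq (addIr (dotp p q))) subrK; apply/eqP.
rewrite /dotp -!intpD; have := intp_deriv ('X * (p * q)).
rewrite !derivM derivX !hE !mul1r mul0r subr0 => <-; congr intp; ring.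
Qed.

Let lincomb (x y a1 b1 a2 b2 a3 b3 a4 b4 a5 b5 c1 c2 c3 c4 c5 : R) :
  a1 = b1 -> a2 = b2 -> a3 = b3 -> a4 = b4 -> a5 = b5 ->
  x - y = c1 * (a1 - b1) + c2 * (a2 - b2) + c3 * (a3 - b3) + c4 * (a4 - b4)
          + c5 * (a5 - b5) -> x = y.
Proof.
move=> -> -> -> -> ->; rewrite !subrr !mulr0 !addr0.
by move/eqP; rewrite subr_eq0 => /eqP.
Qed.

(** The energy identity with the increasing weight [wt]: the weight turns the
    dispersive term into the coercive term (3/2) |q|^2 (Kato smoothing), and
    the numerical traces make the jumps dissipative. *)
Lemma energy_identity h phl E : error_eqs h E ->
  h * dotp (eG E) (wt h phl * eU E) + 3 / 2 * h * dotp (eQ E) (eQ E)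
  + (phl + h) * (sg ^+ 2 * jb E ^+ 2 + sg^-1 ^+ 2 * jc E ^+ 2) / 2
  + phl * (- tpu - tqu ^+ 2 / 2) * ja E ^+ 2
  = flux_r (phl + h) E - flux_l phl E + resid h phl E.
Proof.
move=> [[su sq sp sg_] e1 e2 e3 [t1 t2 t3 _]].
have sL := size_leg (R := R) n.+1.
have szB (p q : {poly R}) a : (size p <= n.+2)%N -> (size (p - a *: L)%R <= n.+2)%N.
  move=> h1; rewrite (leq_trans (size_polyD _ _)) // geq_max h1 size_polyN.
  by rewrite (leq_trans (size_scale_leq _ _)).
(* The three equations are tested with the weighted P, Q and U, and then the first
   two with Q and U: the slope of the weight leaves unweighted products. *)
have := e1 _ (size_wtest h phl sp); have := e2 _ (size_wtest h phl sq).
have := e3 _ (size_wtest h phl su); have := e1 _ sq; have := e2 _ su.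
have ibp (a b : {poly R}) : dotp a b^`() = a.[1] * b.[1] - a.[0] * b.[0] - dotp a^`() b.
  by rewrite dotp_deriv; ring.
rewrite (dotpC (eQ E) (eU E)^`()) (dotpC (eU E) (eQ E)^`()) (ibp (eU E) (wtest _ _ _)) (ibp (eQ E) (wtest _ _ _))
  (ibp (eP E) (wtest _ _ _)).
rewrite (dotp_wtest _ _ _ (szB _ 0 _ sg_)) (dotp_wtest _ _ _ (szB _ 0 _ sq))
  (dotp_wtest _ _ _ (szB _ 0 _ sp)).
have dsz p : (size p <= n.+2)%N -> (size p^`() <= n.+2)%N.
  by move=> /size_deriv_le /leq_trans; apply.
rewrite (dotp_wtest _ _ _ (dsz _ su)) (dotp_wtest _ _ _ (dsz _ sp))
  (dotp_wtest _ _ _ (dsz _ sq)).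
rewrite !dotpBl !dotpZl !wtest1 !wtest0.
have X1 := dotp_X_deriv (eU E) (eP E).
have X2 := dotp_X_deriv (eQ E) (eQ E).
have ibs (a b : {poly R}) : dotp a^`() b + dotp b^`() a = a.[1] * b.[1] - a.[0] * b.[0].
  by rewrite dotp_deriv (dotpC a); ring.
have X3 := ibs (eU E) (eP E).
have X4 := ibs (eQ E) (eQ E).
have X5 := ibs (eQ E) (eU E).
have X6 : dotp (eQ E) ('X * eP E) = dotp (eP E) ('X * eQ E).
  by rewrite -!dotpM (mulrC (eQ E)) (mulrC (eP E)) /dotp; congr intp; ring.
rewrite /resid !dotp_wt /flux_l /flux_r.
have -> : eul E = (eU E).[0] + ja E by rewrite /ja; ring.
have -> : eur E = (eU E).[1] + jb E by rewrite /jb; ring.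
rewrite t1 t2 t3 -/(ja E) -/(jb E) -/(jc E).
have -> : epr E = (eP E).[1] + jc E by rewrite /jc; ring.
move: X1 X2 X3 X4 X5 X6.
move: (legth n.+1) (legc n.+1 (eU E)) (legc n.+1 (eP E)) (legc n.+1 (eQ E)) => th cu cp cq.
move: (ja E) (jb E) (jc E) => ja_ jb_ jc_.
move: ((-1) ^+ n.+1) => s_.
move=> X1 X2 X3 X4 X5 X6 F1 F2 F3 F4 F5.
apply: (lincomb (c1 := 1) (c2 := 1) (c3 := 1) (c4 := 1) (c5 := -1) F1 F2 F3 F4 F5).
have -> : dotp (eP E)^`() ('X * eU E) = (eU E).[1] * (eP E).[1]
  - dotp (eU E) (eP E) - dotp (eU E)^`() ('X * eP E) by rewrite -X1; ring.
have -> : dotp (eQ E)^`() ('X * eQ E) =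
  ((eQ E).[1] * (eQ E).[1] - dotp (eQ E) (eQ E)) / 2 by rewrite -X2; field.
have -> : dotp (eP E)^`() (eU E) = (eU E).[1] * (eP E).[1]
  - (eU E).[0] * (eP E).[0] - dotp (eU E)^`() (eP E) by rewrite -X3; ring.
have -> : dotp (eQ E)^`() (eQ E) =
  ((eQ E).[1] * (eQ E).[1] - (eQ E).[0] * (eQ E).[0]) / 2 by rewrite -X4; field.
have -> : dotp (eQ E)^`() (eU E) = (eQ E).[1] * (eU E).[1]
  - (eQ E).[0] * (eU E).[0] - dotp (eU E)^`() (eQ E) by rewrite -X5; ring.
rewrite X6 (dotpC (eP E) (eQ E)) (dotpC (eP E) (eU E)).
clear -sg_gt0.
move: (dotp (eU E)^`() ('X * eP E)) (dotp (eU E)^`() (eP E)) (dotp (eU E)^`() (eQ E)).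
move: (dotp (eU E) (eP E)) (dotp (eQ E) (eP E)) (dotp (eQ E) (eQ E)).
move: (dotp (eP E) ('X * eQ E)) (dotp (eG E) (eU E)) (dotp (eG E) ('X * eU E)).
move: (dotp (leg n.+1) (eU E)) (dotp (leg n.+1) (eP E)) (dotp (leg n.+1) (eQ E)).
move: (dotp (leg n.+1) ('X * eU E)) (dotp (leg n.+1) ('X * eP E)) (dotp (leg n.+1) ('X * eQ E)).
move: (eU E).[1] (eU E).[0] (eP E).[1] (eP E).[0] (eQ E).[1] (eQ E).[0].
move=> *; field; exact: lt0r_neq0.
Qed.

Lemma dotp_derivr p q :
  dotp p q^`() = p.[1] * q.[1] - p.[0] * q.[0] - dotp p^`() q.
Proof. by rewrite (dotpC p^`()) [in RHS]dotpC dotp_deriv; ring. Qed.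

Lemma signE : s * s = 1.
Proof. by rewrite -expr2 sqrr_sign. Qed.

Lemma vm1 : vm.[1] = 0. Proof. by rewrite !hE !leg_at1 subrr. Qed.
Lemma vm0 : vm.[0] = - 2 * s.
Proof. rewrite !hE !leg_at0 exprS; ring. Qed.
Lemma vp1 : vp.[1] = 2. Proof. rewrite !hE !leg_at1; ring. Qed.
Lemma vp0 : vp.[0] = 0.
Proof. rewrite !hE !leg_at0 exprS; ring. Qed.
Lemma size_vpm : (size vp <= n.+2)%N /\ (size vm <= n.+2)%N.
Proof.
have a : (size (leg n : {poly R}) <= n.+2)%N := leqW (size_leg n).
split; rewrite (leq_trans (size_polyD _ _)) // geq_max ?size_polyN a size_leg //.
Qed.

Let dL p : (size p <= n.+2)%N -> dotp p^`() L = 0.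
Proof. by move=> sp; rewrite dotpC leg_orth // size_deriv_le. Qed.

(** Up to a term of order h, the jump of u at the left end point is the
    component of u along the top Legendre polynomial.  This is what allows a
    mismatch of the numerical trace of p to be compensated by [eal]. *)
Lemma left_jump_id h E : error_eqs h E ->
  s * c_ (eU E) + ja E = s / 2 * (h * dotp (eQ E - ebe E *: L) vm).
Proof.
move=> [[su _ _ _] e1 _ _ _]; rewrite /ja.
have := e1 _ size_vpm.2; rewrite dotp_derivr vm1 vm0 [dotp _^`() _]dotpBr dL //.
rewrite leg_deriv_dot // => e.
have -> : h * dotp (eQ E - ebe E *: L) vm =
  2 * c_ (eU E) + 2 * s * (eul E - (eU E).[0]) by lra.
have := signE; move: ((-1) ^+ n.+1) => t tt.
have -> : t / 2 * (2 * c_ (eU E) + 2 * t * (eul E - (eU E).[0])) =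
  t * c_ (eU E) + (t * t) * (eul E - (eU E).[0]) by field.
by rewrite tt mul1r.
Qed.

(** The top component of p is the right jump of p up to a time derivative. *)
Lemma top_p_id h E : error_eqs h E ->
  2 * c_ (eP E) = - 2 * jc E - h * dotp (eG E - eal E *: L) vp.
Proof.
move=> [[_ _ sp _] _ _ e3 _]; rewrite /jc.
have := e3 _ size_vpm.1; rewrite dotp_derivr vp1 vp0 [dotp _^`() _]dotpDr dL //.
by rewrite leg_deriv_dot // => e; lra.
Qed.

Lemma top_p_jump h E : error_eqs h E ->
  h * (nu * c_ (eP E)) = h * ega E * nu + (sg * jb E + sg^-1 * jc E)
    + s * (tqu * ja E).
Proof.
move=> [[_ sq sp _] _ e2 _ [_ t2 t3 _]].
have := e2 _ (size_leg _); rewrite dotpBl legcE dotpZl -/nu.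
rewrite dotp_derivr dL // leg_at1 leg_at0 t2 t3.
by rewrite -/(ja E) -/(jb E) -/(jc E) => e; lra.
Qed.

Lemma bndM (x y X Y : R) : `|x| <= X -> `|y| <= Y -> `|x * y| <= X * Y.
Proof. by move=> hx hy; rewrite normrM ler_pM. Qed.
Lemma bndD (x y X Y : R) : `|x| <= X -> `|y| <= Y -> `|x + y| <= X + Y.
Proof. by move=> hx hy; rewrite (le_trans (ler_normD _ _)) // lerD. Qed.
Lemma bndN (x X : R) : `|x| <= X -> `|- x| <= X.
Proof. by rewrite normrN. Qed.
Lemma bnd_dot p q X Y : normp p <= X -> normp q <= Y -> `|dotp p q| <= X * Y.
Proof.
move=> hp hq; apply: le_trans (CauchySchwarz _ _) _.
by rewrite ler_pM ?normp_ge0.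
Qed.

Definition jsum E := `|ja E| + `|jb E| + `|jc E|.
Definition small d E := [/\ `|ebe E| <= d, `|ega E| <= d & `|ele E| <= d].

Definition zx : {poly R} := 'X * L - legth n.+1 *: leg n.+2.
Lemma size_zx : (size zx <= n.+2)%N.
Proof.
have := size_projX (size_leg (R := R) n.+1).
by rewrite [legc _ (leg _)]/legc -/(legnu _) divff ?legnu_neq0 // mulr1.
Qed.

(** One bound k for all the constants that depend on the degree and on the
    stabilization. *)
Definition elt_const (k : R) : Prop := 1 <= k /\
  [/\ [/\ nu <= k, nu^-1 <= k, sg <= k, sg^-1 <= k & `|tqu| <= k],
      [/\ `|tpu| <= k, `|legth n.+1| <= k, normp vm <= k, normp vp <= k & normp L <= k],
      [/\ normp ('X * L) <= k, normp zx <= k, normp zx^`() <= k,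
          `|zx.[1]| <= k & `|zx.[0]| <= k],
      (forall p, `|c_ p| <= k * normp p) &
      [/\ (forall p x, (size p <= n.+2)%N -> 0 <= x <= 1 -> `|p.[x]| <= k * normp p),
          (forall p, (size p <= n.+2)%N -> normp p^`() <= k * normp p),
          normp vp^`() <= k & normp 1 <= k]].

Lemma elt_const_ex : exists k, elt_const k.
Proof.
have [k1 k10 H1] := horner_le_normp (R := R) n.+2.
have [k2 k20 H2] := deriv_le_normp (R := R) n.+2.
pose l := [:: 1; nu; nu^-1; sg; sg^-1; `|tqu|; `|tpu|; `|legth n.+1|; normp vm;
  normp vp; normp L; normp ('X * L); normp zx; normp zx^`(); `|zx.[1]|;
  `|zx.[0]|; (Num.sqrt nu)^-1; k1; k2; normp vp^`(); normp 1].
have l0 : all (fun x : R => 0 <= x) l.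
  by rewrite /= !normp_ge0 !normr_ge0 ler01 !invr_ge0 sqrtr_ge0
    (ltW (legnu_gt0 _)) (ltW sg_gt0) k10 k20.
have S x : x \in l -> x <= \sum_(y <- l) y.
  elim: l l0 => //= y l IH /andP[y0 l0]; rewrite big_cons in_cons.
  case/predU1P => [->|/(IH l0) xl].
    rewrite lerDl big_seq sumr_ge0 // => z zl; exact: (allP l0).
  by rewrite (le_trans xl) // lerDr.
exists (\sum_(y <- l) y); split; first by apply: S; rewrite !inE eqxx.
have nn p : 0 <= normp p by exact: normp_ge0.
split; [split|split|split| |split]; try by apply: S; rewrite !inE eqxx ?orbT.
- move=> p; apply: le_trans (legc_le _ _) _; apply: ler_wpM2r => //.
  by apply: S; rewrite !inE eqxx ?orbT.
- move=> p x sp hx; apply: le_trans (H1 _ _ sp hx) _; apply: ler_wpM2r => //.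
  by apply: S; rewrite !inE eqxx ?orbT.
- move=> p sp; apply: le_trans (H2 _ sp) _; apply: ler_wpM2r => //.
  by apply: S; rewrite !inE eqxx ?orbT.
Qed.

(** Two integrations by parts on the element: h p is of the order of q. *)
Lemma p_moment h d E k : elt_const k -> 0 < h ->
  error_eqs h E -> small d E ->
  `|h * dotp L ('X * eP E)| <=
    3 * k ^+ 2 * (h * d + normp (eQ E) + jsum E).
Proof.
move=> [k1 [[_ _ ksg ksg' ktqu] [_ _ _ _ kL] [_ kzx kzx' kzx1 kzx0] _ [ktr _ _ _]]].
move=> h0 [[_ sq sp _] _ e2 _ [_ t2 t3 _]] [_ hga _].
have := e2 _ size_zx; rewrite dotpBl dotpZl t2 t3 -/(ja E) -/(jb E) -/(jc E) => e.
have -> : dotp L ('X * eP E) = dotp (eP E) zx.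
  rewrite /zx dotpBr dotpZr L2_orth // mulr0 subr0 -dotpM dotpC.
  by rewrite mulrC.
have k0 : 0 <= k by rewrite (le_trans ler01).
have -> : h * dotp (eP E) zx = h * (ega E * dotp L zx) - dotp (eQ E) zx^`()
  + ((eQ E).[1] + sg * jb E + sg^-1 * jc E) * zx.[1]
  - ((eQ E).[0] - tqu * ja E) * zx.[0] by lra.
have n1 : `|(eQ E).[1]| <= k * normp (eQ E) by rewrite ktr ?ler01 ?lexx.
have n0 : `|(eQ E).[0]| <= k * normp (eQ E) by rewrite ktr ?ler01 ?lexx.
have a0 := normr_ge0 (ja E); have b0 := normr_ge0 (jb E); have c0 := normr_ge0 (jc E).
have q0 := normp_ge0 (eQ E).
have d0 : 0 <= d by apply: le_trans hga; exact: normr_ge0.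
have B : `|h * (ega E * dotp L zx) - dotp (eQ E) zx^`()
  + ((eQ E).[1] + sg * jb E + sg^-1 * jc E) * zx.[1]
  - ((eQ E).[0] - tqu * ja E) * zx.[0]| <=
  h * (d * (k * k)) + normp (eQ E) * k +
  (k * normp (eQ E) + k * `|jb E| + k * `|jc E|) * k +
  (k * normp (eQ E) + k * `|ja E|) * k.
  apply: bndD; last apply: bndN; last apply: bndM => //.
    apply: bndD; last (apply: bndM => //; apply: bndD; first apply: bndD => //).
      apply: bndD.
        apply: bndM; first by rewrite gtr0_norm.
        by apply: bndM => //; exact: bnd_dot.
      by apply: bndN; exact: bnd_dot.
    all: try (apply: bndM => //; rewrite gtr0_norm ?invr_gt0 //).
  by apply: bndD => //; apply: bndN; exact: bndM.
apply: le_trans B _; rewrite /jsum.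
have kk : k <= k ^+ 2 by rewrite expr2 ler_peMl.
have h0' := ltW h0; have : 0 <= h * d * k ^+ 2 by rewrite !mulr_ge0 ?sqr_ge0.
have : 0 <= (k ^+ 2 - k) * normp (eQ E) by rewrite mulr_ge0 ?subr_ge0.
have : 0 <= k ^+ 2 * `|ja E| by rewrite mulr_ge0 ?sqr_ge0.
have : 0 <= k ^+ 2 * `|jb E| by rewrite mulr_ge0 ?sqr_ge0.
have : 0 <= k ^+ 2 * `|jc E| by rewrite mulr_ge0 ?sqr_ge0.
by rewrite !expr2; lra.
Qed.

Lemma resid_bound k h phl d M E : elt_const k -> 0 < h -> h <= 1 ->
  1 <= phl -> phl <= M -> error_eqs h E -> small d E ->
  resid h phl E + h * dotp (eG E) (corr h phl E) <=
   50 * k ^+ 3 * (M * (h * d * (normp (eU E) + normp (eQ E) + d + jsum E))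
     + jsum E ^+ 2 + h * jsum E * (normp (eU E) + normp (eQ E))).
Proof.
move=> Ck h0 h1 ph1 phM eqs sm; have := p_moment Ck h0 eqs sm.
have := left_jump_id eqs; have := top_p_id eqs; have := top_p_jump eqs.
case: Ck => k1 [[knu knu' ksg ksg' ktqu] [ktpu kth kvm kvp kL] [kXL kzx kzx' kzx1 kzx0] kc [ktr _ _ _]].
case: eqs => [[su sq sp sG] _ _ _ [_ _ _ G]]; case: sm => hbe hga hle.
move=> I3 I2 I1 B0.
set U := normp (eU E); set Q := normp (eQ E); set j := jsum E in B0 *.
have U0 : 0 <= U by exact: normp_ge0.
have Q0 : 0 <= Q by exact: normp_ge0.
have aj : `|ja E| <= j by rewrite /j /jsum -addrA lerDl addr_ge0.
have bj : `|jb E| <= j by rewrite /j /jsum addrAC lerDr addr_ge0.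
have cj : `|jc E| <= j by rewrite /j /jsum lerDr addr_ge0.
have j0 : 0 <= j by rewrite (le_trans _ aj).
have d0 : 0 <= d by apply: le_trans hga; exact: normr_ge0.
have k0 : 0 <= k by rewrite (le_trans ler01).
have h0' := ltW h0.
have hh : `|h| <= h by rewrite ger0_norm.
have M0 : 0 <= M by rewrite (le_trans ler01) // (le_trans ph1).
have phn : `|phl| <= M by rewrite ger0_norm // (le_trans ler01).
have sn : `|s : R| <= 1 by rewrite normrX normrN1 expr1n.
have nun : `|nu| <= k by rewrite gtr0_norm ?legnu_gt0.
have nun' : `|nu^-1| <= k by rewrite gtr0_norm ?invr_gt0 ?legnu_gt0.
have sgn : `|sg| <= k by rewrite gtr0_norm.
have sgn' : `|sg^-1| <= k by rewrite gtr0_norm ?invr_gt0.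
have hcu : `|h * c_ (eU E)| <= h * (k * U) by apply: bndM.
have hcq : `|h * c_ (eQ E)| <= h * (k * Q) by apply: bndM.
have dr : `|sg * jb E + sg^-1 * jc E| <= k * j + k * j.
  by apply: bndD; apply: bndM.
have hcp : `|h * c_ (eP E)| <= h * d + k * (k * j + k * j + 1 * (k * j)).
  have -> : h * c_ (eP E) = h * ega E + nu^-1 * ((sg * jb E + sg^-1 * jc E)
    + s * (tqu * ja E)).
    have := I3; move: ((-1) ^+ n.+1) => t e.
    have nz := legnu_neq0 (R := R) n.+1.
    have -> : h * c_ (eP E) = nu^-1 * (h * (nu * c_ (eP E))) by field.
    by rewrite e; field; rewrite nz gt_eqF.
  by apply: bndD; [exact: bndM|apply: bndM => //; apply: bndD => //;
    apply: bndM => //; apply: bndM].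
have al : eal E = - s * ele E / (h * nu).
  by rewrite -G; field; rewrite !gt_eqF ?legnu_gt0.
have cpE : c_ (eP E) = - jc E - h / 2 * (dotp (eG E) vp - eal E * nu).
  have : dotp (eG E - eal E *: L) vp = dotp (eG E) vp - eal E * nu.
    by rewrite dotpBl dotpZl (dotpDr _ _ L) leg_orth ?add0r // size_leg.
  move=> <-; rewrite -[LHS](mulKf (x := 2)) ?pnatr_eq0 // I2.
  by field.
have dec : resid h phl E + h * dotp (eG E) (corr h phl E) =
  (- (phl * (ele E * (s * c_ (eU E) + ja E)))
   - s * (ele E * (nu^-1 * (h * dotp L ('X * eU E)))))
  + (h * (ebe E * (phl * (nu * jc E))) + 2^-1 * (h * (ebe E * (phl * (s * (ele E * nu)))))
     - ebe E * (h * (h * dotp L ('X * eP E))))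
  + h * (ega E * (phl * dotp L (eQ E) + h * dotp ('X * L) (eQ E)))
  + h * (ebe E * dotp L (eQ E) + ega E * dotp L (eU E))
  + (- (jb E * (sg * jb E + sg^-1 * jc E)) - tqu * (ja E * ja E))
  + legth n.+1 * (jc E * (h * c_ (eU E)) + jb E * (h * c_ (eP E))
      - (sg * jb E + sg^-1 * jc E) * (h * c_ (eQ E)))
  + legth n.+1 * (s * ((ele E - tpu * ja E) * (h * c_ (eU E)) + ja E * (h * c_ (eP E))
      + tqu * (ja E * (h * c_ (eQ E))))).
  rewrite /resid !dotp_wt /corr dotpZr (mulrC 'X L) dotpM.
  rewrite (dotpC L (eU E)) (dotpC L (eP E)) !legcE.
  rewrite [in X in _ - h * ebe E * X]cpE al.
  move: (legth n.+1) (c_ (eU E)) (c_ (eP E)) (c_ (eQ E)) => th cu cp cq.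
  move: (dotp L (eQ E)) (dotp L ('X * eU E)) (dotp L ('X * eP E)) (dotp L ('X * eQ E)).
  move: (dotp (eG E) vp) ((-1) ^+ n.+1) (ja E) (jb E) (jc E) => gvp t xa xb xc x1 x2 x3 x4.
  by field; rewrite !gt_eqF ?legnu_gt0.
rewrite dec.
have c1 : `|s * c_ (eU E) + ja E| <= h * ((Q + d * k) * k).
  rewrite I1; have -> : h * ((Q + d * k) * k) = 2 / 2 * (h * ((Q + d * k) * k)) by field.
  apply: bndM.
    by rewrite normrM normrX normrN1 expr1n mul1r ger0_norm // ler_pdivlMr // mulVf // ler1n.
  apply: bndM => //; apply: bnd_dot => //.
  apply: le_trans (normpB _ _) _; rewrite lerD2l normpZ ler_pM ?normp_ge0 //.
have dU : `|h * dotp L ('X * eU E)| <= h * (k * U).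
  by apply: bndM => //; rewrite -dotpM (mulrC L); apply: bnd_dot.
have T1 : `|- (phl * (ele E * (s * c_ (eU E) + ja E)))
   - s * (ele E * (nu^-1 * (h * dotp L ('X * eU E))))| <=
   M * (d * (h * ((Q + d * k) * k))) + 1 * (d * (k * (h * (k * U)))).
  by apply: bndD; apply: bndN; do ![apply: bndM => //].
have T2 : `|h * (ebe E * (phl * (nu * jc E))) + 2^-1 * (h * (ebe E * (phl * (s * (ele E * nu)))))
     - ebe E * (h * (h * dotp L ('X * eP E)))| <=
  h * (d * (M * (k * j))) + 2^-1 * (h * (d * (M * (1 * (d * k))))) +
  d * (h * (3 * k ^+ 2 * (h * d + Q + j))).
  by apply: bndD; [apply: bndD|apply: bndN]; do ![apply: bndM => //];
    rewrite ger0_norm.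
have T3 : `|h * (ega E * (phl * dotp L (eQ E) + h * dotp ('X * L) (eQ E)))| <=
  h * (d * (M * (k * Q) + h * (k * Q))).
  by do 2![apply: bndM => //]; apply: bndD; apply: bndM => //; apply: bnd_dot.
have T4 : `|h * (ebe E * dotp L (eQ E) + ega E * dotp L (eU E))| <=
   h * (d * (k * Q) + d * (k * U)).
  by apply: bndM => //; apply: bndD; apply: bndM => //; apply: bnd_dot.
have T5 : `|- (jb E * (sg * jb E + sg^-1 * jc E)) - tqu * (ja E * ja E)| <=
   j * (k * j + k * j) + k * (j * j).
  by apply: bndD; apply: bndN; do ![apply: bndM => //].
have T6 : `|legth n.+1 * (jc E * (h * c_ (eU E)) + jb E * (h * c_ (eP E))
      - (sg * jb E + sg^-1 * jc E) * (h * c_ (eQ E)))| <=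
   k * (j * (h * (k * U)) + j * (h * d + k * (k * j + k * j + 1 * (k * j)))
      + (k * j + k * j) * (h * (k * Q))).
  by apply: bndM => //; apply: bndD; [apply: bndD|apply: bndN]; apply: bndM.
have T7 : `|legth n.+1 * (s * ((ele E - tpu * ja E) * (h * c_ (eU E)) + ja E * (h * c_ (eP E))
      + tqu * (ja E * (h * c_ (eQ E)))))| <=
   k * (1 * ((d + k * j) * (h * (k * U)) + j * (h * d + k * (k * j + k * j + 1 * (k * j)))
      + k * (j * (h * (k * Q))))).
  apply: bndM => //; apply: bndM => //; apply: bndD; last by do 2![apply: bndM => //].
  apply: bndD; last by apply: bndM.
  by apply: bndM => //; apply: bndD => //; apply: bndN; apply: bndM.
apply: le_trans (ler_norm _) _.
apply: le_trans.
  by do 6![apply: bndD; last eassumption]; eassumption.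
by rewrite -/U -/Q -/j; apply: resid_arith => //; exact: le_trans phM.
Qed.

Lemma jsum_sqr E : jsum E ^+ 2 <= 3 * jumps E.
Proof.
rewrite /jumps -(real_normK (num_real (ja E))) -(real_normK (num_real (jb E)))
  -(real_normK (num_real (jc E))) /jsum.
move: `|ja E| `|jb E| `|jc E| => x y z.
have := sqr_ge0 (x - y); have := sqr_ge0 (x - z); have := sqr_ge0 (y - z).
rewrite !expr2; lra.
Qed.

(** For a large weight the jump terms of [energy_identity] dominate those of
    [resid_bound], whose constant does not depend on the weight; neither does the
    factor of the square of u, which is what makes the weighted left hand side
    coercive later. *)
Lemma element_energy : exists2 M0, 1 <= M0 & forall M M', M0 <= M -> M <= M' ->
  exists2 C, 0 <= C & forall h phl d E, 0 < h -> h <= 1 -> M <= phl -> phl <= M' ->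
  error_eqs h E -> small d E ->
  h * dotp (eG E) (wt h phl * eU E + corr h phl E)
    + h * normp (eQ E) ^+ 2 + jumps E <=
  flux_r (phl + h) E - flux_l phl E + h * normp (eU E) ^+ 2 + C * (h * d ^+ 2).
Proof.
have [k Ck] := elt_const_ex; have k1 := Ck.1.
have k0 : 0 < k by exact: lt_le_trans ltr01 k1.
pose K : R := 50 * k ^+ 3.
have K0 : 0 <= K by rewrite mulr_ge0 // exprn_ge0 // ltW.
pose c1 : R := 3 * (K + 1 + 2 * K ^+ 2) + 1.
have c10 : 1 <= c1 by rewrite /c1 lerDr mulr_ge0 // !addr_ge0 // mulr_ge0 // sqr_ge0.
have kk1 : 1 <= k ^+ 2 by rewrite exprn_ege1.
have gen (x : R) : x <= 1 -> x / 2 <= - tpu - tqu ^+ 2 / 2.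
  move=> hx; have : x / 2 <= 1 / 2 by rewrite ler_wpM2r ?invr_ge0.
  by have := tpu_le; lra.
exists (2 * k ^+ 2 * c1).
  by rewrite mulr_ege1 // mulr_ege1 // ler1n.
move=> M M' M0 MM.
exists (2 * K ^+ 2 * M' ^+ 2 + K * M').
  have M0' : 0 <= M'.
    apply: le_trans MM; apply: le_trans M0.
    by rewrite !mulr_ge0 ?sqr_ge0 // (le_trans ler01).
  apply: addr_ge0; last exact: mulr_ge0 K0 M0'.
  by apply: mulr_ge0; [apply: mulr_ge0 => //|]; exact: sqr_ge0.
move=> h phl d E h0 h1 ph1 ph2 eqs sm.
have M1 : 1 <= M.
  by apply: le_trans M0; rewrite mulr_ege1 // mulr_ege1 // ler1n.
have ph1' : 1 <= phl := le_trans M1 ph1.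
have := resid_bound Ck h0 h1 ph1' ph2 eqs sm; rewrite -/K.
have := energy_identity phl eqs; have := jsum_sqr E.
rewrite dotpDr -!normp_sqr.
have [_ [[_ _ ksg ksg' _] _ _ _ _]] := Ck.
have ik : k^-1 ^+ 2 <= sg ^+ 2.
  by rewrite ler_pXn2r ?nnegrE ?invr_ge0 ?(ltW sg_gt0) ?(ltW k0) // invf_ple ?posrE.
have ik' : k^-1 ^+ 2 <= sg^-1 ^+ 2.
  by rewrite ler_pXn2r ?nnegrE ?invr_ge0 ?(ltW sg_gt0) ?(ltW k0) // lef_pV2 ?posrE.
have ik1 : k^-1 ^+ 2 <= 1.
  by rewrite exprn_ile1 ?invr_ge0 ?(ltW k0) // invf_le1.
have d0 : 0 <= d by case: sm => + _ _; apply: le_trans; exact: normr_ge0.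
have j0 : 0 <= jsum E by rewrite !addr_ge0.
have U0 := normp_ge0 (eU E); have Q0 := normp_ge0 (eQ E).
have J0 : 0 <= jumps E by rewrite !addr_ge0 ?sqr_ge0.
have diss : c1 * jumps E <=
  (phl + h) * (sg ^+ 2 * jb E ^+ 2 + sg^-1 ^+ 2 * jc E ^+ 2) / 2
  + phl * (- tpu - tqu ^+ 2 / 2) * ja E ^+ 2.
  have -> : c1 * jumps E = (2 * k ^+ 2 * c1) * (k^-1 ^+ 2 / 2 * jumps E).
    by field; rewrite gt_eqF.
  have x0 : 0 <= k^-1 ^+ 2 / 2 * jumps E by apply: mulr_ge0 => //; apply: mulr_ge0; rewrite ?sqr_ge0 ?invr_ge0.
  apply: (@le_trans _ _ (phl * (k^-1 ^+ 2 / 2 * jumps E))).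
    by apply: ler_wpM2r => //; exact: le_trans ph1.
  have a0 := sqr_ge0 (ja E); have b0 := sqr_ge0 (jb E); have c0 := sqr_ge0 (jc E).
  have e1 := ler_wpM2r b0 ik; have e2 := ler_wpM2r c0 ik'.
  have e3 : k^-1 ^+ 2 / 2 * ja E ^+ 2 <= (- tpu - tqu ^+ 2 / 2) * ja E ^+ 2.
    apply: ler_wpM2r => //; exact: gen.
  have p0 : 0 <= phl := le_trans ler01 ph1'.
  apply: (@le_trans _ _ (phl *
     ((sg ^+ 2 * jb E ^+ 2 + sg^-1 ^+ 2 * jc E ^+ 2) / 2 +
      (- tpu - tqu ^+ 2 / 2) * ja E ^+ 2))).
    apply: ler_wpM2l => //; move: e1 e2 e3; rewrite /jumps; clear.
    move: (k^-1 ^+ 2) (sg ^+ 2) (sg^-1 ^+ 2) (_ - _) => ki s1 s2 t.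
    by move: (ja E ^+ 2) (jb E ^+ 2) (jc E ^+ 2) => a b c; lra.
  rewrite [X in X <= _]mulrDr mulrA -[X in _ <= _ + X]mulrA lerD2r.
  rewrite ler_wpM2r ?invr_ge0 // ler_wpM2r ?lerDl ?(ltW h0) //.
  by rewrite addr_ge0 // mulr_ge0 ?sqr_ge0.
have M'0 : 0 <= M' by apply: le_trans ph2; exact: le_trans ler01 ph1'.
have := young_energy K0 M'0 (ltW h0) h1 d0 U0 Q0 j0.
move: diss; rewrite /c1.
move: (jumps E) (jsum E ^+ 2) J0 => J j2 J0.
have K00 : 0 <= K + 1 + 2 * K ^+ 2.
  by rewrite addr_ge0 ?addr_ge0 // mulr_ge0 ?sqr_ge0.
move: (K + 1 + 2 * K ^+ 2) K00 => K1 K10 diss yo j3 id rb.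
have K2 : K1 * j2 <= K1 * (3 * J) by exact: ler_wpM2l.
move: diss yo id rb K2; move: (_ - flux_l _ _) (resid _ _ _) => F Rs.
move: (K * (_ + _)) (_ * (h * d ^+ 2)) => X1 X2 d1 yo id rb K2.
clear -n sg_gt0 tpu_le L2_orth lincomb dL d1 yo id rb K2 J0 j3.
lra.
Qed.

(** The third equation controls the derivative of p, and the jump controls its value
    at the right end point. *)
Lemma element_p : exists2 K, 0 <= K & forall h d E, 0 < h -> h <= 1 ->
  error_eqs h E -> small d E ->
  normp (eP E - (epr E)%:P) <= K * (h * normp (eG E) + jsum E + d).
Proof.
have [k [k1 [[_ _ _ _ _] [ktpu _ _ _ _] _ _ [ktr _ _ kn1]]]] := elt_const_ex.
have [K1 K10 HK1] := poincare_normp (R := R) n.+1.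
have k0 : 0 <= k by rewrite (le_trans ler01).
exists (k + K1 * (1 + k * 2 + k * k)); first by rewrite !(addr_ge0, mulr_ge0).
move=> h d E h0 h1 [[su sq sp sG] _ _ e3 [t1 _ _ _]] [_ _ hle].
have j0 : 0 <= jsum E by rewrite !addr_ge0.
have d0 : 0 <= d by apply: le_trans hle; exact: normr_ge0.
have aj : `|ja E| <= jsum E by rewrite /jsum -addrA lerDl addr_ge0.
have cj : `|jc E| <= jsum E by rewrite /jsum lerDr addr_ge0.
set p' := (eP E)^`(); have sp' : (size p' <= n.+2)%N.
  by rewrite ltnW // ltnS size_deriv_le.
have G0 := normp_ge0 (eG E); have P0 := normp_ge0 p'.
have e : dotp p' p' = - (h * dotp (eG E) p') - jc E * p'.[1]
   + (ele E - tpu * ja E) * p'.[0].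
  have := e3 _ sp'; rewrite dotp_derivr t1 dotpBl dotpZl (dotpC L) dL // mulr0 subr0.
  by rewrite -/p' /jc /ja; lra.
have B : `|dotp p' p'| <= h * (normp (eG E) * normp p') + jsum E * (k * normp p')
   + (d + k * jsum E) * (k * normp p').
  rewrite e; apply: bndD; [apply: bndD; apply: bndN|].
  - by apply: bndM; [rewrite gtr0_norm|exact: bnd_dot].
  - by apply: bndM => //; rewrite ktr ?ler01 ?lexx.
  - apply: bndM; last by rewrite ktr ?ler01 ?lexx.
    by apply: bndD => //; apply: bndN; apply: bndM.
have B' : normp p' <= h * normp (eG E) + jsum E * k + (d + k * jsum E) * k.
  have [->|np] := eqVneq (normp p') 0.
    by rewrite !addr_ge0 ?mulr_ge0 ?addr_ge0 ?mulr_ge0 // ltW.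
  have np0 : 0 < normp p' by rewrite lt_neqAle eq_sym np.
  rewrite -(ler_pM2r np0) -expr2 normp_sqr; apply: le_trans (ler_norm _) _.
  by apply: le_trans B _; rewrite le_eqVlt; apply/orP; left; apply/eqP; ring.
have -> : eP E - (epr E)%:P = (eP E - (eP E).[1]%:P) - jc E *: 1.
  by rewrite /jc -alg_polyC scalerBl !alg_polyC; ring.
apply: le_trans (normpB _ _) _; rewrite normpZ.
have := HK1 _ sp; rewrite -/p' => H.
have H2 : `|jc E| * normp 1 <= jsum E * k by apply: ler_pM => //; exact: normp_ge0.
have H3 := ler_wpM2l K10 B'.
have hG : 0 <= h * normp (eG E) by rewrite mulr_ge0 // ltW.
have q1 := mulr_ge0 K10 (mulr_ge0 k0 hG).
have q2 := mulr_ge0 K10 (mulr_ge0 (mulr_ge0 k0 k0) hG).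
have q3 := mulr_ge0 k0 hG.
have q4 := mulr_ge0 K10 j0.
have q5 := mulr_ge0 (mulr_ge0 K10 k0) j0.
have q6 := mulr_ge0 K10 d0.
have q7 := mulr_ge0 (mulr_ge0 K10 k0) d0.
have q8 := mulr_ge0 (mulr_ge0 K10 (mulr_ge0 k0 k0)) d0.
have q9 := mulr_ge0 k0 d0.
have q10 := mulr_ge0 (mulr_ge0 K10 (mulr_ge0 k0 k0)) j0.
apply: le_trans (lerD H H2) _.
move: H3 q1 q2 q3 q4 q5 q6 q7 q8 q9 q10; clear -n sg_gt0 tpu_le L2_orth lincomb dL.
move: (jsum E) (h * normp (eG E)) (normp p') => J G P *; lra.
Qed.

Lemma flux_p h E : error_eqs h E -> epl E = epr E + h * dotp (eG E) 1.
Proof.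
move=> [_ _ _ e3 _]; have s1 : (size (1 : {poly R})%R <= n.+2)%N by rewrite size_poly1.
have := e3 _ s1; rewrite -(polyC1 R) derivC dotp0 !hornerC polyC1 dotpBl dotpZl.
by rewrite leg_orth ?size_poly1 // => e; lra.
Qed.

Lemma flux_q h E : error_eqs h E -> eqr E = eql E + h * dotp (eP E) 1.
Proof.
move=> [_ _ e2 _ _]; have s1 : (size (1 : {poly R})%R <= n.+2)%N by rewrite size_poly1.
have := e2 _ s1; rewrite -(polyC1 R) derivC dotp0 !hornerC polyC1 dotpBl dotpZl.
by rewrite leg_orth ?size_poly1 // => e; lra.
Qed.

(** ** The coupled system *)

Section System.
Variables (N : nat) (x : nat -> R).
Hypothesis x_lt : forall i, (i < N)%N -> x i < x i.+1.
Implicit Types (EE : 'I_N -> errstate R) (dd : 'I_N -> R).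

Definition hh (i : nat) : R := x i.+1 - x i.

(** The existence of the nodal functions U, Q, P says that the numerical traces are
    single valued. *)
Definition error_sys EE : Prop :=
  (forall i : 'I_N, error_eqs (hh i) (EE i)) /\
  exists U Q P : nat -> R,
    [/\ forall i : 'I_N, eul (EE i) = U i /\ eur (EE i) = U i.+1,
        forall i : 'I_N, eql (EE i) = Q i /\ eqr (EE i) = Q i.+1,
        forall i : 'I_N, epl (EE i) = P i /\ epr (EE i) = P i.+1 &
        [/\ U 0 = 0, U N = 0 & Q N = 0]].

Lemma x_mono i j : (i <= j)%N -> (j <= N)%N -> x i <= x j.
Proof.
move=> ij; rewrite -(subnKC ij); elim: (j - i)%N => [|m IH]; first by rewrite addn0.
rewrite addnS => h; apply: le_trans (IH (ltnW h)) _; apply: ltW; exact: x_lt.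
Qed.

Lemma hh_gt0 (i : 'I_N) : 0 < hh i. Proof. by rewrite subr_gt0 x_lt. Qed.

Lemma sum_hh : \sum_(i < N) hh i = x N - x 0.
Proof. by rewrite -(big_mkord xpredT hh) telescope_sumr. Qed.

(** The values of the global weight at the nodes; [wt] interpolates them. *)
Definition phi (M : R) (i : nat) : R := M + (x i - x 0).

Definition energy_form (M : R) EE (G : 'I_N -> {poly R}) : R :=
  \sum_(i < N) hh i * dotp (G i)
     (wt (hh i) (phi M i) * eU (EE i) + corr (hh i) (phi M i) (EE i)).

End System.
End Element.

(** The increasing weight adds control of q, in the spirit of Kato's smoothing
    estimate; the boundary value Q0 of the trace of q at the left end point is
    kept because it fixes the mean value of p. *)
Lemma global_energy (R : realType) n (sg tqu tpu : R) : 0 < sg ->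
  tpu <= - 2^-1 - 2^-1 * tqu ^+ 2 ->
  exists2 M0, 1 <= M0 & forall M l, M0 <= M -> 0 <= l ->
  exists2 C, 0 <= C & forall N (x : nat -> R) EE dd,
    (forall i, (i < N)%N -> x i < x i.+1) ->
    (forall i : 'I_N, hh x i <= 1) -> x N - x 0 <= l ->
    error_sys n sg tqu tpu x EE -> (forall i, small (dd i) (EE i)) ->
    exists Q0, energy_form n x M EE (fun i => eG (EE i))
      + \sum_(i < N) hh x i * normp (eQ (EE i)) ^+ 2 + \sum_(i < N) jumps (EE i)
      + Q0 ^+ 2 / 2 <=
    \sum_(i < N) hh x i * normp (eU (EE i)) ^+ 2 + C * \sum_(i < N) hh x i * dd i ^+ 2
    /\ \sum_(i < N) hh x i * dotp (eP (EE i)) 1 = - Q0.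
Proof.
move=> sg0 tpul; have [M0 M01 H] := element_energy n sg0 tpul.
exists M0 => // M l MM l0.
have [|C C0 HC] := H M (M + l) MM; first by rewrite lerDl.
exists C => // N x EE dd x_lt h1 xl [eqs [U [Q [P [hU hQ hP [U0 UN QN]]]]]] sm.
exists (Q 0); split; last first.
  rewrite (eq_bigr (fun i : 'I_N => Q i.+1 - Q i)) => [|i _].
    by rewrite -(big_mkord xpredT (fun i => Q i.+1 - Q i)) telescope_sumr // QN sub0r.
  by have := flux_q (eqs i); case: (hQ i) => -> -> ->; rewrite addrAC subrr add0r.
pose F i := - phi x M i * P i * U i + phi x M i * Q i ^+ 2 / 2 + U i * Q i.
have FN : \sum_(i < N) (F i.+1 - F i) <= - (Q 0 ^+ 2 / 2).
  rewrite -(big_mkord xpredT (fun i => F i.+1 - F i)) telescope_sumr // /F U0 UN QN.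
  have M1 : 0 <= M - 1 by rewrite subr_ge0 (le_trans M01).
  by have := mulr_ge0 M1 (sqr_ge0 (Q 0)); rewrite /phi subrr addr0 !expr2; lra.
have main (i : 'I_N) : hh x i * dotp (eG (EE i))
     (wt (hh x i) (phi x M i) * eU (EE i) + corr n (hh x i) (phi x M i) (EE i))
    + hh x i * normp (eQ (EE i)) ^+ 2 + jumps (EE i) <=
    F i.+1 - F i + hh x i * normp (eU (EE i)) ^+ 2 + C * (hh x i * dd i ^+ 2).
  have ph1 : M <= phi x M i by rewrite lerDl subr_ge0 (x_mono x_lt) // ltnW.
  have ph2 : phi x M i <= M + l.
    by rewrite lerD2l (le_trans _ xl) // lerD2r (x_mono x_lt) // ltnW.
  have := HC _ _ _ _ (hh_gt0 x_lt i) (h1 i) ph1 ph2 (eqs i) (sm i).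
  rewrite /flux_r /flux_l; case: (hU i) => -> ->; case: (hQ i) => -> ->; case: (hP i) => -> ->.
  by rewrite /F; have -> : phi x M i + hh x i = phi x M i.+1 by rewrite /phi /hh; ring.
have : \sum_(i < N) (hh x i * dotp (eG (EE i))
     (wt (hh x i) (phi x M i) * eU (EE i) + corr n (hh x i) (phi x M i) (EE i))
    + hh x i * normp (eQ (EE i)) ^+ 2 + jumps (EE i)) <=
   \sum_(i < N) (F i.+1 - F i + hh x i * normp (eU (EE i)) ^+ 2 + C * (hh x i * dd i ^+ 2)).
  by apply: ler_sum.
rewrite big_split [X in X + _ <= _]big_split [X in _ <= X]big_split
  [X in _ <= X + _]big_split /= -mulr_sumr /energy_form; move: FN.
by move: (\sum_(i < N) (F _ - F _)) (\sum_(i < N) jumps _) => FF JJ; lra.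
Qed.

Lemma le_normp (R : realType) (p q : {poly R}) :
  (forall x, 0 < x < 1 -> `|p.[x]| <= `|q.[x]|) -> normp p <= normp q.
Proof.
move=> h; rewrite ler_sqrt ?dotp_ge0 // -subr_ge0.
have -> : dotp q q - dotp p p = intp (q * q - p * p).
  by rewrite intpD -(scaleN1r (p * p)) intpZ mulN1r.
apply: intp_ge0 => x hx; rewrite hornerD hornerN !hornerM subr_ge0 -!expr2.
rewrite -[X in X <= _]real_normK ?num_real // -[X in _ <= X]real_normK ?num_real //.
by rewrite ler_pXn2r ?nnegrE // h.
Qed.

Lemma wt_coercive (R : realType) (h phl : R) (p : {poly R}) : 0 <= h ->
  phl * normp p ^+ 2 <= dotp p (wt h phl * p).
Proof.
move=> h0; rewrite normp_sqr dotp_wt lerDl mulr_ge0 //; apply: intp_ge0.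
by move=> x /andP[x0 _]; rewrite !hornerM hornerX mulrCA mulr_ge0 ?(ltW x0) // -expr2 sqr_ge0.
Qed.

Lemma wt_bounded (R : realType) (h phl : R) (p : {poly R}) : 0 <= h -> 0 <= phl ->
  normp (wt h phl * p) <= (phl + h) * normp p.
Proof.
move=> h0 p0; have ph : 0 <= phl + h by rewrite addr_ge0.
rewrite -(ger0_norm ph) -normpZ; apply: le_normp => x /andP[x0 x1].
rewrite hornerM hornerZ normrM [leRHS]normrM ler_wpM2r // (ger0_norm ph).
rewrite /wt hornerD hornerC hornerZ hornerX ger0_norm; last first.
  by rewrite addr_ge0 // mulr_ge0 // ltW.
by rewrite lerD2l ler_piMr // ltW.
Qed.

(** * Stability of the error equations *)

Section Stability.
Context {R : realType} (n : nat) (sg tqu tpu l : R).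
Hypothesis sg_gt0 : 0 < sg.
Hypothesis tpu_le : tpu <= - 2^-1 - 2^-1 * tqu ^+ 2.
Hypothesis l_ge0 : 0 <= l.

Definition wnorm N (x : nat -> R) (p : 'I_N -> {poly R}) : R :=
  \sum_(i < N) hh x i * normp (p i) ^+ 2.
Definition wsum N (x : nat -> R) (d : 'I_N -> R) : R :=
  \sum_(i < N) hh x i * d i ^+ 2.

Definition grid N (x : nat -> R) : Prop :=
  [/\ forall i, (i < N)%N -> x i < x i.+1,
      forall i : 'I_N, hh x i <= 1 & x N - x 0 <= l].

(** The energy, corrected by a lower order term that turns the time derivative
    in the top component of p into a total derivative. *)
Definition energy N (x : nat -> R) M (EE : 'I_N -> errstate R) : R :=
  \sum_(i < N) hh x i * (2^-1 * dotp (eU (EE i)) (wt (hh x i) (phi x M i) * eU (EE i))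
     + dotp (eU (EE i)) (corr n (hh x i) (phi x M i) (EE i))).

Lemma wnorm_ge0 N x (p : 'I_N -> {poly R}) : grid N x -> 0 <= wnorm x p.
Proof.
move=> [xl _ _]; apply: sumr_ge0 => i _.
by rewrite mulr_ge0 ?sqr_ge0 // ltW // hh_gt0.
Qed.
Lemma wsum_ge0 N x (d : 'I_N -> R) : grid N x -> 0 <= wsum x d.
Proof.
move=> [xl _ _]; apply: sumr_ge0 => i _.
by rewrite mulr_ge0 ?sqr_ge0 // ltW // hh_gt0.
Qed.

Definition corrk M : R := (M + l) * legnu n.+1 / 2 * normp (leg n + leg n.+1 : {poly R}).
Lemma corrk_ge0 M : 0 <= M -> 0 <= corrk M.
Proof.
move=> M0; have nu0 : 0 <= legnu n.+1 :> R by rewrite ltW ?legnu_gt0.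
by rewrite /corrk !mulr_ge0 ?normp_ge0 ?invr_ge0 // addr_ge0.
Qed.

Lemma corr_le M h p d (E : errstate R) : 0 < h -> 0 <= p -> p <= M + l -> `|ebe E| <= d ->
  normp (corr n h p E) <= corrk M * (h * d).
Proof.
move=> h0 p0 p1 hb; have nu0 : 0 < legnu n.+1 :> R by rewrite legnu_gt0.
rewrite /corr normpZ normrN /corrk; set v := normp _.
have -> : (M + l) * legnu n.+1 / 2 * v * (h * d) = h * d * (M + l) * legnu n.+1 / 2 * v by ring.
rewrite ler_wpM2r ?normp_ge0 //.
by do 4?[apply: bndM => //]; rewrite ger0_norm // ?invr_ge0 // ltW.
Qed.

(** The parameter th is kept free because [evolution] is also used on short
    intervals, where th is their length. *)
Lemma weighted_young M : 0 <= M -> exists2 C, 0 <= C &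
  forall N x (EE : 'I_N -> errstate R) dd rho th, grid N x ->
  (forall i, small (dd i) (EE i)) -> 0 < th ->
  `|energy_form n x M EE rho| <=
    C * (th * wnorm x rho + th^-1 * (wnorm x (fun i => eU (EE i)) + wsum x dd)).
Proof.
move=> M0; have k0 := corrk_ge0 M0.
pose K := M + l + 1 + corrk M.
have Ml : 0 <= M + l by rewrite addr_ge0.
have K0 : 0 <= K by rewrite !addr_ge0.
exists K => // N x EE dd rho th [xl x1 xN] sm th0.
apply: le_trans (ler_norm_sum _ _ _) _.
rewrite -big_split /= !mulr_sumr -big_split /= mulr_sumr.
apply: ler_sum => i _.
have h0 := hh_gt0 xl i; have h1 := x1 i; move: h0 h1 (sm i) => h0 h1 [hb _ _].
have p0 : 0 <= phi x M i by rewrite addr_ge0 // subr_ge0 (x_mono xl) // ltnW.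
have p1 : phi x M i <= M + l.
  by rewrite lerD2l (le_trans _ xN) // lerD2r (x_mono xl) // ltnW.
move: (hh x i) (phi x M i) (EE i) (dd i) (rho i) hb h0 h1 p0 p1 => h p E d r hb h0 h1 p0 p1.
have d0 : 0 <= d by apply: le_trans hb; exact: normr_ge0.
have u0 := normp_ge0 (eU E); have r0 := normp_ge0 r.
have B : `|dotp r (wt h p * eU E + corr n h p E)| <= normp r * (K * (normp (eU E) + d)).
  apply: bnd_dot => //; apply: le_trans (normpD _ _) _; rewrite mulrDr; apply: lerD.
    apply: le_trans (wt_bounded _ (ltW h0) p0) _.
    by rewrite ler_wpM2r // /K; lra.
  apply: le_trans (corr_le h0 p0 p1 hb) _.
  apply: ler_pM => //; first by rewrite mulr_ge0 // ltW.
    by rewrite /K lerDr addr_ge0.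
  by rewrite ler_piMl.
rewrite normrM (gtr0_norm h0); apply: le_trans (ler_wpM2l (ltW h0) B) _.
have -> : h * (normp r * (K * (normp (eU E) + d))) = K * (h * (normp r * (normp (eU E) + d))) by ring.
have -> : K * (th * (h * normp r ^+ 2) + th^-1 * (h * normp (eU E) ^+ 2 + h * d ^+ 2)) =
  K * (h * (th * normp r ^+ 2 + th^-1 * (normp (eU E) ^+ 2 + d ^+ 2))) by ring.
rewrite ler_wpM2l // ler_wpM2l ?(ltW h0) //.
move: (normp r) (normp (eU E)) => x1' y; set t := Num.sqrt th.
have t0 : 0 < t by rewrite sqrtr_gt0.
have -> : th = t ^+ 2 by rewrite sqr_sqrtr // ltW.
have s1 := sqr_ge0 (t * x1' - t^-1 * (y + d)); have s2 := sqr_ge0 (t^-1 * (y - d)).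
have tt : t * t^-1 = 1 by rewrite divff // gt_eqF.
have e : (t * x1') * (t^-1 * (y + d)) = x1' * (y + d).
  by rewrite -{2}[x1']mulr1 -tt; ring.
rewrite -exprVn; have s3 := sqr_ge0 (t * x1').
have : 2 * (x1' * (y + d)) <= t ^+ 2 * x1' ^+ 2 + (t^-1 * (y + d)) ^+ 2.
  by rewrite -e; move: s1; rewrite !expr2; lra.
move: s2 s3; move: (t^-1) => ti.
by rewrite !expr2; lra.
Qed.

(** The weight dominates the correction, which is of the order of the data. *)
Lemma energy_coercive M : 8 <= M -> exists2 C, 0 <= C &
  forall N x (EE : 'I_N -> errstate R) dd, grid N x ->
  (forall i, small (dd i) (EE i)) ->
  wnorm x (fun i => eU (EE i)) <= energy x M EE + C * wsum x dd /\
  energy x M EE <= C * (wnorm x (fun i => eU (EE i)) + wsum x dd).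
Proof.
move=> M8; have M0 : 0 <= M by lra.
have k0 := corrk_ge0 M0; set k := corrk M in k0.
have Ml : 0 <= M + l by rewrite addr_ge0.
exists (M + l + 1 + k + k ^+ 2); first by rewrite !addr_ge0 // sqr_ge0.
move=> N x EE dd [xl x1 xN] sm.
have key (i : 'I_N) : 
  normp (eU (EE i)) ^+ 2 <=
   (2^-1 * dotp (eU (EE i)) (wt (hh x i) (phi x M i) * eU (EE i))
     + dotp (eU (EE i)) (corr n (hh x i) (phi x M i) (EE i))) +
   (M + l + 1 + k + k ^+ 2) * dd i ^+ 2 /\
  (2^-1 * dotp (eU (EE i)) (wt (hh x i) (phi x M i) * eU (EE i))
     + dotp (eU (EE i)) (corr n (hh x i) (phi x M i) (EE i))) <=
   (M + l + 1 + k + k ^+ 2) * (normp (eU (EE i)) ^+ 2 + dd i ^+ 2).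
  have h0 := hh_gt0 xl i; have h1 := x1 i; move: h0 h1 (sm i) => h0 h1 [hb _ _].
  have pM : M <= phi x M i by rewrite lerDl subr_ge0 (x_mono xl) // ltnW.
  have p1 : phi x M i <= M + l.
    by rewrite lerD2l (le_trans _ xN) // lerD2r (x_mono xl) // ltnW.
  move: (hh x i) (phi x M i) (EE i) (dd i) hb h0 h1 pM p1 => h p E d hb h0 h1 pM p1.
  have p0 : 0 <= p by exact: le_trans pM.
  have d0 : 0 <= d by apply: le_trans hb; exact: normr_ge0.
  have u0 := normp_ge0 (eU E).
  have A := wt_coercive p (eU E) (ltW h0).
  have B : `|dotp (eU E) (wt h p * eU E)| <= normp (eU E) * ((p + h) * normp (eU E)).
    by apply: bnd_dot => //; apply: wt_bounded => //; exact: ltW.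
  have Cc : `|dotp (eU E) (corr n h p E)| <= normp (eU E) * (k * d).
    apply: bnd_dot => //; apply: le_trans (corr_le h0 p0 p1 hb) _.
    by rewrite ler_wpM2l // ler_piMl.
  move: A B Cc; move: (dotp _ _) (dotp _ _) => z w A B Cc.
  have u2 := sqr_ge0 (normp (eU E)); have d2 := sqr_ge0 d.
  have A' : 8 * normp (eU E) ^+ 2 <= p * normp (eU E) ^+ 2.
    by rewrite ler_wpM2r // (le_trans M8).
  have yg : normp (eU E) * (k * d) <= normp (eU E) ^+ 2 + k ^+ 2 * d ^+ 2.
    have := sqr_ge0 (normp (eU E) - k * d); have := sqr_ge0 (k * d).
    by rewrite !expr2; lra.
  have c1 := mulr_ge0 Ml d2; have c2 := mulr_ge0 k0 d2.
  have c3 := mulr_ge0 k0 u2; have c4 := mulr_ge0 (sqr_ge0 k) u2.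
  have c5 := mulr_ge0 (sqr_ge0 k) d2.
  have c6 : (p + h) * normp (eU E) ^+ 2 <= (M + l + 1) * normp (eU E) ^+ 2.
    by rewrite ler_wpM2r // lerD.
  move: Cc B; rewrite !ler_norml => /andP[Ca Cb] /andP[_ B].
  move: B; rewrite mulrCA -expr2 => B.
  by split; move: (normp (eU E) ^+ 2) (d ^+ 2) (k ^+ 2) A A' B yg c1 c2 c3 c4 c5 c6 u2 d2 => *; lra.
split; rewrite /wnorm /energy /wsum.
  rewrite mulr_sumr -big_split /=; apply: ler_sum => i _; rewrite [X in _ <= _ + X]mulrCA -mulrDr ler_wpM2l ?(ltW (hh_gt0 xl i)) //.
  exact: (key i).1.
rewrite -big_split /= mulr_sumr; apply: ler_sum => i _; rewrite -mulrDr [X in _ <= X]mulrCA ler_wpM2l ?(ltW (hh_gt0 xl i)) //.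
exact: (key i).2.
Qed.

Lemma sqr_sum_le N x (r : 'I_N -> R) : grid N x ->
  (\sum_(i < N) hh x i * r i) ^+ 2 <= l * \sum_(i < N) hh x i * r i ^+ 2.
Proof.
move=> [xl _ xN].
set A := \sum_(i < N) hh x i * r i; set B := \sum_(i < N) hh x i * r i ^+ 2.
have lN : 0 <= x N - x 0 by rewrite subr_ge0 (x_mono xl).
have B0 : 0 <= B by apply: sumr_ge0 => i _; rewrite mulr_ge0 ?sqr_ge0 // ltW // hh_gt0.
have H t : 0 <= t ^+ 2 * (x N - x 0) - 2 * t * A + B.
  have -> : t ^+ 2 * (x N - x 0) - 2 * t * A + B = \sum_(i < N) hh x i * (t - r i) ^+ 2.
    rewrite -sum_hh /A /B !mulr_sumr -sumrB -big_split /=.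
    by apply: eq_bigr => i _; ring.
  by apply: sumr_ge0 => i _; rewrite mulr_ge0 ?sqr_ge0 // ltW // hh_gt0.
have [e|ne] := eqVneq (x N - x 0) 0.
  have A0 : A = 0.
    have [//|nA] := eqVneq A 0.
    have := H ((B + 1) / (2 * A)); rewrite e mulr0 add0r.
    have -> : 2 * ((B + 1) / (2 * A)) * A = B + 1 by field.
    by lra.
  by rewrite A0 expr0n mulr_ge0.
have l0 : 0 < x N - x 0 by rewrite lt_neqAle eq_sym ne.
apply: (@le_trans _ _ ((x N - x 0) * B)); last by rewrite ler_wpM2r.
have := H (A / (x N - x 0)).
have -> : (A / (x N - x 0)) ^+ 2 * (x N - x 0) - 2 * (A / (x N - x 0)) * A + B =
   ((x N - x 0) * B - A ^+ 2) / (x N - x 0) by field.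
by rewrite pmulr_lge0 ?invr_gt0 // subr_ge0.
Qed.

End Stability.

Lemma sqr2_le (R : realType) (x y : R) : (x + y) ^+ 2 <= 2 * x ^+ 2 + 2 * y ^+ 2.
Proof. by have := sqr_ge0 (x - y); rewrite !expr2; lra. Qed.

Lemma youngw (R : realType) (y v z : R) : 0 < y -> v * z <= y * v ^+ 2 + y^-1 * z ^+ 2.
Proof.
move=> y0; have : 0 <= (v * y - z) ^+ 2 / y by rewrite divr_ge0 ?sqr_ge0 // ltW.
have : 0 <= v ^+ 2 * y by rewrite mulr_ge0 ?sqr_ge0 // ltW.
have : 0 <= z ^+ 2 / y by rewrite divr_ge0 ?sqr_ge0 // ltW.
have -> : (v * y - z) ^+ 2 / y = v ^+ 2 * y - 2 * (v * z) + z ^+ 2 / y.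
  by field; rewrite gt_eqF.
by rewrite -(mulrC (z ^+ 2)) -(mulrC (v ^+ 2)); lra.
Qed.

Section StabilityBounds.
Context {R : realType} (n : nat) (sg tqu tpu l : R).
Hypothesis sg_gt0 : 0 < sg.
Hypothesis tpu_le : tpu <= - 2^-1 - 2^-1 * tqu ^+ 2.
Hypothesis l_gt0 : 0 < l.
Let l_ge0 : 0 <= l := ltW l_gt0.

Lemma normp1 : normp (1 : {poly R}) = 1.
Proof.
by rewrite /normp /dotp mulr1 -(derivX R) intp_deriv !hornerX subr0 sqrtr1.
Qed.

(** The third equation with the test function 1 bounds the variation of the trace of
    p by eG, so that it is close to its mean value. *)
Lemma hat_p_bound N (x : nat -> R) EE : grid l N x -> x N - x 0 = l ->
  error_sys n sg tqu tpu x EE ->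
  forall i : 'I_N, `|epr (EE i)| <= l^-1 * `|\sum_(j < N) hh x j * epr (EE j)| +
     2 * \sum_(j < N) hh x j * normp (eG (EE j)).
Proof.
move=> [xl x1 _] xN [eqs [U [Q [P [_ _ hP _]]]]] i.
set G := \sum_(j < N) hh x j * normp (eG (EE j)).
have G0 (j : 'I_N) : 0 <= hh x j * normp (eG (EE j)).
  by rewrite !mulr_ge0 ?normp_ge0 // ltW // hh_gt0.
have step (j : 'I_N) : `|P j.+1 - P j| <= hh x j * normp (eG (EE j)).
  have := flux_p (eqs j); case: (hP j) => -> -> ->.
  rewrite opprD addrA subrr add0r normrN normrM (gtr0_norm (hh_gt0 xl j)).
  rewrite ler_wpM2l ?(ltW (hh_gt0 xl j)) // -[leRHS]mulr1 -normp1.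
  exact: CauchySchwarz.
have diff0 a : (a <= N)%N -> `|P a - P 0| <= \sum_(j < N | (j < a)%N) hh x j * normp (eG (EE j)).
  elim: a => [|a IH] aN; first by rewrite subrr normr0 big_pred0.
  rewrite (bigD1 (Ordinal aN)) //=.
  have -> : P a.+1 - P 0 = (P a.+1 - P a) + (P a - P 0) by ring.
  apply: le_trans (ler_normD _ _) _; apply: lerD; first exact: (step (Ordinal aN)).
  apply: le_trans (IH (ltnW aN)) _; rewrite le_eqVlt; apply/orP; left; apply/eqP.
  apply: eq_bigl => j; rewrite -(inj_eq val_inj) /= ltnS.
  by rewrite ltn_neqAle andbC.
have diff1 a : (a <= N)%N -> `|P a - P 0| <= G.
  move=> /diff0 /le_trans; apply; rewrite /G [leRHS](bigID (fun j : 'I_N => (j < a)%N)) /=.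
  by rewrite lerDl sumr_ge0.
have diff (a b : 'I_N) : `|P a.+1 - P b.+1| <= 2 * G.
  have -> : P a.+1 - P b.+1 = (P a.+1 - P 0) - (P b.+1 - P 0) by ring.
  apply: le_trans (ler_normB _ _) _.
  have := diff1 _ (ltn_ord a); have := diff1 _ (ltn_ord b); lra.
have e : epr (EE i) = l^-1 * (\sum_(j < N) hh x j * epr (EE j)) +
   l^-1 * \sum_(j < N) hh x j * (P i.+1 - P j.+1).
  rewrite -mulrDr -big_split /=.
  under eq_bigr => j _ do rewrite (hP j).2 -mulrDr addrCA subrr addr0.
  by rewrite -mulr_suml sum_hh xN mulKf ?gt_eqF // (hP i).2.
rewrite e; apply: le_trans (ler_normD _ _) _.
have li : 0 <= l^-1 by rewrite invr_ge0.
rewrite !normrM (ger0_norm li) lerD2l ler_pdivrMl //.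
apply: le_trans (ler_norm_sum _ _ _) _; rewrite -xN -sum_hh mulr_suml.
apply: ler_sum => j _; rewrite normrM (gtr0_norm (hh_gt0 xl j)).
by rewrite ler_wpM2l ?(ltW (hh_gt0 xl j)).
Qed.

Lemma sqr3_le (x y z : R) : (x + y + z) ^+ 2 <= 3 * (x ^+ 2 + y ^+ 2 + z ^+ 2).
Proof.
have := sqr_ge0 (x - y); have := sqr_ge0 (x - z); have := sqr_ge0 (y - z).
rewrite !expr2; lra.
Qed.

Lemma ler_abs_sqr (x y : R) : `|x| <= y -> x ^+ 2 <= y ^+ 2.
Proof.
move=> h; rewrite -(real_normK (num_real x)) ler_pXn2r ?nnegrE //.
exact: le_trans h.
Qed.

(** The energy inequality controls q, the jumps and the left boundary trace of q. On
    each element p is controlled up to its right trace ([element_p]), and the mean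
    value of this trace is the boundary trace of q. *)
Lemma system_bound : exists2 C, 0 <= C &
  forall N (x : nat -> R) EE (dd : 'I_N -> R), grid l N x -> x N - x 0 = l ->
  error_sys n sg tqu tpu x EE -> (forall i, small (dd i) (EE i)) ->
  wnorm x (fun i => eQ (EE i)) + wnorm x (fun i => eP (EE i)) <=
  C * (wnorm x (fun i => eG (EE i)) + wnorm x (fun i => eU (EE i)) + wsum x dd).
Proof.
have [M0 M01 H] := global_energy n sg_gt0 tpu_le.
have [C1 C10 H1] := H M0 l (lexx _) l_ge0.
have M00 : 0 <= M0 := le_trans ler01 M01.
have [C2 C20 H2] := weighted_young n l_ge0 M00.
have [K K0 HK] := element_p n tqu tpu sg_gt0.
have li : 0 < l^-1 by rewrite invr_gt0.
pose A := 2 * (1 + C1 + C2).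
pose B := 9 * K ^+ 2 * (1 + A).
pose Cc := A + 2 * B + 2 * l * 3 * (l^-1 ^+ 2 * 2 * (A + l * B) + 4 * l).
have A0 : 0 <= A by rewrite mulr_ge0 // !addr_ge0.
have B0 : 0 <= B by rewrite mulr_ge0 ?addr_ge0 // mulr_ge0 // sqr_ge0.
exists Cc.
  have lB : 0 <= l * B by rewrite mulr_ge0.
  have t1 : 0 <= l^-1 ^+ 2 * 2 * (A + l * B) by apply: mulr_ge0; [apply: mulr_ge0; rewrite ?sqr_ge0|rewrite addr_ge0].
  have t2 : 0 <= 2 * l * 3 * (l^-1 ^+ 2 * 2 * (A + l * B) + 4 * l).
    have l4 : 0 <= 4 * l by exact: mulr_ge0.
    apply: mulr_ge0; last exact: addr_ge0.
    by apply: mulr_ge0 => //; exact: mulr_ge0.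
  by apply: addr_ge0 => //; apply: addr_ge0 => //; exact: mulr_ge0.
move=> N x EE dd gr xN sys sm; have [xl x1 xle] := gr.
have [Q0 [E1 E2]] := H1 _ _ _ _ xl x1 xle sys sm.
have := H2 _ _ EE dd (fun i => eG (EE i)) 1 gr sm ltr01.
rewrite ler_norml invr1 !mul1r => /andP[E3 _].
have hp := hat_p_bound gr xN sys.
have g0 := wnorm_ge0 (fun i => eG (EE i)) gr; have u0 := wnorm_ge0 (fun i => eU (EE i)) gr.
have q0 := wnorm_ge0 (fun i => eQ (EE i)) gr; have d0 := wsum_ge0 dd gr.
set S := wnorm x (fun i => eG (EE i)) + wnorm x (fun i => eU (EE i)) + wsum x dd.
have S0 : 0 <= S by rewrite !addr_ge0.
move: E1; rewrite -/(wnorm x (fun i => eQ (EE i))) -/(wnorm x (fun i => eU (EE i))) -/(wsum x dd) => E1.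
set J := \sum_(i < N) jumps (EE i) in E1.
have J0 : 0 <= J.
  by apply: sumr_ge0 => i _; rewrite !addr_ge0 ?sqr_ge0.
have E4 : wnorm x (fun i => eQ (EE i)) + J + Q0 ^+ 2 / 2 <= (1 + C1 + C2) * S.
  have := mulr_ge0 C10 g0; have := mulr_ge0 C10 u0; have := mulr_ge0 C20 g0.
  have := mulr_ge0 C20 u0; have := mulr_ge0 C20 d0.
  move: E3 E1 g0 u0 d0; rewrite /S.
  move: (wnorm x (fun i => eG (EE i))) (wnorm x (fun i => eU (EE i))) (wsum x dd) => g u d.
  clear; lra.
have Q00 := sqr_ge0 Q0.
have qA : wnorm x (fun i => eQ (EE i)) <= A * S by rewrite /A; clear -E4 J0 Q00 q0; lra.
have JA : J <= A * S by rewrite /A; clear -E4 J0 Q00 q0; lra.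
have Q0A : Q0 ^+ 2 <= A * S by rewrite /A; clear -E4 J0 Q00 q0; lra.
pose r (i : 'I_N) := K * (hh x i * normp (eG (EE i)) + jsum (EE i) + dd i).
have rP i : normp (eP (EE i) - (epr (EE i))%:P) <= r i.
  by apply: HK => //; [exact: hh_gt0|exact: sys.1].
have r2 : \sum_(i < N) hh x i * r i ^+ 2 <= B * S.
  apply: (@le_trans _ _ (9 * K ^+ 2 * (wnorm x (fun i => eG (EE i)) + J + wsum x dd))).
    rewrite /wnorm /J /wsum -!big_split mulr_sumr /=; apply: ler_sum => i _.
    have h0 := hh_gt0 xl i; have h1 := x1 i.
    rewrite /r exprMn.
    have := sqr3_le (hh x i * normp (eG (EE i))) (jsum (EE i)) (dd i).
    have := jsum_sqr (EE i).
    have : 0 <= jumps (EE i) by rewrite !addr_ge0 ?sqr_ge0.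
    set a := normp (eG (EE i)); set T := (hh x i * a + jsum (EE i) + dd i) ^+ 2; move: (hh x i) h0 h1 => h h0 h1.
    move: (jumps _) (jsum _) (dd i) @T => j js d T j0 jl T3.
    have a2 : 0 <= a ^+ 2 := sqr_ge0 a; have dq := sqr_ge0 d.
    have -> : h * (K ^+ 2 * T) = K ^+ 2 * (h * T) by ring.
    have -> : 9 * K ^+ 2 * (h * a ^+ 2 + j + h * d ^+ 2) =
       K ^+ 2 * (9 * (h * a ^+ 2 + j + h * d ^+ 2)) by ring.
    rewrite ler_wpM2l ?sqr_ge0 //.
    have t1 : h * T <= h * (3 * (a ^+ 2 + 3 * j + d ^+ 2)).
      rewrite ler_wpM2l ?(ltW h0) //; apply: le_trans T3 _; rewrite ler_wpM2l //.
      rewrite lerD2r lerD // exprMn ler_piMl // exprn_ile1 // ltW //.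
    apply: le_trans t1 _.
    have := mulr_ge0 (ltW h0) a2; have := mulr_ge0 (ltW h0) dq.
    have : h * j <= j by rewrite ler_piMl.
    by clear; move: (a ^+ 2) (d ^+ 2) => aa d2; lra.
  rewrite /B -(mulrA (9 * K ^+ 2)) ler_wpM2l ?mulr_ge0 ?sqr_ge0 //.
  by rewrite mulrDl mul1r /S; move: JA; rewrite /S; clear -u0; lra.
have Sr : (\sum_(i < N) hh x i * r i) ^+ 2 <= l * (B * S).
  apply: le_trans (sqr_sum_le l_ge0 _ gr) _.
  by rewrite ler_wpM2l.
have Sg : (\sum_(i < N) hh x i * normp (eG (EE i))) ^+ 2 <= l * S.
  apply: le_trans (sqr_sum_le l_ge0 _ gr) _; rewrite ler_wpM2l //.
  by rewrite -/(wnorm x (fun i => eG (EE i))) /S -addrA lerDl addr_ge0.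
have Sp : (\sum_(j < N) hh x j * epr (EE j)) ^+ 2 <= 2 * (A + l * B) * S.
  have b : `|\sum_(j < N) hh x j * epr (EE j)| <= `|Q0| + \sum_(i < N) hh x i * r i.
    have -> : \sum_(j < N) hh x j * epr (EE j) = - Q0 -
        \sum_(j < N) hh x j * dotp (eP (EE j) - (epr (EE j))%:P) 1.
      rewrite -E2 -sumrB; apply: eq_bigr => j _.
      rewrite dotpBl -mulrBr; congr (_ * _); rewrite -alg_polyC dotpZl -normp_sqr normp1.
      by rewrite expr1n; ring.
    apply: le_trans (ler_normB _ _) _; rewrite normrN lerD2l.
    apply: le_trans (ler_norm_sum _ _ _) _; apply: ler_sum => j _.
    rewrite normrM (gtr0_norm (hh_gt0 xl j)) ler_wpM2l ?(ltW (hh_gt0 xl j)) //.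
    by apply: le_trans (CauchySchwarz _ _) _; rewrite normp1 mulr1.
  apply: le_trans (ler_abs_sqr b) _.
  move: Sr Q0A; set y := \sum_(_ < _) _; rewrite -(real_normK (num_real Q0)).
  have := sqr_ge0 (`|Q0| - y); rewrite !expr2; clear; lra.
have ep i : epr (EE i) ^+ 2 <= 3 * (l^-1 ^+ 2 * (2 * (A + l * B)) + 4 * l) * S.
  apply: le_trans (ler_abs_sqr (hp i)) _; move: Sp Sg.
  rewrite -[X in X <= _ -> _](real_normK (num_real _)).
  move: `|\sum_(j < N) hh x j * epr (EE j)| (\sum_(j < N) hh x j * normp (eG (EE j))) => s1 s2 e1 e2.
  have := sqr_ge0 (l^-1 * s1 - 2 * s2); have := sqr_ge0 (l^-1 * s1); have := sqr_ge0 s2.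
  have : l^-1 ^+ 2 * s1 ^+ 2 <= l^-1 ^+ 2 * (2 * (A + l * B) * S).
    by rewrite ler_wpM2l ?sqr_ge0.
  rewrite -exprMn; move: (l^-1 * s1) => y; move: (l^-1 ^+ 2) => k.
  move: e2; rewrite !expr2; clear; lra.
have wp : wnorm x (fun i => eP (EE i)) <= 2 * \sum_(i < N) hh x i * r i ^+ 2 +
   2 * \sum_(i < N) hh x i * epr (EE i) ^+ 2.
  rewrite /wnorm !mulr_sumr -big_split /=; apply: ler_sum => i _.
  have -> : 2 * (hh x i * r i ^+ 2) + 2 * (hh x i * epr (EE i) ^+ 2) =
    hh x i * (2 * r i ^+ 2 + 2 * epr (EE i) ^+ 2) by ring.
  rewrite ler_wpM2l ?(ltW (hh_gt0 xl i)) //.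
  have : normp (eP (EE i)) <= r i + `|epr (EE i)|.
    have -> : eP (EE i) = (eP (EE i) - (epr (EE i))%:P) + epr (EE i) *: 1.
      by rewrite alg_polyC subrK.
    apply: le_trans (normpD _ _) _; rewrite normpZ normp1 mulr1.
    exact: lerD.
  move=> b; have : `|normp (eP (EE i))| <= r i + `|epr (EE i)|.
    by rewrite ger0_norm ?normp_ge0.
  move=> /ler_abs_sqr => /le_trans; apply; rewrite -(real_normK (num_real (epr _))).
  exact: sqr2_le.
have we : \sum_(i < N) hh x i * epr (EE i) ^+ 2 <=
    l * (3 * (l^-1 ^+ 2 * (2 * (A + l * B)) + 4 * l) * S).
  have e : \sum_(i < N) hh x i = l by rewrite sum_hh.
  rewrite -[X in X * _]e mulr_suml; apply: ler_sum => i _.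
  by rewrite ler_wpM2l ?(ltW (hh_gt0 xl i)).
move: wp r2 we qA; rewrite /Cc; clear.
move: (wnorm _ _) (wnorm _ _) (\sum_(_ < _) _) (\sum_(_ < _) _) (l^-1 ^+ 2) => a b c d k.
lra.
Qed.

(** With eG = eU - rho the left hand side of the energy inequality contains the
    weighted square of u, which for a large weight absorbs the square of u on the
    right. *)
Lemma stationary_bound : exists2 C, 0 <= C &
  forall N (x : nat -> R) EE (dd : 'I_N -> R) rho, grid l N x ->
  error_sys n sg tqu tpu x EE -> (forall i, small (dd i) (EE i)) ->
  (forall i, eG (EE i) = eU (EE i) - rho i) ->
  wnorm x (fun i => eU (EE i)) <= C * (wnorm x rho + wsum x dd).
Proof.
have [M0 M01 H] := global_energy n sg_gt0 tpu_le.
pose M := Num.max M0 8.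
have MM : M0 <= M by rewrite le_max lexx.
have M8 : 8 <= M by rewrite le_max lexx orbT.
have M00 : 0 <= M := le_trans (ler0n _ _) M8.
have [C1 C10 H1] := H M l MM l_ge0.
have [C2 C20 H2] := weighted_young n l_ge0 M00.
have [C3 C30 H3] := energy_coercive n l_ge0 M8.
exists (C1 + C2 * (C2 + 1) + 1 + C3).
  by rewrite !addr_ge0 // mulr_ge0 // addr_ge0.
move=> N x EE dd rho gr sys sm eg; have [xl x1 xle] := gr.
have [Q0 [E1 _]] := H1 _ _ _ _ xl x1 xle sys sm.
have th0 : 0 < C2 + 1 by rewrite ltr_pwDr.
have := H2 _ _ EE dd rho _ gr sm th0; rewrite ler_norml => /andP[_ E3].
have [E4 _] := H3 _ _ EE dd gr sm.
have g0 := wnorm_ge0 rho gr; have u0 := wnorm_ge0 (fun i => eU (EE i)) gr.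
have q0 := wnorm_ge0 (fun i => eQ (EE i)) gr; have d0 := wsum_ge0 dd gr.
have J0 : 0 <= \sum_(i < N) jumps (EE i).
  by apply: sumr_ge0 => i _; rewrite !addr_ge0 ?sqr_ge0.
have ef : energy n x M EE + 4 * wnorm x (fun i => eU (EE i)) <=
   energy_form n x M EE (fun i => eG (EE i)) + energy_form n x M EE rho.
  rewrite /energy /wnorm /energy_form mulr_sumr -!big_split /=; apply: ler_sum => i _.
  have h0 := hh_gt0 xl i; rewrite mulrCA -!mulrDr ler_wpM2l ?(ltW h0) //.
  rewrite eg -dotpDl subrK dotpDr.
  have pM : 8 <= phi x M i by rewrite (le_trans M8) // lerDl subr_ge0 (x_mono xl) // ltnW.
  have := wt_coercive (phi x M i) (eU (EE i)) (ltW h0).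
  have : 8 * normp (eU (EE i)) ^+ 2 <= phi x M i * normp (eU (EE i)) ^+ 2.
    by rewrite ler_wpM2r ?sqr_ge0.
  lra.
have ci : C2 * (C2 + 1)^-1 <= 1 by rewrite ler_pdivrMr // mul1r lerDl.
have k1 : C2 * (C2 + 1)^-1 * wnorm x (fun i => eU (EE i)) <= wnorm x (fun i => eU (EE i)).
  by rewrite -[leRHS]mul1r ler_wpM2r.
have k2 : C2 * (C2 + 1)^-1 * wsum x dd <= wsum x dd.
  by rewrite -[leRHS]mul1r ler_wpM2r.
move: E1; rewrite -/(wnorm x (fun i => eQ (EE i))) -/(wnorm x (fun i => eU (EE i))) -/(wsum x dd).
have Q00 := sqr_ge0 Q0.
have t1 : 0 <= C2 * (C2+1) * wsum x dd by rewrite !mulr_ge0 // ltW.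
have t2 := mulr_ge0 C10 g0; have t3 := mulr_ge0 C30 g0.
move: E3 E4 ef k1 k2 t1 t2 t3 Q00 J0 q0 u0 d0 g0; clear.
move: (\sum_(_ < _) jumps _) (Q0 ^+ 2) (energy _ _ _ _).
move: (wnorm x rho) (wnorm x (fun i => eU _)) (wnorm _ _) (wsum _ _) (_^-1).
clear; move=> *; lra.
Qed.

(** ** Linearity *)

Definition esub (E F : errstate R) : errstate R :=
  Errstate (eU E - eU F) (eQ E - eQ F) (eP E - eP F) (eG E - eG F)
    (eul E - eul F) (eur E - eur F) (eql E - eql F) (eqr E - eqr F)
    (epl E - epl F) (epr E - epr F) (eal E - eal F) (ebe E - ebe F)
    (ega E - ega F) (ele E - ele F).

Lemma error_eqs_sub h E F : error_eqs n sg tqu tpu h E ->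
  error_eqs n sg tqu tpu h F -> error_eqs n sg tqu tpu h (esub E F).
Proof.
move=> [[a1 a2 a3 a4] e1 e2 e3 [t1 t2 t3 t4]] [[b1 b2 b3 b4] f1 f2 f3 [u1 u2 u3 u4]].
have sz (p q : {poly R}) : (size p <= n.+2)%N -> (size q <= n.+2)%N ->
    (size (p - q)%R <= n.+2)%N.
  by move=> *; rewrite (leq_trans (size_polyD _ _)) // geq_max size_polyN; apply/andP.
split; rewrite /esub /=; first by split; exact: sz.
- move=> v sv; have := e1 v sv; have := f1 v sv.
  rewrite !(dotpBl, dotpZl); lra.
- move=> v sv; have := e2 v sv; have := f2 v sv.
  rewrite !(dotpBl, dotpZl); lra.
- move=> v sv; have := e3 v sv; have := f3 v sv.
  rewrite !(dotpBl, dotpZl); lra.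
split; rewrite ?hornerD ?hornerN; [lra|lra| |by rewrite !mulrBr t4 u4].
by rewrite t3 u3; ring.
Qed.

Lemma error_sys_sub N (x : nat -> R) (EE FF : 'I_N -> errstate R) :
  error_sys n sg tqu tpu x EE -> error_sys n sg tqu tpu x FF ->
  error_sys n sg tqu tpu x (fun i => esub (EE i) (FF i)).
Proof.
move=> [e [U [Q [P [hU hQ hP [U0 UN QN]]]]]] [f [U' [Q' [P' [hU' hQ' hP' [U0' UN' QN']]]]]].
split; first by move=> i; exact: error_eqs_sub.
exists (fun i => U i - U' i), (fun i => Q i - Q' i), (fun i => P i - P' i).
split => [i|i|i|] /=.
- by case: (hU i) => -> ->; case: (hU' i) => -> ->.
- by case: (hQ i) => -> ->; case: (hQ' i) => -> ->.
- by case: (hP i) => -> ->; case: (hP' i) => -> ->.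
- by rewrite U0 U0' UN UN' QN QN' subrr.
Qed.

End StabilityBounds.

(** * Evolution in time *)

Lemma real_induction (R : realType) (P : R -> Prop) (t0 : R) :
  P 0 ->
  (forall t, 0 < t <= t0 -> (forall r, 0 <= r < t -> P r) -> P t) ->
  (forall t, 0 <= t < t0 -> P t -> exists2 d, 0 < d & forall s, t < s < t + d -> s <= t0 -> P s) ->
  forall t, 0 <= t <= t0 -> P t.
Proof.
move=> P0 Pl Pr t /andP[tge tle].
have t00 : 0 <= t0 := le_trans tge tle.
pose S := [set s | 0 <= s <= t0 /\ forall r, 0 <= r <= s -> P r].
have S0 : S 0.
  split; first by rewrite lexx.
  by move=> r /andP[r0 r1]; rewrite (_ : r = 0) //; apply/eqP; rewrite eq_le r1.
have hS : has_sup S by split; [exists 0|exists t0 => s [/andP[]]].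
set z := sup S.
have z0 : 0 <= z by exact: ub_le_sup hS.2 _ S0.
have zt : z <= t0 by apply: ge_sup => //; [exists 0|move=> s [/andP[]]].
have below r : 0 <= r < z -> P r.
  move=> /andP[r0 rz]; have zr : 0 < z - r by rewrite subr_gt0.
  have [s [_ Ps]] := sup_adherent zr hS; rewrite opprB addrC subrK => rs.
  by apply: Ps; rewrite r0 ltW.
have Pz : P z.
  move: z0; rewrite le_eqVlt => /predU1P[<- //|z0].
  by apply: Pl => //; rewrite z0.
have Pz' r : 0 <= r <= z -> P r.
  move=> /andP[r0]; rewrite le_eqVlt => /predU1P[-> //|rz].
  by apply: below; rewrite r0.
have [tz|zlt] := leP t z; first by apply: Pz'; rewrite tge.
have zt0 : z < t0 := lt_le_trans zlt tle.
have [|d d0 Pd] := Pr z _ Pz; first by rewrite z0.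
pose s := Num.min (z + d / 2) t0.
have zs : z < s by rewrite lt_min zt0 ltrDl divr_gt0.
have st : s <= t0 by rewrite ge_min lexx orbT.
have sd : s < z + d by rewrite gt_min ltrD2l gtr_pMr // invf_lt1 ?ltr1n.
have : S s.
  split; first by rewrite st (le_trans z0 (ltW zs)).
  move=> r /andP[r0 rs]; have [rz|zr] := leP r z; first by apply: Pz'; rewrite r0.
  by apply: Pd; rewrite ?zr ?(le_lt_trans rs) // (le_trans rs).
by move=> /(ub_le_sup hS.2); rewrite -/z leNgt zs.
Qed.

(** The hypothesis bounds the upper right Dini derivative, because the correction of
    the energy is only Lipschitz continuous in time; the conclusion is propagated by
    real induction. *)
Lemma gronwall (R : realType) (y : R -> R) (A Y t0 : R) :
  {within `[0, t0], continuous y} -> y 0 <= Y -> 0 <= Y ->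
  (forall t, 0 < t < t0 -> \forall s \near t^'+, y s <= y t * (1 + A * (s - t))) ->
  forall t, 0 <= t <= t0 -> y t <= Y * expR (A * t).
Proof.
move=> yc y0 Y0 yd t ht; apply/ler_addgt0Pl => e e0.
have t00 : 0 <= t0 by case/andP: ht; exact: le_trans.
pose e' := e / expR (A * t); have e'0 : 0 < e' by rewrite divr_gt0 // expR_gt0.
have -> : e + Y * expR (A * t) = (Y + e') * expR (A * t).
  by rewrite mulrDl /e' divfK ?gt_eqF ?expR_gt0 // addrC.
pose w s := y s - (Y + e') * expR (A * s).
suff : w t <= 0 by rewrite subr_le0.
have wc : {within `[0, t0], continuous w}.
  move=> s; apply: cvgB; first exact: yc.
  apply: cvgM; first exact: cvg_cst.
  apply: continuous_comp; last exact: continuous_expR.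
  apply: cvgM; first exact: cvg_cst.
  apply: (@continuous_subspaceT _ _ `[0,t0]%classic (fun x : R => x)) => r; exact: cvg_id.
have wc' s : 0 <= s <= t0 -> w @ within `[0, t0] (nbhs s) --> w s.
  move=> hs; have /subspace_continuousP := wc; apply.
  by rewrite /= in_itv.
have nearP s (Q : R -> Prop) : 0 <= s <= t0 ->
    (\forall z \near w s, Q z) -> exists2 d, 0 < d & forall r, 0 <= r <= t0 ->
    `|s - r| < d -> Q (w r).
  move=> hs /(wc' _ hs); rewrite /within /= => /nbhs_ballP[d /= d0 H].
  by exists d => // r hr sr; apply: H => //=; rewrite in_itv.
apply: (@real_induction R (fun t => w t <= 0) t0) ht.
- by rewrite /w mulr0 expR0 mulr1 subr_le0 (le_trans y0) // lerDl ltW.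
- move=> s /andP[s0 st] H; rewrite leNgt; apply/negP => ws.
  have [||d d0 Hd] := nearP s (fun z => 0 < z); first by rewrite (ltW s0).
    exact: lt_nbhsr.
  pose r := Num.max 0 (s - d / 2).
  have rs : r < s by rewrite gt_max s0 ltrBlDr ltrDl divr_gt0.
  have r0 : 0 <= r by rewrite le_max lexx.
  have : w r <= 0 by apply: H; rewrite r0.
  rewrite leNgt => /negP; apply; apply: Hd; first by rewrite r0 (le_trans (ltW rs)).
  rewrite gtr0_norm ?subr_gt0 // ltrBlDl -ltrBlDr lt_max; apply/orP; right.
  by rewrite ltrD2l ltrN2 gtr_pMr // invf_lt1 ?ltr1n.
- move=> s /andP[s0 st] ws.
  move: s0; rewrite le_eqVlt => /predU1P[se|s0].
    subst s; have [||d d0 Hd] := nearP 0 (fun z => z < 0).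
    + by rewrite lexx.
    + by apply: lt_nbhsl; rewrite /w mulr0 expR0 mulr1 subr_lt0 (le_lt_trans y0) // ltrDl.
    exists d => // r /andP[r0]; rewrite add0r => rd rt; apply: ltW; apply: Hd.
      by rewrite (ltW r0).
    by rewrite sub0r normrN gtr0_norm.
  have hs : 0 < s < t0 by rewrite s0.
  have : \forall r \near s^'+, y r <= y s * (1 + A * (r - s)) /\ 0 <= 1 + A * (r - s).
    near=> r; split; first by near: r; exact: yd.
    have : `|r - s| <= (`|A| + 1)^-1.
      have a0 : 0 < (`|A| + 1)^-1 by rewrite invr_gt0 ltr_pwDr.
      rewrite ger0_norm ?subr_ge0 ?(@ltW _ _ s r) // lerBlDl ltW //.
      by near: r; apply: nbhs_right_lt; rewrite ltrDl.
    move=> rs; have : `|A * (r - s)| <= 1.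
      rewrite normrM (le_trans (ler_wpM2l (normr_ge0 _) rs)) //.
      by rewrite ler_pdivrMr ?ltr_pwDr // mul1r lerDl.
    by rewrite ler_norml => /andP[+ _]; rewrite -subr_ge0 opprK addrC.
  rewrite near_withinE => /nbhs_ballP[d /= d0 Hd]; exists d => // r /andP[sr rd] _.
  have [|H1 H2] := Hd r _ sr.
    by rewrite -ball_normE /= distrC gtr0_norm ?subr_gt0 // ltrBlDl.
  rewrite /w subr_le0; apply: le_trans H1 _; rewrite subr_le0 in ws.
  apply: le_trans (ler_wpM2r H2 ws) _; rewrite -mulrA ler_wpM2l ?addr_ge0 ?(ltW e'0) //.
  have -> : A * r = A * s + A * (r - s) by ring.
  by rewrite expRD ler_wpM2l ?expR_ge0 // expR_ge1Dx.
Unshelve. all: by end_near.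
Qed.

Section PolyCvg.
Context {R : realType} {T : Type} {F : set_system T} {FF : Filter F}.
Implicit Types (p q : {poly R}) (f g : T -> {poly R}).

Definition pcvg f p := normp (f s - p) @[s --> F] --> (0 : R).

Lemma pcvg_cst p : pcvg (fun=> p) p.
Proof. by rewrite /pcvg subrr normp0; exact: cvg_cst. Qed.

Lemma pcvg_le f p (b : T -> R) : (\forall s \near F, normp (f s - p) <= b s) ->
  b @ F --> (0 : R) -> pcvg f p.
Proof.
move=> fb b0; apply: (@squeeze_cvgr _ _ _ _ (fun=> 0) b) => //; last exact: cvg_cst.
by near=> s; rewrite normp_ge0; near: s.
Unshelve. all: by end_near. Qed.

Lemma pcvgD f g p q : pcvg f p -> pcvg g q -> pcvg (fun s => f s + g s) (p + q).
Proof.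
move=> fp gq; apply: pcvg_le (_ : (fun s => normp (f s - p) + normp (g s - q)) @ F --> _).
  near=> s; rewrite opprD addrACA; exact: normpD.
by rewrite -[X in _ --> X]addr0; exact: cvgD.
Unshelve. all: by end_near. Qed.

Lemma pcvgZ (a : T -> R) (c : R) f p : a @ F --> c -> pcvg f p ->
  pcvg (fun s => a s *: f s) (c *: p).
Proof.
move=> ac fp; apply: pcvg_le (_ : (fun s => `|a s| * normp (f s - p) + `|a s - c| * normp p) @ F --> _).
  near=> s; rewrite -!normpZ.
  have -> : a s *: f s - c *: p = a s *: (f s - p) + (a s - c) *: p.
    by rewrite scalerBr scalerBl addrA subrK.
  exact: normpD.
have -> : 0 = `|c| * 0 + `|c - c| * normp p by rewrite subrr normr0 mulr0 mul0r addr0.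
apply: cvgD; first by apply: cvgM => //; exact: cvg_norm.
by apply: cvgM; [apply: cvg_norm; apply: cvgB => //; exact: cvg_cst|exact: cvg_cst].
Unshelve. all: by end_near. Qed.

Lemma pcvgB f g p q : pcvg f p -> pcvg g q -> pcvg (fun s => f s - g s) (p - q).
Proof.
move=> fp gq; apply: pcvgD => //; rewrite /pcvg.
by under eq_fun do rewrite -opprD normpN.
Qed.

Lemma pcvg_dotp f g p q : pcvg f p -> pcvg g q ->
  dotp (f s) (g s) @[s --> F] --> dotp p q.
Proof.
move=> fp gq; apply/cvgrPdist_le => e e0.
have : normp (f s - p) * (normp (g s - q) + normp q) + normp p * normp (g s - q)
   @[s --> F] --> (0 : R).
  have -> : 0 = 0 * (0 + normp q) + normp p * 0 by rewrite mul0r mulr0 addr0.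
  apply: cvgD; apply: cvgM => //; try exact: cvg_cst.
  by apply: cvgD => //; exact: cvg_cst.
move=> /cvgrPdist_le /(_ e e0); apply: filterS => s; rewrite sub0r normrN => h.
apply: le_trans (le_trans (ler_norm _) h).
have -> : dotp p q - dotp (f s) (g s) = - (dotp (f s - p) (g s) + dotp p (g s - q)).
  by rewrite dotpBl dotpBr; ring.
rewrite normrN; apply: bndD; apply: le_trans (CauchySchwarz _ _) _ => //.
rewrite ler_wpM2l ?normp_ge0 //.
by rewrite -{1}[g s](subrK q) normpD.
Qed.

Lemma normp_mul_le (w : {poly R}) : exists2 K, 0 <= K & forall p, normp (w * p) <= K * normp p.
Proof.
have [K K0 H] := horner_bounded w; exists K => // p.
rewrite -(ger0_norm K0) -normpZ; apply: le_normp => x /andP[x0 x1].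
rewrite hornerM hornerZ !normrM ler_wpM2r // (ger0_norm K0) H //.
by rewrite !ltW.
Qed.

Lemma pcvgM (w : {poly R}) f p : pcvg f p -> pcvg (fun s => w * f s) (w * p).
Proof.
move=> fp; have [K K0 H] := normp_mul_le w.
apply: pcvg_le (_ : (fun s => K * normp (f s - p)) @ F --> _).
  by near=> s; rewrite -mulrBr; exact: H.
by rewrite -[X in _ --> X](mulr0 K); apply: cvgM => //; exact: cvg_cst.
Unshelve. all: by end_near. Qed.

End PolyCvg.

Lemma cvg_sumr (R : realType) (T : Type) (F : set_system T) (FF : Filter F)
  I (r : seq I) (P : pred I) (f : I -> T -> R) (a : I -> R) :
  (forall i, P i -> f i @ F --> a i) ->
  \sum_(i <- r | P i) f i s @[s --> F] --> \sum_(i <- r | P i) a i.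
Proof.
move=> h; elim: r => [|i r IH].
  by rewrite big_nil; under eq_fun do rewrite big_nil; exact: cvg_cst.
rewrite big_cons; under eq_fun do rewrite big_cons.
by case: ifP => // Pi; apply: cvgD => //; exact: h.
Qed.

Lemma pcvg_filter (R : realType) (T : Type) (F G : set_system T) (f : T -> {poly R}) p :
  G `=>` F -> pcvg (F := F) f p -> pcvg (F := G) f p.
Proof. by move=> GF; exact: cvg_trans (cvg_app _ GF). Qed.

Section Evolution.
Context {R : realType} (n : nat) (sg tqu tpu l : R).
Hypothesis sg_gt0 : 0 < sg.
Hypothesis tpu_le : tpu <= - 2^-1 - 2^-1 * tqu ^+ 2.
Hypothesis l_gt0 : 0 < l.
Let l_ge0 : 0 <= l := ltW l_gt0.

(** The weighted energy is propagated in time.  Here rho is the part of the time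
    derivative of u that is not part of the right hand side, and th is free: it
    is the length of the time interval for the first step of the argument and 1
    for the second. *)
Lemma evolution : exists2 C, 0 <= C &
  forall N (x : nat -> R) (EE : R -> 'I_N -> errstate R) (dd : R -> 'I_N -> R) rho
    th t0 W Rh Bb, grid l N x -> 0 < th -> 0 < W -> 0 <= Bb ->
  (forall t, 0 <= t <= t0 -> (forall i, small (dd t i) (EE t i)) /\ wsum x (dd t) <= W) ->
  (forall t, 0 < t < t0 -> error_sys n sg tqu tpu x (EE t)) ->
  (forall t i, 0 < t < t0 -> pcvg (F := t^'+)
     (fun s => (s - t)^-1 *: (eU (EE s i) - eU (EE t i))) (eG (EE t i) + rho i)) ->
  (forall t i, 0 <= t <= t0 -> pcvg (F := within `[0, t0]%classic (nbhs t))
     (fun s => eU (EE s i)) (eU (EE t i))) ->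
  (forall s t, 0 <= s <= t0 -> 0 <= t <= t0 ->
     \sum_(i < N) hh x i * (hh x i * (ebe (EE s i) - ebe (EE t i))) ^+ 2 <= Bb * (s - t) ^+ 2) ->
  wnorm x rho <= Rh ->
  forall t, 0 <= t <= t0 -> wnorm x (fun i => eU (EE t i)) <=
    C * (wnorm x (fun i => eU (EE 0 i)) + W + th ^+ 2 * (Rh + Bb)) *
      expR (C * (1 + th^-1) * t0).
Proof.
have [M0 M01 H] := global_energy n sg_gt0 tpu_le.
pose M := Num.max M0 8.
have MM : M0 <= M by rewrite le_max lexx.
have M8 : 8 <= M by rewrite le_max lexx orbT.
have M00 : 0 <= M := le_trans (ler0n _ _) M8.
have [C1 C10 H1] := H M l MM l_ge0.
have [C2 C20 H2] := weighted_young n l_ge0 M00.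
have [C3 C30 H3] := energy_coercive n l_ge0 M8.
have k0 := corrk_ge0 n l_ge0 M00.
have [k kE] : exists k, k = corrk n l M by exists (corrk n l M).
rewrite -kE in k0; pose C4 := 1 + C2 + k.
have C41 : 1 <= C4 by rewrite /C4 -addrA lerDl addr_ge0.
pose C5 := C4 * C3 + C1 + 1 + C2 + C4.
have C40 : 0 <= C4 := le_trans ler01 C41.
have C50 : 0 <= C5.
  by do 4 ![apply: addr_ge0 => //]; exact: mulr_ge0.
have C60 : 0 <= C4 + C5 + 2 * C3.
  by apply: addr_ge0; [apply: addr_ge0|exact: mulr_ge0].
exists (C4 + C5 + 2 * C3) => //.
move=> N x EE dd rho th t0 W Rh Bb gr th0 W0 Bb0 sm sys der cont lip rhoR t ht.
have [xl x1 xle] := gr.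
pose f s := energy n x M (EE s).
pose r := 1 + th^-1.
have thi : 0 < th^-1 by rewrite invr_gt0.
have r1 : 1 <= r by rewrite lerDl ltW.
pose A := C4 * r.
have A1 : 1 <= A by rewrite mulr_ege1.
have A0 : 0 < A by exact: lt_le_trans A1.
have Rh0 : 0 <= Rh by exact: le_trans (wnorm_ge0 rho gr) rhoR.
pose B := C5 * (r * W + th * (Rh + Bb)).
have fP s : 0 <= s <= t0 -> wnorm x (fun i => eU (EE s i)) <= f s + C3 * W /\
   f s <= C3 * (wnorm x (fun i => eU (EE s i)) + W).
  move=> hs; have [s1 s2] := sm s hs; have [a b] := H3 _ _ _ _ gr s1; split.
    by apply: le_trans a _; rewrite lerD2l ler_wpM2l.
  by apply: le_trans b _; rewrite ler_wpM2l // lerD2l.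
have ht0 : 0 <= t0 by case/andP: ht; exact: le_trans.
have ebe_cvg s (i : 'I_N) : 0 <= s <= t0 ->
    ebe (EE r i) @[r --> within `[0, t0]%classic (nbhs s)] --> ebe (EE s i).
  move=> hs; have h0 := hh_gt0 xl i.
  pose K := Num.sqrt (Bb / hh x i ^+ 3).
  have K0 : 0 <= K by exact: sqrtr_ge0.
  have lipi q : 0 <= q <= t0 -> `|ebe (EE s i) - ebe (EE q i)| <= K * `|s - q|.
    move=> hq; rewrite -ler_sqr ?nnegrE ?mulr_ge0 // exprMn !real_normK ?num_real //.
    rewrite sqr_sqrtr ?divr_ge0 ?exprn_ge0 ?(ltW h0) // mulrAC ler_pdivlMr ?exprn_gt0 //.
    apply: le_trans (lip _ _ hs hq); rewrite (bigD1 i) //=.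
    have -> : (ebe (EE s i) - ebe (EE q i)) ^+ 2 * hh x i ^+ 3 =
       hh x i * (hh x i * (ebe (EE s i) - ebe (EE q i))) ^+ 2 by ring.
    rewrite lerDl; apply: sumr_ge0 => j _.
    by apply: mulr_ge0; [exact: ltW (hh_gt0 xl j)|exact: sqr_ge0].
  apply/cvgrPdist_le => e e0.
  have d0 : 0 < e / (K + 1) by rewrite divr_gt0 // ltr_wpDl.
  rewrite near_withinE; near=> q => hq; have := lipi q; rewrite /= in_itv in hq *.
  move=> /(_ hq) /le_trans; apply.
  have : `|s - q| < e / (K + 1) by near: q; exact: nbhsx_ballx.
  rewrite ltr_pdivlMr ?ltr_wpDl // => hl; apply: ltW; apply: le_lt_trans hl.
  by rewrite mulrC mulrDr mulr1 lerDl.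
have corr_cvg s (i : 'I_N) : 0 <= s <= t0 ->
    pcvg (F := within `[0, t0]%classic (nbhs s))
     (fun q => corr n (hh x i) (phi x M i) (EE q i)) (corr n (hh x i) (phi x M i) (EE s i)).
  move=> hs; apply: pcvgZ; last exact: pcvg_cst.
  apply: cvgN; apply: cvgM; last exact: cvg_cst.
  apply: cvgM; last exact: cvg_cst.
  apply: cvgM; last exact: cvg_cst.
  by apply: cvgM; [exact: cvg_cst|exact: ebe_cvg].
have fcont : {within `[0, t0], continuous f}.
  apply/subspace_continuousP => s; rewrite /= in_itv /= => hs.
  apply: cvg_sumr => i _; apply: cvgM; first exact: cvg_cst.
  apply: cvgD; last by apply: pcvg_dotp; [exact: cont|exact: corr_cvg].
  apply: cvgM; first exact: cvg_cst.
  by apply: pcvg_dotp; [exact: cont|apply: pcvgM; exact: cont].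
have at_r s : 0 < s < t0 -> s^'+ `=>` within `[0, t0]%classic (nbhs s).
  move=> /andP[s0 st] P; rewrite /within /= => hP.
  change (nbhs s (fun q => s < q -> P q)).
  near=> q => sq; have : (`[0, t0]%classic q -> P q) by near: q.
  apply; rewrite /= in_itv /= (ltW (lt_trans s0 sq)) ltW //.
  by near: q; exact: lt_nbhsl.
have dini s : 0 < s < t0 -> \forall q \near s^'+, f q <= f s + (q - s) * (A * f s + B).
  move=> hs; have hs' : 0 <= s <= t0 by case/andP: hs => *; rewrite !ltW.
  have [[sms Ws] [fs1 fs2]] := (sm s hs', fP s hs').
  pose u q i := eU (EE q i).
  pose w (i : 'I_N) := wt (hh x i) (phi x M i).
  pose c q (i : 'I_N) := corr n (hh x i) (phi x M i) (EE q i).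
  pose rq q i := (q - s)^-1 *: (u q i - u s i).
  pose Y q := \sum_(i < N) hh x i * (2^-1 * dotp (rq q i) (w i * u q i) +
      2^-1 * dotp (rq q i) (w i * u s i) + dotp (rq q i) (c q i)).
  have Ycvg : Y q @[q --> s^'+] --> energy_form n x M (EE s) (fun i => eG (EE s i))
      + energy_form n x M (EE s) rho.
    have -> : energy_form n x M (EE s) (fun i => eG (EE s i)) + energy_form n x M (EE s) rho
     = \sum_(i < N) hh x i * (2^-1 * dotp (eG (EE s i) + rho i) (w i * u s i) +
      2^-1 * dotp (eG (EE s i) + rho i) (w i * u s i) + dotp (eG (EE s i) + rho i) (c s i)).
      rewrite -big_split /=; apply: eq_bigr => i _.
      rewrite -mulrDr -dotpDl -/(w i) -/(u s i) -/(c s i) dotpDr; congr (_ * _).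
      by field.
    have ru i : pcvg (F := s^'+) (fun q => u q i) (u s i).
      by apply: pcvg_filter (cont s i hs'); exact: at_r.
    apply: cvg_sumr => i _; apply: cvgM; first exact: cvg_cst.
    apply: cvgD; first apply: cvgD.
    - apply: cvgM; first exact: cvg_cst.
      by apply: pcvg_dotp; [exact: der|exact: pcvgM].
    - apply: cvgM; first exact: cvg_cst.
      by apply: pcvg_dotp; [exact: der|exact: pcvg_cst].
    - apply: pcvg_dotp; [exact: der|].
      by apply: pcvg_filter (corr_cvg s i hs'); exact: at_r.
  have wn0 := wnorm_ge0 (fun i => eU (EE s i)) gr.
  have Gb : energy_form n x M (EE s) (fun i => eG (EE s i)) + energy_form n x M (EE s) rho
     <= (1 + C2 * th^-1) * wnorm x (fun i => eU (EE s i)) + (C1 + C2 * th^-1) * W + C2 * th * Rh.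
    have [Q0 [E1 _]] := H1 _ _ _ _ xl x1 xle (sys _ hs) sms.
    have := H2 _ _ (EE s) (dd s) rho _ gr sms th0; rewrite ler_norml => /andP[_ E3].
    move: E1; rewrite -/(wnorm x (fun i => eQ (EE s i))) -/(wnorm x (fun i => eU (EE s i))) -/(wsum x (dd s)) => E1.
    have J0 : 0 <= \sum_(i < N) jumps (EE s i).
      by apply: sumr_ge0 => i _; rewrite !addr_ge0 ?sqr_ge0.
    have q0 := wnorm_ge0 (fun i => eQ (EE s i)) gr.
    have Q2 := sqr_ge0 Q0.
    have g1 : C1 * wsum x (dd s) <= C1 * W by rewrite ler_wpM2l.
    have g2 : C2 * th^-1 * wsum x (dd s) <= C2 * th^-1 * W.
      by rewrite ler_wpM2l // mulr_ge0 // ltW.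
    have g3 : C2 * th * wnorm x rho <= C2 * th * Rh.
      by rewrite ler_wpM2l // mulr_ge0 // ltW.
    move: E1 E3 J0 q0 Q2 g1 g2 g3; clear.
    move: (wnorm x (fun i => eU (EE s i))) (\sum_(i < N) jumps (EE s i)) (Q0 ^+ 2)
      (wsum _ _) (th^-1) (wnorm x rho) (wnorm x _) => *; lra.
  have Yle : \forall q \near s^'+, Y q <= (1 + C2 * th^-1) * wnorm x (fun i => eU (EE s i)) + (C1 + C2 * th^-1) * W + C2 * th * Rh + W.
    have : energy_form n x M (EE s) (fun i => eG (EE s i)) + energy_form n x M (EE s) rho
       < (1 + C2 * th^-1) * wnorm x (fun i => eU (EE s i)) + (C1 + C2 * th^-1) * W + C2 * th * Rh + W.
      by apply: le_lt_trans Gb _; rewrite ltrDl.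
    move=> hlt; pose proof (Z := cvgr_le _ Ycvg _ hlt). exact: Z.
  near=> q.
  have sq : s < q by near: q; exact: nbhs_right_gt.
  have qt : q < t0 by near: q; apply: nbhs_right_lt; case/andP: hs.
  have hq : 0 <= q <= t0.
    by rewrite (ltW qt) andbT (le_trans _ (ltW sq)) //; case/andP: hs'.
  have dq : 0 < q - s by rewrite subr_gt0.
  have fq : f q - f s = (q - s) * Y q + \sum_(i < N) hh x i * dotp (u s i) (c q i - c s i).
    rewrite /f /energy /Y mulr_sumr -sumrB -big_split /=; apply: eq_bigr => i _.
    rewrite -/(w i) -/(u q i) -/(u s i) -/(c q i) -/(c s i).
    have eu : u q i = u s i + (q - s) *: rq q i.
      by rewrite /rq scalerA divff ?gt_eqF // scale1r addrC subrK.
    rewrite !eu; move: (rq q i) (c q i) (c s i) => y cq cs.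
    have sy a b : dotp a (w i * b) = dotp b (w i * a).
      by rewrite /dotp; congr intp; ring.
    have -> : w i * (u s i + (q - s) *: y) = w i * u s i + (q - s) *: (w i * y).
      by rewrite mulrDr scalerAr.
    rewrite dotpBr !(dotpDl, dotpDr, dotpZl, dotpZr) (sy (u s i) y).
    by field.
  have ci i : normp (c q i - c s i) <= k * (hh x i * `|ebe (EE q i) - ebe (EE s i)|).
    have -> : c q i - c s i = corr n (hh x i) (phi x M i) (esub (EE q i) (EE s i)).
      by rewrite /c /corr -scalerBl /=; congr (_ *: _); ring.
    rewrite kE; apply: corr_le => //; first exact: hh_gt0.
    - by rewrite addr_ge0 // subr_ge0 (x_mono xl) // ltnW.
    - by rewrite lerD2l (le_trans _ xle) // lerD2r (x_mono xl) // ltnW.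
  have Zb : \sum_(i < N) hh x i * dotp (u s i) (c q i - c s i) <=
     (q - s) * (k * (th^-1 * wnorm x (fun i => eU (EE s i)) + th * Bb)).
    apply: (@le_trans _ _ (\sum_(i < N) (k * ((q - s) * th^-1 * (hh x i * normp (u s i) ^+ 2) +
       (q - s)^-1 * th * (hh x i * (hh x i * (ebe (EE q i) - ebe (EE s i))) ^+ 2))))).
      apply: ler_sum => i _; have h0 := hh_gt0 xl i.
      apply: (@le_trans _ _ (hh x i * (normp (u s i) * (k * (hh x i * `|ebe (EE q i) - ebe (EE s i)|))))).
        rewrite ler_wpM2l ?(ltW h0) //; apply: le_trans (ler_norm _) _.
        exact: bnd_dot.
      rewrite -(real_normK (num_real (hh x i * _))) normrM (gtr0_norm h0).
      move: (hh x i * `|_|) => z; move: (normp (u s i)) => v.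
      have -> : hh x i * (v * (k * z)) = k * (hh x i * (v * z)) by ring.
      rewrite ler_wpM2l // 2!(mulrCA _ (hh x i)) -mulrDr ler_wpM2l ?(ltW h0) //.
      set y := (q - s) / th.
      have y0 : 0 < y by rewrite divr_gt0.
      have -> : (q - s)^-1 * th = y^-1 by rewrite /y invf_div mulrC.
      exact: youngw.
    rewrite -mulr_sumr big_split /= -!mulr_sumr.
    have := lip q s hq hs' => hl.
    have -> : (q - s) * (k * (th^-1 * wnorm x (fun i => eU (EE s i)) + th * Bb)) =
      k * ((q - s) / th * wnorm x (fun i => eU (EE s i)) + (q - s)^-1 * th * (Bb * (q - s) ^+ 2)).
      by field; rewrite !gt_eqF.
    rewrite ler_wpM2l // lerD2l ler_wpM2l // mulr_ge0 ?invr_ge0 // ltW //.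
  rewrite -lerBlDl fq; apply: le_trans (lerD (lexx _) Zb) _.
  rewrite -mulrDr ler_wpM2l ?(ltW dq) //.
  have : Y q <= (1 + C2 * th^-1) * wnorm x (fun i => eU (EE s i)) + (C1 + C2 * th^-1) * W + C2 * th * Rh + W by near: q.
  have e1 : 0 <= (C4 * r - (1 + (C2 + k) * th^-1)) * wnorm x (fun i => eU (EE s i)).
    rewrite mulr_ge0 // subr_ge0 /r /C4.
    have := mulr_ge0 C20 (ltW thi); have := mulr_ge0 k0 (ltW thi).
    by move: C20 k0 thi; clear -n sg tqu tpu l sg_gt0 tpu_le l_gt0 l_ge0; lra.
  have e2 : C4 * r * wnorm x (fun i => eU (EE s i)) <= C4 * r * (f s + C3 * W).
    by rewrite ler_wpM2l // ltW.
  have e3 : 0 <= W * th^-1 by rewrite mulr_ge0 ?ltW.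
  have e4 : 0 <= th * Rh by rewrite mulr_ge0 // ltW.
  have e5 : 0 <= th * Bb by rewrite mulr_ge0 // ltW.
  have e6 : C2 * W / th <= (C5 - C4 * C3) * (W / th).
    have -> : C2 * W / th = C2 * (W / th) by ring.
    rewrite ler_wpM2r // /C5; move: C10 C20 C40; clear -n sg tqu tpu l sg_gt0 tpu_le l_gt0 l_ge0; lra.
  have e7 : (C1 + 1) * W <= (C5 - C4 * C3) * W.
    rewrite ler_wpM2r ?(ltW W0) // /C5; move: C10 C20 C40; clear -n sg tqu tpu l sg_gt0 tpu_le l_gt0 l_ge0; lra.
  have C45 : C4 <= C5.
    rewrite /C5 lerDr; do 3 ![apply: addr_ge0 => //]; exact: mulr_ge0.
  have e8 : C2 * (th * Rh) <= C5 * (th * Rh).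
    rewrite ler_wpM2r // (le_trans _ C45) // /C4; move: k0; clear -n sg tqu tpu l sg_gt0 tpu_le l_gt0 l_ge0; lra.
  have e9 : k * (th * Bb) <= C5 * (th * Bb).
    rewrite ler_wpM2r // (le_trans _ C45) // /C4; move: C20; clear -n sg tqu tpu l sg_gt0 tpu_le l_gt0 l_ge0; lra.
  move: e1 e2 e6 e7 e8 e9; rewrite /A /B /r.
  move: (wnorm _ _) (f s) (Y q) (th^-1) => wu fs Yq ti.
  clear -n sg tqu tpu l sg_gt0 tpu_le l_gt0 l_ge0; move=> *; lra.
pose y s := f s + B / A.
have B0 : 0 <= B.
  rewrite /B mulr_ge0 // addr_ge0 //; first by rewrite mulr_ge0 ?(ltW W0) // (le_trans ler01).
  by rewrite mulr_ge0 ?addr_ge0 // ltW.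
have BA0 : 0 <= B / A by rewrite divr_ge0 // ltW.
have h00 : 0 <= (0 : R) <= t0 by rewrite lexx.
have wn00 := wnorm_ge0 (fun i => eU (EE 0 i)) gr.
pose Yc := C3 * (wnorm x (fun i => eU (EE 0 i)) + W) + B / A.
have Yc0 : 0 <= Yc by rewrite addr_ge0 // mulr_ge0 // addr_ge0 // ltW.
have key : y t <= Yc * expR (A * t).
  apply: (@gronwall R y A Yc t0) => //.
  - by move=> s; apply: cvgD; [exact: fcont|exact: cvg_cst].
  - by rewrite lerD2r (fP 0 h00).2.
  - move=> s hs; apply: filterS (dini s hs) => q.
    rewrite /y; have -> : (f s + B / A) * (1 + A * (q - s)) = f s + (q - s) * (A * f s + B) + B / A.
      by field; rewrite gt_eqF.
    by rewrite lerD2r.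
have [ft _] := fP t ht.
have eA : 1 <= expR (A * t0).
  by rewrite -expR0 ler_expR mulr_ge0 // ltW.
have tt : expR (A * t) <= expR (A * t0).
  by rewrite ler_expR ler_wpM2l ?(ltW A0) //; case/andP: ht.
have C456 : C4 <= C4 + C5 + 2 * C3 by rewrite -addrA lerDl addr_ge0 // mulr_ge0.
have eC : expR (A * t0) <= expR ((C4 + C5 + 2 * C3) * (1 + th^-1) * t0).
  by rewrite ler_expR ler_wpM2r // ler_wpM2r // (le_trans ler01).
have BAe : B / A <= C5 * (W + th ^+ 2 * (Rh + Bb)).
  have rB : 0 <= Rh + Bb by rewrite addr_ge0.
  have i1 : th <= th ^+ 2 * r.
    by rewrite /r mulrDr mulr1 expr2 -mulrA divff ?gt_eqF // mulr1 lerDr mulr_ge0 // ltW.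
  have i2 : th * (Rh + Bb) <= th ^+ 2 * r * (Rh + Bb) by rewrite ler_wpM2r.
  have i3 : r * W + th * (Rh + Bb) <= r * (W + th ^+ 2 * (Rh + Bb)).
    by rewrite [leRHS]mulrDr lerD2l (le_trans i2) // (mulrC (th ^+ 2)) -mulrA.
  rewrite ler_pdivrMr // /B -mulrA ler_wpM2l //.
  apply: le_trans i3 _; rewrite mulrC ler_wpM2l //.
    by rewrite addr_ge0 ?(ltW W0) // mulr_ge0 ?sqr_ge0.
  by rewrite /A ler_peMl // (le_trans ler01).
have S0 : 0 <= th ^+ 2 * (Rh + Bb) by rewrite mulr_ge0 ?sqr_ge0 ?addr_ge0.
apply: le_trans ft _.
apply: (@le_trans _ _ ((Yc + C3 * W) * expR (A * t0))).
  rewrite mulrDl lerD //.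
    apply: le_trans (_ : y t <= _); first by rewrite /y lerDl.
    by apply: le_trans key _; rewrite ler_wpM2l.
  by rewrite ler_peMr // mulr_ge0 // ltW.
apply: ler_pM => //.
  by rewrite addr_ge0 // mulr_ge0 // ltW.
rewrite /Yc; apply: le_trans (lerD (lerD (lexx _) BAe) (lexx _)) _.
have z1 := mulr_ge0 C40 wn00; have z2 := mulr_ge0 C50 wn00; have z3 := mulr_ge0 C30 wn00.
have z4 := mulr_ge0 C40 (ltW W0); have z5 := mulr_ge0 C40 S0; have z6 := mulr_ge0 C30 S0.
move: z1 z2 z3 z4 z5 z6; move: (wnorm _ _) (th ^+ 2 * _) => a b; clear; lra.
Unshelve. all: by end_near.
Qed.
End Evolution.

Lemma continuous_integrable (R : realType) (f : R -> R) (a b : R) : continuous f ->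
  (@lebesgue_measure R).-integrable `[a, b] (EFin \o f).
Proof.
move=> cf; apply: continuous_compact_integrable; first exact: segment_compact.
exact: continuous_subspaceT.
Qed.

Section PointwiseDerivatives.
Context {R : realType}.
Implicit Types (f g : R -> R) (x a b c : R).

Lemma der_eq f x a b : a = b -> is_derive x 1 f a -> is_derive x 1 f b.
Proof. by move=> ->. Qed.
Lemma der_cst c x : is_derive x 1 (fun=> c) (0 : R).
Proof. exact: is_derive_cst. Qed.
Lemma derD f g x a b : is_derive x 1 f a -> is_derive x 1 g b ->
  is_derive x 1 (fun t => f t + g t) (a + b).
Proof. exact: is_deriveD. Qed.
Lemma derB f g x a b : is_derive x 1 f a -> is_derive x 1 g b ->
  is_derive x 1 (fun t => f t - g t) (a - b).
Proof. exact: is_deriveB. Qed.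
Lemma derM f g x a b : is_derive x 1 f a -> is_derive x 1 g b ->
  is_derive x 1 (fun t => f t * g t) (f x * b + g x * a).
Proof. exact: is_deriveM. Qed.
Lemma derZ c f x a : is_derive x 1 f a -> is_derive x 1 (fun t => c * f t) (c * a).
Proof. exact: is_deriveZ. Qed.
Lemma der_shift c f x a : is_derive (x + c) 1 f a -> is_derive x 1 (fun t => f (t + c)) a.
Proof.
move=> fa; suff: is_derive x 1 (fun t => f (t + c)) (a * 1) by rewrite mulr1.
apply: (@is_derive1_comp _ f (fun t => t + c)) => //.
suff: is_derive x 1 (fun t => t + c) (1 + 0) by rewrite addr0.
exact: (derD (is_derive_id _ _) (der_cst c x)).
Qed.
Lemma der_scale c f x a : is_derive (c * x) 1 f a -> is_derive x 1 (fun t => f (c * t)) (c * a).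
Proof.
move=> fa; rewrite mulrC.
apply: (@is_derive1_comp _ f (fun t => c * t)) => //.
suff: is_derive x 1 (fun t => c * t) (c * 1) by rewrite mulr1.
by apply: derZ; exact: is_derive_id.
Qed.
Lemma der_sum I (r : seq I) (P : pred I) (f : I -> R -> R) (a : I -> R) x :
  (forall i, is_derive x 1 (f i) (a i)) ->
  is_derive x 1 (fun t => \sum_(i <- r | P i) f i t) (\sum_(i <- r | P i) a i).
Proof.
move=> h; elim: r => [|i r IH].
  by rewrite big_nil; under eq_fun do rewrite big_nil; exact: der_cst.
rewrite big_cons; under eq_fun do rewrite big_cons.
by case: ifP => // _; exact: derD.
Qed.
Lemma der_slope f x a : is_derive x 1 f a ->
  exists2 g, (forall z, f z = f x + g z * (z - x)) & g z @[z --> x] --> a.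
Proof.
move=> /is_derive1_caratheodory[g [gE gc ga]]; exists g; last by rewrite -ga.
by move=> z; rewrite -gE addrC subrK.
Qed.
Lemma der_quotient f x a : is_derive x 1 f a ->
  (f z - f x) / (z - x) @[z --> x^'] --> a.
Proof.
move=> /der_slope[g gE gc].
have : g z @[z --> x^'] --> a by apply: cvg_trans gc; apply: cvg_app; exact: cvg_within.
apply: cvg_trans; apply: near_eq_cvg; near=> z.
rewrite gE addrAC subrr add0r mulfK // subr_eq0.
by near: z; exact: nbhs_dnbhs_neq.
Unshelve. all: by end_near. Qed.
End PointwiseDerivatives.

Lemma antiderivative (R : realType) (f : R -> R) (c : R) : continuous f ->
  exists F, forall x, c < x -> is_derive x 1 F (f x).
Proof.
move=> cf; exists (fun x => \int[@lebesgue_measure R]_(t in `[c, x]) f t)%R => x cx.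
have xx : x < x + 1 by rewrite ltrDl.
have [d1 d2] := continuous_FTC1_closed xx (continuous_integrable c (x + 1) cf) cx (cf x).
by apply: DeriveDef; [exact: d1|rewrite -derive1E].
Qed.

(** Variation of constants. *)
Lemma linear_ode (R : realType) (f : R -> R) (k a0 : R) : continuous f ->
  exists2 y, y 0 = a0 & forall t : R, -1 < t -> is_derive t 1 y (f t - k * y t).
Proof.
move=> cf; have [|F dF] := antiderivative (f := fun t => expR (k * t) * f t) (-1).
  move=> t; apply: cvgM; last exact: cf.
  apply: continuous_comp; last exact: continuous_expR.
  by apply: cvgM; [exact: cvg_cst|exact: cvg_id].
exists (fun t => expR (- k * t) * (a0 + F t - F 0)).
  by rewrite mulr0 expR0 mul1r addrK.
move=> t ht; have dFt := dF t ht.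
have e : expR (- k * t) * expR (k * t) = 1 by rewrite -expRD mulNr addNr expR0.
apply: (@der_eq _ _ _ (expR (- k * t) * (0 + expR (k * t) * f t - 0) +
    (a0 + F t - F 0) * (- k * expR (- k * t)))).
  by rewrite add0r subr0 mulrA e mul1r; ring.
apply: (derM (f := fun t => expR (- k * t)) (g := fun t => a0 + F t - F 0)).
  exact: (der_scale (is_derive_expR _)).
Qed.

(** The mean value theorem for the scalar product of v with its increment. *)
Lemma mean_value_sqr (R : realType) N (c : 'I_N -> R) (v w : R -> 'I_N -> R) (K s t : R) :
  (forall i, 0 <= c i) -> s <= t ->
  (forall i r, s <= r <= t -> is_derive r 1 (fun r => v r i) (w r i)) ->
  (forall r, s <= r <= t -> \sum_(i < N) c i * w r i ^+ 2 <= K) ->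
  \sum_(i < N) c i * (v t i - v s i) ^+ 2 <= K * (t - s) ^+ 2.
Proof.
move=> c0; rewrite le_eqVlt => /predU1P[<- _ _|st dv bd].
  by rewrite subrr expr0n mulr0 big1 // => i _; rewrite subrr expr0n mulr0.
set Z := \sum_(i < N) _.
pose d i := v t i - v s i.
have dS r : s <= r <= t -> is_derive r 1 (fun r => \sum_(i < N) c i * d i * v r i) (\sum_(i < N) c i * d i * w r i).
  by move=> hr; apply: der_sum => i; apply: derZ; exact: dv.
have [||r rst] := @MVT R (fun r => \sum_(i < N) c i * d i * v r i)
    (fun r => \sum_(i < N) c i * d i * w r i) s t st.
- by move=> r; rewrite in_itv /= => /andP[a b]; apply: dS; rewrite !ltW.
- by apply: derivable_within_continuous => r; rewrite in_itv => /dS[].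
rewrite -sumrB => e.
have ZE : Z = \sum_(i < N) c i * d i * w r i * (t - s).
  by rewrite -mulr_suml -e /Z; apply: eq_bigr => i _; rewrite /d; ring.
have hr : s <= r <= t by move: rst; rewrite in_itv /= => /andP[a b]; rewrite !ltW.
have Z2 : Z <= 2^-1 * Z + 2^-1 * (K * (t - s) ^+ 2).
  rewrite {1}ZE; apply: (@le_trans _ _ (\sum_(i < N) 2^-1 * (c i * d i ^+ 2 + (t - s) ^+ 2 * (c i * w r i ^+ 2)))).
    apply: ler_sum => i _; have := mulr_ge0 (c0 i) (sqr_ge0 (d i - (t - s) * w r i)).
    by rewrite !expr2; lra.
  rewrite -mulr_sumr big_split /= -mulr_sumr -mulrDr ler_wpM2l ?invr_ge0 // lerD2l.
  by rewrite mulrC ler_wpM2r ?sqr_ge0 // bd.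
lra.
Qed.

Lemma gronwall_deriv (R : realType) (y : R -> R) (a A t : R) :
  is_derive t 1 y a -> a < A * y t ->
  \forall s \near t^'+, y s <= y t * (1 + A * (s - t)).
Proof.
move=> /der_slope[g gE gc] ha; have gc' : g z @[z --> t^'+] --> a.
  by apply: cvg_trans gc; apply: cvg_app; exact: cvg_within.
near=> s; rewrite (gE s) [leRHS]mulrDr mulr1 lerD2l mulrA ler_wpM2r //.
  by rewrite subr_ge0 ltW.
by rewrite mulrC ltW //; near: s; exact: cvgr_lt gc' _ ha.
Unshelve. all: by end_near. Qed.

(** Stiff relaxation on each element: although the rates blow up like the
    inverse of the mesh size, the weighted sum of squares keeps the bound of the
    quasi stationary state F / La. *)
Lemma relaxation_bound (R : realType) N (h : 'I_N -> R) (hm La nu B t0 : R)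
   (y F : R -> 'I_N -> R) : (forall i, 0 < h i <= hm) -> 0 < hm -> 0 < La -> 0 < nu -> 0 < B ->
  (forall i t, 0 <= t <= t0 -> is_derive t 1 (fun t => y t i) ((F t i - La * y t i) / (h i * nu))) ->
  (forall t, 0 <= t <= t0 -> \sum_(i < N) F t i ^+ 2 <= B) ->
  \sum_(i < N) h i * y 0 i ^+ 2 <= hm * B / La ^+ 2 ->
  forall t, 0 <= t <= t0 -> \sum_(i < N) h i * y t i ^+ 2 <= 2 * hm * B / La ^+ 2.
Proof.
move=> h0 hm0 La0 nu0 B0 dy FB y0 t ht.
pose c := La / (nu * hm); have c0 : 0 < c by rewrite divr_gt0 // mulr_gt0.
pose Z t := \sum_(i < N) h i * y t i ^+ 2.
pose b := 2 * hm * B / La ^+ 2.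
have L2 : 0 < La ^+ 2 by rewrite exprn_gt0.
have b0 : 0 < b by rewrite divr_gt0 // !mulr_gt0.
pose dZ t := \sum_(i < N) h i * (2 * y t i * ((F t i - La * y t i) / (h i * nu))).
have dZP s : 0 <= s <= t0 -> is_derive s 1 (fun r => Z r - b) (dZ s).
  move=> hs; rewrite -(subr0 (dZ s)); apply: derB.
  apply: der_sum => i; apply: derZ; apply: der_eq (derM (dy i s hs) (dy i s hs)).
  by ring.
have ZB s : 0 <= s <= t0 -> dZ s < - c * (Z s - b).
  move=> hs; have : dZ s <= La / nu * (B / La ^+ 2) - c * Z s.
    apply: (@le_trans _ _ (\sum_(i < N) (La / nu * (F s i ^+ 2 / La ^+ 2) - La / nu * y s i ^+ 2))).
      apply: ler_sum => i _; have hi : h i != 0 by rewrite gt_eqF //; case/andP: (h0 i).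
      have -> : h i * (2 * y s i * ((F s i - La * y s i) / (h i * nu))) =
         La / nu * (2 * (F s i / La) * y s i - 2 * y s i ^+ 2).
        by field; rewrite hi !gt_eqF.
      rewrite -mulrBr ler_wpM2l ?divr_ge0 ?(ltW La0) ?(ltW nu0) // -expr_div_n.
      by have := sqr_ge0 (F s i / La - y s i); rewrite !expr2; lra.
    rewrite sumrB -!mulr_sumr -mulr_suml lerB //.
      by rewrite ler_wpM2l ?divr_ge0 ?(ltW La0) ?(ltW nu0) // ler_wpM2r ?invr_ge0 ?sqr_ge0 // FB.
    rewrite /c /Z invfM mulrA -mulrA ler_wpM2l ?divr_ge0 ?(ltW La0) ?(ltW nu0) // mulr_sumr.
    apply: ler_sum => i _; rewrite mulrA ler_piMl ?sqr_ge0 //.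
    by rewrite mulrC ler_pdivrMr // mul1r; case/andP: (h0 i).
  move=> /le_lt_trans; apply; rewrite mulNr mulrBr opprB ltrD2r.
  have -> : c * b = 2 * (La / nu * (B / La ^+ 2)).
    by rewrite /c /b; field; rewrite !gt_eqF.
  by rewrite mulr_natl mulr2n ltrDl !mulr_gt0 // invr_gt0.
have ht0 : 0 <= t0 by case/andP: ht; exact: le_trans.
suff : Z t - b <= 0 * expR (- c * t) by rewrite mul0r subr_le0.
apply: (@gronwall R (fun t => Z t - b) (- c) 0 t0) => //.
- by apply: derivable_within_continuous => s; rewrite in_itv => /dZP[].
- rewrite subr_le0 (le_trans y0) // /b -!mulrA ler_peMl ?ler1n //.
  by rewrite !mulr_ge0 ?invr_ge0 ?sqr_ge0 // ltW.
- move=> s /andP[s0 st]; apply: gronwall_deriv (dZP s _) (ZB s _).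
  + by rewrite !ltW.
  + by rewrite !ltW.
Qed.

(** * The discrete error estimate *)

(** Values at the end points of an element minus those of the projection. *)
Record traces (R : realType) := Traces {
  tul : R; tur : R; tql : R; tqr : R; tpl : R; tpr : R
}.

Section Gauge.
Context {R : realType} (n : nat) (sg tqu tpu : R).
Hypothesis sg_gt0 : 0 < sg.
Local Notation L := (leg n.+1 : {poly R}).
Local Notation nu := (legnu n.+1 : R).
Local Notation s := ((-1) ^+ n.+1 : R).
Implicit Types (a b : traces R) (c d : R).

Definition tsub a b := Traces (tul a - tul b) (tur a - tur b) (tql a - tql b)
  (tqr a - tqr b) (tpl a - tpl b) (tpr a - tpr b).
Definition trsq a := tul a ^+ 2 + tur a ^+ 2 + tql a ^+ 2 + tqr a ^+ 2
  + tpl a ^+ 2 + tpr a ^+ 2.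
Definition trabs a := `|tul a| + `|tur a| + `|tql a| + `|tqr a| + `|tpl a| + `|tpr a|.

Lemma trabs_ge0 a : 0 <= trabs a.
Proof. by rewrite /trabs !addr_ge0. Qed.
Lemma trsq_ge0 a : 0 <= trsq a.
Proof. by rewrite /trsq !addr_ge0 ?sqr_ge0. Qed.

Lemma sqr6_le (x1 x2 x3 x4 x5 x6 : R) : (x1 + x2 + x3 + x4 + x5 + x6) ^+ 2 <=
  6 * (x1 ^+ 2 + x2 ^+ 2 + x3 ^+ 2 + x4 ^+ 2 + x5 ^+ 2 + x6 ^+ 2).
Proof.
have -> : x1 + x2 + x3 + x4 + x5 + x6 = (x1 + x2 + x3) + (x4 + x5 + x6) by ring.
apply: le_trans (sqr2_le _ _) _.
by have := sqr3_le x1 x2 x3; have := sqr3_le x4 x5 x6; lra.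
Qed.

Lemma trabs_sqr a : trabs a ^+ 2 <= 6 * trsq a.
Proof.
rewrite /trsq -(real_normK (num_real (tul a))) -(real_normK (num_real (tur a)))
  -(real_normK (num_real (tql a))) -(real_normK (num_real (tqr a)))
  -(real_normK (num_real (tpl a))) -(real_normK (num_real (tpr a))).
exact: sqr6_le.
Qed.

(** [rate] and [drive] are the coefficients of [gle] as an affine function of the
    multiple added to u; see [gle_drive]. *)
Definition rate := sg ^+ 2 + sg * tqu - tpu.
Definition drive a := - s * tpl a + tpr a - sg * tqr a + sg * s * tql a
  + (sg * tqu - tpu) * s * tul a + sg ^+ 2 * tur a.
(** [gbe] and [gga] are the multiples added to q and p, given the multiple c added
    to u: they remove the data from both traces of q. [gle] is the data then left in
    the left trace of p. *)
Definition gbe a c := s * tql a + tqu * (s * tul a - c).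
Definition gga a c := tpr a - sg * (tqr a - gbe a c) + sg ^+ 2 * (tur a - c).
Definition gle a c := tpl a - s * gga a c + tpu * (tul a - s * c).

Lemma gle_drive a c : - s * gle a c = drive a - rate * c.
Proof.
have := signE (R := R) n; rewrite /gle /gga /gbe /drive /rate.
move: ((-1) ^+ n.+1) => t tt.
have -> : - t * (tpl a - t * (tpr a - sg * (tqr a - (t * tql a + tqu * (t * tul a - c)))
    + sg ^+ 2 * (tur a - c)) + tpu * (tul a - t * c)) =
  - t * tpl a + (t * t) * (tpr a - sg * tqr a + sg ^+ 2 * (tur a - c) + tpu * c)
  + sg * ((t * t) * (t * tql a + tqu * (t * tul a - c))) - tpu * t * tul a by ring.
by rewrite tt; ring.
Qed.

Lemma gbe_sub a b c d : gbe (tsub a b) (c - d) = gbe a c - gbe b d.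
Proof. by rewrite /gbe /=; ring. Qed.
Lemma gga_sub a b c d : gga (tsub a b) (c - d) = gga a c - gga b d.
Proof. by rewrite /gga gbe_sub /=; ring. Qed.
Lemma gle_sub a b c d : gle (tsub a b) (c - d) = gle a c - gle b d.
Proof. by rewrite /gle gga_sub /=; ring. Qed.
Lemma drive_sub a b : drive (tsub a b) = drive a - drive b.
Proof. by rewrite /drive /=; ring. Qed.

Definition gk := 1 + sg + `|tqu| + `|tpu|.
Definition gK := 9 * gk ^+ 2.

Lemma gauge_bound a c : [/\ `|gbe a c| <= gK * (trabs a + `|c|),
   `|gga a c| <= gK * (trabs a + `|c|), `|gle a c| <= gK * (trabs a + `|c|) &
   `|drive a| <= gK * trabs a].
Proof.
have sn (y : R) : `|s * y| = `|y| by rewrite normrM normrX normrN1 expr1n mul1r.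
have k1 : 1 <= gk by rewrite /gk -!addrA lerDl !addr_ge0 // ltW.
have k0 : 0 <= gk := le_trans ler01 k1.
have ksg : `|sg| <= gk by rewrite gtr0_norm // /gk -!addrA addrCA lerDl !addr_ge0.
have kqu : `|tqu| <= gk by rewrite /gk addrAC lerDr !addr_ge0 // ltW.
have kpu : `|tpu| <= gk by rewrite /gk lerDr !addr_ge0 // ltW.
have kk : gk <= gk ^+ 2 by rewrite expr2 ler_peMl.
have main c' : [/\ `|gbe a c'| <= 2 * gk * (trabs a + `|c'|),
   `|gga a c'| <= 5 * gk ^+ 2 * (trabs a + `|c'|) &
   `|gle a c'| <= gK * (trabs a + `|c'|)].
  set X := trabs a + `|c'|.
  have X0 : 0 <= X by rewrite addr_ge0 // trabs_ge0.
  have z1 := normr_ge0 (tul a); have z2 := normr_ge0 (tur a).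
  have z3 := normr_ge0 (tql a); have z4 := normr_ge0 (tqr a).
  have z5 := normr_ge0 (tpl a); have z6 := normr_ge0 (tpr a).
  have z7 := normr_ge0 c'.
  have e1 : `|tul a| + `|c'| <= X by rewrite /X /trabs; lra.
  have e2 : `|tur a| + `|c'| <= X by rewrite /X /trabs; lra.
  have e3 : `|tql a| <= X by rewrite /X /trabs; lra.
  have e4 : `|tqr a| <= X by rewrite /X /trabs; lra.
  have e5 : `|tpl a| <= X by rewrite /X /trabs; lra.
  have e6 : `|tpr a| <= X by rewrite /X /trabs; lra.
  clear z1 z2 z3 z4 z5 z6 z7.
  have kX : X <= gk * X by rewrite ler_peMl.
  have kkX : gk * X <= gk ^+ 2 * X by rewrite ler_wpM2r.
  have b1 : `|gbe a c'| <= 2 * gk * X.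
    apply: (@le_trans _ _ (X + gk * X)); last by lra.
    apply: bndD; first by rewrite sn.
    by apply: bndM => //; apply: le_trans e1; apply: bndD; rewrite ?sn ?normrN.
  have b2 : `|gga a c'| <= 5 * gk ^+ 2 * X.
    apply: (@le_trans _ _ (X + gk * (X + 2 * gk * X) + gk ^+ 2 * X)).
      apply: bndD; [apply: bndD => //; apply: bndN; apply: bndM => //|].
        by apply: bndD => //; exact: bndN.
      apply: bndM; first by rewrite normrX ler_pXn2r ?nnegrE.
      by apply: le_trans e2; apply: bndD; rewrite ?normrN.
    by move: kX kkX; rewrite !expr2; lra.
  split => //; apply: (@le_trans _ _ (X + 5 * gk ^+ 2 * X + gk * X)).
    apply: bndD; first by apply: bndD => //; apply: bndN; rewrite sn.
    by apply: bndM => //; apply: le_trans e1; apply: bndD; rewrite ?normrN ?sn.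
  by rewrite /gK; lra.
have X0 c' : 0 <= trabs a + `|c'| by rewrite addr_ge0 // trabs_ge0.
have [b1 b2 b3] := main c; split.
- apply: le_trans b1 _; rewrite ler_wpM2r // /gK; lra.
- apply: le_trans b2 _; rewrite ler_wpM2r // /gK; lra.
- exact: b3.
have [_ _] := main 0; rewrite normr0 addr0; apply: le_trans.
have := gle_drive a 0; rewrite mulr0 subr0 => <-.
by rewrite mulNr normrN sn.
Qed.

Lemma drive_sqr a : drive a ^+ 2 <= 6 * gK ^+ 2 * trsq a.
Proof.
have [_ _ _ /ler_abs_sqr /le_trans] := gauge_bound a 0; apply.
have -> : 6 * gK ^+ 2 * trsq a = gK ^+ 2 * (6 * trsq a) by ring.
by rewrite exprMn ler_wpM2l ?sqr_ge0 // trabs_sqr.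
Qed.

Definition raw_eqs (h : R) (u q p g : {poly R}) (a : traces R) (ul ur ql qr pl pr : R) : Prop :=
  [/\ [/\ (size u <= n.+2)%N, (size q <= n.+2)%N, (size p <= n.+2)%N & (size g <= n.+2)%N],
      forall v : {poly R}, (size v <= n.+2)%N ->
        h * dotp q v + dotp u v^`() = ur * v.[1] - ul * v.[0],
      forall z : {poly R}, (size z <= n.+2)%N ->
        h * dotp p z + dotp q z^`() = qr * z.[1] - ql * z.[0],
      forall w : {poly R}, (size w <= n.+2)%N ->
        h * dotp g w - dotp p w^`() + pr * w.[1] - pl * w.[0] = 0 &
      [/\ pl = tpl a + p.[0] - tpu * (ul - tul a - u.[0]),
          ql = tql a + q.[0] - tqu * (ul - tul a - u.[0]) &
          qr = tqr a + q.[1] + sg * (ur - tur a - u.[1]) + sg^-1 * (pr - tpr a - p.[1])]].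

(** Adding multiples of the top Legendre polynomial to the projections moves the
    projection errors from the numerical traces to the gauge variables. *)
Definition mk_err (u q p g : {poly R}) (a : traces R) (al dal ul ur ql qr pl pr : R) :=
  Errstate (u + al *: L) (q + gbe a al *: L) (p + gga a al *: L) (g + dal *: L)
    ul ur ql qr pl pr dal (gbe a al) (gga a al) (gle a al).

Lemma mk_err_eqs h u q p g a al dal ul ur ql qr pl pr :
  raw_eqs h u q p g a ul ur ql qr pl pr -> h * nu * dal = - s * gle a al ->
  error_eqs n sg tqu tpu h (mk_err u q p g a al dal ul ur ql qr pl pr).
Proof.
move=> [[su sq sp sG] e1 e2 e3 [t1 t2 t3]] G.
have sL := size_leg (R := R) n.+1.
have sz (f : {poly R}) c : (size f <= n.+2)%N -> (size (f + c *: L)%R <= n.+2)%N.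
  move=> sf; rewrite (leq_trans (size_polyD _ _)) // geq_max sf.
  by rewrite (leq_trans (size_scale_leq _ _)).
have oL (v : {poly R}) : (size v <= n.+2)%N -> dotp L v^`() = 0.
  by move=> sv; rewrite leg_orth // size_deriv_le.
split; rewrite /mk_err /=; first by split; exact: sz.
- by move=> v sv; rewrite addrK dotpDl dotpZl oL // mulr0 addr0 e1.
- by move=> v sv; rewrite addrK dotpDl dotpZl oL // mulr0 addr0 e2.
- by move=> v sv; rewrite addrK dotpDl dotpZl oL // mulr0 addr0 e3.
move: G; have := signE (R := R) n; rewrite !hornerD !hornerZ leg_at1 leg_at0.
rewrite /gle /gga /gbe; move: ((-1) ^+ n.+1) => t tt G; split => //.
- rewrite t1; lra.
- rewrite t2; have -> : (t * tql a + tqu * (t * tul a - al)) * t =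
    (t * t) * (tql a + tqu * tul a) - tqu * al * t by ring.
  by rewrite tt; ring.
- by rewrite t3; field; rewrite gt_eqF.
Qed.

End Gauge.

Lemma pcvg_comp (R : realType) (T S : Type) (F : set_system T) (G : set_system S)
  (g : T -> S) (f : S -> {poly R}) p :
  g @ F `=>` G -> pcvg (F := G) f p -> pcvg (F := F) (f \o g) p.
Proof. by move=> gF fp; apply: cvg_trans fp => P; exact: gF. Qed.

Lemma clamp_continuous (R : realType) (f : R -> R) (K T : R) : 0 <= T -> 0 <= K ->
  (forall s t, 0 <= s <= T -> 0 <= t <= T -> `|f s - f t| <= K * `|s - t|) ->
  continuous (fun t => f (Num.max 0 (Num.min T t))).
Proof.
move=> T0 K0 lip t; apply/cvgrPdist_le => e e0.
have cl s : 0 <= Num.max 0 (Num.min T s) <= T.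
  by rewrite le_max lexx /= ge_max T0 ge_min lexx.
have d0 : 0 < e / (K + 1) by rewrite divr_gt0 // ltr_wpDl.
have nr : \forall s \near t, `|t - s| < e / (K + 1).
  by apply/nbhs_normP; exists (e / (K + 1)).
near=> s; apply: le_trans (lip _ _ (cl t) (cl s)) _.
have : `|t - s| < e / (K + 1) by near: s.
rewrite ltr_pdivlMr ?ltr_wpDl // => hl.
apply: (@le_trans _ _ (K * `|t - s|)).
  rewrite ler_wpM2l //.
  have : forall a b c : R, `|Num.max c a - Num.max c b| <= `|a - b| /\ `|Num.min c a - Num.min c b| <= `|a - b|.
    move=> a b c; rewrite /Num.max /Num.min.
    have n0 := normr_ge0 (a - b); have := ler_norm (a - b); have := ler_norm (b - a).
    rewrite (distrC b a) => h1 h2.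
    split; case: ltP => x1; case: ltP => x2; rewrite ?subrr ?normr0 // ler_norml; lra.
  move=> H; apply: le_trans (H _ _ 0).1 _; exact: (H _ _ T).2.
apply: le_trans (ltW hl); rewrite mulrDr mulr1 mulrC lerDl //.
Unshelve. all: by end_near. Qed.

Section DiscreteHelpers.
Context {R : realType} (l : R).

Lemma wnorm_add N (x : nat -> R) (p q : 'I_N -> {poly R}) : grid l N x ->
  wnorm x (fun i => p i + q i) <= 2 * wnorm x p + 2 * wnorm x q.
Proof.
move=> [xl _ _]; rewrite /wnorm !mulr_sumr -big_split /=; apply: ler_sum => i _.
have -> : forall a b c : R, 2 * (a * b) + 2 * (a * c) = a * (2 * b + 2 * c) by move=> *; ring.
rewrite ler_wpM2l ?(ltW (hh_gt0 xl i)) //.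
apply: le_trans (sqr2_le _ _); rewrite ler_pXn2r ?nnegrE ?addr_ge0 ?normp_ge0 //.
exact: normpD.
Qed.

Lemma wnorm_opp N (x : nat -> R) (p : 'I_N -> {poly R}) :
  wnorm x (fun i => - p i) = wnorm x p.
Proof. by apply: eq_bigr => i _; rewrite normpN. Qed.

Lemma wnorm_sub N (x : nat -> R) (p q : 'I_N -> {poly R}) : grid l N x ->
  wnorm x (fun i => p i - q i) <= 2 * wnorm x p + 2 * wnorm x q.
Proof. by move=> gr; rewrite -(wnorm_opp x q); exact: wnorm_add. Qed.

Lemma wnorm_leg N (x : nat -> R) k (c : 'I_N -> R) :
  wnorm x (fun i => c i *: leg k) = legnu k * \sum_(i < N) hh x i * c i ^+ 2.
Proof.
rewrite /wnorm mulr_sumr; apply: eq_bigr => i _.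
by rewrite normp_sqr dotpZl dotpZr -/(legnu k); ring.
Qed.

Lemma wnorm_scale N (x : nat -> R) (c : R) (p : 'I_N -> {poly R}) :
  wnorm x (fun i => c *: p i) = c ^+ 2 * wnorm x p.
Proof.
rewrite /wnorm mulr_sumr; apply: eq_bigr => i _.
by rewrite normpZ exprMn real_normK ?num_real //; ring.
Qed.

Lemma wnorm_cvg N (x : nat -> R) (T : Type) (F : set_system T) (FF : Filter F)
  (f : T -> 'I_N -> {poly R}) p : (forall i, pcvg (F := F) (fun s => f s i) (p i)) ->
  wnorm x (f s) @[s --> F] --> wnorm x p.
Proof.
move=> h; apply: cvg_sumr => i _; apply: cvgM; first exact: cvg_cst.
by under eq_fun do rewrite normp_sqr; rewrite normp_sqr; exact: pcvg_dotp.
Qed.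

End DiscreteHelpers.

(** Polynomials are projected errors, [gd] is the time derivative of [ud], and the
    nodal functions are the errors of the numerical traces. *)
Record error_data (R : realType) (N : nat) := ErrorData {
  tr : R -> 'I_N -> traces R;
  ud : R -> 'I_N -> {poly R}; qd : R -> 'I_N -> {poly R};
  pd : R -> 'I_N -> {poly R}; gd : R -> 'I_N -> {poly R};
  Ud : R -> nat -> R; Qd : R -> nat -> R; Pd : R -> nat -> R
}.

Lemma pcvg_ext (R : realType) (T : Type) (F : set_system T) (f g : T -> {poly R}) p :
  (forall s, g s = f s) -> pcvg (F := F) f p -> pcvg (F := F) g p.
Proof. by move=> /funext ->. Qed.

Lemma within_dnbhsP (R : realType) (A P : set R) (t : R) : within A t^' P <->
  exists2 d, 0 < d & forall z, `|t - z| < d -> z != t -> A z -> P z.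
Proof.
split=> [|[d d0 H]].
  move=> h; have /nbhs_normP[d /= d0 H] : nbhs t (fun z => z != t -> A z -> P z) by exact: h.
  by exists d => // z tz; exact: H.
change (nbhs t (fun z => z != t -> A z -> P z)); apply/nbhs_normP.
by exists d => // z; exact: H.
Qed.

Lemma pcvg_near (R : realType) (A : set R) (t : R) (f g : R -> {poly R}) p :
  (forall s, s != t -> g s = f s) -> pcvg (F := within A t^') f p ->
  pcvg (F := within A t^') g p.
Proof.
move=> fg; apply: cvg_trans => P /within_dnbhsP[d d0 H].
change (within A t^' ((fun s => normp (g s - p)) @^-1` P)).
by apply/within_dnbhsP; exists d => // z tz zt Az; rewrite /preimage /= fg //; exact: H.
Qed.

Lemma pcvg_dnbhs (R : realType) (A : set R) (t : R) (f : R -> {poly R}) :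
  pcvg (F := within A t^') f (f t) -> pcvg (F := within A (nbhs t)) f (f t).
Proof.
move=> h; apply/cvgrPdist_le => e e0; have /cvgrPdist_le /(_ e e0) := h.
rewrite !near_withinE => h'; near=> s => As.
have [->|st] := eqVneq s t; first by rewrite subrr normp0 subrr normr0 ltW.
by move: As; have : s != t -> A s -> `|0 - normp (f s - f t)| <= e; [near: s|exact].
Unshelve. all: by end_near. Qed.

Lemma right_within (R : realType) (T t : R) : 0 <= t < T ->
  t^'+ `=>` within `[0, T]%classic t^'.
Proof.
move=> /andP[t0 tT] P /within_dnbhsP[d d0 H].
near=> z; have tz : t < z by near: z; exact: nbhs_right_gt.
apply: H.
- rewrite distrC gtr0_norm ?subr_gt0 // ltrBlDl; near: z; apply: nbhs_right_lt.
  by rewrite ltrDl.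
- by rewrite gt_eqF.
- by rewrite /= in_itv /= (le_trans t0 (ltW tz)) ltW //; near: z; exact: nbhs_right_lt.
Unshelve. all: by end_near. Qed.

Lemma left_within (R : realType) (T t : R) : 0 < t <= T ->
  t^'- `=>` within `[0, T]%classic t^'.
Proof.
move=> /andP[t0 tT] P /within_dnbhsP[d d0 H].
near=> z; have tz : z < t by near: z; exact: nbhs_left_lt.
apply: H.
- rewrite gtr0_norm ?subr_gt0 // ltrBlDr -ltrBlDl; near: z; apply: nbhs_left_gt.
  by rewrite ltrBlDr ltrDl.
- by rewrite lt_eqF.
- rewrite /= in_itv /= (le_trans (ltW tz) tT) andbT ltW //; near: z; exact: nbhs_left_gt.
Unshelve. all: by end_near. Qed.

Lemma shift_within (R : realType) (T t e : R) : 0 <= t -> 0 <= e -> t + e < T ->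
  s + e @[s --> t^'+] `=>` within `[0, T]%classic (t + e)^'.
Proof.
move=> t0 e0 tT P /within_dnbhsP[d d0 H].
change (t^'+ (fun s => P (s + e))).
near=> z; have tz : t < z by near: z; exact: nbhs_right_gt.
apply: H.
- rewrite opprD addrACA subrr addr0 distrC gtr0_norm ?subr_gt0 // ltrBlDl; near: z.
  by apply: nbhs_right_lt; rewrite ltrDl.
- by rewrite gt_eqF // ltrD2r.
- rewrite /= in_itv /= addr_ge0 //= ?(le_trans t0 (ltW tz)) //.
  by rewrite -lerBrDr ltW //; near: z; apply: nbhs_right_lt; rewrite ltrBrDr.
Unshelve. all: by end_near. Qed.

Lemma shift_within_nbhs (R : realType) (T t e : R) : 0 <= e ->
  s + e @[s --> within `[0, T - e]%classic (nbhs t)] `=>` within `[0, T]%classic (nbhs (t + e)).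
Proof.
move=> e0 P h; have /nbhs_normP[d /= d0 H] : nbhs (t + e) (fun z => `[0, T]%classic z -> P z) by exact: h.
change (nbhs t (fun s => `[0, T - e]%classic s -> P (s + e))); apply/nbhs_normP.
exists d => //= z tz; rewrite /= in_itv /= => /andP[z0 zT]; apply: H.
  by rewrite /= opprD addrACA subrr addr0.
by rewrite /= in_itv /= addr_ge0 //= -lerBrDr.
Qed.

Lemma eq_lew (R : realType) (x y : R) : x = y -> x <= y.
Proof. by move=> ->. Qed.

Section Discrete.
Context {R : realType} (n : nat) (sg tqu tpu l T : R).
Hypothesis sg_gt0 : 0 < sg.
Hypothesis tqu_ge0 : 0 <= tqu.
Hypothesis tpu_le : tpu <= - 2^-1 - 2^-1 * tqu ^+ 2.
Hypothesis l_gt0 : 0 < l.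
Hypothesis T_gt0 : 0 < T.
Local Notation L := (leg n.+1 : {poly R}).
Local Notation nu := (legnu n.+1 : R).
Local Notation La := (rate sg tqu tpu).
Local Notation K := (gK sg tqu tpu).

Lemma rate_gt0 : 0 < La.
Proof.
have := mulr_ge0 (ltW sg_gt0) tqu_ge0; have := sqr_ge0 tqu; have := sqr_ge0 sg.
rewrite /rate; have := tpu_le; lra.
Qed.

Lemma gK_ge1 : 1 <= K.
Proof.
have k1 : 1 <= gk sg tqu tpu by rewrite /gk -!addrA lerDl !addr_ge0 // ltW.
by rewrite /gK mulr_ege1 ?exprn_ege1 // ler1n.
Qed.

Definition cD := 6 * K ^+ 2.
Local Notation K2 := cD.
Lemma K2_gt0 : 0 < K2.
Proof. by rewrite mulr_gt0 // exprn_gt0 // (lt_le_trans ltr01 gK_ge1). Qed.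
Definition cA := 4 * K2 / La ^+ 2.
Local Notation c1 := cA.
Lemma La2 : 0 < La ^+ 2. Proof. by rewrite exprn_gt0 // rate_gt0. Qed.
Lemma c1_ge0 : 0 <= c1.
Proof. by rewrite divr_ge0 ?(ltW La2) // mulr_ge0 // ltW // K2_gt0. Qed.
Definition cL := 10 * K2 / nu ^+ 2.
Local Notation c2 := cL.
Lemma nu2 : 0 < nu ^+ 2. Proof. by rewrite exprn_gt0 // legnu_gt0. Qed.
Lemma c2_ge0 : 0 <= c2.
Proof. by rewrite divr_ge0 ?(ltW nu2) // mulr_ge0 // ltW // K2_gt0. Qed.

(** Second time differences enter only through the correction of the energy, hence
    only for the left traces of u and q and with a factor hh for each power. *)
Definition trace_bounds N (x : nat -> R) (B : R) (D : error_data R N) : Prop :=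
  [/\ forall t, 0 <= t <= T -> \sum_(i < N) trsq (tr D t i) <= B,
      forall s t, 0 <= s <= T -> 0 <= t <= T ->
        \sum_(i < N) trsq (tsub (tr D s i) (tr D t i)) <= B * (s - t) ^+ 2 &
      forall s t e, 0 <= s -> 0 <= t -> 0 <= e -> s + e <= T -> t + e <= T ->
        \sum_(i < N) hh x i ^+ 2 *
          ((tul (tr D (s + e) i) - tul (tr D s i) - (tul (tr D (t + e) i) - tul (tr D t i))) ^+ 2
          + (tql (tr D (s + e) i) - tql (tr D s i) - (tql (tr D (t + e) i) - tql (tr D t i))) ^+ 2)
         <= B * (s - t) ^+ 2 * e ^+ 2].

(** At time 0 the stationary problem holds, in which u takes the place of its time
    derivative. *)
Definition solves N (x : nat -> R) (D : error_data R N) : Prop :=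
  [/\ forall t (i : 'I_N), 0 <= t <= T ->
        raw_eqs n sg tqu tpu (hh x i) (ud D t i) (qd D t i) (pd D t i)
          (if t == 0 then ud D t i else gd D t i) (tr D t i)
          (Ud D t i) (Ud D t i.+1) (Qd D t i) (Qd D t i.+1) (Pd D t i) (Pd D t i.+1),
      forall t, 0 <= t <= T -> [/\ Ud D t 0 = 0, Ud D t N = 0 & Qd D t N = 0] &
      forall t (i : 'I_N), 0 <= t <= T -> pcvg (F := within `[0, T]%classic t^')
        (fun s => (s - t)^-1 *: (ud D s i - ud D t i)) (gd D t i)].

Section Data.
Variables (N : nat) (x : nat -> R) (hm B : R) (D : error_data R N).
Hypothesis gr : grid l N x.
Hypothesis h_le : forall i : 'I_N, hh x i <= hm.
Hypothesis hm_gt0 : 0 < hm.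
Hypothesis B_gt0 : 0 < B.
Hypothesis tB : trace_bounds x B D.
Hypothesis sol : solves x D.

Let h0 (i : 'I_N) : 0 < hh x i. Proof. by case: gr => xl _ _; exact: hh_gt0. Qed.

Definition clampT (t : R) := Num.max 0 (Num.min T t).
Lemma clampT_id t : 0 <= t <= T -> clampT t = t.
Proof.
move=> /andP[t0 tT]; rewrite /clampT; have -> : Num.min T t = t by apply/min_idPr.
by apply/max_idPr.
Qed.

Lemma drive_continuous (i : 'I_N) :
  continuous (fun t => drive n sg tqu tpu (tr D (clampT t) i) / (hh x i * nu)).
Proof.
have T0 := ltW T_gt0.
apply: (@clamp_continuous R (fun t => drive n sg tqu tpu (tr D t i) / (hh x i * nu))
  (Num.sqrt (K2 * B) / (hh x i * nu))) => //.
  by rewrite divr_ge0 ?sqrtr_ge0 // mulr_ge0 ?ltW ?legnu_gt0.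
move=> s t hs ht; rewrite -mulrBl normrM -drive_sub mulrAC.
rewrite [X in _ * X]ger0_norm ?invr_ge0; last by rewrite mulr_ge0 ?(ltW (h0 i)) ?(ltW (legnu_gt0 _)).
rewrite ler_wpM2r ?invr_ge0 ?mulr_ge0 ?(ltW (h0 i)) ?(ltW (legnu_gt0 _)) //.
have KB : 0 <= K2 * B := ltW (mulr_gt0 K2_gt0 B_gt0).
rewrite -sqrtr_sqr -(sqrtr_sqr (s - t)) -sqrtrM // ler_sqrt ?(mulr_ge0 KB) ?sqr_ge0 //.
apply: le_trans (drive_sqr n tqu tpu sg_gt0 _) _.
rewrite -/cD -(mulrA K2) (ler_pM2l K2_gt0).
case: tB => _ b1 _; apply: le_trans (b1 s t hs ht); rewrite (bigD1 i) //= lerDl.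
by apply: sumr_ge0 => j _; exact: trsq_ge0.
Qed.

(** The initial value is the equilibrium, for which [gle] vanishes. *)
Lemma alpha_ex (i : 'I_N) : exists2 y : R -> R, y 0 = drive n sg tqu tpu (tr D 0 i) / La &
  forall t : R, 0 <= t <= T -> is_derive t 1 y
    ((drive n sg tqu tpu (tr D t i) - La * y t) / (hh x i * nu)).
Proof.
have [y y0 dy] := linear_ode (La / (hh x i * nu)) (drive n sg tqu tpu (tr D 0 i) / La)
  (drive_continuous (i := i)).
exists y => // t ht; have t1 : -1 < t by case/andP: ht => t0 _; apply: lt_le_trans t0; rewrite ltrN10.
by apply: der_eq (dy t t1); rewrite clampT_id // mulrAC -mulrBl.
Qed.

Definition alpha t (i : 'I_N) : R := projT1 (cid2 (alpha_ex i)) t.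
Lemma alpha0 i : alpha 0 i = drive n sg tqu tpu (tr D 0 i) / La.
Proof. by rewrite /alpha; case: cid2. Qed.
Definition dalpha t (i : 'I_N) := (drive n sg tqu tpu (tr D t i) - La * alpha t i) / (hh x i * nu).
Lemma alpha_der i t : 0 <= t <= T -> is_derive t 1 (fun t => alpha t i) (dalpha t i).
Proof. by rewrite /dalpha /alpha; case: cid2 => y /= _; exact. Qed.

Lemma sum_drive (a : 'I_N -> traces R) (b : R) : \sum_(i < N) trsq (a i) <= b ->
  \sum_(i < N) drive n sg tqu tpu (a i) ^+ 2 <= K2 * b.
Proof.
move=> ab; apply: le_trans (ler_wpM2l (ltW K2_gt0) ab); rewrite mulr_sumr.
by apply: ler_sum => i _; exact: drive_sqr.
Qed.

Lemma sum_h_le (y : 'I_N -> R) b : (forall i, 0 <= y i) -> \sum_(i < N) y i <= b ->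
  \sum_(i < N) hh x i * y i <= hm * b.
Proof.
move=> y0 yb; apply: le_trans (ler_wpM2l (ltW hm_gt0) yb); rewrite mulr_sumr.
by apply: ler_sum => i _; rewrite ler_wpM2r.
Qed.

Let K2p := K2_gt0. Let La2p := La2. Let nu2p := nu2.
Let hi (i : 'I_N) : 0 < hh x i <= hm. Proof. by rewrite h0 h_le. Qed.

Lemma alpha_bound t : 0 <= t <= T -> \sum_(i < N) hh x i * alpha t i ^+ 2 <= c1 * (hm * B).
Proof.
move=> ht; case: tB => b0 _ _.
have KB : 0 < K2 * B by rewrite mulr_gt0.
apply: le_trans (_ : 2 * hm * (K2 * B) / La ^+ 2 <= _); last first.
  have : 0 <= K2 * (hm * B) / La ^+ 2.
    by rewrite divr_ge0 ?(ltW La2) // ltW // mulr_gt0 // mulr_gt0.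
  rewrite /cA; have -> : 2 * hm * (K2 * B) / La ^+ 2 = 2 * (K2 * (hm * B) / La ^+ 2) by ring.
  have -> : 4 * K2 / La ^+ 2 * (hm * B) = 4 * (K2 * (hm * B) / La ^+ 2) by ring.
  lra.
apply: (@relaxation_bound R N (hh x) hm La nu (K2 * B) T alpha
   (fun t i => drive n sg tqu tpu (tr D t i))) => //.
- exact: rate_gt0.
- exact: legnu_gt0.
- by move=> i s hs; exact: alpha_der.
- by move=> s hs; apply: sum_drive; exact: b0.
- under eq_bigr => i _ do rewrite alpha0 expr_div_n mulrA.
  rewrite -mulr_suml ler_wpM2r ?invr_ge0 ?(ltW La2) //.
  apply: sum_h_le => [i|]; first exact: sqr_ge0.
  by apply: sum_drive; apply: b0; rewrite lexx ltW.
Qed.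

Lemma alpha_diff0 t : 0 <= t <= T ->
  \sum_(i < N) hh x i * (alpha t i - alpha 0 i) ^+ 2 <= 2 * hm * (K2 * B * t ^+ 2) / La ^+ 2.
Proof.
move=> /andP[t0 tT]; case: tB => _ b1 _; move: t0; rewrite le_eqVlt => /predU1P[<-|t0].
  rewrite big1 ?expr0n /= ?mulr0 ?mul0r // => i _; by rewrite subrr expr0n mulr0.
have KB : 0 < K2 * B * t ^+ 2 by rewrite mulr_gt0 ?exprn_gt0 // mulr_gt0.
have z0 : 0 <= (0 : R) <= T by rewrite lexx ltW.
apply: (@relaxation_bound R N (hh x) hm La nu (K2 * B * t ^+ 2) t
   (fun s i => alpha s i - alpha 0 i)
   (fun s i => drive n sg tqu tpu (tsub (tr D s i) (tr D 0 i)))) => //.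
- exact: rate_gt0.
- exact: legnu_gt0.
- move=> i s /andP[s0 st]; have hs : 0 <= s <= T by rewrite s0 (le_trans st).
  rewrite -[X in is_derive _ _ _ X]subr0; apply: (@derB _ (fun s => alpha s i)).
  apply: der_eq (alpha_der i hs); rewrite /dalpha drive_sub alpha0; congr (_ / _).
  by field; rewrite gt_eqF // rate_gt0.
- move=> s /andP[s0 st]; rewrite -mulrA; apply: sum_drive.
  apply: le_trans (b1 s 0 _ z0) _; first by rewrite s0 (le_trans st).
  by rewrite subr0 ler_wpM2l ?(ltW B_gt0) // ler_pXn2r ?nnegrE // (le_trans s0).
- rewrite big1 => [|i _]; last by rewrite subrr expr0n mulr0.
  by rewrite divr_ge0 ?(ltW La2) // mulr_ge0 ?ltW.
- by rewrite (ltW t0) lexx.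
Qed.

Lemma alpha_diff t e : 0 <= t -> 0 <= e -> t + e <= T ->
  \sum_(i < N) hh x i * (alpha (t + e) i - alpha t i) ^+ 2 <= c1 * (hm * B) * e ^+ 2.
Proof.
move=> t0 e0 tT; case: tB => _ b1 _; move: e0; rewrite le_eqVlt => /predU1P[<-|e0].
  rewrite expr0n mulr0 big1 // => i _; by rewrite addr0 subrr expr0n mulr0.
have KB : 0 < 2 * (K2 * B * e ^+ 2) by rewrite mulr_gt0 // mulr_gt0 ?exprn_gt0 // mulr_gt0.
have -> : c1 * (hm * B) * e ^+ 2 = 2 * hm * (2 * (K2 * B * e ^+ 2)) / La ^+ 2 by rewrite /cA; ring.
apply: (@relaxation_bound R N (hh x) hm La nu _ (T - e)
   (fun s i => alpha (s + e) i - alpha s i)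
   (fun s i => drive n sg tqu tpu (tsub (tr D (s + e) i) (tr D s i)))) => //.
- exact: rate_gt0.
- exact: legnu_gt0.
- move=> i s /andP[s0 st].
  have hs : 0 <= s <= T by rewrite s0 (le_trans st) // gerBl ltW.
  have hse : 0 <= s + e <= T by rewrite addr_ge0 ?(ltW e0) //= -lerBrDr.
  have d1 : is_derive s 1 (fun s => alpha (s + e) i) (dalpha (s + e) i).
    exact: (@der_shift _ e (fun s => alpha s i)) (alpha_der i hse).
  apply: der_eq (derB d1 (alpha_der i hs)).
  by rewrite /dalpha drive_sub; ring.
- move=> s /andP[s0 st].
  have hs : 0 <= s <= T by rewrite s0 (le_trans st) // gerBl ltW.
  have hse : 0 <= s + e <= T by rewrite addr_ge0 ?(ltW e0) //= -lerBrDr.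
  apply: le_trans (sum_drive (b1 _ _ hse hs)) _.
  rewrite addrAC subrr add0r mulrA mulr_natl mulr2n lerDl.
  by rewrite mulr_ge0 ?sqr_ge0 // mulr_ge0 // ltW.
- under eq_bigr do rewrite add0r.
  have he : 0 <= e <= T by rewrite ltW //= (le_trans _ tT) // lerDr.
  by apply: le_trans (alpha_diff0 he) _; apply: eq_lew; ring.
- by rewrite t0 lerBrDr.
Qed.

Lemma relax_sqr (a : R) (F A : 'I_N -> R) :
  \sum_(i < N) F i ^+ 2 <= a -> \sum_(i < N) hh x i * A i ^+ 2 <= 4 * (hm * a) / La ^+ 2 -> 
  \sum_(i < N) hh x i * ((F i - La * A i) / nu) ^+ 2 <= 10 * (hm * a) / nu ^+ 2.
Proof.
move=> Fa Aa.
have Fa' := sum_h_le (fun i => sqr_ge0 (F i)) Fa.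
apply: (@le_trans _ _ (\sum_(i < N) (2 * (hh x i * F i ^+ 2) + 2 * La ^+ 2 * (hh x i * A i ^+ 2)) / nu ^+ 2)).
  apply: ler_sum => i _; rewrite expr_div_n [leLHS]mulrA ler_wpM2r ?invr_ge0 ?(ltW nu2) //.
  have -> : 2 * (hh x i * F i ^+ 2) + 2 * La ^+ 2 * (hh x i * A i ^+ 2) =
    hh x i * (2 * F i ^+ 2 + 2 * (- (La * A i)) ^+ 2) by ring.
  by rewrite ler_wpM2l ?(ltW (h0 i)) // sqr2_le.
rewrite -mulr_suml ler_wpM2r ?invr_ge0 ?(ltW nu2) // big_split /= -!mulr_sumr.
have : 2 * La ^+ 2 * \sum_(i < N) hh x i * A i ^+ 2 <= 2 * La ^+ 2 * (4 * (hm * a) / La ^+ 2).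
  by rewrite ler_wpM2l // mulr_ge0 // ltW.
have -> : 2 * La ^+ 2 * (4 * (hm * a) / La ^+ 2) = 8 * (hm * a).
  by field; rewrite gt_eqF // rate_gt0.
by move: Fa'; lra.
Qed.

Lemma alpha_lip s t : 0 <= s <= T -> 0 <= t <= T ->
  \sum_(i < N) hh x i * (hh x i * (alpha s i - alpha t i)) ^+ 2 <= c2 * (hm * B) * (s - t) ^+ 2.
Proof.
wlog st : s t / t <= s.
  move=> H hs ht; have [ts|/ltW st] := leP t s; first exact: H.
  have := H t s st ht hs; rewrite -(opprB s t) sqrrN; apply: le_trans.
  by apply: ler_sum => i _; rewrite -(opprB (alpha s i)) mulrN sqrrN.
move=> hs ht; under eq_bigr do rewrite mulrBr.
apply: (@mean_value_sqr R N (hh x) (fun r i => hh x i * alpha r i)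
   (fun r i => (drive n sg tqu tpu (tr D r i) - La * alpha r i) / nu)) => //.
- by move=> i; exact: ltW.
- move=> i r /andP[r1 r2]; have hr : 0 <= r <= T.
    by case/andP: hs => _ sT; case/andP: ht => t0 _; rewrite (le_trans t0) // (le_trans r2).
  apply: der_eq (derZ (hh x i) (alpha_der i hr)); rewrite /dalpha.
  by field; rewrite !gt_eqF ?legnu_gt0.
- move=> r /andP[r1 r2]; have hr : 0 <= r <= T.
    by case/andP: hs => _ sT; case/andP: ht => t0 _; rewrite (le_trans t0) // (le_trans r2).
  have -> : c2 * (hm * B) = 10 * (hm * (K2 * B)) / nu ^+ 2 by rewrite /cL; ring.
  case: tB => b0 _ _; apply: relax_sqr; first exact: (sum_drive (b0 r hr)).
  by apply: le_trans (alpha_bound hr) _; rewrite /cA; apply: eq_lew; ring.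
Qed.

Lemma alpha_lip_diff s t e : 0 <= s -> 0 <= t -> 0 <= e -> s + e <= T -> t + e <= T ->
  \sum_(i < N) hh x i * (hh x i * (alpha (s + e) i - alpha s i - (alpha (t + e) i - alpha t i))) ^+ 2
    <= c2 * (hm * B) * e ^+ 2 * (s - t) ^+ 2.
Proof.
wlog st : s t / t <= s.
  move=> H s0 t0 e0 sT tT; have [ts|/ltW st] := leP t s; first exact: H.
  have := H t s st t0 s0 e0 tT sT; rewrite -(opprB s t) sqrrN; apply: le_trans.
  by apply: ler_sum => i _; rewrite -opprB mulrN sqrrN.
move=> s0 t0 e0 sT tT; under eq_bigr do rewrite mulrBr.
apply: (@mean_value_sqr R N (hh x) (fun r i => hh x i * (alpha (r + e) i - alpha r i))
   (fun r i => (drive n sg tqu tpu (tsub (tr D (r + e) i) (tr D r i))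
      - La * (alpha (r + e) i - alpha r i)) / nu)) => //.
- by move=> i; exact: ltW.
- move=> i r /andP[r1 r2]; have r0 : 0 <= r by exact: le_trans r1.
  have reT : r + e <= T by apply: le_trans sT; rewrite lerD2r.
  have hr : 0 <= r <= T by rewrite r0 (le_trans _ reT) // lerDl.
  have hre : 0 <= r + e <= T by rewrite addr_ge0.
  have d1 : is_derive r 1 (fun s => alpha (s + e) i) (dalpha (r + e) i).
    exact: (@der_shift _ e (fun s => alpha s i)) (alpha_der i hre).
  apply: der_eq (derZ (hh x i) (derB d1 (alpha_der i hr))); rewrite /dalpha drive_sub.
  by field; rewrite !gt_eqF ?legnu_gt0.
- move=> r /andP[r1 r2]; have r0 : 0 <= r by exact: le_trans r1.
  have reT : r + e <= T by apply: le_trans sT; rewrite lerD2r.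
  have hr : 0 <= r <= T by rewrite r0 (le_trans _ reT) // lerDl.
  have hre : 0 <= r + e <= T by rewrite addr_ge0.
  have -> : c2 * (hm * B) * e ^+ 2 = 10 * (hm * (K2 * (B * e ^+ 2))) / nu ^+ 2 by rewrite /cL; ring.
  case: tB => _ b1 _; apply: relax_sqr.
    apply: sum_drive; apply: le_trans (b1 _ _ hre hr) _.
    by rewrite addrAC subrr add0r.
  by apply: le_trans (alpha_diff r0 e0 reT) _; rewrite /cA; apply: eq_lew; ring.
Qed.

(** At time 0 the stationary problem is read as the same system with [ud] in place
    of [gd]; the gauge is at rest there. *)
Definition EE t (i : 'I_N) : errstate R :=
  mk_err n sg tqu tpu (ud D t i) (qd D t i) (pd D t i)
    (if t == 0 then ud D t i else gd D t i) (tr D t i) (alpha t i) (dalpha t i)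
    (Ud D t i) (Ud D t i.+1) (Qd D t i) (Qd D t i.+1) (Pd D t i) (Pd D t i.+1).

Lemma EE_sys t : 0 <= t <= T -> error_sys n sg tqu tpu x (EE t).
Proof.
case: sol => eqs bd _ ht; split; last first.
  by exists (Ud D t), (Qd D t), (Pd D t); split=> //; exact: bd.
move=> i; apply: mk_err_eqs => //; first exact: eqs.
rewrite gle_drive /dalpha; field.
by rewrite !gt_eqF ?legnu_gt0.
Qed.

Definition dds (a : 'I_N -> traces R) (c : 'I_N -> R) (i : 'I_N) := K * (trabs (a i) + `|c i|).

Lemma dds_sum (a : 'I_N -> traces R) c b1 b2 : \sum_(i < N) trsq (a i) <= b1 ->
  \sum_(i < N) hh x i * c i ^+ 2 <= b2 ->
  wsum x (dds a c) <= K ^+ 2 * (12 * (hm * b1) + 2 * b2).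
Proof.
move=> ab cb; have ab' := sum_h_le (fun i => trsq_ge0 (a i)) ab.
apply: (@le_trans _ _ (\sum_(i < N) K ^+ 2 * (12 * (hh x i * trsq (a i)) + 2 * (hh x i * c i ^+ 2)))).
  apply: ler_sum => i _; rewrite /dds exprMn mulrCA ler_wpM2l ?sqr_ge0 //.
  have -> : 12 * (hh x i * trsq (a i)) + 2 * (hh x i * c i ^+ 2) =
    hh x i * (2 * (6 * trsq (a i)) + 2 * c i ^+ 2) by ring.
  rewrite ler_wpM2l ?(ltW (h0 i)) //; apply: le_trans (sqr2_le _ _) _.
  by rewrite real_normK ?num_real // lerD2r ler_wpM2l // trabs_sqr.
rewrite -mulr_sumr ler_wpM2l ?sqr_ge0 // big_split /= -!mulr_sumr.
by rewrite lerD // ler_wpM2l.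
Qed.

Lemma EE_small t i : small (dds (tr D t) (alpha t) i) (EE t i).
Proof. by have [] := gauge_bound n tqu tpu sg_gt0 (tr D t i) (alpha t i). Qed.

Lemma EE_small_sub s t i :
  small (dds (fun i => tsub (tr D s i) (tr D t i)) (fun i => alpha s i - alpha t i) i)
    (esub (EE s i) (EE t i)).
Proof.
have [] := gauge_bound n tqu tpu sg_gt0 (tsub (tr D s i) (tr D t i)) (alpha s i - alpha t i).
by rewrite gbe_sub gga_sub gle_sub.
Qed.

Lemma EE_der t i : 0 <= t <= T -> pcvg (F := within `[0, T]%classic t^')
  (fun s => (s - t)^-1 *: (eU (EE s i) - eU (EE t i))) (gd D t i + dalpha t i *: L).
Proof.
case: sol => _ _ der ht.
have : pcvg (F := within `[0, T]%classic t^')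
   (fun s => (s - t)^-1 *: (ud D s i - ud D t i) + ((alpha s i - alpha t i) / (s - t)) *: L)
   (gd D t i + dalpha t i *: L).
  apply: pcvgD; first exact: der.
  apply: pcvgZ; last exact: pcvg_cst.
  apply: cvg_trans (der_quotient (alpha_der i ht)); apply: cvg_app; exact: cvg_within.
apply: pcvg_ext => s; rewrite /EE /=.
have -> : ud D s i + alpha s i *: L - (ud D t i + alpha t i *: L) =
   (ud D s i - ud D t i) + (alpha s i - alpha t i) *: L.
  by rewrite scalerBl opprD addrACA.
by rewrite scalerDr scalerA mulrC.
Qed.

Let D0 := hm * B.
Let D0_gt0 : 0 < D0. Proof. exact: mulr_gt0. Qed.

Definition cS := K ^+ 2 * (12 + 2 * c1).
Lemma cS_gt0 : 0 < cS.
Proof.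
rewrite mulr_gt0 ?exprn_gt0 ?(lt_le_trans ltr01 gK_ge1) // ltr_wpDr //.
by rewrite mulr_ge0 // c1_ge0.
Qed.

Lemma small0 t : 0 <= t <= T -> wsum x (dds (tr D t) (alpha t)) <= cS * D0.
Proof.
move=> ht; case: tB => b0 _ _; apply: le_trans (dds_sum (b0 t ht) (alpha_bound ht)) _.
by apply: eq_lew; rewrite /cS /D0; ring.
Qed.

Lemma small1 t e : 0 <= t -> 0 <= e -> t + e <= T ->
  wsum x (dds (fun i => tsub (tr D (t + e) i) (tr D t i)) (fun i => alpha (t + e) i - alpha t i))
    <= cS * D0 * e ^+ 2.
Proof.
move=> t0 e0 te; case: tB => _ b1 _.
have ht : 0 <= t <= T by rewrite t0 (le_trans _ te) // lerDl.
have hte : 0 <= t + e <= T by rewrite addr_ge0.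
apply: le_trans (dds_sum (b1 _ _ hte ht) (alpha_diff t0 e0 te)) _.
by apply: eq_lew; rewrite /cS /D0; ring.
Qed.

Definition cB := 3 * (1 + tqu ^+ 2) * (1 + c2).
Lemma cB_ge0 : 0 <= cB.
Proof. by rewrite /cB !mulr_ge0 ?addr_ge0 ?sqr_ge0 ?c2_ge0. Qed.

Lemma gbe_lip (a : 'I_N -> traces R) (c : 'I_N -> R) b :
  \sum_(i < N) hh x i ^+ 2 * (tul (a i) ^+ 2 + tql (a i) ^+ 2) <= B * b ->
  \sum_(i < N) hh x i * (hh x i * c i) ^+ 2 <= c2 * D0 * b ->
  \sum_(i < N) hh x i * (hh x i * gbe n tqu (a i) (c i)) ^+ 2 <= cB * D0 * b.
Proof.
move=> ab cb.
have ab' : \sum_(i < N) hh x i * (hh x i ^+ 2 * (tul (a i) ^+ 2 + tql (a i) ^+ 2)) <= hm * (B * b).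
  apply: sum_h_le => // i; apply: mulr_ge0; first exact: sqr_ge0.
  by rewrite addr_ge0 ?sqr_ge0.
have k0 : 0 <= 3 * (1 + tqu ^+ 2) by rewrite mulr_ge0 // addr_ge0 ?sqr_ge0.
apply: (@le_trans _ _ (3 * (1 + tqu ^+ 2) * (\sum_(i < N) (hh x i * (hh x i ^+ 2 * (tul (a i) ^+ 2 + tql (a i) ^+ 2)) + hh x i * (hh x i * c i) ^+ 2)))).
  rewrite mulr_sumr; apply: ler_sum => i _.
  have -> : 3 * (1 + tqu ^+ 2) * (hh x i * (hh x i ^+ 2 * (tul (a i) ^+ 2 + tql (a i) ^+ 2)) +
      hh x i * (hh x i * c i) ^+ 2) = hh x i * (3 * (1 + tqu ^+ 2) *
      (hh x i ^+ 2 * (tul (a i) ^+ 2 + tql (a i) ^+ 2) + (hh x i * c i) ^+ 2)) by ring.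
  rewrite ler_wpM2l ?(ltW (h0 i)) //.
  have := signE (R := R) n; rewrite /gbe; move: ((-1) ^+ n.+1) => e ee.
  have -> : hh x i * (e * tql (a i) + tqu * (e * tul (a i) - c i)) =
     e * (hh x i * tql (a i)) + tqu * (e * (hh x i * tul (a i))) + - (tqu * (hh x i * c i)) by ring.
  apply: le_trans (sqr3_le _ _ _) _; rewrite sqrrN !exprMn [e ^+ 2]expr2 ee !mul1r.
  rewrite -mulrA ler_wpM2l //.
  have := mulr_ge0 (sqr_ge0 tqu) (mulr_ge0 (sqr_ge0 (hh x i)) (sqr_ge0 (tql (a i)))).
  have := mulr_ge0 (sqr_ge0 (hh x i)) (sqr_ge0 (tul (a i))).
  have := mulr_ge0 (sqr_ge0 (hh x i)) (sqr_ge0 (c i)).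
  by lra.
have -> : cB * D0 * b = 3 * (1 + tqu ^+ 2) * (hm * (B * b) + c2 * D0 * b).
  by rewrite /cB /D0; ring.
by rewrite ler_wpM2l // big_split /= lerD.
Qed.

Lemma lip0 s t : 0 <= s <= T -> 0 <= t <= T ->
  \sum_(i < N) hh x i * (hh x i * (ebe (EE s i) - ebe (EE t i))) ^+ 2 <= cB * D0 * (s - t) ^+ 2.
Proof.
move=> hs ht; under eq_bigr do rewrite -gbe_sub; apply: gbe_lip; last exact: alpha_lip.
case: tB => _ b1 _; apply: le_trans (b1 s t hs ht); apply: ler_sum => i _.
apply: (@le_trans _ _ (1 * (tul (tsub (tr D s i) (tr D t i)) ^+ 2 + tql (tsub (tr D s i) (tr D t i)) ^+ 2))).
  rewrite ler_wpM2r ?addr_ge0 ?sqr_ge0 //.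
  case: gr => _ x1 _; rewrite exprn_ile1 // ltW // h0.
rewrite mul1r /trsq; move: (tul _) (tur _) (tql _) (tqr _) (tpl _) (tpr _) => y1 y2 y3 y4 y5 y6.
have := sqr_ge0 y2; have := sqr_ge0 y4; have := sqr_ge0 y5; have := sqr_ge0 y6.
by lra.
Qed.

Lemma lip1 s t e : 0 <= s -> 0 <= t -> 0 <= e -> s + e <= T -> t + e <= T ->
  \sum_(i < N) hh x i * (hh x i * (ebe (esub (EE (s + e) i) (EE s i))
      - ebe (esub (EE (t + e) i) (EE t i)))) ^+ 2 <= cB * D0 * e ^+ 2 * (s - t) ^+ 2.
Proof.
move=> s0 t0 e0 sT tT.
under eq_bigr do rewrite /esub /= -!gbe_sub.
rewrite -mulrA; apply: gbe_lip; last first.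
  by apply: le_trans (alpha_lip_diff s0 t0 e0 sT tT) _; rewrite /D0; apply: eq_lew; ring.
case: tB => _ _ b2; apply: le_trans (b2 s t e s0 t0 e0 sT tT) _.
by apply: eq_lew; ring.
Qed.

Definition cE := s2val (cid2 (evolution n sg_gt0 tpu_le l_gt0)).
Definition cS0 := s2val (cid2 (stationary_bound n sg_gt0 tpu_le l_gt0)).
Definition cSy := s2val (cid2 (system_bound n sg_gt0 tpu_le l_gt0)).
Lemma cE_ge0 : 0 <= cE.
Proof. exact: (s2valP (cid2 (evolution n sg_gt0 tpu_le l_gt0))). Qed.
Lemma cS0_ge0 : 0 <= cS0.
Proof. exact: (s2valP (cid2 (stationary_bound n sg_gt0 tpu_le l_gt0))). Qed.
Lemma cSy_ge0 : 0 <= cSy.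
Proof. exact: (s2valP (cid2 (system_bound n sg_gt0 tpu_le l_gt0))). Qed.

Let z0 : 0 <= (0 : R) <= T. Proof. by rewrite lexx ltW. Qed.

Lemma wnorm_alpha (t : R) : 0 <= t <= T ->
  wnorm x (fun i => alpha t i *: L) <= nu * (c1 * D0).
Proof.
by move=> ht; rewrite wnorm_leg ler_wpM2l ?(ltW (legnu_gt0 _)) // alpha_bound.
Qed.

Definition c5 := cS0 * (nu * c1 + cS).
Lemma initial_bound : wnorm x (fun i => eU (EE 0 i)) <= c5 * D0.
Proof.
have : wnorm x (fun i => eU (EE 0 i)) <= cS0 *
   (wnorm x (fun i => alpha 0 i *: L) + wsum x (dds (tr D 0) (alpha 0))).
  apply: (s2valP' (cid2 (stationary_bound n sg_gt0 tpu_le l_gt0)) N x (EE 0)) => //.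
  - exact: EE_sys.
  - by move=> i; exact: EE_small.
  move=> i; rewrite /EE /= eqxx addrK /dalpha alpha0.
  have -> : drive n sg tqu tpu (tr D 0 i) - La * (drive n sg tqu tpu (tr D 0 i) / La) = 0.
    by field; rewrite gt_eqF // rate_gt0.
  by rewrite mul0r scale0r addr0.
move=> /le_trans; apply; rewrite /c5 -mulrA ler_wpM2l ?cS0_ge0 // mulrDl lerD //.
  by rewrite -mulrA; exact: wnorm_alpha.
exact: small0.
Qed.

Definition c6 := 2 * (c5 + nu * c1).
Lemma c5_ge0 : 0 <= c5.
Proof.
rewrite mulr_ge0 ?cS0_ge0 // addr_ge0 ?(ltW cS_gt0) // mulr_ge0 ?c1_ge0 // ltW //.
exact: legnu_gt0.
Qed.
Lemma nuc1_ge0 : 0 <= nu * c1.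
Proof. by rewrite mulr_ge0 ?c1_ge0 // ltW // legnu_gt0. Qed.
Lemma c6_ge0 : 0 <= c6.
Proof. by rewrite mulr_ge0 // addr_ge0 ?c5_ge0 // nuc1_ge0. Qed.
Lemma initial_rate : wnorm x (fun i => eG (EE 0 i)) <= c6 * D0.
Proof.
have -> : wnorm x (fun i => eG (EE 0 i)) = wnorm x (fun i => eU (EE 0 i) - alpha 0 i *: L).
  apply: eq_bigr => i _; congr (_ * normp _ ^+ 2); rewrite /EE /= eqxx addrK /dalpha alpha0.
  have -> : drive n sg tqu tpu (tr D 0 i) - La * (drive n sg tqu tpu (tr D 0 i) / La) = 0.
    by field; rewrite gt_eqF // rate_gt0.
  by rewrite mul0r scale0r addr0.
apply: le_trans (wnorm_sub _ _ gr) _.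
by have := initial_bound; have := wnorm_alpha z0; rewrite /c6; lra.
Qed.

Lemma eU_cont t i : 0 <= t <= T -> pcvg (F := within `[0, T]%classic (nbhs t))
  (fun s => eU (EE s i)) (eU (EE t i)).
Proof.
move=> ht; apply: pcvg_dnbhs.
have : pcvg (F := within `[0, T]%classic t^')
  (fun s => eU (EE t i) + (s - t) *: ((s - t)^-1 *: (eU (EE s i) - eU (EE t i)))) (eU (EE t i) + 0 *: (gd D t i + dalpha t i *: L)).
  apply: pcvgD; first exact: pcvg_cst.
  apply: pcvgZ; last exact: EE_der.
  apply/cvgrPdist_lt => e e0; apply/within_dnbhsP; exists e => // z tz _ _.
  by rewrite sub0r normrN distrC.
rewrite scale0r addr0; apply: pcvg_near => s st.
by rewrite scalerA divff ?subr_eq0 // scale1r addrC subrK.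
Qed.

(** [evolution] on the interval [0, t] with th = t: the difference with the initial
    state is of order t, since its time derivative is bounded at time 0 by
    [initial_rate]. *)
Lemma window_bound t : 0 <= t <= T ->
  wnorm x (fun i => eU (EE t i) - eU (EE 0 i)) <=
  cE * (cS + c6 + cB) * expR (cE * (T + 1)) * D0 * t ^+ 2.
Proof.
move=> /andP[t0 tT]; move: t0; rewrite le_eqVlt => /predU1P[<-|t0].
  rewrite expr0n mulr0 /wnorm big1 // => i _.
  by rewrite subrr normp0 expr0n mulr0.
have hsT s : 0 <= s <= t -> 0 <= s <= T by move=> /andP[-> st]; rewrite (le_trans st).
have : wnorm x (fun i => eU (esub (EE t i) (EE 0 i))) <=
   cE * (wnorm x (fun i => eU (esub (EE 0 i) (EE 0 i))) + cS * D0 * t ^+ 2 +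
     t ^+ 2 * (c6 * D0 + cB * D0)) * expR (cE * (1 + t^-1) * t).
  apply: (s2valP' (cid2 (evolution n sg_gt0 tpu_le l_gt0)) N x (fun s i => esub (EE s i) (EE 0 i))
     (fun s => dds (fun i => tsub (tr D s i) (tr D 0 i)) (fun i => alpha s i - alpha 0 i))
     (fun i => eG (EE 0 i))) => //.
  - by rewrite mulr_gt0 ?exprn_gt0 // mulr_gt0 // cS_gt0.
  - by rewrite mulr_ge0 ?cB_ge0 // ltW.
  - move=> s /andP[s0 st]; split; first by move=> i; exact: EE_small_sub.
    have := small1 (lexx 0) s0; rewrite add0r => /(_ (le_trans st tT)) /le_trans; apply.
    rewrite ler_wpM2l //; first by rewrite mulr_ge0 // ltW // cS_gt0.
    by rewrite ler_pXn2r ?nnegrE // (le_trans s0).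
  - move=> s /andP[s0 st]; apply: error_sys_sub; apply: EE_sys => //.
    by apply: hsT; rewrite !ltW.
  - move=> s i /andP[s0 st]; have hs : 0 <= s <= T by apply: hsT; rewrite !ltW.
    have -> : eG (esub (EE s i) (EE 0 i)) + eG (EE 0 i) = gd D s i + dalpha s i *: L.
      by rewrite /esub /= subrK gt_eqF.
    have sf : s^'+ `=>` within `[0, T]%classic s^'.
      by apply: right_within; rewrite (ltW s0) (lt_le_trans st).
    apply: pcvg_ext (pcvg_filter sf (EE_der i hs)) => r.
    by rewrite /esub /= opprB addrA subrK.
  - move=> s i hs; have sf : within `[0, t]%classic (nbhs s) `=>` within `[0, T]%classic (nbhs s).
      move=> P; rewrite /within /=; apply: filterS => z Pz hz; apply: Pz; move: hz.
      by rewrite /= !in_itv /=; exact: hsT.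
    exact: pcvgB (pcvg_filter sf (eU_cont i (hsT _ hs))) (pcvg_cst _).
  - move=> s r hs hr; apply: le_trans (lip0 (hsT _ hs) (hsT _ hr)).
    by apply: ler_sum => i _; rewrite /esub /= opprB addrA subrK.
  - exact: initial_rate.
  - by rewrite (ltW t0) lexx.
have -> : wnorm x (fun i => eU (esub (EE 0 i) (EE 0 i))) = 0.
  by rewrite /wnorm big1 // => i _; rewrite /= subrr normp0 expr0n mulr0.
move=> /le_trans; apply; rewrite add0r.
have -> : cE * (cS * D0 * t ^+ 2 + t ^+ 2 * (c6 * D0 + cB * D0)) =
  cE * (cS + c6 + cB) * D0 * t ^+ 2 by ring.
have -> : cE * (cS + c6 + cB) * expR (cE * (T + 1)) * D0 * t ^+ 2 =
   cE * (cS + c6 + cB) * D0 * t ^+ 2 * expR (cE * (T + 1)) by ring.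
have c60 := c6_ge0.
apply: ler_wpM2l.
  rewrite mulr_ge0 ?sqr_ge0 // mulr_ge0 ?(ltW D0_gt0) // mulr_ge0 ?cE_ge0 //.
  by rewrite !addr_ge0 ?cB_ge0 // ltW // cS_gt0.
rewrite ler_expR -mulrA ler_wpM2l ?cE_ge0 // mulrDl mul1r mulVf ?gt_eqF //.
by rewrite lerD2r.
Qed.

Definition c7 := cE * (cS + c6 + cB) * expR (cE * (T + 1)).
Definition c8 := cE * (c7 + cS + cB) * expR (cE * 2 * T).
Lemma c7_ge0 : 0 <= c7.
Proof.
have c60 := c6_ge0.
by rewrite mulr_ge0 ?expR_ge0 // mulr_ge0 ?cE_ge0 // !addr_ge0 ?cB_ge0 // ltW // cS_gt0.
Qed.
Lemma c8_ge0 : 0 <= c8.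
Proof.
by rewrite mulr_ge0 ?expR_ge0 // mulr_ge0 ?cE_ge0 // !addr_ge0 ?cB_ge0 ?c7_ge0 // ltW // cS_gt0.
Qed.

(** Time differences solve the same equations with the differences of the data,
    and their initial value has just been estimated. *)
Lemma difference_bound t e : 0 <= t -> 0 < e -> t + e <= T ->
  wnorm x (fun i => eU (EE (t + e) i) - eU (EE t i)) <= c8 * D0 * e ^+ 2.
Proof.
move=> t0 e0 tT.
have hs1 s : 0 <= s <= T - e -> 0 <= s <= T.
  by move=> /andP[-> st]; rewrite (le_trans st) // gerBl ltW.
have hs2 s : 0 <= s <= T - e -> 0 <= s + e <= T.
  by move=> /andP[s0 st]; rewrite addr_ge0 ?(ltW e0) //= -lerBrDr.
have : wnorm x (fun i => eU (esub (EE (t + e) i) (EE t i))) <=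
   cE * (wnorm x (fun i => eU (esub (EE (0 + e) i) (EE 0 i))) + cS * D0 * e ^+ 2 +
     1 ^+ 2 * (0 + cB * D0 * e ^+ 2)) * expR (cE * (1 + 1^-1) * (T - e)).
  apply: (s2valP' (cid2 (evolution n sg_gt0 tpu_le l_gt0)) N x
     (fun s i => esub (EE (s + e) i) (EE s i))
     (fun s => dds (fun i => tsub (tr D (s + e) i) (tr D s i)) (fun i => alpha (s + e) i - alpha s i))
     (fun=> 0)) => //.
  - by rewrite mulr_gt0 ?exprn_gt0 // mulr_gt0 // cS_gt0.
  - by rewrite mulr_ge0 ?sqr_ge0 // mulr_ge0 ?cB_ge0 // ltW.
  - move=> s /andP[s0 st]; split; first by move=> i; exact: EE_small_sub.
    by apply: small1 => //; [exact: ltW|rewrite -lerBrDr].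
  - move=> s /andP[s0 st]; have hs : 0 <= s <= T - e by rewrite !ltW.
    by apply: error_sys_sub; apply: EE_sys; [exact: hs2|exact: hs1].
  - move=> s i /andP[s0 st]; have hs : 0 <= s <= T - e by rewrite !ltW.
    have -> : eG (esub (EE (s + e) i) (EE s i)) + 0 =
      (gd D (s + e) i + dalpha (s + e) i *: L) - (gd D s i + dalpha s i *: L).
      by rewrite /esub /= addr0 !gt_eqF // addr_gt0.
    have sf1 : s^'+ `=>` within `[0, T]%classic s^'.
      by apply: right_within; rewrite (ltW s0) (lt_le_trans st) // gerBl ltW.
    have sf2 : r + e @[r --> s^'+] `=>` within `[0, T]%classic (s + e)^'.
      by apply: shift_within; rewrite ?(ltW s0) ?(ltW e0) // -ltrBrDr.
    apply: pcvg_ext (pcvgB (pcvg_comp sf2 (EE_der i (hs2 _ hs))) (pcvg_filter sf1 (EE_der i (hs1 _ hs)))) => r.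
    rewrite /comp (_ : r + e - (s + e) = r - s); last by ring.
    have eUs E F : eU (esub E F) = eU E - eU F by [].
    rewrite -scalerBr !eUs; congr (_ *: _).
    by move: (eU _) (eU _) (eU _) (eU _) => a1 a2 a3 a4; ring.
  - move=> s i hs; apply: pcvgB.
      exact: (pcvg_comp (@shift_within_nbhs R T s e (ltW e0)) (eU_cont i (hs2 s hs))).
    have sf : within `[0, T - e]%classic (nbhs s) `=>` within `[0, T]%classic (nbhs s).
      move=> P; rewrite /within /=; apply: filterS => z Pz hz; apply: Pz; move: hz.
      by rewrite /= !in_itv /=; exact: hs1.
    exact: pcvg_filter sf (eU_cont i (hs1 s hs)).
  - move=> s r /andP[s0 st] /andP[r0 rt].
    by apply: lip1; rewrite ?(ltW e0) // -lerBrDr.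
  - by rewrite /wnorm big1 // => i _; rewrite normp0 expr0n mulr0.
  - by rewrite t0 lerBrDr.
have he : 0 <= e <= T by rewrite ltW //= (le_trans _ tT) // lerDr.
move=> /le_trans; apply; rewrite add0r; have := window_bound he.
rewrite -/c7 => w0.
apply: (@le_trans _ _ (cE * ((c7 + cS + cB) * D0 * e ^+ 2) * expR (cE * 2 * T))).
  have X0 : 0 <= (c7 + cS + cB) * D0 * e ^+ 2.
    rewrite mulr_ge0 ?sqr_ge0 // mulr_ge0 ?(ltW D0_gt0) //.
    by rewrite !addr_ge0 ?cB_ge0 ?c7_ge0 // ltW // cS_gt0.
  apply: ler_pM; rewrite ?expR_ge0 //.
  - rewrite mulr_ge0 ?cE_ge0 // !addr_ge0 ?wnorm_ge0 //.
    + by apply: wnorm_ge0; exact: gr.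
    + by rewrite mulr_ge0 ?sqr_ge0 // mulr_ge0 // ltW // cS_gt0.
    + by rewrite expr1n mul1r add0r mulr_ge0 ?sqr_ge0 // mulr_ge0 ?cB_ge0 // ltW.
  - rewrite ler_wpM2l ?cE_ge0 // expr1n mul1r add0r.
    by move: w0; rewrite /esub /=; lra.
  - rewrite ler_expR invr1; have -> : 1 + 1 = 2 :> R by ring.
    by rewrite ler_wpM2l ?mulr_ge0 ?cE_ge0 // gerBl ltW.
by apply: eq_lew; rewrite /c8; ring.
Qed.

Lemma difference_bound' s t : 0 <= s <= T -> 0 <= t <= T ->
  wnorm x (fun i => eU (EE s i) - eU (EE t i)) <= c8 * D0 * (s - t) ^+ 2.
Proof.
wlog st : s t / t <= s.
  move=> H hs ht; have [ts|/ltW st] := leP t s; first exact: H.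
  have := H t s st ht hs; rewrite -(opprB s t) sqrrN; apply: le_trans.
  by apply: ler_sum => i _; rewrite -opprB normpN.
move=> /andP[s0 sT] /andP[t0 tT]; move: st; rewrite le_eqVlt => /predU1P[->|st].
  by rewrite subrr expr0n mulr0 /wnorm big1 // => i _; rewrite subrr normp0 expr0n mulr0.
have e0 : 0 < s - t by rewrite subr_gt0.
have := difference_bound t0 e0; rewrite (addrC t) subrK; exact.
Qed.

Definition c9 := 2 * (c8 + nu * c1).
Lemma ud_diff s t : 0 <= s <= T -> 0 <= t <= T ->
  wnorm x (fun i => ud D s i - ud D t i) <= c9 * D0 * (s - t) ^+ 2.
Proof.
wlog st : s t / t <= s.
  move=> H hs ht; have [ts|/ltW st] := leP t s; first exact: H.
  have := H t s st ht hs; rewrite -(opprB s t) sqrrN; apply: le_trans.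
  by apply: ler_sum => i _; rewrite -opprB normpN.
move=> hs ht; have e0 : 0 <= s - t by rewrite subr_ge0.
have -> : wnorm x (fun i => ud D s i - ud D t i) =
    wnorm x (fun i => (eU (EE s i) - eU (EE t i)) - (alpha s i - alpha t i) *: L).
  by apply: eq_bigr => i _; rewrite /EE /= scalerBl; congr (_ * normp _ ^+ 2); ring.
apply: le_trans (wnorm_sub _ _ gr) _; rewrite wnorm_leg.
have := difference_bound' hs ht.
have t0 : 0 <= t by case/andP: ht.
have sT : s <= T by case/andP: hs.
have := alpha_diff t0 e0; rewrite (addrC t) subrK => /(_ sT) h1 h2.
have h3 : nu * (\sum_(i < N) hh x i * (alpha s i - alpha t i) ^+ 2) <= nu * (c1 * D0 * (s - t) ^+ 2).
  by rewrite ler_wpM2l // ltW // legnu_gt0.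
by rewrite /c9; lra.
Qed.

Definition c10 := 2 * (c8 * T ^+ 2 + c5).
Lemma eU_bound t : 0 <= t <= T -> wnorm x (fun i => eU (EE t i)) <= c10 * D0.
Proof.
move=> ht; have -> : wnorm x (fun i => eU (EE t i)) =
    wnorm x (fun i => (eU (EE t i) - eU (EE 0 i)) + eU (EE 0 i)).
  by apply: eq_bigr => i _; rewrite subrK.
apply: le_trans (wnorm_add _ _ gr) _.
have := initial_bound; have := difference_bound' ht z0; rewrite subr0.
have : c8 * D0 * t ^+ 2 <= c8 * D0 * T ^+ 2.
  rewrite (ler_wpM2l (mulr_ge0 c8_ge0 (ltW D0_gt0))) //.
  by case/andP: ht => t0 tT; rewrite ler_pXn2r ?nnegrE // ltW.
by rewrite /c10; lra.
Qed.

Lemma eG_bound t : 0 <= t <= T -> wnorm x (fun i => eG (EE t i)) <= (c6 + c8) * D0.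
Proof.
move=> ht; have [->|t0] := eqVneq t 0.
  apply: le_trans initial_rate _; rewrite ler_wpM2r ?(ltW D0_gt0) // lerDl c8_ge0 //.
have tp : 0 < t by rewrite lt_neqAle eq_sym t0; case/andP: ht.
have -> : wnorm x (fun i => eG (EE t i)) = wnorm x (fun i => gd D t i + dalpha t i *: L).
  by apply: eq_bigr => i _; rewrite /EE /= (negbTE t0).
have cv : wnorm x (fun i => (s - t)^-1 *: (eU (EE s i) - eU (EE t i))) @[s --> t^'-] -->
    wnorm x (fun i => gd D t i + dalpha t i *: L).
  apply: wnorm_cvg => i; apply: pcvg_filter (EE_der i ht); apply: left_within.
  by rewrite tp; case/andP: ht.
apply: (@le_trans _ _ (c8 * D0)); last first.
  by rewrite ler_wpM2r ?(ltW D0_gt0) // lerDr c6_ge0.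
apply: (cvgr_to_le cv); near=> s.
have st : s < t by near: s; exact: nbhs_left_lt.
have s0 : 0 < s by near: s; exact: nbhs_left_gt.
have hs : 0 <= s <= T by rewrite (ltW s0) (le_trans (ltW st)) //; case/andP: ht.
rewrite wnorm_scale exprVn mulrC ler_pdivrMr; first exact: difference_bound'.
by rewrite exprn_even_gt0 //= subr_eq0 lt_eqF.
Unshelve. all: by end_near. Qed.

Definition c11 := cSy * (c6 + c8 + c10 + cS).
Lemma eQP_bound t : 0 <= t <= T -> x N - x 0 = l ->
  wnorm x (fun i => eQ (EE t i)) + wnorm x (fun i => eP (EE t i)) <= c11 * D0.
Proof.
move=> ht xN; have := s2valP' (cid2 (system_bound n sg_gt0 tpu_le l_gt0)) N x (EE t)
  (dds (tr D t) (alpha t)) gr xN (EE_sys ht) (EE_small t).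
rewrite -/cSy => /le_trans; apply; rewrite /c11 -mulrA ler_wpM2l ?cSy_ge0 //.
by have := eG_bound ht; have := eU_bound ht; have := small0 ht; lra.
Qed.

Lemma gauge_sum (t : R) (g : 'I_N -> R) : 0 <= t <= T ->
  (forall i, `|g i| <= dds (tr D t) (alpha t) i) ->
  wnorm x (fun i => g i *: L) <= nu * cS * D0.
Proof.
move=> ht h; rewrite wnorm_leg -mulrA ler_wpM2l ?(ltW (legnu_gt0 _)) //.
apply: le_trans (small0 ht); apply: ler_sum => i _; rewrite ler_wpM2l ?(ltW (h0 i)) //.
exact: ler_abs_sqr.
Qed.

Definition c12 := 2 * (c10 + nu * c1) + 2 * (c11 + nu * cS + nu * cS).
Lemma data_bound t : 0 <= t <= T -> x N - x 0 = l ->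
  wnorm x (ud D t) + wnorm x (qd D t) + wnorm x (pd D t) <= c12 * D0.
Proof.
move=> ht xN.
have -> : wnorm x (ud D t) = wnorm x (fun i => eU (EE t i) - alpha t i *: L).
  by apply: eq_bigr => i _; rewrite /EE /= addrK.
have -> : wnorm x (qd D t) = wnorm x (fun i => eQ (EE t i) - ebe (EE t i) *: L).
  by apply: eq_bigr => i _; rewrite /EE /= addrK.
have -> : wnorm x (pd D t) = wnorm x (fun i => eP (EE t i) - ega (EE t i) *: L).
  by apply: eq_bigr => i _; rewrite /EE /= addrK.
have := wnorm_sub (fun i => eU (EE t i)) (fun i => alpha t i *: L) gr.
have := wnorm_sub (fun i => eQ (EE t i)) (fun i => ebe (EE t i) *: L) gr.
have := wnorm_sub (fun i => eP (EE t i)) (fun i => ega (EE t i) *: L) gr.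
have := eU_bound ht; have := eQP_bound ht xN; have := wnorm_alpha ht.
have sm1 i : `|ebe (EE t i)| <= dds (tr D t) (alpha t) i by case: (EE_small t i).
have sm2 i : `|ega (EE t i)| <= dds (tr D t) (alpha t) i by case: (EE_small t i).
have := gauge_sum ht sm1; have := gauge_sum ht sm2.
by rewrite /c12; lra.
Qed.

End Data.

(** The difference quotients bound [gd], after which [system_bound] yields q and p. *)
Theorem discrete_error : exists2 C, 0 <= C &
  forall N (x : nat -> R) hm B (D : error_data R N), grid l N x -> x N - x 0 = l ->
  (forall i : 'I_N, hh x i <= hm) -> 0 < hm -> 0 < B -> trace_bounds x B D -> solves x D ->
  (forall t, 0 <= t <= T ->
    wnorm x (ud D t) + wnorm x (qd D t) + wnorm x (pd D t) <= C * (hm * B)) /\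
  (forall s t, 0 <= s <= T -> 0 <= t <= T ->
    wnorm x (fun i => ud D s i - ud D t i) <= C * (hm * B) * (s - t) ^+ 2).
Proof.
exists (Num.max 0 c12 + Num.max 0 c9); first by rewrite addr_ge0 // le_max lexx.
move=> N x hm B D gr xN hle hm0 B0 tB sol.
have D0 : 0 <= hm * B by rewrite mulr_ge0 // ltW.
split=> [t ht|s t hs ht].
  apply: le_trans (data_bound gr hle hm0 B0 tB sol ht xN) _.
  rewrite ler_wpM2r // (@le_trans _ _ (Num.max 0 c12)) ?le_max ?lexx ?orbT //.
  by rewrite lerDl le_max lexx.
apply: le_trans (ud_diff gr hle hm0 B0 tB sol hs ht) _.
rewrite ler_wpM2r ?sqr_ge0 // ler_wpM2r // (@le_trans _ _ (Num.max 0 c9)) ?le_max ?lexx ?orbT //.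
by rewrite lerDr le_max lexx.
Qed.

End Discrete.

(** * Integrals and weak derivatives on an interval *)

Section AlmostEverywhere.
Context {R : realType}.
Local Notation mu := (@lebesgue_measure R).
Implicit Types P Q : R -> Prop.

Lemma ae_and P Q : {ae mu, forall x, P x} -> {ae mu, forall x, Q x} ->
  {ae mu, forall x, P x /\ Q x}.
Proof.
move=> [N [mN N0 hN]] [M [mM M0 hM]]; exists (N `|` M); split.
- exact: measurableU.
- exact: null_set_setU.
- move=> x; apply: contra_notP => /not_orP[h1 h2]; split.
    by apply: contra_notP h1 => ?; apply: hN.
  by apply: contra_notP h2 => ?; apply: hM.
Qed.

Lemma ae_S P Q : (forall x, P x -> Q x) -> {ae mu, forall x, P x} ->
  {ae mu, forall x, Q x}.
Proof.
move=> h [N [mN N0 hN]]; exists N; split => // x hx; apply: hN => /= ?.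
by apply: hx; apply: h.
Qed.

Lemma ae_S2 P Q (P' : R -> Prop) : (forall x, P x -> Q x -> P' x) ->
  {ae mu, forall x, P x} -> {ae mu, forall x, Q x} -> {ae mu, forall x, P' x}.
Proof. by move=> h hP hQ; apply: ae_S (ae_and hP hQ) => x [? ?]; apply: h. Qed.

Lemma ae_forall (P : nat -> R -> Prop) : (forall n, {ae mu, forall x, P n x}) ->
  {ae mu, forall x, forall n, P n x}.
Proof.
move=> h; have H := @negligible_bigcup _ _ R mu (fun n => ~` [set x | P n x]) h.
by apply: negligibleS H => x /= /existsNP[n hn]; exists n.
Qed.

Lemma ae_exists P (c d : R) : c < d -> {ae mu, forall x, P x} ->
  exists2 x, x \in `]c, d[ & P x.
Proof.
move=> cd [N [mN N0 hN]]; apply: contrapT => h.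
have : (mu `]c, d[%classic <= mu N)%E.
  apply: (le_measure (mu : {measure set _ -> \bar R})); rewrite ?inE //.
  by move=> x hx; apply: hN => /= hP; apply: h; exists x.
by rewrite N0 lebesgue_measure_itv /= lte_fin cd -EFinB lee_fin leNgt subr_gt0 cd.
Qed.

Lemma ae_pred (c : R) : {ae mu, forall x, x != c}.
Proof.
exists [set c]; split; rewrite ?lebesgue_measure_set1 //.
by move=> x /= /negP; rewrite negbK => /eqP.
Qed.

Lemma ae_true P : (forall x, P x) -> {ae mu, forall x, P x}.
Proof. by move=> h; exists set0; split => // x /=; apply. Qed.

End AlmostEverywhere.

Section Integrals.
Context {R : realType}.
Local Notation mu := (@lebesgue_measure R).
Implicit Types (f g v w : R -> R) (c d x y : R).

Definition itg c d f : R := \int[mu]_(x in `]c, d[) f x.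

Definition itb c d f : Prop := mu.-integrable `]c, d[ (EFin \o f).

Lemma mitv c d : measurable (`]c, d[ : set R). Proof. exact: measurable_itv. Qed.

Lemma mu_itv c d : c < d -> mu `]c, d[ = (d - c)%:E.
Proof. by move=> cd; rewrite lebesgue_measure_itv /= lte_fin cd. Qed.

Lemma itb_meas c d f : itb c d f -> measurable_fun `]c, d[ f.
Proof. by move=> /integrableP[/measurable_EFinP]. Qed.

Lemma itbD c d f g : itb c d f -> itb c d g -> itb c d (fun x => f x + g x).
Proof. by move=> hf hg; have := integrableD (mu := mu) (mitv c d) hf hg. Qed.

Lemma itbB c d f g : itb c d f -> itb c d g -> itb c d (fun x => f x - g x).
Proof. by move=> hf hg; have := integrableB (mu := mu) (mitv c d) hf hg. Qed.

Lemma itbZ c d r f : itb c d f -> itb c d (fun x => r * f x).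
Proof. by move=> hf; have := integrableZl (mu := mu) (mitv c d) r hf. Qed.

Lemma itbN c d f : itb c d f -> itb c d (fun x => - f x).
Proof.
move=> /(itbZ (-1)); rewrite (_ : (fun x => _) = (fun x => - f x)) //.
by apply/funext => x; rewrite mulN1r.
Qed.

Lemma itb_abs c d f : itb c d f -> itb c d (fun x => `|f x|).
Proof. by move=> hf; have := integrable_abse hf. Qed.

Lemma itb_bounded c d f M : measurable_fun `]c, d[ f ->
  (forall x, x \in `]c, d[ -> `|f x| <= M) -> itb c d f.
Proof.
move=> mf hM; have muf : (mu `]c, d[ < +oo)%E.
  by rewrite lebesgue_measure_itv /=; case: ifP => _; rewrite -?EFinB ltry.
apply: measurable_bounded_integrable => //.
exists `|M|; split; first exact: num_real.
move=> y hy x hx /=; apply: le_trans (ltW hy); apply: le_trans (ler_norm _).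
exact: hM.
Qed.

Lemma itb_cst c d r : itb c d (fun=> r).
Proof. by apply: (@itb_bounded _ _ _ `|r|). Qed.

Lemma itb_mulr c d f g M : itb c d f -> measurable_fun `]c, d[ g ->
  (forall x, x \in `]c, d[ -> `|g x| <= M) -> itb c d (fun x => f x * g x).
Proof.
move=> hf mg hM; apply: (@le_integrable _ _ _ mu _ (mitv c d) _ (fun x => (M * f x)%:E)).
- by apply/measurable_EFinP; apply: measurable_funM => //; exact: itb_meas.
- move=> x hx /=; rewrite lee_fin !normrM mulrC; apply: ler_wpM2r => //.
  by apply: le_trans (ler_norm _); apply: hM.
- exact: itbZ.
Qed.

Lemma itb_sub c d c' d' f : c <= c' -> d' <= d -> itb c d f -> itb c' d' f.
Proof.
move=> cc dd; apply: integrableS; [exact: measurable_itv|exact: measurable_itv|].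
by apply: subset_itv; rewrite bnd_simp.
Qed.

Lemma itb_le c d f g : measurable_fun `]c, d[ f -> itb c d g ->
  (forall x, x \in `]c, d[ -> `|f x| <= g x) -> itb c d f.
Proof.
move=> mf hg h; apply: (@le_integrable _ _ _ mu _ (mitv c d) _ (EFin \o g)) => //.
- by apply/measurable_EFinP.
- by move=> x hx /=; rewrite lee_fin; apply: le_trans (h _ hx) (ler_norm _).
Qed.

Lemma itb_cont c d f : {within `[c, d], continuous f} -> itb c d f.
Proof.
move=> cf; have : mu.-integrable `[c, d] (EFin \o f).
  by apply: continuous_compact_integrable => //; exact: segment_compact.
by apply: integrableS => //; exact: subset_itv_oo_cc.
Qed.

Lemma itgD c d f g : itb c d f -> itb c d g ->
  itg c d (fun x => f x + g x) = itg c d f + itg c d g.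
Proof. exact: RintegralD. Qed.

Lemma itgB c d f g : itb c d f -> itb c d g ->
  itg c d (fun x => f x - g x) = itg c d f - itg c d g.
Proof. exact: RintegralB. Qed.

Lemma itgZ c d r f : itb c d f -> itg c d (fun x => r * f x) = r * itg c d f.
Proof. exact: RintegralZl. Qed.

Lemma itgN c d f : itb c d f -> itg c d (fun x => - f x) = - itg c d f.
Proof.
move=> hf; rewrite -mulN1r -itgZ //; congr (itg c d _).
by apply/funext => x; rewrite mulN1r.
Qed.

Lemma itg_ext c d f g : (forall x, x \in `]c, d[ -> f x = g x) ->
  itg c d f = itg c d g.
Proof. by move=> h; apply: eq_Rintegral => x; rewrite inE; exact: h. Qed.

Lemma itb_ext c d f g : (forall x, x \in `]c, d[ -> f x = g x) ->
  itb c d f -> itb c d g.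
Proof.
move=> h; apply: eq_integrable => // x; rewrite inE /= => hx.
by rewrite h.
Qed.

Lemma itg_ae c d f g : measurable_fun `]c, d[ f -> measurable_fun `]c, d[ g ->
  {ae mu, forall x, x \in `]c, d[ -> f x = g x} -> itg c d f = itg c d g.
Proof.
move=> mf mg h; rewrite /itg /Rintegral; congr fine.
apply: ae_eq_integral => //; [exact/measurable_EFinP|exact/measurable_EFinP|].
by apply: ae_S h => x h hx /=; rewrite h.
Qed.

Lemma itb_ae c d f g : measurable_fun `]c, d[ g ->
  {ae mu, forall x, x \in `]c, d[ -> f x = g x} -> itb c d f -> itb c d g.
Proof.
move=> mg h hf; have mf := itb_meas hf.
move/integrableP : hf => [_ hf]; apply/integrableP; split.
  by apply/measurable_EFinP.
rewrite -(@ae_eq_integral _ _ _ mu _ _ (fun x => `|(EFin \o f) x|%E)) //.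
- by apply: measurableT_comp => //; apply/measurable_EFinP.
- by apply: measurableT_comp => //; apply/measurable_EFinP.
- by apply: ae_S h => x h hx /=; rewrite h.
Qed.

Lemma itg_norm c d f : itb c d f -> `|itg c d f| <= itg c d (fun x => `|f x|).
Proof. exact: le_normr_Rintegral. Qed.

Lemma itg_le c d f g : itb c d f -> itb c d g ->
  (forall x, x \in `]c, d[ -> f x <= g x) -> itg c d f <= itg c d g.
Proof. by move=> hf hg h; apply: le_Rintegral. Qed.

Lemma itg_ge0 c d f : (forall x, x \in `]c, d[ -> 0 <= f x) -> 0 <= itg c d f.
Proof. by move=> h; apply: Rintegral_ge0 => x /h. Qed.

Lemma itg_cst c d r : c <= d -> itg c d (fun=> r) = r * (d - c).
Proof.
rewrite le_eqVlt => /predU1P[->|cd].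
  by rewrite /itg set_itvoo0 Rintegral_set0 subrr mulr0.
rewrite /itg Rintegral_cst //; congr (_ * _).
by have /= -> := mu_itv cd.
Qed.

Lemma itg_ae_le c d f g : itb c d f -> itb c d g ->
  {ae mu, forall x, x \in `]c, d[ -> f x <= g x} -> itg c d f <= itg c d g.
Proof.
move=> hf hg h; have mf := itb_meas hf; have mg := itb_meas hg.
pose M x := Num.max (f x) (g x).
have hM : itb c d M.
  apply: (@itb_le _ _ _ (fun x => `|f x| + `|g x|)).
  - exact: measurable_maxr.
  - by apply: itbD; exact: itb_abs.
  - move=> x _; rewrite /M; case: (leP (f x) (g x)) => _.
      by rewrite lerDr.
    by rewrite lerDl.
have -> : itg c d g = itg c d M.
  apply: itg_ae => //; first exact: itb_meas.
  by apply: ae_S h => x h hx; rewrite /M; apply/esym/max_r/h.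
by apply: itg_le => // x _; rewrite /M le_max lexx.
Qed.

Lemma itg_ae_bound c d f M : c <= d -> itb c d f ->
  {ae mu, forall x, x \in `]c, d[ -> `|f x| <= M} -> `|itg c d f| <= M * (d - c).
Proof.
move=> cd hf h; apply: le_trans (itg_norm hf) _; rewrite -itg_cst //.
by apply: itg_ae_le => //; [exact: itb_abs|exact: itb_cst].
Qed.

Lemma itg_bound c d f M : c <= d -> itb c d f ->
  (forall x, x \in `]c, d[ -> `|f x| <= M) -> `|itg c d f| <= M * (d - c).
Proof. by move=> cd hf h; apply: itg_ae_bound => //; apply: ae_true. Qed.

Lemma itg_empty c d f : d <= c -> itg c d f = 0.
Proof. by move=> dc; rewrite /itg set_itv_ge ?bnd_simp -?leNgt // Rintegral_set0. Qed.

Lemma itg_split c d e f : c <= d -> d <= e -> itb c e f ->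
  itg c e f = itg c d f + itg d e f.
Proof.
move=> cd de hf.
have := cd; rewrite le_eqVlt => /predU1P[ceq|lcd].
  by rewrite -ceq (itg_empty _ (lexx c)) add0r.
have := de; rewrite le_eqVlt => /predU1P[ceq|lde].
  by rewrite -ceq (itg_empty _ (lexx d)) addr0.
have h1 : itb c d f by apply: itb_sub hf.
have := @Rintegral_itvB R f (BRight c) (BLeft e) d.
rewrite /itg => <- //; rewrite ?bnd_simp //.
rewrite -(Rintegral_itv_bndo_bndc (a := BRight c)) //.
by rewrite addrC subrK.
Qed.

Lemma itg_cc c d f : itb c d f -> itg c d f = \int[mu]_(x in `[c, d]) f x.
Proof.
move=> hf; have [cd|dc] := ltP c d; last first.
  rewrite (itg_empty _ dc); move: dc; rewrite le_eqVlt => /predU1P[->|dc].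
    by rewrite set_itv1 Rintegral_set1.
  by rewrite set_itv_ge ?bnd_simp -?ltNge // Rintegral_set0.
rewrite /itg Rintegral_itv_bndo_bndc // Rintegral_itv_obnd_cbnd //.
have [mf hi] := integrableP _ _ _ hf.
apply/integrableP; split.
  rewrite -(@setUitv1 _ _ (BRight c) d true) ?bnd_simp ?ltW //.
  apply/measurable_funU => //; split => //.
  exact: measurable_fun_set1.
rewrite -integral_itv_bndo_bndc //.
by apply: measurableT_comp.
Qed.

End Integrals.

Section MoreIntegrals.
Context {R : realType}.
Local Notation mu := (@lebesgue_measure R).
Implicit Types (f g v w : R -> R) (c d x y : R).

Lemma itg_dominated c d (f_ : nat -> R -> R) f g :
  (forall n, measurable_fun `]c, d[ (f_ n)) ->
  (forall x, x \in `]c, d[ -> f_ n x @[n --> \oo] --> f x) ->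
  itb c d g -> (forall n x, x \in `]c, d[ -> `|f_ n x| <= g x) ->
  itb c d f /\ itg c d (f_ n) @[n --> \oo] --> itg c d f.
Proof.
move=> mf ff ig fg; have mD := mitv c d.
have mfl : measurable_fun `]c, d[ f by apply: measurable_fun_cvg ff.
have [|||||i1 _ i2] := @dominated_convergence _ _ R mu _ mD
    (fun n => EFin \o f_ n) (EFin \o f) (EFin \o g).
- by move=> n; apply/measurable_EFinP; exact: mf.
- by apply/measurable_EFinP.
- by apply: ae_true => x hx; apply: cvg_EFin; [exact: nearW|exact: ff].
- exact: ig.
- by apply: ae_true => x n hx /=; rewrite lee_fin; exact: fg.
split=> //; have : (fun n => (itg c d (f_ n))%:E) n @[n --> \oo] --> (itg c d f)%:E.
  rewrite /itg /Rintegral fineK; last by apply: integrable_fin_num.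
  apply: cvg_trans i2; apply: near_eq_cvg; apply: nearW => n /=.
  rewrite fineK //; apply: integrable_fin_num => //.
  by apply: itb_le ig _ => // x; exact: fg.
by move/fine_cvg.
Qed.

Lemma itg_supp c d c' d' f : c <= c' -> c' <= d' -> d' <= d -> itb c d f ->
  (forall x, x \in `]c, d[ -> x \notin `]c', d'[ -> f x = 0) ->
  itg c d f = itg c' d' f.
Proof.
move=> cc cd dd hf h0; rewrite (itg_split cc (le_trans cd dd)) // (itg_split cd dd);
  last exact: itb_sub hf.
rewrite [X in X + _](_ : _ = 0); last first.
  rewrite (itg_ext (g := fun=> 0)) ?itg_cst ?mul0r // => x; rewrite in_itv /= => /andP[h1 h2].
  apply: h0; rewrite in_itv /= ?negb_and -?leNgt ?(ltW h2) // h1 /=.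
  by apply: lt_le_trans h2 (le_trans cd dd).
rewrite [X in _ + (_ + X)](_ : _ = 0) ?addr0 ?add0r //.
rewrite (itg_ext (g := fun=> 0)) ?itg_cst ?mul0r // => x; rewrite in_itv /= => /andP[h1 h2].
apply: h0; rewrite in_itv /= ?negb_and -?leNgt ?(ltW h1) ?orbT // h2 andbT.
by apply: le_lt_trans h1; apply: le_trans cd.
Qed.

Lemma itg_cont c d w : c <= d -> itb c d w ->
  {within `[c, d], continuous (fun x => itg c x w)}.
Proof.
move=> cd hw.
have mw : measurable_fun `[c, d] w.
  move: cd; rewrite le_eqVlt => /predU1P[<-|cd].
    by rewrite set_itv1; exact: measurable_fun_set1.
  rewrite -(@setUitv1 _ _ (BLeft c) d true) ?bnd_simp ?ltW //.
  apply/measurable_funU => //; split; last exact: measurable_fun_set1.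
  rewrite -(@setU1itv _ _ (BLeft d) c false) ?bnd_simp //.
  apply/measurable_funU => //; split; first exact: measurable_fun_set1.
  exact: itb_meas hw.
have hc : mu.-integrable `[c, d] (EFin \o w).
  have [_ hi] := integrableP _ _ _ hw.
  apply/integrableP; split; first exact/measurable_EFinP.
  have m2 : measurable_fun `[c, d] (fun x => `|(EFin \o w) x|%E).
    by apply: measurableT_comp => //; exact/measurable_EFinP.
  rewrite -integral_itv_bndo_bndc; last first.
    by apply: measurable_funS m2 => //; exact: subset_itv_co_cc.
  rewrite -integral_itv_obnd_cbnd //.
  by apply: measurable_funS m2 => //; exact: subset_itv_oo_cc.
have := parameterized_integral_continuous cd hc.
apply: subspace_eq_continuous => x; rewrite inE /= in_itv /= => /andP[h1 h2].
apply/esym/itg_cc; exact: itb_sub hw.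
Qed.

(** Lebesgue points, with integrals over symmetric intervals. *)
Definition lpt f x := forall e, 0 < e -> exists2 r, 0 < r &
  forall s, 0 < s -> s < r -> itg (x - s) (x + s) (fun y => `|f y - f x|) <= e * s.

Lemma lpt_ae c d f : itb c d f -> {ae mu, forall x, x \in `]c, d[ -> lpt f x}.
Proof.
move=> hf; pose f' : R -> R := f \_ `]c, d[%classic.
have locf : locally_integrable setT f'.
  apply: open_integrable_locally => //; first exact: openT.
  by rewrite -restrict_EFin; apply/integrable_restrict => //; rewrite setTI.
have := lebesgue_differentiation locf; apply: ae_S => x lx hx e e0.
have := hx; rewrite in_itv /= => /andP[cx xd].
have e20 : 0 < e / 2 by rewrite divr_gt0.
have e2E : (0 < (e / 2)%:E)%E by rewrite lte_fin.
have := lx; rewrite /lebesgue_pt => /fine_cvgP[fin_davg /cvgr0_norm_le /(_ _ e20) /=].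
case=> r /= r0 hr; case: fin_davg => r' /= r'0 hr'.
exists (Num.min (Num.min r r') (Num.min (x - c) (d - x))).
  by rewrite !lt_min r0 r'0 !subr_gt0 cx xd.
move=> s s0; rewrite !lt_min => /andP[/andP[sr sr'] /andP[sc sd]].
have bs : `|0 - s| < r by rewrite sub0r normrN gtr0_norm.
have bs' : `|0 - s| < r' by rewrite sub0r normrN gtr0_norm.
have := hr s bs s0; have := hr' s bs' s0.
rewrite /davg /iavg lebesgue_measure_ball; last exact: ltW.
move=> fn.
have hb : ball x s = `](x - s), (x + s)[%classic by rewrite ball_itv.
have sub : `](x - s), (x + s)[ `<=` `]c, d[.
  by apply: subset_itv; rewrite bnd_simp; lra.
have f'E y : y \in `](x - s), (x + s)[ -> f' y = f y.
  by move=> hy; rewrite /f' patchT // inE; exact: sub.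
have hint : itb (x - s) (x + s) (fun y => `|f y - f x|).
  by apply: itb_abs; apply: itbB; [apply: itb_sub hf; lra|exact: itb_cst].
have -> : (\int[mu]_(y in ball x s) `|((center (f' x) \o f') y)%:E|)%E =
    (itg (x - s) (x + s) (fun y => `|f y - f x|))%:E.
  rewrite hb /itg /Rintegral fineK; last by apply: integrable_fin_num.
  apply: eq_integral => y; rewrite inE /= => hy.
  by rewrite f'E // f'E // in_itv /=; lra.
rewrite inver mulrn_eq0 /= gt_eqF // -EFinM /= ger0_norm; last first.
  by apply: mulr_ge0; [rewrite invr_ge0 mulrn_wge0 // ltW|apply: itg_ge0 => ? _].
rewrite ler_pdivrMl ?mulrn_wgt0 // => h; apply: le_trans h _.
by rewrite -[s *+ 2]mulr_natl; apply: eq_lew; field.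
Qed.

Lemma lpt_avg c d f x M : itb c d f -> x \in `]c, d[ -> lpt f x ->
  (forall al be, c < al -> al < be -> be < d -> `|itg al be f| <= M * (be - al)) ->
  `|f x| <= M.
Proof.
move=> hf hx lx hM; have := hx; rewrite in_itv /= => /andP[cx xd].
apply/ler_addgt0Pr => e e0; have [r r0 hr] := lx (e * 2) ltac:(lra).
pose s := Num.min (r / 2) (Num.min ((x - c) / 2) ((d - x) / 2)).
have s0 : 0 < s by rewrite /s !lt_min; apply/and3P; split; lra.
have [s1 s2 s3] : [/\ s <= r / 2, s <= (x - c) / 2 & s <= (d - x) / 2].
  by rewrite /s !ge_min !lexx !orbT.
have := hr s s0 ltac:(lra) => h1; have h2 := hM (x - s) (x + s) ltac:(lra) ltac:(lra) ltac:(lra).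
have hf' : itb (x - s) (x + s) f by apply: itb_sub hf; lra.
have h3 : `|itg (x - s) (x + s) (fun y => f y - f x)| <= e * 2 * s.
  by apply: le_trans (itg_norm _) h1; apply: itbB => //; exact: itb_cst.
move: h3; rewrite itgB //; last exact: itb_cst.
rewrite itg_cst; last lra.
move: h2; set J := itg _ _ _ => h2 h3.
have h4 : `|f x * (x + s - (x - s))| <= (M + e) * (2 * s).
  rewrite (_ : f x * _ = J - (J - f x * (x + s - (x - s)))); last by rewrite subKr.
  apply: le_trans (ler_normB _ _) _.
  by apply: le_trans (lerD h2 h3) _; apply: eq_lew; ring.
move: h4; rewrite (_ : x + s - (x - s) = 2 * s); last ring.
by rewrite normrM [`|2 * s|]ger0_norm ?ler_pM2r //; lra.
Qed.

(** Lebesgue's differentiation theorem. *)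
Lemma ae_bound_avg c d f M : itb c d f ->
  (forall al be, c < al -> al < be -> be < d -> `|itg al be f| <= M * (be - al)) ->
  {ae mu, forall x, x \in `]c, d[ -> `|f x| <= M}.
Proof. by move=> hf h; apply: ae_S (lpt_ae hf) => x lx hx; apply: lpt_avg (lx hx) h. Qed.

Lemma ae_eq0_avg c d f : itb c d f ->
  (forall al be, c < al -> al < be -> be < d -> itg al be f = 0) ->
  {ae mu, forall x, x \in `]c, d[ -> f x = 0}.
Proof.
move=> hf h; have := @ae_bound_avg c d f 0 hf; move=> H.
have {}H : {ae mu, forall x, x \in `]c, d[ -> `|f x| <= 0}.
  by apply: H => al be h1 h2 h3; rewrite h // normr0 mul0r.
by apply: ae_S H => x hx /hx; rewrite normr_le0 => /eqP.
Qed.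

End MoreIntegrals.

Section Continuity.
Context {R : realType}.
Implicit Types f g : R -> R.

Lemma cont_cst (r : R) : continuous (fun _ : R => r).
Proof. exact: cst_continuous. Qed.

Lemma contM f g : continuous f -> continuous g -> continuous (fun x => f x * g x).
Proof. by move=> hf hg x; apply: cvgM; [exact: hf|exact: hg]. Qed.

Lemma contD f g : continuous f -> continuous g -> continuous (fun x => f x + g x).
Proof. by move=> hf hg x; apply: cvgD; [exact: hf|exact: hg]. Qed.

Lemma contB f g : continuous f -> continuous g -> continuous (fun x => f x - g x).
Proof. by move=> hf hg x; apply: cvgB; [exact: hf|exact: hg]. Qed.

End Continuity.

Section Cutoffs.
Context {R : realType}.
Implicit Types (x y z : R).

Lemma is_derive_quad (f : R -> R) x a C :
  (forall z, `|f z - f x - a * (z - x)| <= C * (z - x) ^+ 2) -> is_derive x 1 f a.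
Proof.
move=> h; have C0 : 0 <= C.
  by have := h (x + 1); rewrite (_ : x + 1 - x = 1); [rewrite expr1n !mulr1 => h1; apply: le_trans h1; exact: normr_ge0|ring].
have q : h0^-1 *: (f (h0 *: (1 : R) + x) - f x) @[h0 --> (0 : R)^'] --> a.
  apply/cvgrPdist_le => e e0; near=> s.
  have s0 : s != 0 by near: s; exact: nbhs_dnbhs_neq.
  rewrite [_ *: 1]mulr1 /=.
  have -> : a - s^-1 *: (f (s + x) - f x) = - (s^-1 * (f (s + x) - f x - a * (s + x - x))).
    by rewrite /GRing.scale /= addrK; field.
  rewrite normrN normrM normfV ler_pdivrMl ?normr_gt0 //.
  apply: le_trans (h _) _; rewrite addrK -real_normK ?num_real // expr2 mulrA [leRHS]mulrC.
  apply: ler_wpM2r => //.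
  have : `|s| <= e / (C + 1).
    near: s; apply: dnbhs0_le; by rewrite divr_gt0 // ltr_wpDl.
  rewrite ler_pdivlMr ?ltr_wpDl // => hs; apply: le_trans hs.
  by rewrite mulrC ler_wpM2l // lerDl.
apply: DeriveDef; first by apply/cvg_ex; exists a; exact: q.
by rewrite /derive; apply/cvg_lim.
Unshelve. all: by end_near. Qed.

Definition plus2 y : R := (Num.max 0 y) ^+ 2 / 2.

Lemma plus2_der x : is_derive x 1 plus2 (Num.max 0 x).
Proof.
apply: (@is_derive_quad _ _ _ 1) => z; rewrite /plus2 mul1r.
have h2 := sqr_ge0 (z - x).
case: (leP 0 z) => hz; case: (leP 0 x) => hx; rewrite ler_norml; apply/andP; split; nra.
Qed.

(** A smooth step from 0 to 1 over [0, 2], and its derivative. *)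
Definition step y : R := plus2 y - 2 * plus2 (y - 1) + plus2 (y - 2).
Definition tent y : R := Num.max 0 y - 2 * Num.max 0 (y - 1) + Num.max 0 (y - 2).

Lemma step_der x : is_derive x 1 step (tent x).
Proof.
rewrite /step /tent.
have h a : is_derive x 1 (fun y => plus2 (y - a)) (Num.max 0 (x - a)).
  by have := der_shift (plus2_der (x - a)).
have h0 := plus2_der x.
exact: (derD (derB h0 (derZ 2 (h 1))) (h 2)).
Qed.

Ltac maxcases := repeat match goal with |- context [Num.max 0 ?a] => case: (leP 0 a) => ? end.

Lemma step0 y : y <= 0 -> step y = 0.
Proof. by move=> h; rewrite /step /plus2; maxcases; nra. Qed.

Lemma step1 y : 2 <= y -> step y = 1.
Proof. by move=> h; rewrite /step /plus2; maxcases; nra. Qed.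

Lemma step_bnd y : 0 <= step y <= 1.
Proof. by rewrite /step /plus2; maxcases; nra. Qed.

Lemma tent_bnd y : 0 <= tent y <= 1.
Proof. by rewrite /tent; maxcases; lra. Qed.

Lemma tent0 y : (y <= 0) || (2 <= y) -> tent y = 0.
Proof. by move=> /orP h; rewrite /tent; case: h => h; maxcases; lra. Qed.

Lemma tent_continuous : continuous tent.
Proof.
have h a : continuous (fun y : R => Num.max 0 (y - a)).
  have -> : (fun y : R => Num.max 0 (y - a)) = (fun y => (y - a + `|y - a|) * 2^-1).
    by apply/funext => y; case: (leP 0 (y - a)) => h; [rewrite ger0_norm //|rewrite ltr0_norm //]; lra.
  have c1 : continuous (fun y : R => y - a).
    by apply: contB; [move=> ?; exact: cvg_id|exact: cont_cst].
  apply: contM; last exact: cont_cst.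
  apply: contD => // x; apply: (continuous_comp (f := fun y => y - a)); first exact: c1.
  exact: norm_continuous.
have h0 : continuous (fun y : R => Num.max 0 y).
  suff -> : (fun y : R => Num.max 0 y) = (fun y => Num.max 0 (y - 0)) by exact: h.
  by apply/funext => y; rewrite subr0.
apply: contD; last exact: h.
by apply: contB => //; apply: contM; [exact: cont_cst|exact: h].
Qed.

End Cutoffs.

Section WeakDerivatives.
Context {R : realType}.
Local Notation mu := (@lebesgue_measure R).
Implicit Types (f g v w : R -> R) (c d x y : R).

Lemma itg_ftc_on (F f : R -> R) c d : c <= d ->
  (forall x, c - 1 < x -> is_derive x 1 F (f x)) -> continuous f -> itg c d f = F d - F c.
Proof.
rewrite le_eqVlt => /predU1P[<-|cd] dF cf; first by rewrite itg_empty // subrr.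
have cF x : c - 1 < x -> {for x, continuous F}.
  move=> hx; apply: differentiable_continuous; apply/derivable1_diffP.
  exact: (@ex_derive _ _ _ _ _ _ _ (dF x hx)).
rewrite itg_cc; last by apply: itb_cont; exact: continuous_subspaceT.
rewrite /Rintegral (continuous_FTC2 (F := F)) //.
- exact: continuous_subspaceT.
- split.
  + move=> x; rewrite in_itv /= => /andP[cx _].
    by apply: (@ex_derive _ _ _ _ _ _ _ (dF x _)); lra.
  + by apply/cvg_at_right_filter/cF; lra.
  + by apply/cvg_at_left_filter/cF; lra.
- move=> x; rewrite in_itv /= => /andP[cx _].
  have h : is_derive x 1 F (f x) by apply: dF; lra.
  by rewrite derive1E derive_val.
Qed.

Lemma itg_ftc (F f : R -> R) c d : c <= d -> (forall x, is_derive x 1 F (f x)) ->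
  continuous f -> itg c d f = F d - F c.
Proof. by move=> cd dF; apply: itg_ftc_on. Qed.

(** An approximation of the indicator function of (al, be) by test functions. *)
Definition cutoff (al be s x : R) : R := step ((x - al) / s) - step ((x - be) / s).
Definition dcutoff (al be s x : R) : R := (tent ((x - al) / s) - tent ((x - be) / s)) / s.

Lemma cutoff_der al be s x : is_derive x 1 (cutoff al be s) (dcutoff al be s x).
Proof.
have h a : is_derive x 1 (fun y => step ((y - a) / s)) (tent ((x - a) / s) * s^-1).
  apply: is_derive_eq; first apply: is_derive1_comp.
    exact: step_der.
  by rewrite scaler0 add0r subr0 /GRing.scale /= mulr1.
rewrite /dcutoff mulrBl; exact: derB (h al) (h be).
Qed.

Lemma scaled_continuous (f : R -> R) a s : continuous f ->
  continuous (fun x => f ((x - a) / s)).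
Proof.
move=> cf x; apply: (continuous_comp (f := fun x => (x - a) / s)); last exact: cf.
apply: continuousM; last exact: cst_continuous.
by apply: continuousB; [exact: cvg_id|exact: cst_continuous].
Qed.

Lemma dcutoff_continuous al be s : continuous (dcutoff al be s).
Proof.
apply: contM; last exact: cont_cst.
by apply: contB; apply: scaled_continuous; exact: tent_continuous.
Qed.

Lemma derive1_is (F f : R -> R) : (forall x, is_derive x 1 F (f x)) -> derive1 F = f.
Proof. by move=> h; apply/funext => x; rewrite derive1E derive_val. Qed.

Lemma derivable_cont (F : R -> R) : (forall x, derivable F x 1) -> continuous F.
Proof. by move=> h x; apply: differentiable_continuous; apply/derivable1_diffP. Qed.

Lemma cutoff_test c d al be s : 0 < s -> c < al -> al <= be -> be + 2 * s < d ->
  test_function c d (cutoff al be s).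
Proof.
move=> s0 cal ab bd; have hd x := cutoff_der al be s x; split.
- by move=> x; exact: ex_derive.
- by rewrite (derive1_is hd); exact: dcutoff_continuous.
- exists al, (be + 2 * s); split => // x.
  rewrite in_itv /= negb_and -!ltNge /cutoff => /orP[hx|hx].
    by rewrite !step0 ?subrr // pmulr_lle0 ?invr_gt0 //; lra.
  by rewrite !step1 ?subrr // ler_pdivlMr //; lra.
Qed.

Lemma tent_avg c d v al e : itb c d v -> c < al -> al < d -> lpt v al -> 0 < e ->
  exists2 r, 0 < r & forall s, 0 < s -> s < r ->
    `|itg c d (fun x => v x * (tent ((x - al) / s) / s)) - v al| <= e.
Proof.
move=> hv ca ad lv e0; have e30 : 0 < e / 3 by lra.
have [r r0 hr] := lv _ e30.
exists (Num.min (r / 3) (Num.min ((al - c) / 3) ((d - al) / 3))).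
  by rewrite !lt_min; apply/and3P; split; lra.
move=> s s0; rewrite !lt_min => /and3P[s1 s2 s3].
pose K x := tent ((x - al) / s) / s.
have cK : continuous K.
  apply: contM; last exact: cont_cst.
  by apply: scaled_continuous; exact: tent_continuous.
have K0 x : 0 <= K x.
  by rewrite /K divr_ge0 ?(ltW s0) //; have /andP[] := tent_bnd ((x - al) / s).
have K1 x : K x <= s^-1.
  by rewrite /K ler_pdivrMr // mulVf ?gt_eqF //; have /andP[] := tent_bnd ((x - al) / s).
have iK c' d' : itb c' d' K by apply: itb_cont; exact: continuous_subspaceT.
have mK c' d' := itb_meas (iK c' d').
have KM x : `|K x| <= s^-1 by rewrite ger0_norm.
have dK x : is_derive x 1 (fun y => step ((y - al) / s)) (K x).
  apply: is_derive_eq; first apply: is_derive1_comp.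
    exact: step_der.
  by rewrite scaler0 add0r subr0 /GRing.scale /= mulr1.
have hK : itg c d K = 1.
  rewrite (itg_ftc (ltW (lt_trans ca ad)) dK cK) step1; last by rewrite ler_pdivlMr //; lra.
  by rewrite step0 ?subr0 // pmulr_lle0 ?invr_gt0 //; lra.
have hva c' d' : itb c' d' v -> itb c' d' (fun x => v x - v al).
  by move=> h; apply: itbB => //; exact: itb_cst.
have hvK : itb c d (fun x => (v x - v al) * K x).
  by apply: (itb_mulr (M := s^-1)) => //; exact: hva.
have -> : itg c d (fun x => v x * (tent ((x - al) / s) / s)) - v al =
    itg c d (fun x => (v x - v al) * K x).
  rewrite -[X in _ - X]mulr1 -hK -itgZ // -itgB //.
  - by apply: itg_ext => x _; rewrite /K; ring.
  - exact: (itb_mulr hv (mK c d) (M := s^-1) (fun x _ => KM x)).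
  - exact: itbZ.
have hv' : itb (al - 3 * s) (al + 3 * s) v by apply: itb_sub hv; lra.
rewrite (@itg_supp _ c d (al - 3 * s) (al + 3 * s)) //; try lra; last first.
  move=> x hx; rewrite in_itv /= negb_and -!leNgt => h.
  rewrite /K tent0 ?mul0r ?mulr0 //; apply/orP.
  case/orP: h => h; [left|right].
    by rewrite pmulr_lle0 ?invr_gt0 //; lra.
  by rewrite ler_pdivlMr //; lra.
have hvK' : itb (al - 3 * s) (al + 3 * s) (fun x => (v x - v al) * K x).
  by apply: itb_sub hvK; lra.
apply: le_trans (itg_norm hvK') _.
apply: le_trans (itg_le (g := fun x => s^-1 * `|v x - v al|) _ _ _) _.
- exact: itb_abs.
- by apply: itbZ; apply: itb_abs; exact: hva.
- move=> x _; rewrite normrM mulrC; apply: ler_wpM2r => //.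
rewrite itgZ; last by apply: itb_abs; exact: hva.
rewrite ler_pdivrMl //; apply: le_trans (hr (3 * s) _ _) _; lra.
Qed.

End WeakDerivatives.

Section AbsoluteContinuity.
Context {R : realType}.
Local Notation mu := (@lebesgue_measure R).
Implicit Types (f g v w : R -> R) (c d x y : R).

Lemma step_cvg (z s0 : R) : 0 < s0 ->
  step (z / (s0 / n.+1%:R)) @[n --> \oo] --> (if 0 < z then 1 else 0 : R).
Proof.
move=> s00; case: ltP => hz; apply: cvg_near_cst.
  near=> n; rewrite step1 // invfM invrK mulrCA ler_pdivlMl //.
  have : s0 * 2 / z <= n%:R by near: n; exact: nbhs_infty_ger.
  rewrite ler_pdivrMr // => h; apply: le_trans h _; rewrite mulrC.
  by apply: ler_wpM2l; [exact: ltW|rewrite ler_nat].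
apply: nearW => n; rewrite step0 // pmulr_lle0 // invr_gt0 divr_gt0 //.
Unshelve. all: by end_near. Qed.

(** The derivatives of the cutoffs are averaging kernels to the right of al and of
    be. *)
Lemma weak_ac c d v w al be : weak_deriv c d v w -> c < al -> al < be -> be < d ->
  lpt v al -> lpt v be -> v be - v al = itg al be w.
Proof.
move=> [hv hw H] cal ab bd lva lvb.
pose s0 := (d - be) / 4; have s00 : 0 < s0 by rewrite /s0; lra.
pose s n := s0 / n.+1%:R.
have sgt n : 0 < s n by rewrite /s divr_gt0.
have sle n : s n <= s0.
  by rewrite /s ler_pdivrMr // ler_peMr ?(ltW s00) // ler1n.
have test n : test_function c d (cutoff al be (s n)).
  by apply: cutoff_test => //; [exact: ltW|have := sle n; rewrite /s0; lra].
have cD n : continuous (cutoff al be (s n)).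
  by apply: derivable_cont => x; exact: (@ex_derive _ _ _ _ _ _ _ (cutoff_der al be (s n) x)).
have bD n x : `|cutoff al be (s n) x| <= 1.
  rewrite /cutoff; have /andP[h1 h2] := step_bnd ((x - al) / s n).
  have /andP[h3 h4] := step_bnd ((x - be) / s n).
  by rewrite ler_norml; apply/andP; split; lra.
have mC c' d' f : continuous f -> measurable_fun `]c', d'[ f.
  by move=> cf; apply: (@itb_meas R); apply: itb_cont; exact: continuous_subspaceT.
pose chi x : R := (if 0 < x - al then 1 else 0) - (if 0 < x - be then 1 else 0).
have [hl1 hl2] : itb c d (fun x => w x * chi x) /\
    itg c d (fun x => w x * cutoff al be (s n) x) @[n --> \oo] -->
    itg c d (fun x => w x * chi x).
  apply: (@itg_dominated _ c d (fun n x => w x * cutoff al be (s n) x) _ (fun x => `|w x|)).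
  - by move=> n; apply: measurable_funM; [exact: itb_meas hw|exact: mC].
  - by move=> x _; apply: cvgM; [exact: cvg_cst|apply: cvgB; exact: step_cvg].
  - exact: itb_abs.
  - by move=> n x _; rewrite normrM ler_piMr.
have E : itg c d (fun x => w x * chi x) = itg al be w.
  rewrite (@itg_split _ c be) //; try lra.
  rewrite [X in _ + X](_ : _ = 0) ?addr0; last first.
    rewrite (itg_ext (g := fun=> 0)) ?itg_cst ?mul0r ?(ltW bd) // => x.
    by rewrite in_itv /= /chi => /andP[h1 h2]; rewrite !ifT ?subr0 ?subrr ?mulr0 //; lra.
  rewrite (@itg_supp _ c be al be) //; try lra.
  - apply: itg_ext => x; rewrite in_itv /= /chi => /andP[h1 h2].
    by rewrite ifT ?ifF ?subr0 ?mulr1 //; lra.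
  - by apply: itb_sub hl1; lra.
  - move=> x; rewrite !in_itv /= => /andP[h1 h2]; rewrite h2 andbT -leNgt => h3.
    by rewrite /chi !ifF ?subrr ?mulr0 //; lra.
have hl3 : itg c d (fun x => v x * dcutoff al be (s n) x) @[n --> \oo] --> v al - v be.
  apply/cvgrPdist_le => e e0; have e20 : 0 < e / 2 by lra.
  have [r1 r10 h1] := tent_avg hv cal (lt_trans ab bd) lva e20.
  have [r2 r20 h2] := tent_avg hv (lt_trans cal ab) bd lvb e20.
  near=> n.
  have hs : s n < Num.min r1 r2.
    have m0 : 0 < Num.min r1 r2 by rewrite lt_min r10 r20.
    rewrite /s ltr_pdivrMr // mulrC -ltr_pdivrMr //.
    have : s0 / Num.min r1 r2 <= n%:R by near: n; exact: nbhs_infty_ger.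
    by move/le_lt_trans; apply; rewrite ltr_nat.
  move: hs; rewrite lt_min => /andP[hs1 hs2].
  have := h1 (s n) (sgt n) hs1; have := h2 (s n) (sgt n) hs2.
  have cT a : continuous (fun x => tent ((x - a) / s n) / s n).
    by apply: contM; [apply: scaled_continuous; exact: tent_continuous|exact: cont_cst].
  have bT a x : `|tent ((x - a) / s n) / s n| <= (s n)^-1.
    have /andP[t0 t1] := tent_bnd ((x - a) / s n).
    rewrite ger0_norm; last by rewrite divr_ge0 // ltW.
    by rewrite ler_pdivrMr // mulVf ?gt_eqF.
  have iT a : itb c d (fun x => v x * (tent ((x - a) / s n) / s n)).
    by apply: (itb_mulr hv (mC _ _ _ (cT a)) (M := (s n)^-1)) => x _; exact: bT.
  have -> : itg c d (fun x => v x * dcutoff al be (s n) x) =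
      itg c d (fun x => v x * (tent ((x - al) / s n) / s n)) -
      itg c d (fun x => v x * (tent ((x - be) / s n) / s n)).
    rewrite -itgB; [|exact: iT|exact: iT].
    by apply: itg_ext => x _; rewrite /dcutoff !mulrBl mulrBr.
  rewrite !ler_norml => /andP[k1 k2] /andP[k3 k4].
  by apply/andP; split; lra.
have hl4 : itg c d (fun x => v x * dcutoff al be (s n) x) @[n --> \oo] --> - itg al be w.
  rewrite -E; have -> : (fun n => itg c d (fun x => v x * dcutoff al be (s n) x)) =
      (fun n => - itg c d (fun x => w x * cutoff al be (s n) x)).
    apply/funext => n; have := H _ (test n).
    by rewrite (derive1_is (cutoff_der al be (s n))).
  exact: cvgN.
have h := cvg_unique _ hl3 hl4.
by rewrite -opprB h // opprK.
Unshelve. all: by end_near. Qed.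

(** The absolutely continuous representative. *)
Lemma weak_rep c d v w : c < d -> weak_deriv c d v w ->
  exists A, {ae mu, forall x, x \in `]c, d[ -> v x = A + itg c x w}.
Proof.
move=> cd H; have [hv hw _] := H.
have [x0 hx0 l0] := ae_exists cd (lpt_ae hv).
have {}l0 := l0 hx0; move: hx0; rewrite in_itv /= => /andP[cx0 xd0].
exists (v x0 - itg c x0 w); apply: ae_S (lpt_ae hv) => x lx hx.
have {}lx := lx hx; move: hx; rewrite in_itv /= => /andP[cx xd].
case: (ltgtP x x0) => [xx|xx|->]; last by rewrite subrK.
- have h := weak_ac H cx xx xd0 lx l0.
  rewrite (itg_split (ltW cx) (ltW xx)) -?h; last by apply: itb_sub hw; lra.
  by ring.
- have h := weak_ac H cx0 xx xd l0 lx.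
  rewrite (itg_split (ltW cx0) (ltW xx)) -?h; last by apply: itb_sub hw; lra.
  by ring.
Qed.

Lemma within_cvg_itv (f : R -> R) c d x : {within `[c, d], continuous f} ->
  x \in `[c, d] -> forall e, 0 < e -> exists2 r, 0 < r &
    forall y, y \in `[c, d] -> `|x - y| < r -> `|f x - f y| <= e.
Proof.
move=> cf hx e e0; have /subspace_continuousP h := cf; have := h x hx.
move=> /cvgrPdist_le /(_ e e0); rewrite near_withinE => /nbhs_normP[r /= r0 hr].
by exists r => // y hy xy; apply: hr.
Qed.

Lemma ae_le_within (f : R -> R) c d M : c < d -> {within `[c, d], continuous f} ->
  {ae mu, forall x, x \in `]c, d[ -> f x <= M} ->
  forall x, x \in `[c, d] -> f x <= M.
Proof.
move=> cd cf h x hx; apply/ler_addgt0Pr => e e0.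
have [r r0 hr] := within_cvg_itv cf hx e0.
move: (hx); rewrite in_itv /= => /andP[cx xd].
have [y hy fy] : exists2 y, y \in `](Num.max c (x - r)), (Num.min d (x + r))[ &
    (y \in `]c, d[ -> f y <= M).
  apply: ae_exists => //; case: (leP c (x - r)) => ?; case: (leP d (x + r)) => ?; lra.
move: hy; rewrite in_itv /= gt_max lt_min => /andP[/andP[y1 y2] /andP[y3 y4]].
have := hr y; rewrite in_itv /= (ltW y1) (ltW y3) => /(_ isT).
have := fy; rewrite in_itv /= y1 y3 => /(_ isT) fy'.
move=> H; have := H ltac:(by rewrite ltr_norml; apply/andP; split; lra).
by rewrite ler_norml => /andP[? ?]; lra.
Qed.

Lemma ae_norm_within (f : R -> R) c d M : c < d -> {within `[c, d], continuous f} ->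
  {ae mu, forall x, x \in `]c, d[ -> `|f x| <= M} ->
  forall x, x \in `[c, d] -> `|f x| <= M.
Proof.
move=> cd cf h; apply: (ae_le_within (f := fun x => `|f x|)) => //.
move=> x; apply: continuous_comp; first exact: cf.
exact: norm_continuous.
Qed.

Lemma within_sub (f g : R -> R) c d : {within `[c, d], continuous f} ->
  {within `[c, d], continuous g} -> {within `[c, d], continuous (fun x => f x - g x)}.
Proof. by move=> cf cg x; apply: cvgB; [exact: cf|exact: cg]. Qed.

Lemma within_add (f g : R -> R) c d : {within `[c, d], continuous f} ->
  {within `[c, d], continuous g} -> {within `[c, d], continuous (fun x => f x + g x)}.
Proof. by move=> cf cg x; apply: cvgD; [exact: cf|exact: cg]. Qed.

Lemma within_mul (f g : R -> R) c d : {within `[c, d], continuous f} ->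
  {within `[c, d], continuous g} -> {within `[c, d], continuous (fun x => f x * g x)}.
Proof. by move=> cf cg x; apply: cvgM; [exact: cf|exact: cg]. Qed.

Lemma ae_eq_within (f g : R -> R) c d : c < d -> {within `[c, d], continuous f} ->
  {within `[c, d], continuous g} ->
  {ae mu, forall x, x \in `]c, d[ -> f x = g x} ->
  forall x, x \in `[c, d] -> f x = g x.
Proof.
move=> cd cf cg h x hx; apply/eqP; rewrite -subr_eq0 -normr_le0.
apply: (@ae_norm_within (fun x => f x - g x) c d) => //; first exact: within_sub.
by apply: ae_S h => y hy /hy ->; rewrite subrr normr0.
Qed.

(** The function agrees with its absolutely continuous representative everywhere,
    since both are continuous. *)
Lemma weak_ftc c d v w : c < d -> {within `[c, d], continuous v} -> weak_deriv c d v w ->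
  forall al be, c <= al -> al <= be -> be <= d -> v be - v al = itg al be w.
Proof.
move=> cd cv H; have [hv hw _] := H; have [A hA] := weak_rep cd H.
have E : forall x, x \in `[c, d] -> v x = A + itg c x w.
  apply: ae_eq_within hA => //; apply: within_add; last exact: itg_cont (ltW cd) hw.
  by apply: continuous_subspaceT; exact: cont_cst.
move=> al be h1 h2 h3; rewrite !E ?in_itv /=; [|lra|lra].
by rewrite (itg_split h1 h2) ?addrKA ?[RHS]addrC; [ring|apply: itb_sub hw; lra].
Qed.

Lemma weak_deriv_ae c d v v' w : measurable_fun `]c, d[ v' ->
  {ae mu, forall x, x \in `]c, d[ -> v x = v' x} ->
  weak_deriv c d v w -> weak_deriv c d v' w.
Proof.
move=> mv' h [hv hw H]; have hv' : itb c d v' by exact: itb_ae h hv.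
split=> // phi tphi; rewrite -(H _ tphi).
have [_ cphi _] := tphi.
have mphi : measurable_fun `]c, d[ (derive1 phi).
  by apply: (@itb_meas R); apply: itb_cont; exact: continuous_subspaceT.
apply: itg_ae.
- exact: measurable_funM.
- by apply: measurable_funM => //; exact: itb_meas hv.
- by apply: ae_S h => x hx /hx ->.
Qed.

(** Both derivatives have the same integrals over the intervals between Lebesgue
    points. *)
Lemma weak_unique c d v v' w w' : c < d -> weak_deriv c d v w -> weak_deriv c d v' w' ->
  {ae mu, forall x, x \in `]c, d[ -> v x = v' x} ->
  {ae mu, forall x, x \in `]c, d[ -> w x = w' x}.
Proof.
move=> cd H H' h; have [hv hw _] := H; have [hv' hw' _] := H'.
have {}H := weak_deriv_ae (itb_meas hv') h H.
have : {ae mu, forall x, x \in `]c, d[ -> w x - w' x = 0}.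
  apply: ae_eq0_avg; first exact: itbB.
  have [A hA] := weak_rep cd H; have [A' hA'] := weak_rep cd H'.
  have E : forall x, x \in `[c, d] -> A + itg c x w = A' + itg c x w'.
    apply: (ae_eq_within cd).
    - by apply: within_add; [apply: continuous_subspaceT; exact: cont_cst|exact: itg_cont (ltW cd) hw].
    - by apply: within_add; [apply: continuous_subspaceT; exact: cont_cst|exact: itg_cont (ltW cd) hw'].
    - by apply: ae_S2 hA hA' => x h1 h2 hx; rewrite -h1 // -h2.
  move=> al be ca ab bd; rewrite itgB; [|by apply: itb_sub hw; lra|by apply: itb_sub hw'; lra].
  have h1 := E al ltac:(rewrite in_itv /=; lra); have := E be ltac:(rewrite in_itv /=; lra).
  rewrite (itg_split (ltW ca) (ltW ab)); last by apply: itb_sub hw; lra.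
  rewrite (itg_split (ltW ca) (ltW ab)); last by apply: itb_sub hw'; lra.
  by move=> h2; lra.
by apply: ae_S => x hx /hx /eqP; rewrite subr_eq0 => /eqP.
Qed.

Lemma bounded_within (f : R -> R) c d : {within `[c, d], continuous f} ->
  exists M, forall x, x \in `[c, d] -> `|f x| <= M.
Proof.
move=> cf; have [cd|dc] := leP c d; last first.
  by exists 0 => x; rewrite in_itv /= => /andP[h1 h2]; lra.
have cn : {within `[c, d], continuous (fun x => `|f x|)}.
  by move=> x; apply: continuous_comp; [exact: cf|exact: norm_continuous].
have [y _ hy] := EVT_max cd cn.
by exists `|f y| => x hx; apply: hy.
Qed.

Lemma itb_mulc c d f g : itb c d f -> {within `[c, d], continuous g} ->
  itb c d (fun x => f x * g x).
Proof.
move=> hf cg; have [M hM] := bounded_within cg.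
apply: (itb_mulr hf (itb_meas (itb_cont cg)) (M := M)) => x hx.
by apply: hM; apply: subset_itv_oo_cc.
Qed.

Lemma test_off c d phi : test_function c d phi -> exists c' d', [/\ c < c', d' < d,
  forall x, x \notin `[c', d'] -> phi x = 0 &
  forall x, x \notin `[c', d'] -> derive1 phi x = 0].
Proof.
move=> [p1 p2 [c1 [d1 [cc1 dd1 p3]]]]; exists c1, d1; split => // x hx.
have nr : \near x, 0 = phi x.
  have : nbhs x (~` `[c1, d1]%classic).
    apply: open_nbhs_nbhs; split; last by move/negP: hx.
    by apply: closed_openC; exact: itv_closed.
  by apply: filterS => y /negP hy; rewrite p3.
have dc : is_derive x 1 phi 0.
  by apply: (near_eq_is_derive nr); exact: is_derive_cst.
by rewrite derive1E derive_val.
Qed.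

Lemma weak_restrict c d c' d' v w : c <= c' -> c' < d' -> d' <= d ->
  weak_deriv c d v w -> weak_deriv c' d' v w.
Proof.
move=> cc cd dd [hv hw H]; split; [exact: itb_sub hv|exact: itb_sub hw|].
move=> phi tphi; have [c1 [d1 [cc1 dd1 p3 p0]]] := test_off tphi.
have [p1 p2 _] := tphi; have cphi : continuous phi by exact: (derivable_cont p1).
have tphi' : test_function c d phi.
  by split=> //; exists c1, d1; split => //; lra.
have off x : x \notin `]c', d'[ -> x \notin `[c1, d1].
  by apply: contra; rewrite !in_itv /= => /andP[h1 h2]; apply/andP; split; lra.
have := H _ tphi'.
rewrite -!/(itg c d _) -!/(itg c' d' _) (@itg_supp _ c d c' d' _ cc (ltW cd) dd).
- rewrite (@itg_supp _ c d c' d' _ cc (ltW cd) dd) //.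
    by apply: itb_mulc => //; exact: continuous_subspaceT.
  by move=> x _ /off hx; rewrite p3 ?mulr0.
- exact: (itb_mulc hv (continuous_subspaceT p2)).
- by move=> x _ /off hx; rewrite p0 ?mulr0.
Qed.

Lemma weak_mul c d v w (psi psi' : R -> R) : weak_deriv c d v w ->
  (forall x, is_derive x 1 psi (psi' x)) -> continuous psi' ->
  weak_deriv c d (fun x => v x * psi x) (fun x => w x * psi x + v x * psi' x).
Proof.
move=> [hv hw H] dpsi cpsi'.
have cpsi : continuous psi by apply: derivable_cont => x; exact: (@ex_derive _ _ _ _ _ _ _ (dpsi x)).
have W (f : R -> R) : continuous f -> {within `[c, d], continuous f}.
  exact: continuous_subspaceT.
split; first by apply: itb_mulc => //; exact: W.
  by apply: itbD; apply: itb_mulc => //; exact: W.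
move=> phi tphi; have [c1 [d1 [cc1 dd1 p3 p0]]] := test_off tphi.
have [p1 p2 _] := tphi; have cphi : continuous phi by exact: (derivable_cont p1).
have dphi x : is_derive x 1 phi (derive1 phi x).
  by apply: DeriveDef; [exact: p1|rewrite derive1E].
have dpp x : is_derive x 1 (fun y => phi y * psi y) (phi x * psi' x + psi x * derive1 phi x).
  exact: derM.
have cpp : continuous (fun x => phi x * psi' x + psi x * derive1 phi x).
  by apply: contD; apply: contM.
have tpp : test_function c d (fun y => phi y * psi y).
  split; first by move=> x; exact: (@ex_derive _ _ _ _ _ _ _ (dpp x)).
    by rewrite (derive1_is dpp).
  by exists c1, d1; split => // x hx; rewrite p3 ?mul0r.
have := H _ tpp; rewrite (derive1_is dpp) -!/(itg c d _) => E.
have -> : itg c d (fun x => v x * psi x * derive1 phi x) =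
    itg c d (fun x => v x * (phi x * psi' x + psi x * derive1 phi x)) -
    itg c d (fun x => v x * (phi x * psi' x)).
  rewrite -itgB; [|by apply: itb_mulc => //; exact: W|by apply: itb_mulc => //; apply: W; exact: contM].
  by apply: itg_ext => x _; ring.
rewrite E -opprD; congr (- _); rewrite -itgD; last 2 first.
  - by apply: itb_mulc => //; apply: W; exact: contM.
  - by apply: itb_mulc => //; apply: W; exact: contM.
by apply: itg_ext => x _; ring.
Qed.

(** [weak_ftc] for the product of v and psi. *)
Lemma weak_parts c d v w (psi psi' : R -> R) : c < d -> {within `[c, d], continuous v} ->
  weak_deriv c d v w -> (forall x, is_derive x 1 psi (psi' x)) -> continuous psi' ->
  itg c d (fun x => w x * psi x) = v d * psi d - v c * psi c -
    itg c d (fun x => v x * psi' x).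
Proof.
move=> cd cv H dpsi cpsi'; have [hv hw _] := H.
have cpsi : continuous psi by apply: derivable_cont => x; exact: (@ex_derive _ _ _ _ _ _ _ (dpsi x)).
have W (f : R -> R) : continuous f -> {within `[c, d], continuous f}.
  exact: continuous_subspaceT.
rewrite (weak_ftc cd _ (weak_mul H dpsi cpsi') (lexx c) (ltW cd) (lexx d)); last first.
  by apply: within_mul => //; exact: W.
by rewrite itgD ?addrK //; apply: itb_mulc => //; exact: W.
Qed.

Lemma poly_der (p : {poly R}) x : is_derive x 1 (horner p) p^`().[x].
Proof. exact: is_derive_poly. Qed.

Lemma poly_cont (p : {poly R}) : continuous (horner p).
Proof. exact: continuous_horner. Qed.

Lemma itg_mono c d c' d' f : c <= c' -> c' <= d' -> d' <= d -> itb c d f ->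
  (forall x, x \in `]c, d[ -> 0 <= f x) -> itg c' d' f <= itg c d f.
Proof.
move=> cc cd dd hf f0.
rewrite (itg_split cc (le_trans cd dd)) // (itg_split cd dd); last by apply: itb_sub hf.
have h1 : 0 <= itg c c' f.
  by apply: itg_ge0 => x; rewrite in_itv /= => /andP[? ?]; apply: f0; rewrite in_itv /=; apply/andP; split; lra.
have h2 : 0 <= itg d' d f.
  by apply: itg_ge0 => x; rewrite in_itv /= => /andP[? ?]; apply: f0; rewrite in_itv /=; apply/andP; split; lra.
by lra.
Qed.

Definition chain c d n (D : nat -> R -> R) := forall j, (j < n)%N -> weak_deriv c d (D j) (D j.+1).

(** By induction on n: the polynomial for the first derivative is integrated, and
    the constant comes from the absolutely continuous representative. *)
Lemma taylor c d n D : c < d -> chain c d n.+1 D -> exists Q : {poly R},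
  (size Q <= n.+1)%N /\ {ae mu, forall x, x \in `]c, d[ ->
     `|D 0%N x - Q.[x]| <= (d - c) ^+ n * itg c d (fun y => `|D n.+1 y|)}.
Proof.
move=> cd; elim: n D => [|n IH] D ch.
  have [A hA] := weak_rep cd (ch 0%N isT); have [_ h1 _] := ch 0%N isT.
  exists A%:P; split; first exact: size_polyC_leq1.
  apply: ae_S hA => x h hx; rewrite h // hornerC addrC addKr expr0 mul1r.
  move: hx; rewrite in_itv /= => /andP[cx xd].
  apply: le_trans (itg_norm _) _; first by apply: itb_sub h1; lra.
  by apply: itg_mono => //; [lra|lra|exact: itb_abs].
have [|Q1 [sQ1 hQ1]] := IH (fun j => D j.+1); first by move=> j hj; apply: ch.
have [A hA] := weak_rep cd (ch 0%N isT); have [_ h1 _] := ch 0%N isT.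
pose P := prim Q1 - (prim Q1).[c]%:P.
have dP x : is_derive x 1 (horner P) Q1.[x].
  by have := poly_der P x; rewrite derivB deriv_prim derivC subr0.
exists (A%:P + P); split.
  rewrite (leq_trans (size_polyD _ _)) // geq_max (leq_trans (size_polyC_leq1 _)) //=.
  rewrite (leq_trans (size_polyD _ _)) // geq_max size_polyN (leq_trans (size_polyC_leq1 _)) // andbT.
  by rewrite (leq_trans (size_poly _ _)).
apply: ae_S hA => x h hx; rewrite h // hornerD hornerC opprD addrACA subrr add0r.
move: hx; rewrite in_itv /= => /andP[cx xd].
have -> : P.[x] = itg c x (horner Q1).
  rewrite (itg_ftc (ltW cx) dP (poly_cont (p := _))).
  by rewrite [X in _ - X]hornerD hornerN hornerC subrr subr0.
have i1 : itb c x (D 1%N) by apply: itb_sub h1; lra.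
have i2 : itb c x (horner Q1) by apply: itb_cont; apply: continuous_subspaceT; exact: poly_cont.
rewrite -itgB //; apply: le_trans (itg_ae_bound (ltW cx) (itbB i1 i2) _) _.
  apply: ae_S hQ1 => y + hy; apply; move: hy; rewrite !in_itv /= => /andP[? ?]; apply/andP; split; lra.
rewrite exprS -mulrA [leRHS]mulrC; apply: ler_wpM2l; last lra.
by apply: mulr_ge0; [apply: exprn_ge0; lra|apply: itg_ge0 => ? _].
Qed.

End AbsoluteContinuity.

(** * Functions of time and space *)

Lemma abs_fine_le (R : realType) (y : \bar R) : (`|fine y|%:E <= `|y|)%E.
Proof. by case: y => [r| |] //=; rewrite normr0 leey. Qed.

Lemma itb_restrict (R : realType) (c d : R) (f g : R -> R) :
  (@lebesgue_measure R).-integrable setT (EFin \o g) ->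
  (forall x, x \in `]c, d[ -> g x = f x) -> itb c d f.
Proof.
move=> hg gf; apply: (itb_ext gf).
by apply: (integrableS _ _ _ hg) => //; exact: measurable_itv.
Qed.

Section RealFubini.
Context {R : realType}.
Local Notation mu := (@lebesgue_measure R).
Variable F : R * R -> R.
Hypothesis iF : (mu \x mu)%E.-integrable setT (EFin \o F).

Lemma Rfubini_int1 : mu.-integrable setT (EFin \o (fun t => \int[mu]_x F (t, x))).
Proof.
have h := integrable_fubini_F iF.
apply: (le_integrable measurableT _ _ h).
  apply/measurable_EFinP; apply: measurableT_comp; first exact: fine_measurable.
  exact: measurable_int h.
by move=> t _; exact: abs_fine_le.
Qed.

Lemma fubini_G_integrable : mu.-integrable setT (fubini_G mu (EFin \o F)).
Proof.
have mF : measurable_fun setT (EFin \o F) by exact: measurable_int iF.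
pose F' (z : R * R) := (EFin \o F) (z.2, z.1).
have mF' : measurable_fun setT F'.
  by apply: measurableT_comp mF _; exact: measurable_swap.
have iF' : (mu \x mu)%E.-integrable setT F'.
  by apply/integrable12ltyP => //; apply/(integrable21ltyP mu mu mF).
exact: (integrable_fubini_F iF').
Qed.

Lemma Rfubini_int2 : mu.-integrable setT (EFin \o (fun x => \int[mu]_t F (t, x))).
Proof.
have h := fubini_G_integrable.
apply: (le_integrable measurableT _ _ h).
  apply/measurable_EFinP; apply: measurableT_comp; first exact: fine_measurable.
  exact: measurable_int h.
by move=> t _; exact: abs_fine_le.
Qed.

Lemma Rfubini : \int[mu]_t (\int[mu]_x F (t, x)) = \int[mu]_x (\int[mu]_t F (t, x)).
Proof.
have key (G : R -> \bar R) : mu.-integrable setT G ->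
    (\int[mu]_t (fine (G t))%:E = \int[mu]_t G t)%E.
  move=> iG; apply: ae_eq_integral => //.
  - apply/measurable_EFinP; apply: measurableT_comp; first exact: fine_measurable.
    exact: measurable_int iG.
  - exact: measurable_int iG.
  - have := integrable_ae measurableT iG; apply: filterS => x h _.
    by rewrite fineK //; exact: h.
rewrite {1}/Rintegral {2}/Rintegral.
rewrite (key _ (integrable_fubini_F iF)) (key _ fubini_G_integrable).
by congr fine; exact: (Fubini iF).
Qed.

End RealFubini.

Section SpaceTime.
Context {R : realType} (a b T : R).
Hypotheses (hab : a < b) (hT : 0 < T).
Local Notation mu := (@lebesgue_measure R).
Implicit Types (V : R -> R -> R) (k phi : R -> R).

(** The bound is asked at almost every time for almost every point of space, which
    is what the Sobolev embedding on the elements gives. *)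
Definition stbdd (M : R) V :=
  measurable_fun (`]0, T] `*` `]a, b[) (fun z : R * R => V z.1 z.2) /\
  {ae mu, forall t, t \in `]0, T[ -> {ae mu, forall x, x \in `]a, b[ -> `|V t x| <= M}}.

Definition bker (B : R) k :=
  measurable_fun `]a, b[ k /\ forall x, x \in `]a, b[ -> `|k x| <= B.

Lemma section_meas V t : measurable_fun (`]0, T] `*` `]a, b[) (fun z : R * R => V z.1 z.2) ->
  t \in `]0, T] -> measurable_fun `]a, b[ (V t).
Proof.
move=> mV ht; have -> : V t = (fun z : R * R => V z.1 z.2) \o (fun x => (t, x)) by [].
apply: (measurable_comp _ _ mV).
- by apply: measurableX; exact: measurable_itv.
- by move=> z [x hx <-]; split.
- by apply: (measurable_funS measurableT) => //; exact: pair1_measurable.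
Qed.

Definition stF V k phi (z : R * R) : R :=
  ((fun z : R * R => V z.1 z.2) \_ (`]0, T[ `*` `]a, b[)) z * (k \_ `]a, b[) z.2 * phi z.1.

Lemma stF_int V M k B phi : stbdd M V -> bker B k -> continuous phi ->
  (mu \x mu)%E.-integrable setT (EFin \o stF V k phi).
Proof.
move=> [mV bV] [mk bk] cphi.
have [P hP] := bounded_within (continuous_subspaceT cphi (A := `[0, T])).
have mS : measurable (`]0, T[ `*` `]a, b[ : set (R * R)).
  by apply: measurableX; exact: measurable_itv.
have mF : measurable_fun setT (stF V k phi).
  apply: measurable_funM; last first.
    by apply: measurableT_comp => //; exact: continuous_measurable_fun.
  apply: measurable_funM; last first.
    apply: measurableT_comp; last exact: measurable_snd.
    by apply/(measurable_restrictT _ _).1.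
  apply/(measurable_restrictT _ _).1 => //.
  apply: measurable_funS mV.
    by apply: measurableX; exact: measurable_itv.
  by move=> z [/= h1 h2]; split => //; move: h1; exact: subset_itv_oo_oc.
apply/integrable12ltyP; first exact/measurable_EFinP.
pose C := `|M| * `|B| * `|P|.
apply: (@le_lt_trans _ _ (\int[mu]_t ((C * (b - a))%:E * (\1_`]0, T[ t)%:E))%E).
  apply: ae_ge0_le_integral => //.
  - by move=> t _; apply: integral_ge0.
  - have mm : measurable_fun setT (fun z => `|(stF V k phi z)%:E|%E).
      by apply: measurableT_comp => //; exact/measurable_EFinP.
    exact: (measurable_fun_fubini_tonelli_F (m2 := mu) _ mm).
  - by move=> t _; rewrite -EFinM lee_fin mulr_ge0 // mulr_ge0 // ?subr_ge0 ?(ltW hab) // mulr_ge0 // mulr_ge0.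
  - apply: emeasurable_funM => //; apply/measurable_EFinP; exact: measurable_indic.
  - move: bV; apply: ae_S => t bt _.
    rewrite indicE; case: (boolP (t \in `]0, T[)) => ht; last first.
      rewrite (_ : (t \in _) = false) ?mule0; last by apply/negbTE; rewrite notin_setE; exact/negP.
      rewrite integral0_eq // => x _ /=; rewrite /stF patchE memNset ?mul0r ?normr0 //.
      by move=> [/=]; rewrite (negbTE ht).
    rewrite mem_set // mule1; have {}bt := bt ht.
    have -> : (C * (b - a))%:E = (\int[mu]_x (C%:E * (\1_`]a, b[ x)%:E))%E.
      rewrite ge0_integralZl //.
      - by rewrite integral_indic // setIT; have /= -> := mu_itv hab.
      - by apply/measurable_EFinP; exact: measurable_indic.
      - by rewrite lee_fin mulr_ge0 // mulr_ge0.
    apply: ae_ge0_le_integral => //.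
    + apply: measurableT_comp => //; apply/measurable_EFinP.
      exact: (measurableT_comp mF (pair1_measurable t)).
    + by move=> x _; rewrite -EFinM lee_fin mulr_ge0 // mulr_ge0 // mulr_ge0.
    + by apply: emeasurable_funM => //; apply/measurable_EFinP; exact: measurable_indic.
    + move: bt; apply: ae_S => x bx _; rewrite indicE /stF /=.
      case: (boolP (x \in `]a, b[)) => hx; last first.
        rewrite (_ : (x \in _) = false) ?mule0; last by apply/negbTE; rewrite notin_setE; exact/negP.
        by rewrite patchE memNset ?mul0r ?normr0 // => -[/= _]; rewrite (negbTE hx).
      rewrite mem_set // mule1 lee_fin !patchE !mem_set //= !normrM.
      apply: ler_pM => //.
        by apply: ler_pM => //; [apply: le_trans (bx hx) (ler_norm _)|apply: le_trans (bk _ hx) (ler_norm _)].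
      by apply: le_trans (hP _ _) (ler_norm _); apply: subset_itv_oo_cc.
have -> : (\int[mu]_t ((C * (b - a))%:E * (\1_`]0, T[ t)%:E) = (C * (b - a) * T)%:E)%E.
  rewrite ge0_integralZl //.
  - by rewrite integral_indic // setIT; have /= -> := mu_itv hT; rewrite subr0.
  - by apply/measurable_EFinP; exact: measurable_indic.
  - by rewrite lee_fin mulr_ge0 // ?subr_ge0 ?(ltW hab) // mulr_ge0 // mulr_ge0.
by rewrite ltry.
Qed.

Lemma stF_row V k phi t : \int[mu]_x stF V k phi (t, x) =
  ((fun t => itg a b (fun x => V t x * k x * phi t)) \_ `]0, T[) t.
Proof.
rewrite patchE; case: ifPn => ht.
  rewrite /itg [RHS]Rintegral_mkcond; apply: eq_Rintegral => x _.
  rewrite /stF !patchE /=; case: (boolP (x \in `]a, b[%classic)) => hx.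
    by rewrite mem_set //=; split; [move: ht|move: hx]; rewrite inE.
  by rewrite mulr0 mul0r.
have -> : (fun x => stF V k phi (t, x)) = (fun=> 0).
  apply/funext => x; rewrite /stF patchE memNset ?mul0r // => -[/= h _].
  by move/negP: ht; apply; rewrite inE.
by rewrite /Rintegral integral0.
Qed.

Lemma stF_col V k phi x : \int[mu]_t stF V k phi (t, x) =
  ((fun x => itg 0 T (fun t => V t x * k x * phi t)) \_ `]a, b[) x.
Proof.
rewrite patchE; case: ifPn => hx.
  rewrite /itg [RHS]Rintegral_mkcond; apply: eq_Rintegral => t _.
  rewrite /stF !patchE /=; case: (boolP (t \in `]0, T[%classic)) => ht.
    rewrite hx mem_set //=; split; [move: ht|move: hx]; by rewrite inE.
  rewrite memNset ?mul0r // => -[/= h _].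
  by move/negP: ht; apply; rewrite inE.
have -> : (fun t => stF V k phi (t, x)) = (fun=> 0).
  apply/funext => t; rewrite /stF patchE memNset ?mul0r // => -[/= _ h].
  by move/negP: hx; apply; rewrite inE.
by rewrite /Rintegral integral0.
Qed.

Lemma st_int1 V M k B phi : stbdd M V -> bker B k -> continuous phi ->
  itb 0 T (fun t => itg a b (fun x => V t x * k x * phi t)).
Proof.
move=> hV hk hphi; apply: (itb_restrict (Rfubini_int1 (stF_int hV hk hphi))) => t ht.
by rewrite /= stF_row patchE mem_set.
Qed.

Lemma st_int2 V M k B phi : stbdd M V -> bker B k -> continuous phi ->
  itb a b (fun x => itg 0 T (fun t => V t x * k x * phi t)).
Proof.
move=> hV hk hphi; apply: (itb_restrict (Rfubini_int2 (stF_int hV hk hphi))) => t ht.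
by rewrite /= stF_col patchE mem_set.
Qed.

Lemma st_swap V M k B phi : stbdd M V -> bker B k -> continuous phi ->
  itg 0 T (fun t => itg a b (fun x => V t x * k x * phi t)) =
  itg a b (fun x => itg 0 T (fun t => V t x * k x * phi t)).
Proof.
move=> hV hk hphi; have := Rfubini (stF_int hV hk hphi).
have -> : (fun t => \int[mu]_x stF V k phi (t, x)) =
    ((fun t => itg a b (fun x => V t x * k x * phi t)) \_ `]0, T[).
  by apply/funext => t; exact: stF_row.
have -> : (fun x => \int[mu]_t stF V k phi (t, x)) =
    ((fun x => itg 0 T (fun t => V t x * k x * phi t)) \_ `]a, b[).
  by apply/funext => t; exact: stF_col.
by rewrite -!Rintegral_mkcond.
Qed.

Lemma bker1 : bker 1 (fun=> 1).
Proof. by split=> // x _; rewrite normr1. Qed.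

Lemma st_row_int V M : stbdd M V ->
  {ae mu, forall t, t \in `]0, T[ -> itb a b (V t) /\ {ae mu, forall x, x \in `]a, b[ -> `|V t x| <= M}}.
Proof.
move=> [mV bV]; apply: ae_S bV => t bt ht; have {}bt := bt ht; split=> //.
have mVt : measurable_fun `]a, b[ (V t).
  by apply: section_meas mV _; exact: subset_itv_oo_oc.
pose W x := Num.min M (Num.max (- M) (V t x)).
have hW : itb a b W.
  have M0 : 0 <= M.
    have [x hx hb] := ae_exists hab bt.
    exact: le_trans (hb hx).
  apply: (itb_bounded (M := M)).
    by apply: measurable_minr => //; apply: measurable_maxr.
  by move=> x _; rewrite ler_norml /W le_min le_max ge_min !lexx /= andbT; lra.
apply: itb_ae hW => //; apply: ae_S bt => x hx /hx; rewrite ler_norml /W => /andP[h1 h2].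
by rewrite max_r // min_r.
Qed.

Lemma st_col_int V M phi : stbdd M V -> continuous phi ->
  {ae mu, forall x, x \in `]a, b[ -> itb 0 T (fun t => V t x * phi t)}.
Proof.
move=> hV hphi; have := ae_integrable2 (stF_int hV bker1 hphi).
apply: ae_S => x h hx.
apply: (itb_restrict (g := fun t => stF V (fun=> 1) phi (t, x)) h) => t ht.
by rewrite /stF !patchE /= !mem_set //= mulr1.
Qed.

Lemma st_kernel V M k B : stbdd M V -> bker B k ->
  itb 0 T (fun t => itg a b (fun x => V t x * k x)).
Proof.
move=> hV hk; have := st_int1 hV hk (@cont_cst R 1).
by apply: itb_ext => t _; apply: itg_ext => x _; rewrite mulr1.
Qed.

Lemma st_time V M phi : stbdd M V -> continuous phi ->
  itb a b (fun x => itg 0 T (fun t => V t x * phi t)).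
Proof.
move=> hV hphi; have := st_int2 hV bker1 hphi.
by apply: itb_ext => t _; apply: itg_ext => x _; rewrite mulr1.
Qed.

Lemma st_swap' V M k B phi : stbdd M V -> bker B k -> continuous phi ->
  itg 0 T (fun t => itg a b (fun x => V t x * k x) * phi t) =
  itg a b (fun x => itg 0 T (fun t => V t x * phi t) * k x).
Proof.
move=> hV hk hphi; have [mk bk] := hk.
have i1 : itb 0 T (fun t => itg a b (fun x => V t x * k x) * phi t).
  by apply: itb_mulc; [exact: st_kernel hV hk|exact: continuous_subspaceT].
have i2 : itb a b (fun x => itg 0 T (fun t => V t x * phi t) * k x).
  by apply: (itb_mulr (st_time hV hphi) mk bk).
rewrite (itg_ae (g := fun t => itg a b (fun x => V t x * k x * phi t)) (itb_meas i1)).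
- rewrite (st_swap hV hk hphi); apply: itg_ae.
  + exact: itb_meas (st_int2 hV hk hphi).
  + exact: itb_meas i2.
  + apply: ae_S (st_col_int hV hphi) => x h hx; have {}h := h hx.
    rewrite mulrC -itgZ //; apply: itg_ext => t _; ring.
- exact: itb_meas (st_int1 hV hk hphi).
- apply: ae_S (st_row_int hV) => t h ht; have [{}h _] := h ht.
  rewrite mulrC -itgZ; first by apply: itg_ext => x _; ring.
  exact: itb_mulr h mk bk.
Qed.

(** Fubini's theorem exchanges the integrals in space and in time. *)
Lemma st_weak V V' M M' k B : stbdd M V -> stbdd M' V' -> @weak_tderiv R a b T V V' ->
  bker B k -> weak_deriv 0 T (fun t => itg a b (fun x => V t x * k x))
    (fun t => itg a b (fun x => V' t x * k x)).
Proof.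
move=> hV hV' H hk; have [mk bk] := hk; split; [exact: st_kernel hV hk|exact: st_kernel hV' hk|].
move=> phi tphi; have [p1 p2 _] := tphi; have cphi := derivable_cont p1.
rewrite -!/(itg 0 T _) (st_swap' hV hk p2) (st_swap' hV' hk cphi) -itgN; last first.
  by apply: (itb_mulr (st_time hV' cphi) mk bk).
apply: itg_ae.
- by apply: itb_meas; apply: (itb_mulr (st_time hV p2) mk bk).
- by apply: itb_meas; apply: itbN; apply: (itb_mulr (st_time hV' cphi) mk bk).
- by apply: ae_S (H _ tphi) => x h hx; rewrite /itg h // mulNr.
Qed.

End SpaceTime.

Section TimeRegularity.
Context {R : realType}.
Local Notation mu := (@lebesgue_measure R).

(** Reduces limits in time to sequences, for which there is dominated convergence. *)
Lemma cvg_by_seq (A : set R) (t : R) (H : R -> R) (l : R) :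
  (forall s_ : nat -> R, (forall n, A (s_ n) /\ s_ n != t) ->
     s_ n @[n --> \oo] --> t -> H (s_ n) @[n --> \oo] --> l) ->
  H s @[s --> within A t^'] --> l.
Proof.
move=> h; apply/cvgrPdist_le => e e0; apply: contrapT => hn.
have {}hn (d : R) : 0 < d -> exists z, [/\ `|t - z| < d, z != t, A z & e < `|l - H z|].
  move=> d0; apply: contrapT => hz; apply: hn; apply/within_dnbhsP; exists d => // z tz zt Az.
  by rewrite leNgt; apply/negP => lz; apply: hz; exists z.
have hs n := cid (hn n.+1%:R^-1 ltac:(by rewrite invr_gt0)).
pose s_ n := sval (hs n).
have s_P n : [/\ `|t - s_ n| < n.+1%:R^-1, s_ n != t, A (s_ n) & e < `|l - H (s_ n)|] := svalP (hs n).
have s_t : s_ n @[n --> \oo] --> t.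
  apply/cvgrPdist_le => e' e'0; near=> n.
  have [h1 _ _ _] := s_P n; apply: le_trans (ltW h1) _.
  rewrite invf_ple ?posrE //; apply: le_trans (_ : n%:R <= _); last by rewrite ler_nat.
  by near: n; exact: nbhs_infty_ger.
have hA n : A (s_ n) /\ s_ n != t by have [] := s_P n.
have /cvgrPdist_le /(_ e e0) [n0 _ /(_ n0 (leqnn n0))] := h s_ hA s_t.
by rewrite leNgt; have [_ _ _ ->] := s_P n0.
Unshelve. all: by end_near. Qed.

Lemma within_by_dnbhs (c d : R) (f : R -> R) :
  (forall t, t \in `[c, d] -> f s @[s --> within `[c, d]%classic t^'] --> f t) ->
  {within `[c, d], continuous f}.
Proof.
move=> h; apply/subspace_continuousP => t ht.
apply/cvgrPdist_le => e e0; rewrite near_withinE.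
have /cvgrPdist_le /(_ e e0) := h t ht; move=> /within_dnbhsP[r r0 hr].
apply/nbhs_normP; exists r => // z /= tz zA.
have [->|zt] := eqVneq z t; first by rewrite subrr normr0 ltW.
exact: hr.
Qed.

Lemma within_lip (c d : R) (f : R -> R) (K : R) :
  (forall s t, s \in `[c, d] -> t \in `[c, d] -> `|f s - f t| <= K * `|s - t|) ->
  {within `[c, d], continuous f}.
Proof.
move=> h; apply: within_by_dnbhs => t ht; apply/cvgrPdist_le => e e0.
apply/within_dnbhsP; exists (e / (`|K| + 1)); first by rewrite divr_gt0 // ltr_wpDl.
move=> z tz zt zA; apply: le_trans (h _ _ ht zA) _.
have : (`|K| + 1) * `|t - z| <= e by rewrite mulrC -ler_pdivlMr ?ltr_wpDl // ltW.
apply: le_trans; apply: ler_wpM2r => //.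
by apply: le_trans (ler_norm _) _; rewrite lerDl.
Qed.

Variables (a b T : R).
Hypotheses (hab : a < b) (hT : 0 < T).

Definition ind (al be x : R) : R := if (al < x) && (x < be) then 1 else 0.

Lemma bker_ind al be : bker a b 1 (ind al be).
Proof.
split=> [|x _]; last by rewrite /ind; case: ifP => _; rewrite ?normr1 ?normr0.
have -> : ind al be = \1_(`]al, be[%classic).
  apply/funext => x; rewrite indicE /ind; case: ifPn => hx.
    by rewrite mem_set //= in_itv.
  by rewrite memNset //= in_itv; exact/negP.
exact: measurable_indic.
Qed.

Lemma itg_ind v al be : a <= al -> al <= be -> be <= b -> itb a b v ->
  itg a b (fun x => v x * ind al be x) = itg al be v.
Proof.
move=> h1 h2 h3 hv; rewrite (itg_supp h1 h2 h3).
- by apply: itg_ext => x; rewrite in_itv /ind => ->; rewrite mulr1.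
- by have [mk bk] := bker_ind al be; exact: itb_mulr hv mk bk.
- by move=> x _; rewrite in_itv /ind => /negbTE ->; rewrite mulr0.
Qed.

Section Family.
Variables (v : R -> R -> R) (V1 : R -> R -> R) (M : R).
Hypothesis hv : forall t, t \in `[0, T] -> {within `[a, b], continuous (v t)}.
Hypotheses (bv : exists M0, stbdd a b T M0 v) (bV1 : stbdd a b T M V1)
  (wv : @weak_tderiv R a b T v V1).

(** The integrals over subintervals are continuous in time and have bounded weak
    derivatives, hence are Lipschitz continuous at every time; the differentiation
    theorem then gives the values at points. *)
Lemma lipschitz_in_time :
  (forall al be, a <= al -> al < be -> be <= b ->
     {within `[0, T], continuous (fun t => itg al be (v t))}) ->
  forall s t x, s \in `[0, T] -> t \in `[0, T] -> x \in `[a, b] ->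
    `|v s x - v t x| <= M * `|s - t|.
Proof.
move=> hc; have [M0 bv0] := bv.
have M_ge0 : 0 <= M.
  have [t ht h] := ae_exists hT (st_row_int hab bV1); have [_ {}h] := h ht.
  by have [x hx {}h] := ae_exists hab h; exact: le_trans (h hx).
move=> s t x hs ht hx; wlog : s t hs ht / s <= t => [H|].
  by have [/H|/ltW/H] := leP s t; [exact|rewrite distrC [`|s - t|]distrC; exact].
move=> st'; have -> : `|s - t| = t - s by rewrite distrC ger0_norm ?subr_ge0.
have hint r : r \in `[0, T] -> itb a b (v r) by move=> hr; apply: itb_cont; exact: hv.
apply: (ae_norm_within (f := fun x => v s x - v t x) hab) hx; first by apply: within_sub; exact: hv.
apply: ae_bound_avg => [|al be h1 h2 h3]; first by apply: itbB; exact: hint.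
have wd := st_weak hab hT bv0 bV1 wv (bker_ind al be).
have i0 r : r \in `[0, T] -> itg a b (fun x => v r x * ind al be x) = itg al be (v r).
  by move=> hr; apply: itg_ind; rewrite ?ltW //; exact: hint.
have cG : {within `[0, T], continuous (fun r => itg a b (fun x => v r x * ind al be x))}.
  apply: subspace_eq_continuous (hc al be (ltW h1) h2 (ltW h3)) => r.
  by rewrite inE => hr; exact/esym/i0.
move: (hs) (ht); rewrite !in_itv /= => /andP[s0 sT] /andP[t0 tT].
rewrite itgB; try by apply: itb_sub (hint _ _) => //; exact: ltW.
have := weak_ftc hT cG wd s0 st' tT; rewrite !i0 // => E.
rewrite distrC E mulrAC; apply: itg_ae_bound => //.
  by have [_ h _] := wd; apply: itb_sub h.
apply: ae_S (st_row_int hab bV1) => r hr; rewrite in_itv /= => /andP[r1 r2].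
have [ir br] := hr ltac:(rewrite in_itv /=; lra).
rewrite (itg_ind (ltW h1) (ltW h2) (ltW h3) ir); apply: (itg_ae_bound (ltW h2)).
  by apply: itb_sub ir; exact: ltW.
by apply: ae_S br => x0 hx0 h; apply: hx0; move: h; rewrite !in_itv /=; lra.
Qed.

Hypothesis lip : forall s t x, s \in `[0, T] -> t \in `[0, T] -> x \in `[a, b] ->
    `|v s x - v t x| <= M * `|s - t|.

Lemma kernel_within k B : bker a b B k ->
  {within `[0, T], continuous (fun t => itg a b (fun x => v t x * k x))}.
Proof.
move=> [mk bk]; apply: (@within_lip _ _ _ (M * B * (b - a))) => s t hs ht.
have hint r : r \in `[0, T] -> itb a b (v r) by move=> hr; apply: itb_cont; exact: hv.
have hk r : r \in `[0, T] -> itb a b (fun x => v r x * k x).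
  by move=> hr; exact: itb_mulr (hint r hr) mk bk.
rewrite -itgB; [|exact: hk|exact: hk].
rewrite mulrAC; apply: itg_bound; rewrite ?ltW //; first by apply: itbB; exact: hk.
move=> x hx; rewrite -mulrBl normrM mulrAC; apply: ler_pM => //; last exact: bk.
by apply: lip => //; exact: subset_itv_oo_cc hx.
Qed.

Variables (k_ : nat -> R -> R) (B_ : nat -> R) (L : (R -> R) -> R) (C_ : nat -> R) (C : R).
Hypotheses (bk : forall n, bker a b (B_ n) (k_ n)) (CC : C_ n @[n --> \oo] --> C)
  (kL : forall w : R -> R, {within `[a, b], continuous w} ->
     itg a b (fun x => w x * k_ n x) @[n --> \oo] --> L w).

(** A bound on the action of the kernels at almost every time passes to the limit
    functional at every time. *)
Lemma functional_bound :
  (forall n, {ae mu, forall t, t \in `]0, T[ -> `|itg a b (fun x => v t x * k_ n x)| <= C_ n}) ->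
  forall t, t \in `[0, T] -> `|L (v t)| <= C.
Proof.
move=> h t ht; apply: (ler_cvg_to _ CC); first exact: cvg_norm (kL (hv ht)).
by apply: nearW => n; apply: (ae_norm_within hT (kernel_within (bk n)) (h n)).
Qed.

Lemma kernel_ftc n s t : 0 <= s -> s <= t -> t <= T ->
  itg a b (fun x => v t x * k_ n x) - itg a b (fun x => v s x * k_ n x) =
  itg s t (fun r => itg a b (fun x => V1 r x * k_ n x)).
Proof.
move=> s0 st tT; have [M0 bv0] := bv.
exact: (weak_ftc hT (kernel_within (bk n)) (st_weak hab hT bv0 bV1 wv (bk n)) s0 st tT).
Qed.

Lemma kernel_sub n s t : s \in `[0, T] -> t \in `[0, T] ->
  itg a b (fun x => (v s x - v t x) * k_ n x) =
  itg a b (fun x => v s x * k_ n x) - itg a b (fun x => v t x * k_ n x).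
Proof.
move=> hs ht; have [mk hk] := bk n.
have hint r : r \in `[0, T] -> itb a b (fun x => v r x * k_ n x).
  by move=> hr; apply: itb_mulr mk hk; apply: itb_cont; exact: hv.
rewrite -itgB; [|exact: hint|exact: hint].
by apply: itg_ext => x _; rewrite mulrBl.
Qed.

Lemma functional_lipschitz :
  (forall n, {ae mu, forall t, t \in `]0, T[ -> `|itg a b (fun x => V1 t x * k_ n x)| <= C_ n}) ->
  forall s t, s \in `[0, T] -> t \in `[0, T] ->
    `|L (fun x => v s x - v t x)| <= C * `|s - t|.
Proof.
move=> h s t hs ht.
have cw : {within `[a, b], continuous (fun x => v s x - v t x)} by apply: within_sub; exact: hv.
have CC' : (C_ n * `|s - t|) @[n --> \oo] --> C * `|s - t|.
  by apply: cvgM => //; exact: cvg_cst.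
apply: (ler_cvg_to (cvg_norm (kL cw)) CC').
apply: nearW => n; rewrite kernel_sub //.
wlog : s t hs ht {cw CC'} / s <= t => [H|st].
  by have [/H|/ltW/H] := leP s t; [exact|rewrite distrC [`|s - t|]distrC; exact].
have -> : `|s - t| = t - s by rewrite distrC ger0_norm ?subr_ge0.
rewrite distrC; move: (hs) (ht); rewrite !in_itv /= => /andP[s0 sT] /andP[t0 tT].
rewrite kernel_ftc //; apply: itg_ae_bound => //.
  by apply: itb_sub (st_kernel hab hT bV1 (bk n)).
by apply: ae_S (h n) => r hr hr'; apply: hr; move: hr'; rewrite !in_itv /=; lra.
Qed.

Variables (V2 : R -> R -> R).
Hypotheses (bV2 : exists M2, stbdd a b T M2 V2) (wV1 : @weak_tderiv R a b T V1 V2).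

(** The action of one kernel is a function of time with a Lipschitz continuous
    derivative; the mean value theorem is applied to its increment over a time e. *)
Lemma functional_second_difference :
  (forall n, {ae mu, forall t, t \in `]0, T[ -> `|itg a b (fun x => V2 t x * k_ n x)| <= C_ n}) ->
  forall s t e, 0 <= s -> 0 <= t -> 0 <= e -> s + e <= T -> t + e <= T ->
    `|L (fun x => v (s + e) x - v s x - (v (t + e) x - v t x))| <= C * `|s - t| * e.
Proof.
move=> h s t e s0 t0 e0 sT tT; have [M2 bV2'] := bV2.
have in0T r : 0 <= r -> r <= T -> r \in `[0, T] by move=> ? ?; rewrite in_itv /=; lra.
have wS r r' : r \in `[0, T] -> r' \in `[0, T] ->
  {within `[a, b], continuous (fun x => v r x - v r' x)}.
  by move=> hr hr'; apply: within_sub; exact: hv.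
have cw : {within `[a, b], continuous (fun x => v (s + e) x - v s x - (v (t + e) x - v t x))}.
  by apply: within_sub; apply: wS; apply: in0T; lra.
have CC' : (C_ n * `|s - t| * e) @[n --> \oo] --> C * `|s - t| * e.
  by apply: cvgM; [apply: cvgM => //; exact: cvg_cst|exact: cvg_cst].
apply: (ler_cvg_to (cvg_norm (kL cw)) CC').
apply: nearW => n.
have -> : itg a b (fun x => (v (s + e) x - v s x - (v (t + e) x - v t x)) * k_ n x) =
    itg a b (fun x => (v (s + e) x - v s x) * k_ n x) - itg a b (fun x => (v (t + e) x - v t x) * k_ n x).
  have [mk hk] := bk n.
  rewrite -itgB; first by apply: itg_ext => x _; rewrite mulrBl.
    by apply: itb_mulr mk hk; apply: itb_cont; apply: wS; apply: in0T; lra.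
  by apply: itb_mulr mk hk; apply: itb_cont; apply: wS; apply: in0T; lra.
have wd := st_weak hab hT bV1 bV2' wV1 (bk n).
set g1 := (fun t => itg a b (fun x => V1 t x * k_ n x)) in wd.
set g2 := (fun t => itg a b (fun x => V2 t x * k_ n x)) in wd.
have [i1 i2 _] := wd; have [A hA] := weak_rep hT wd.
have Cn0 : 0 <= C_ n by have [x hx H] := ae_exists hT (h n); exact: le_trans (H hx).
pose g r := A + itg 0 r g2.
have lipg' r r' : 0 <= r -> r <= r' -> r' <= T -> `|g r - g r'| <= C_ n * `|r - r'|.
  move=> h1 h2 h3; rewrite distrC [`|r - r'|]distrC [`|r' - r|]ger0_norm ?subr_ge0 //.
  rewrite /g (itg_split h1 h2); last by apply: itb_sub i2.
  rewrite (_ : A + (itg 0 r g2 + itg r r' g2) - (A + itg 0 r g2) = itg r r' g2); last ring.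
  apply: itg_ae_bound => //; first by apply: itb_sub i2.
  by apply: ae_S (h n) => z hz hz'; apply: hz; move: hz'; rewrite !in_itv /=; lra.
have lipg r r' : 0 <= r <= T -> 0 <= r' <= T -> `|g r - g r'| <= C_ n * `|r - r'|.
  move=> /andP[h1 h2] /andP[h3 h4]; have [rr|/ltW rr] := leP r r'; first exact: lipg'.
  by rewrite distrC [`|r - r'|]distrC; exact: lipg'.
pose f r := g (Num.max 0 (Num.min T r)).
have cf : continuous f by exact: (clamp_continuous (ltW hT) Cn0 lipg).
have fE r : 0 <= r <= T -> f r = g r by move=> /andP[h1 h2]; rewrite /f min_r // max_r.
have [F dF] := antiderivative (-1) cf.
have GE r r' : 0 <= r -> r <= r' -> r' <= T ->
    itg a b (fun x => (v r' x - v r x) * k_ n x) = F r' - F r.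
  move=> h1 h2 h3; rewrite kernel_sub; [|apply: in0T; lra|apply: in0T; lra].
  rewrite kernel_ftc // -/g1.
  have cfi c d : itb c d f by apply: itb_cont; exact: continuous_subspaceT.
  rewrite (itg_ae (g := f)).
  - by apply: itg_ftc_on => // x hx; apply: dF; lra.
  - by apply: (@itb_meas R); apply: itb_sub i1.
  - by apply: (@itb_meas R).
  - apply: ae_S hA => z hz hz'; rewrite hz ?fE //; move: hz'; rewrite !in_itv /=; lra.
rewrite (GE s (s + e)) ?lerDl // (GE t (t + e)) ?lerDl //.
pose H r := F (r + e) - F r.
have dH (r : R) : 0 <= r -> is_derive r 1 H (f (r + e) - f r).
  by move=> hr; apply: derB; [apply: der_shift|]; apply: dF; lra.
have cH (r : R) : 0 <= r -> {for r, continuous H}.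
  by move=> hr; apply: differentiable_continuous; apply/derivable1_diffP; exact: (@ex_derive _ _ _ _ _ _ _ (dH r hr)).
rewrite -/(H s) -/(H t).
wlog : s t s0 t0 sT tT {cw CC'} / s <= t => [W|st].
  by have [/W|/ltW/W] := leP s t; [exact|rewrite distrC [`|s - t|]distrC; exact].
have [r||c] := @MVT_segment R H (fun r => f (r + e) - f r) s t st.
- by rewrite in_itv /= => /andP[? ?]; apply: dH; lra.
- apply/subspace_continuousP => r; rewrite /= in_itv /= => /andP[r1 r2].
  by apply: cvg_within_filter; apply: cH; lra.
rewrite in_itv /= => /andP[c1 c2] E.
rewrite distrC E normrM mulrAC; apply: ler_pM => //; last by rewrite distrC.
rewrite !fE; [|lra|lra]; apply: le_trans (lipg _ _ _ _) _; [lra|lra|].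
by rewrite addrC addKr ger0_norm.
Qed.

End Family.
End TimeRegularity.

(** * Meshes and broken Sobolev spaces *)

Section SquareIntegrable.
Context {R : realType}.
Local Notation mu := (@lebesgue_measure R).
Implicit Types (f g : R -> R) (c d : R).

Lemma sqre_poweR (X : \bar R) : (0 <= X)%E -> (X ^+ 2 = X `^ 2%:R)%E.
Proof.
case: X => [r| |] //= r0.
  by rewrite -EFinM -expr2 powR_mulrn.
by rewrite mulyy pnatr_eq0.
Qed.

Lemma L2norm_sqr c d f : (L2norm c d f ^+ 2 = \int[mu]_(x in `]c, d[) (f x ^+ 2)%:E)%E.
Proof.
rewrite /L2norm sqre_poweR ?Lnorm_ge0 // poweR_Lnorm ?pnatr_eq0 //.
rewrite [RHS]integral_mkcond; apply: eq_integral => x _ /=.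
rewrite !patchE; case: ifP => _ /=; last by rewrite normr0 powR0 ?pnatr_eq0.
by rewrite powR_mulrn // real_normK ?num_real.
Qed.

Lemma L2norm_le_itg c d f K : measurable_fun `]c, d[ f ->
  (L2norm c d f ^+ 2 <= (K ^+ 2)%:E)%E ->
  itb c d (fun x => f x ^+ 2) /\ itg c d (fun x => f x ^+ 2) <= K ^+ 2.
Proof.
rewrite L2norm_sqr => mf h.
have i2 : itb c d (fun x => f x ^+ 2).
  apply/integrableP; split; first by apply/measurable_EFinP; exact: measurable_funX.
  apply: le_lt_trans (ltry (K ^+ 2)); apply: le_trans h.
  rewrite le_eqVlt; apply/orP; left; apply/eqP; apply: eq_integral => x _ /=.
  by rewrite ger0_norm ?sqr_ge0.
split=> //; rewrite -lee_fin /itg /Rintegral fineK //.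
by apply: integrable_fin_num.
Qed.

Lemma itg_L2norm_le c d f C : 0 <= C -> itb c d (fun x => f x ^+ 2) ->
  itg c d (fun x => f x ^+ 2) <= C ^+ 2 -> (L2norm c d f <= C%:E)%E.
Proof.
move=> C0 i2 h.
have : (L2norm c d f ^+ 2 <= (C ^+ 2)%:E)%E.
  rewrite L2norm_sqr; move: h; rewrite -lee_fin /itg /Rintegral fineK //.
  by apply: integrable_fin_num.
have : (0 <= L2norm c d f)%E by exact: Lnorm_ge0.
case: (L2norm c d f) => [r| |] //=.
by rewrite !lee_fin => r0; rewrite ler_sqr ?nnegrE.
Qed.

Lemma itg_L1_L2 c d f : c <= d -> itb c d f -> itb c d (fun x => f x ^+ 2) ->
  itg c d (fun x => `|f x|) <= Num.sqrt ((d - c) * itg c d (fun x => f x ^+ 2)).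
Proof.
rewrite le_eqVlt => /predU1P[<-|cd] i1 i2; first by rewrite itg_empty // sqrtr_ge0.
set I1 := itg c d _; set I2 := itg c d _.
have h0 : 0 < d - c by rewrite subr_gt0.
have I10 : 0 <= I1 by apply: itg_ge0.
have I20 : 0 <= I2 by apply: itg_ge0 => x _; exact: sqr_ge0.
pose l := I1 / (d - c).
have : 0 <= itg c d (fun x => f x ^+ 2 - (2 * l * `|f x| - l ^+ 2)).
  apply: itg_ge0 => x _; rewrite -(real_normK (num_real (f x))).
  by have := sqr_ge0 (`|f x| - l); rewrite sqrrB mulr2n; lra.
have ia := itb_abs i1.
rewrite itgB //; last by apply: itbB; [exact: itbZ|exact: itb_cst].
rewrite itgB; [|exact: itbZ|exact: itb_cst].
rewrite itgZ // itg_cst; last exact: ltW.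
rewrite -/I1 -/I2 => h.
rewrite -(ger0_norm I10) -sqrtr_sqr ler_sqrt; last by rewrite mulr_ge0 // ltW.
have : I1 ^+ 2 / (d - c) <= I2.
  move: h; rewrite /l (_ : I2 - _ = I2 - I1 ^+ 2 / (d - c)) ?subr_ge0 //.
  by field; rewrite gt_eqF.
by rewrite ler_pdivrMr // mulrC.
Qed.

Lemma itb_mul_ind c d c' d' f : itb c' d' f -> itb c d (fun x => f x * ind c' d' x).
Proof.
move=> hf; have h : mu.-integrable setT (EFin \o (f \_ `]c', d'[)).
  by rewrite -restrict_EFin; apply/integrable_restrict => //; rewrite setTI.
apply: (itb_restrict h) => x _; rewrite patchE /ind; case: ifPn => hx.
  by move: hx; rewrite inE /= in_itv /= => ->; rewrite mulr1.
by rewrite ifF ?mulr0 //; apply/negbTE; move: hx; rewrite notin_setE /= in_itv /= => /negP.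
Qed.

End SquareIntegrable.

Section Meshes.
Context {R : realType} {a b : R} (m : mesh a b).
Local Notation mu := (@lebesgue_measure R).
Local Notation N := (nelt m).
Local Notation x := (node m).

Lemma node_mono i j : (i <= j <= N)%N -> x i <= x j.
Proof.
case/andP=> ij; elim: j ij => [|j IH] ij jN; first by move: ij; rewrite leqn0 => /eqP ->.
move: ij; rewrite leq_eqVlt => /predU1P[->//|ij].
by apply: le_trans (IH ij (ltnW jN)) _; apply: ltW; exact: node_lt.
Qed.

Lemma node_bounds i : (i <= N)%N -> a <= x i <= b.
Proof.
move=> iN; have := @node_mono 0 i; have := @node_mono i N.
by rewrite node_first node_last leq0n iN leqnn => -> // ->.
Qed.

Lemma elt_lt (i : 'I_N) : x i < x i.+1.
Proof. exact: node_lt (ltn_ord i). Qed.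

Lemma elt_ge (i : 'I_N) : a <= x i.
Proof. by have /andP[] := node_bounds (ltnW (ltn_ord i)). Qed.

Lemma elt_le (i : 'I_N) : x i.+1 <= b.
Proof. by have /andP[] := node_bounds (ltn_ord i). Qed.

Lemma mesh_find y : y \in `]a, b[ -> (forall i, (i <= N)%N -> y != x i) ->
  exists i : 'I_N, y \in `](x i), (x i.+1)[.
Proof.
rewrite in_itv /= => /andP[ay yb] hy.
have ex : exists i, (i <= N)%N && (y < x i) by exists N; rewrite leqnn node_last.
case: (ex_minnP ex) => -[|i] /andP[iN yi] hmin.
  by move: yi; rewrite node_first ltNge (ltW ay).
exists (Ordinal iN); rewrite in_itv /= yi andbT lt_neqAle eq_sym hy ?(ltnW iN) //=.
rewrite leNgt; apply/negP => h; have := hmin i; rewrite h (ltnW iN) => /(_ isT).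
by rewrite ltnn.
Qed.

Lemma ae_mesh (P : R -> Prop) :
  (forall i : 'I_N, {ae mu, forall y, y \in `](x i), (x i.+1)[ -> P y}) ->
  {ae mu, forall y, y \in `]a, b[ -> P y}.
Proof.
move=> h.
have h1 : {ae mu, forall y, forall i, (i <= N)%N -> y != x i}.
  by apply: ae_forall => i; apply: ae_S (ae_pred (x i)) => y.
have h2 : {ae mu, forall y, forall i, forall iN : (i < N)%N, y \in `](x i), (x i.+1)[ -> P y}.
  apply: ae_forall => i; case: (boolP (i < N)%N) => iN; last by apply: ae_true => y iN'; move: iN; rewrite iN'.
  by apply: ae_S (h (Ordinal iN)) => y hy _.
apply: ae_S2 h1 h2 => y h1 h2 hy; have [i hi] := mesh_find hy h1.
exact: h2 (ltn_ord i) hi.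
Qed.

Lemma itg_mesh f : itb a b f -> itg a b f = \sum_(i < N) itg (x i) (x i.+1) f.
Proof.
move=> hf; have key n : (n <= N)%N -> itg (x 0%N) (x n) f = \sum_(i < n) itg (x i) (x i.+1) f.
  elim: n => [|n IH] nN; first by rewrite big_ord0 itg_empty.
  rewrite big_ord_recr /= -IH ?(ltnW nN) //; apply: itg_split.
  - by apply: node_mono; rewrite leq0n ltnW.
  - exact/ltW/node_lt.
  - apply: itb_sub hf; first by rewrite node_first.
    by have /andP[] := node_bounds nN.
by rewrite -key // node_first node_last.
Qed.

End Meshes.

Section Pieces.
Context {R : realType} {a b : R}.
Local Notation mu := (@lebesgue_measure R).
Implicit Types (m : mesh a b) (W : R -> R).

(** K only provides integrability and may depend on the mesh; K0 is the constant of
    the error estimate. *)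
Definition pieces m (s : nat) (K K0 : R) W (D : 'I_(nelt m) -> nat -> R -> R) : Prop :=
  [/\ forall i : 'I_(nelt m), D i 0%N = W,
      forall i : 'I_(nelt m), chain (node m i) (node m i.+1) s (D i),
      forall (i : 'I_(nelt m)) l, (l <= s)%N -> itb (node m i) (node m i.+1) (fun x => D i l x ^+ 2) /\
        itg (node m i) (node m i.+1) (fun x => D i l x ^+ 2) <= K ^+ 2 &
      \sum_(i < nelt m) itg (node m i) (node m i.+1) (fun x => D i s x ^+ 2) <= K0 ^+ 2].

Lemma chain_itb c d s D l : chain c d s D -> (0 < s)%N -> (l <= s)%N -> @itb R c d (D l).
Proof.
move=> ch s0; case: l => [|l] ls; first by have [] := ch 0%N s0.
by have [] := ch l ls.
Qed.

Lemma sobolev_pieces m s (K : R) W : (0 < s)%N -> 0 <= K ->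
  (forall i : 'I_(nelt m), sobolev_le (node m i) (node m i.+1) s K W) ->
  exists D, @pieces m s K (Num.sqrt (nelt m)%:R * K) W D.
Proof.
move=> s0 K0 h; have hD i := cid (h i).
exists (fun i => sval (hD i)).
have P i := svalP (hD i).
have H (i : 'I_(nelt m)) l : (l <= s)%N -> itb (node m i) (node m i.+1) (fun x => sval (hD i) l x ^+ 2) /\
        itg (node m i) (node m i.+1) (fun x => sval (hD i) l x ^+ 2) <= K ^+ 2.
  move=> ls; have [_ mD _ [_ hs]] := P i; apply: L2norm_le_itg; first exact: mD.
  apply: le_trans hs; have ls' : (l < s.+1)%N by [].
  rewrite (bigD1 (Ordinal ls')) //= leeDl //; apply: sume_ge0 => j _.
  by apply: mule_ge0; exact: Lnorm_ge0.
split=> //.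
- by move=> i; have [] := P i.
- by move=> i; have [_ _ hc _] := P i.
- rewrite exprMn sqr_sqrtr ?ler0n //.
  apply: (le_trans (ler_sum _ (fun i _ => (H i s (leqnn s)).2))).
  by rewrite sumr_const card_ord mulr_natl.
Qed.

Lemma chain_agree c d c' d' s D D' : Num.max c c' < Num.min d d' ->
  @chain R c d s D -> chain c' d' s D' ->
  {ae mu, forall x, x \in `](Num.max c c'), (Num.min d d')[ -> D 0%N x = D' 0%N x} ->
  forall l, (l <= s)%N ->
  {ae mu, forall x, x \in `](Num.max c c'), (Num.min d d')[ -> D l x = D' l x}.
Proof.
move=> cd ch ch' h; elim=> [|l IH] ls //; apply: (weak_unique cd _ _ (IH (ltnW ls))).
- by apply: weak_restrict (ch l ls) => //; rewrite ?le_max ?ge_min lexx.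
- by apply: weak_restrict (ch' l ls) => //; rewrite ?le_max ?ge_min lexx orbT.
Qed.

(** On the intersection of two elements the derivatives agree by uniqueness, so that
    both sums are the integral of one function. *)
Lemma pieces_remesh m m0 s K K0 K' K0' W W' D D' : (0 < s)%N ->
  {ae mu, forall x, x \in `]a, b[ -> W x = W' x} ->
  @pieces m s K K0 W D -> @pieces m0 s K' K0' W' D' -> @pieces m s K K0' W D.
Proof.
move=> s0 WW [D0 ch DK _] [D0' ch' DK' S']; split=> //.
pose Z2 x := \sum_(j < nelt m0) D' j s x ^+ 2 * ind (node m0 j) (node m0 j.+1) x.
have iZ : itb a b Z2.
  have : forall r : seq 'I_(nelt m0), itb a b (fun x => \sum_(j <- r) D' j s x ^+ 2 * ind (node m0 j) (node m0 j.+1) x).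
    elim=> [|j r IH].
      by apply: itb_ext (itb_cst a b 0) => x _; rewrite big_nil.
    apply: itb_ext (itbD (itb_mul_ind a b (DK' j s (leqnn s)).1) IH) => x _.
    by rewrite big_cons.
  by apply.
have Zj (j : 'I_(nelt m0)) y : y \in `](node m0 j), (node m0 j.+1)[ -> Z2 y = D' j s y ^+ 2.
  move=> hy; rewrite /Z2 (bigD1 j) //= big1 ?addr0 => [|j' j'j].
    by move: hy; rewrite in_itv /ind => ->; rewrite mulr1.
  rewrite /ind ifF ?mulr0 //; apply/negbTE; move: hy; rewrite in_itv /= => /andP[y1 y2].
  rewrite negb_and -!leNgt; have [lt|lt|e] := ltngtP j j'.
  - by rewrite (le_trans (ltW y2)) //; apply: node_mono; rewrite lt ltnW.
  - rewrite orbC (le_trans _ (ltW y1)) //; apply: node_mono; rewrite lt /=.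
    exact: ltnW.
  - by move: j'j; rewrite (ord_inj e) eqxx.
have Zi (i : 'I_(nelt m)) : {ae mu, forall y, y \in `](node m i), (node m i.+1)[ -> D i s y ^+ 2 = Z2 y}.
  have h (j : 'I_(nelt m0)) : {ae mu, forall y, y \in `](node m0 j), (node m0 j.+1)[ ->
      y \in `](node m i), (node m i.+1)[ -> D i s y ^+ 2 = Z2 y}.
    have [cd|dc] := ltP (Num.max (node m i) (node m0 j)) (Num.min (node m i.+1) (node m0 j.+1)).
      have := @chain_agree _ _ _ _ s _ _ cd (ch i) (ch' j) _ s (leqnn s); rewrite D0 D0' => H.
      apply: (@ae_S _ _ _ _ (H _)) => [y hy h1 h2|].
        rewrite (Zj j) // hy //; move: h1 h2; rewrite !in_itv /= gt_max lt_min.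
        by move=> /andP[-> ->] /andP[-> ->].
      apply: ae_S WW => y hy h1; apply: hy; move: h1; rewrite !in_itv /= gt_max lt_min.
      move=> /andP[/andP[h1 h2] /andP[h3 h4]]; apply/andP; split.
        exact: le_lt_trans (elt_ge i) h1.
      exact: lt_le_trans h3 (elt_le i).
    apply: ae_true => y; rewrite !in_itv /= => /andP[h1 h2] /andP[h3 h4].
    have : Num.max (node m i) (node m0 j) < Num.min (node m i.+1) (node m0 j.+1).
      by rewrite gt_max !lt_min; apply/andP; split; apply/andP; split; lra.
    by move=> h; lra.
  apply: ae_S (ae_mesh h) => y hy hi; apply: hy => //; move: (hi); rewrite !in_itv /=.
  move=> /andP[h1 h2]; apply/andP; split.
    exact: le_lt_trans (elt_ge i) h1.
  exact: lt_le_trans h2 (elt_le i).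
rewrite (eq_bigr (fun i : 'I_(nelt m) => itg (node m i) (node m i.+1) Z2)); last first.
  move=> i _; apply: itg_ae (Zi i).
  - by apply: (@itb_meas R); exact: (DK i s (leqnn s)).1.
  - by apply: (@itb_meas R); apply: itb_sub iZ; [exact: elt_ge|exact: elt_le].
rewrite -(itg_mesh m iZ) (itg_mesh m0 iZ); apply: le_trans S'.
by apply: ler_sum => j _; apply: eq_lew; apply: itg_ext => y; exact: Zj.
Qed.

(** The Sobolev embedding on the elements. *)
Lemma pieces_bounded m s (K : R) : (0 < s)%N -> 0 <= K -> exists M, forall W K0 D,
  @pieces m s K K0 W D -> {ae mu, forall y, y \in `]a, b[ -> `|W y| <= M}.
Proof.
move=> s0 K0.
pose h (i : 'I_(nelt m)) := node m i.+1 - node m i.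
pose M (i : 'I_(nelt m)) := Num.sqrt (h i * K ^+ 2) / h i + 2 * Num.sqrt (h i * K ^+ 2).
have h0 i : 0 < h i by rewrite subr_gt0 elt_lt.
have M0 i : 0 <= M i.
  by rewrite /M addr_ge0 ?mulr_ge0 ?sqrtr_ge0 // invr_ge0 ltW.
exists (\sum_i M i) => W K0' D [D0 ch DK _]; apply: (ae_mesh (m := m)) => i.
have b1 l : (l <= s)%N -> itg (node m i) (node m i.+1) (fun y => `|D i l y|) <= Num.sqrt (h i * K ^+ 2).
  move=> ls; have [i2 k2] := DK i l ls.
  apply: le_trans (itg_L1_L2 (ltW (elt_lt i)) (chain_itb (ch i) s0 ls) i2) _.
  by apply: ler_wsqrtr; apply: ler_wpM2l => //; exact/ltW/h0.
have [A hA] := weak_rep (elt_lt i) (ch i 0%N s0).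
have i0 := chain_itb (ch i) s0 (leq0n s); have i1 := chain_itb (ch i) s0 s0.
have osc y : y \in `](node m i), (node m i.+1)[ ->
    `|itg (node m i) y (D i 1%N)| <= Num.sqrt (h i * K ^+ 2).
  rewrite in_itv /= => /andP[y1 y2]; apply: le_trans (itg_norm _) _.
    by apply: itb_sub i1 => //; exact: ltW.
  apply: le_trans (b1 1%N s0); apply: itg_mono => //; try exact: ltW.
  exact: itb_abs.
have bA : `|A| <= Num.sqrt (h i * K ^+ 2) / h i + Num.sqrt (h i * K ^+ 2).
  rewrite -lerBlDr ler_pdivlMr // -itg_cst; last exact/ltW/elt_lt.
  set sq := Num.sqrt (h i * K ^+ 2).
  have H : itg (node m i) (node m i.+1) (fun=> `|A| - sq) <=
      itg (node m i) (node m i.+1) (fun y => `|D i 0%N y|).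
    apply: itg_ae_le; [exact: itb_cst|exact: itb_abs|].
    apply: ae_S hA => y hy h1; rewrite hy // lerBlDr.
    have := osc y h1; rewrite -/sq; set J := itg _ _ _ => hJ.
    have := ler_normB (A + J) J; rewrite addrK => hA'; lra.
  exact: (le_trans H (b1 0%N (leq0n s))).
apply: ae_S hA => y hy h1; rewrite -(D0 i) hy //.
apply: le_trans (ler_normD _ _) _; apply: le_trans (lerD bA (osc y h1)) _.
rewrite (bigD1 i) //=; apply: le_trans (_ : _ <= M i) _; first by rewrite /M; lra.
by rewrite lerDl; apply: sumr_ge0.
Qed.

End Pieces.

Section Regularity.
Context {R : realType} (a b T : R).
Hypotheses (hab : a < b) (hT : 0 < T).
Local Notation mu := (@lebesgue_measure R).

(** K0 is one constant for all the times and all the time derivatives, while the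
    existence of M and K is enough. *)
Definition regular (m : mesh a b) (r s : nat) (K0 : R) (v : R -> R -> R)
    (V : nat -> R -> R -> R) : Prop :=
  [/\ V 0%N = v,
      forall j, (j <= r)%N -> exists M, stbdd a b T M (V j),
      forall j, (j <= r)%N -> exists K, {ae mu, forall t, t \in `]0, T[ ->
        exists D, @pieces R a b m s K K0 (V j t) D} &
      forall j, (j < r)%N -> @weak_tderiv R a b T (V j) (V j.+1)].

Lemma Winfty_regular m r s v : (0 < s)%N -> bochner_Winfty m T r s v ->
  exists K0 V, regular m r s K0 v V.
Proof.
move=> s0 [V [V0 hV wV]].
have key j : (j <= r)%N -> exists2 K : R, 0 <= K & {ae mu, forall t, t \in `]0, T[ ->
    exists D, @pieces R a b m s K (Num.sqrt (nelt m)%:R * K) (V j t) D}.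
  move=> jr; have [_ [K hK]] := hV j jr.
  exists (Num.max 0 K); first by rewrite le_max lexx.
  apply: ae_S hK => t h ht; have {}h := h (subset_itv_oo_oc ht).
  have [N0|N0] := posnP (nelt m).
    have E : a = b := etrans (esym (node_first m)) (etrans (congr1 (node m) (esym N0)) (node_last m)).
    by exfalso; have := lt_eqF hab; rewrite (introT eqP E).
  have K0 : 0 <= K by have [D [_ _ _ []]] := h (Ordinal N0).
  rewrite max_r //; exact: sobolev_pieces.
have ex (j : nat) : exists K : R, (j <= r)%N -> 0 <= K /\ {ae mu, forall t, t \in `]0, T[ ->
    exists D, @pieces R a b m s K (Num.sqrt (nelt m)%:R * K) (V j t) D}.
  case: (boolP (j <= r)%N) => jr; last by exists 0.
  by have [K K0 hK] := key j jr; exists K.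
have [K hK] := choice ex.
exists (\sum_(j < r.+1) Num.sqrt (nelt m)%:R * K j), V; split=> // j jr.
- have [K0 hKj] := hK j jr.
  have [M hM] := pieces_bounded m s0 K0.
  exists M; split; first by have [] := hV j jr.
  by apply: ae_S hKj => t h ht; have [D /hM] := h ht.
- have [K0 hKj] := hK j jr; exists (K j); apply: ae_S hKj => t h ht.
  have [D [D1 D2 D3 D4]] := h ht; exists D; split=> //.
  apply: le_trans D4 _; have jr' : (j < r.+1)%N by [].
  have p i : (i <= r)%N -> 0 <= Num.sqrt (nelt m)%:R * K i.
    by move=> ir; rewrite mulr_ge0 ?sqrtr_ge0 //; have [] := hK i ir.
  have s1 : 0 <= \sum_(j0 < r.+1 | j0 != Ordinal jr') Num.sqrt (nelt m)%:R * K j0.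
    by apply: sumr_ge0 => i _; apply: p; rewrite -ltnS.
  rewrite (bigD1 (Ordinal jr')) //= ler_sqr ?nnegrE ?addr_ge0 ?p //.
  by rewrite lerDl.
Qed.

(** Rational end points leave countably many conditions, which hold simultaneously
    at almost every time. *)
Lemma ae_eq_rat (W W' : R -> R) : itb a b W -> itb a b W' ->
  (forall q : rat, a < ratr q < b -> itg a (ratr q) W = itg a (ratr q) W') ->
  {ae mu, forall x, x \in `]a, b[ -> W x = W' x}.
Proof.
move=> hW hW' hq; have hB := itbB hW hW'.
have cF := itg_cont (ltW hab) hB.
have F0 x : x \in `[a, b] -> itg a x (fun y => W y - W' y) = 0.
  move=> hx; apply/eqP; rewrite -normr_le0; apply/ler_addgt0Pr => e e0; rewrite add0r.
  have [r r0 hr] := within_cvg_itv cF hx e0; move: (hx); rewrite in_itv /= => /andP[ax xb].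
  have lt : Num.max a (x - r) < Num.min b (x + r).
    have hab' := hab; by case: (leP a (x - r)) => ?; case: (leP b (x + r)) => ?; lra.
  have [q] := rat_in_itvoo lt; rewrite in_itv /= gt_max lt_min => /andP[/andP[q1 q2] /andP[q3 q4]].
  have := hr (ratr q); rewrite in_itv /= (ltW q1) (ltW q3) => /(_ isT).
  rewrite (_ : itg a (ratr q) (fun y => W y - W' y) = 0) ?subr0.
    by apply; rewrite ltr_norml; apply/andP; split; lra.
  rewrite itgB ?hq ?subrr ?q1 //; by [apply: itb_sub hW => //; exact: ltW|apply: itb_sub hW' => //; exact: ltW].
have : {ae mu, forall x, x \in `]a, b[ -> W x - W' x = 0}.
  apply: ae_eq0_avg => // al be h1 h2 h3.
  have := @itg_split R a al be _ (ltW h1) (ltW h2) (itb_sub (lexx a) (ltW h3) hB).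
  rewrite !F0 ?in_itv /=; [by rewrite add0r => <-|lra|lra].
by apply: ae_S => x hx /hx /eqP; rewrite subr_eq0 => /eqP.
Qed.

(** By induction on j: the integrals up to a rational point have unique weak
    derivatives in time. *)
Lemma regular_unique m m' r s K0 K0' v V V' : regular m r s K0 v V ->
  regular m' r s K0' v V' -> forall j, (j <= r)%N ->
  {ae mu, forall t, t \in `]0, T[ -> {ae mu, forall x, x \in `]a, b[ -> V j t x = V' j t x}}.
Proof.
move=> [V0 bV _ wV] [V0' bV' _ wV']; elim=> [|j IH] jr.
  by apply: ae_true => t _; apply: ae_true => x _; rewrite V0 V0'.
have {}IH := IH (ltnW jr).
have [M0 B0] := bV j (ltnW jr); have [M1 B1] := bV j.+1 jr.
have [M0' B0'] := bV' j (ltnW jr); have [M1' B1'] := bV' j.+1 jr.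
have Q (q : rat) : a < ratr q < b -> {ae mu, forall t, t \in `]0, T[ ->
    itg a (ratr q) (V j.+1 t) = itg a (ratr q) (V' j.+1 t)}.
  move=> /andP[q1 q2]; have kk := bker_ind a b a (ratr q).
  have w1 := st_weak hab hT B0 B1 (wV j jr) kk.
  have w2 := st_weak hab hT B0' B1' (wV' j jr) kk.
  have E (U : R -> R) : itb a b U -> itg a b (fun x => U x * ind a (ratr q) x) = itg a (ratr q) U.
    by move=> hU; apply: itg_ind; rewrite ?lexx ?(ltW q1) ?(ltW q2).
  have e0 : {ae mu, forall t, t \in `]0, T[ -> itg a b (fun x => V j t x * ind a (ratr q) x) =
     itg a b (fun x => V' j t x * ind a (ratr q) x)}.
    apply: ae_S2 (ae_and (st_row_int hab B0) (st_row_int hab B0')) IH => t [h1 h2] h ht.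
    have [i1 _] := h1 ht; have [i2 _] := h2 ht; have [mk bk] := kk.
    apply: itg_ae.
    - by apply: itb_meas; exact: itb_mulr i1 mk bk.
    - by apply: itb_meas; exact: itb_mulr i2 mk bk.
    - by apply: ae_S (h ht) => x hx /hx ->.
  apply: ae_S2 (ae_and (st_row_int hab B1) (st_row_int hab B1')) (weak_unique hT w1 w2 e0) => t [h1 h2] h ht.
  have [i1 _] := h1 ht; have [i2 _] := h2 ht.
  by have := h ht; rewrite !E.
have Qall : {ae mu, forall t, forall n : nat, if unpickle n is Some q then
    a < ratr (q : rat) < b -> t \in `]0, T[ ->
    itg a (ratr q) (V j.+1 t) = itg a (ratr q) (V' j.+1 t) else True}.
  apply: ae_forall => n; case: (unpickle n) => [q|]; last exact: ae_true.
  case: (boolP (a < ratr q < b)) => hq; last exact: ae_true.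
  by apply: ae_S (Q q hq) => t h _.
apply: ae_S2 (ae_and (st_row_int hab B1) (st_row_int hab B1')) Qall => t [h1 h2] h ht.
have [i1 _] := h1 ht; have [i2 _] := h2 ht.
by apply: ae_eq_rat => // q hq; have := h (pickle q); rewrite pickleK; apply.
Qed.

(** Classically, some mesh makes the function regular or none does; the constant of
    one mesh serves for all by [pieces_remesh]. *)
Lemma uniform_regularity r s v : (0 < s)%N -> exists2 K0, 0 <= K0 &
  forall m, bochner_Winfty m T r s v -> exists V, regular m r s K0 v V.
Proof.
move=> s0.
have [[m0 h0]|no] := pselect (exists m0 : mesh a b, bochner_Winfty m0 T r s v); last first.
  by exists 0 => // m hm; exfalso; apply: no; exists m.
have [K0 [V0 reg0]] := Winfty_regular s0 h0; exists `|K0| => // m hm.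
have [K [V reg]] := Winfty_regular s0 hm; exists V.
have uni := regular_unique reg reg0.
have [a1 a2 a3 a4] := reg; have [_ _ b3 _] := reg0; split=> // j jr.
have [K1 h1] := a3 j jr; have [K2 h2] := b3 j jr; exists K1.
apply: ae_S2 (ae_and h1 h2) (uni j jr) => t [g1 g2] e ht.
have [D hD] := g1 ht; have [D' hD'] := g2 ht; exists D.
have [d1 d2 d3 d4] := pieces_remesh s0 (e ht) hD hD'.
by split=> //; rewrite real_normK ?num_real.
Qed.

End Regularity.

(** * Functionals of point values and integrals on the elements *)

Section MeshSums.
Context {R : realType} {a b : R} (m : mesh a b).
Local Notation N := (nelt m).
Local Notation x := (node m).

Lemma sum_ind_elt (f : 'I_N -> R) (i : 'I_N) y : y \in `](x i), (x i.+1)[ ->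
  \sum_(j < N) ind (x j) (x j.+1) y * f j = f i.
Proof.
move=> hy; rewrite (bigD1 i) //= big1 ?addr0 => [|j ji].
  by move: hy; rewrite in_itv /ind => ->; rewrite mul1r.
rewrite /ind ifF ?mul0r //; apply/negbTE; move: hy; rewrite in_itv /= => /andP[y1 y2].
rewrite negb_and -!leNgt; have [lt|lt|e] := ltngtP i j.
- by rewrite (le_trans (ltW y2)) //; apply: node_mono; rewrite lt ltnW.
- rewrite orbC (le_trans _ (ltW y1)) //; apply: node_mono; rewrite lt /=.
  exact: ltnW.
- by move: ji; rewrite (ord_inj e) eqxx.
Qed.

End MeshSums.

Section Kernels.
Context {R : realType} (a b : R).
Implicit Types k : R -> R.

Definition bounded_kernel k : Prop := exists B, bker a b B k.

Lemma bkD k k' : bounded_kernel k -> bounded_kernel k' -> bounded_kernel (fun x => k x + k' x).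
Proof.
move=> [B [m1 h1]] [B' [m2 h2]]; exists (B + B'); split; first exact: measurable_funD.
by move=> x hx; apply: le_trans (ler_normD _ _) (lerD (h1 x hx) (h2 x hx)).
Qed.

Lemma bkM k k' : bounded_kernel k -> bounded_kernel k' -> bounded_kernel (fun x => k x * k' x).
Proof.
move=> [B [m1 h1]] [B' [m2 h2]]; exists (B * B'); split; first exact: measurable_funM.
by move=> x hx; rewrite normrM; apply: ler_pM => //; [exact: h1|exact: h2].
Qed.

Lemma bk_cont k : continuous k -> bounded_kernel k.
Proof.
move=> ck; have ck' : {within `[a, b], continuous k} by exact: continuous_subspaceT.
have [M hM] := bounded_within ck'; exists M; split; first exact: itb_meas (itb_cont ck').
by move=> x hx; apply: hM; exact: subset_itv_oo_cc hx.
Qed.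

Lemma bk_ind al be : bounded_kernel (ind al be).
Proof. by exists 1; exact: bker_ind. Qed.

Lemma bk_sum (I : Type) (r : seq I) (F : I -> R -> R) : (forall i, bounded_kernel (F i)) ->
  bounded_kernel (fun x => \sum_(i <- r) F i x).
Proof.
move=> h; elim: r => [|i r IH].
  by rewrite (_ : (fun x => _) = (fun=> 0)); [apply: bk_cont; exact: cont_cst|apply/funext => x; rewrite big_nil].
rewrite (_ : (fun x => _) = (fun x => F i x + \sum_(j <- r) F j x)); first exact: bkD.
by apply/funext => x; rewrite big_cons.
Qed.

End Kernels.

Section PointValues.
Context {R : realType}.
Local Notation mu := (@lebesgue_measure R).
Implicit Types (w W : R -> R) (c d y lam : R).

(** Average of a function over the homothetic image, of ratio lam and center y, of
    the interval (c, d). *)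
Definition havg lam y c d w : R :=
  itg (y - lam * (y - c)) (y + lam * (d - y)) w / (lam * (d - c)).

Lemma havg_cvg y c d w : c < d -> y \in `[c, d] -> {within `[c, d], continuous w} ->
  havg n.+1%:R^-1 y c d w @[n --> \oo] --> w y.
Proof.
move=> cd hy cw; move: (hy); rewrite in_itv /= => /andP[cy yd].
apply/cvgrPdist_le => e e0; have [r r0 hr] := within_cvg_itv cw hy e0.
near=> n; set lam : R := n.+1%:R^-1.
have l0 : 0 < lam by rewrite invr_gt0.
have l1 : lam <= 1 by rewrite invf_le1 // ler1n.
have lr : lam * (d - c) < r.
  rewrite mulrC ltr_pdivrMr // mulrC -ltr_pdivrMr //.
  have : (d - c) / r <= n%:R by near: n; exact: nbhs_infty_ger.
  by move/le_lt_trans; apply; rewrite ltr_nat.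
have h0 : 0 < lam * (d - c) by rewrite mulr_gt0 // subr_gt0.
set al := y - lam * (y - c); set be := y + lam * (d - y).
have ld : be - al = lam * (d - c) by rewrite /be /al; ring.
have h1 : lam * (y - c) <= 1 * (y - c) by rewrite ler_wpM2r // subr_ge0.
have h2 : lam * (d - y) <= 1 * (d - y) by rewrite ler_wpM2r // subr_ge0.
have h3 : 0 <= lam * (y - c) by rewrite mulr_ge0 ?subr_ge0 // ltW.
have h4 : 0 <= lam * (d - y) by rewrite mulr_ge0 ?subr_ge0 // ltW.
have iw : itb al be w by apply: itb_sub (itb_cont cw); rewrite /al /be; lra.
rewrite /havg -/al -/be -ld distrC.
have ab : al <= be by rewrite -subr_ge0 ld ltW.
have -> : itg al be w / (be - al) - w y = itg al be (fun z => w z - w y) / (be - al).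
  rewrite itgB ?itg_cst //; last exact: itb_cst.
  by field; rewrite ld gt_eqF.
rewrite normrM normfV (gtr0_norm (x := be - al)) ?ld // -ld ler_pdivrMr ?ld // -ld.
apply: itg_bound => //; first by apply: itbB => //; exact: itb_cst.
move=> z; rewrite in_itv /= => /andP[z1 z2]; rewrite distrC; apply: hr.
  by rewrite in_itv /=; move: z1 z2; rewrite /al /be; lra.
by rewrite ltr_norml; move: z1 z2 lr; rewrite /al /be; lra.
Unshelve. all: by end_near. Qed.

Lemma havg_rep lam y c d W (V D1 : R -> R) A : c < d -> 0 < lam -> lam <= 1 -> y \in `[c, d] ->
  itb c d V -> itb c d D1 -> itb c d (fun x => D1 x ^+ 2) ->
  (forall x, x \in `[c, d] -> W x = A + itg c x D1) ->
  {ae mu, forall x, x \in `]c, d[ -> V x = W x} ->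
  `|havg lam y c d V - W y| <= Num.sqrt (lam * (d - c) * itg c d (fun x => D1 x ^+ 2)).
Proof.
move=> cd l0 l1; rewrite in_itv /= => /andP[cy yd] iV iD iD2 hW VW.
have h0 : 0 < lam * (d - c) by rewrite mulr_gt0 // subr_gt0.
rewrite /havg; set al := y - lam * (y - c); set be := y + lam * (d - y).
have ld : be - al = lam * (d - c) by rewrite /be /al; ring.
have h1 : lam * (y - c) <= 1 * (y - c) by rewrite ler_wpM2r // subr_ge0.
have h2 : lam * (d - y) <= 1 * (d - y) by rewrite ler_wpM2r // subr_ge0.
have h3 : 0 <= lam * (y - c) by rewrite mulr_ge0 ?subr_ge0 // ltW.
have h4 : 0 <= lam * (d - y) by rewrite mulr_ge0 ?subr_ge0 // ltW.
have ab : al <= be by rewrite -subr_ge0 ld ltW.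
have [ca ay yb bd] : [/\ c <= al, al <= y, y <= be & be <= d] by rewrite /al /be; split; lra.
have iV' : itb al be V by apply: itb_sub iV.
have iD' : itb al be D1 by apply: itb_sub iD.
set J := Num.sqrt _.
have osc z : al <= z <= be -> `|W z - W y| <= J.
  have osc' z1 z2 : al <= z1 -> z1 <= z2 -> z2 <= be -> `|W z2 - W z1| <= J.
    move=> g1 g2 g3; rewrite !hW ?in_itv /=; try lra.
    rewrite (@itg_split _ c z1 z2) //; [|lra|by apply: itb_sub iD; lra].
    rewrite (_ : A + (itg c z1 D1 + itg z1 z2 D1) - (A + itg c z1 D1) = itg z1 z2 D1); last ring.
    apply: le_trans (itg_norm _) _; first by apply: itb_sub iD'.
    apply: le_trans (itg_mono g1 g2 g3 (itb_abs iD') _) _ => //.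
    apply: le_trans (itg_L1_L2 ab iD' (itb_sub ca bd iD2)) _.
    rewrite ld; apply: ler_wsqrtr; apply: ler_wpM2l; first exact: ltW.
    by apply: itg_mono => // ? _; exact: sqr_ge0.
  move=> /andP[g1 g2]; have [zy|/ltW yz] := leP z y; last exact: osc'.
  by rewrite distrC; exact: osc'.
have -> : itg al be V / (lam * (d - c)) - W y = itg al be (fun z => V z - W y) / (be - al).
  rewrite itgB ?itg_cst //; last exact: itb_cst.
  by rewrite -ld; field; rewrite ld gt_eqF.
rewrite normrM normfV (gtr0_norm (x := be - al)) ?ld // -ld ler_pdivrMr ?ld // -ld.
apply: itg_ae_bound => //; first by apply: itbB => //; exact: itb_cst.
apply: ae_S VW => z hz; rewrite in_itv /= => /andP[z1 z2].
rewrite hz ?in_itv /=; last lra.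
by apply: osc; lra.
Qed.

End PointValues.

Lemma sum_CS (R : realType) N (c d : 'I_N -> R) : (forall i, 0 <= d i) ->
  \sum_(i < N) `|c i| * Num.sqrt (d i) <= Num.sqrt (\sum_(i < N) c i ^+ 2) * Num.sqrt (\sum_(i < N) d i).
Proof.
move=> d0; set A := \sum_(i < N) c i ^+ 2; set B := \sum_(i < N) d i.
have A0 : 0 <= A by apply: sumr_ge0 => i _; exact: sqr_ge0.
have B0 : 0 <= B by apply: sumr_ge0.
have [Az|An] := eqVneq A 0.
  have h i : c i = 0.
    have /allP /(_ i) : all (fun i => c i ^+ 2 == 0) (index_enum 'I_N).
      by move: Az; rewrite /A => /eqP; rewrite psumr_eq0 // => j _; exact: sqr_ge0.
    by rewrite mem_index_enum => /(_ isT); rewrite sqrf_eq0 => /eqP.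
  by rewrite big1 ?mulr_ge0 ?sqrtr_ge0 // => i _; rewrite h normr0 mul0r.
have [Bz|Bn] := eqVneq B 0.
  have h i : d i = 0.
    have /allP /(_ i) : all (fun i => d i == 0) (index_enum 'I_N).
      by move: Bz; rewrite /B => /eqP; rewrite psumr_eq0.
    by rewrite mem_index_enum => /(_ isT) /eqP.
  by rewrite big1 ?mulr_ge0 ?sqrtr_ge0 // => i _; rewrite h sqrtr0 mulr0.
have p0 : 0 < Num.sqrt A by rewrite sqrtr_gt0 lt_neqAle eq_sym An.
have q0 : 0 < Num.sqrt B by rewrite sqrtr_gt0 lt_neqAle eq_sym Bn.
have := sqr_sqrtr A0; have := sqr_sqrtr B0; set p := Num.sqrt A in p0 *; set q := Num.sqrt B in q0 * => qB pA.
apply: (@le_trans _ _ (\sum_(i < N) (p * q / 2) * (c i ^+ 2 / p ^+ 2 + d i / q ^+ 2))).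
  apply: ler_sum => i _; rewrite -(sqr_sqrtr (d0 i)) -(real_normK (num_real (c i))).
  rewrite sqrtr_sqr (ger0_norm (sqrtr_ge0 _)); set u := `|c i|; set w := Num.sqrt (d i).
  have := sqr_ge0 (u * q - w * p) => h.
  rewrite -subr_ge0 (_ : _ - _ = (u * q - w * p) ^+ 2 / (2 * p * q)); last by field; rewrite !gt_eqF.
  by apply: divr_ge0 => //; rewrite -mulrA; apply: mulr_ge0 => //; apply: mulr_ge0; exact: ltW.
rewrite -mulr_sumr big_split /= -!mulr_suml -/A -/B -pA -qB.
by apply: eq_lew; field; rewrite !gt_eqF.
Qed.

Lemma stbdd_le (R : realType) (a b T M M' : R) V : M <= M' -> stbdd a b T M V -> stbdd a b T M' V.
Proof.
move=> MM [mV bV]; split=> //; apply: ae_S bV => t h ht.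
by apply: ae_S (h ht) => x hx /hx h'; exact: le_trans h' MM.
Qed.

Section Functionals.
Context {R : realType} (a b T : R).
Hypotheses (hab : a < b) (hT : 0 < T).
Local Notation mu := (@lebesgue_measure R).
Variables (m : mesh a b).
Local Notation N := (nelt m).
Local Notation x := (node m).

(** Functionals made of two point values and an integral on each element. *)
Variables (al be y z : 'I_N -> R) (G : 'I_N -> R -> R).
Hypotheses (hy : forall i, y i \in `[x i, x i.+1]) (hz : forall i, z i \in `[x i, x i.+1])
  (cG : forall i, continuous (G i)).

Definition loc (i : 'I_N) (w : R -> R) : R :=
  al i * w (y i) + be i * w (z i) + itg (x i) (x i.+1) (fun s => w s * G i s).

Variables (s : nat) (gam : R).
Hypotheses (s0 : (0 < s)%N) (gam0 : 0 <= gam)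
  (hloc : forall (i : 'I_N) (D : nat -> R -> R) (W : R -> R), chain (x i) (x i.+1) s D ->
     itb (x i) (x i.+1) (fun t => D s t ^+ 2) ->
     {within `[x i, x i.+1], continuous W} ->
     {ae mu, forall t, t \in `](x i), (x i.+1)[ -> D 0%N t = W t} ->
     `|loc i W| <= gam * Num.sqrt (itg (x i) (x i.+1) (fun t => D s t ^+ 2))).

Let lam (n : nat) : R := n.+1%:R^-1.
Let mollified n (i : 'I_N) (t : R) : R :=
  al i / (lam n * (x i.+1 - x i)) * ind (y i - lam n * (y i - x i)) (y i + lam n * (x i.+1 - y i)) t +
  be i / (lam n * (x i.+1 - x i)) * ind (z i - lam n * (z i - x i)) (z i + lam n * (x i.+1 - z i)) t + G i t.
Let kern (c : 'I_N -> R) n (t : R) : R :=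
  \sum_(i < N) ind (x i) (x i.+1) t * (c i * mollified n i t).

Let lam_gt0 n : 0 < lam n. Proof. by rewrite invr_gt0. Qed.
Let lam_le1 n : lam n <= 1. Proof. by rewrite invf_le1 // ler1n. Qed.

Let kern_bounded c n : bounded_kernel a b (kern c n).
Proof.
apply: bk_sum => i; apply: bkM; first exact: bk_ind.
apply: bkM; first by apply: bk_cont; exact: cont_cst.
apply: bkD; last exact: bk_cont.
by apply: bkD; apply: bkM; [apply: bk_cont; exact: cont_cst|exact: bk_ind|apply: bk_cont; exact: cont_cst|exact: bk_ind].
Qed.

Let pt_in n (i : 'I_N) t : t \in `[x i, x i.+1] ->
  [/\ x i <= t - lam n * (t - x i), t - lam n * (t - x i) <= t + lam n * (x i.+1 - t) &
      t + lam n * (x i.+1 - t) <= x i.+1].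
Proof.
rewrite in_itv /= => /andP[t1 t2]; have l0 := ltW (lam_gt0 n); have l1 := lam_le1 n.
have h1 : lam n * (t - x i) <= 1 * (t - x i) by rewrite ler_wpM2r // subr_ge0.
have h2 : lam n * (x i.+1 - t) <= 1 * (x i.+1 - t) by rewrite ler_wpM2r // subr_ge0.
have h3 : 0 <= lam n * (t - x i) by rewrite mulr_ge0 // subr_ge0.
have h4 : 0 <= lam n * (x i.+1 - t) by rewrite mulr_ge0 // subr_ge0.
by split; lra.
Qed.

Let kern_act c n w : itb a b w -> itg a b (fun t => w t * kern c n t) =
  \sum_(i < N) c i * (al i * havg (lam n) (y i) (x i) (x i.+1) w +
    be i * havg (lam n) (z i) (x i) (x i.+1) w + itg (x i) (x i.+1) (fun t => w t * G i t)).
Proof.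
move=> iw; have [B [mk bk]] := kern_bounded c n.
rewrite (itg_mesh m (itb_mulr iw mk bk)); apply: eq_bigr => i _.
have iwi : itb (x i) (x i.+1) w by apply: itb_sub iw; [exact: elt_ge|exact: elt_le].
have [p1 p2 p3] := pt_in n (hy i); have [p4 p5 p6] := pt_in n (hz i).
have e t : t \in `](x i), (x i.+1)[ -> w t * kern c n t = c i * (
   al i / (lam n * (x i.+1 - x i)) * (w t * ind (y i - lam n * (y i - x i)) (y i + lam n * (x i.+1 - y i)) t) +
   be i / (lam n * (x i.+1 - x i)) * (w t * ind (z i - lam n * (z i - x i)) (z i + lam n * (x i.+1 - z i)) t) + w t * G i t).
  by move=> ht; rewrite /kern (sum_ind_elt (fun i => c i * mollified n i t) ht) /mollified; ring.
rewrite (itg_ext e).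
have ii al' be' : itb (x i) (x i.+1) (fun t => w t * ind al' be' t).
  by have [mi bi] := bker_ind (x i) (x i.+1) al' be'; exact: itb_mulr iwi mi bi.
have iG : itb (x i) (x i.+1) (fun t => w t * G i t).
  by apply: itb_mulc => //; exact: continuous_subspaceT.
rewrite itgZ; last by apply: itbD => //; apply: itbD; exact: itbZ.
rewrite itgD //; last by apply: itbD; exact: itbZ.
rewrite itgD; [|exact: itbZ|exact: itbZ].
rewrite itgZ // itgZ // !itg_ind //.
by rewrite /havg; congr (_ * (_ + _ + _)); rewrite mulrAC mulrA.
Qed.

Let kern_cvg c (w : R -> R) : {within `[a, b], continuous w} ->
  itg a b (fun t => w t * kern c n t) @[n --> \oo] --> \sum_(i < N) c i * loc i w.
Proof.
move=> cw; have iw := itb_cont cw.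
have -> : (fun n => itg a b (fun t => w t * kern c n t)) = (fun n => \sum_(i < N) c i * (al i * havg (lam n) (y i) (x i) (x i.+1) w +
    be i * havg (lam n) (z i) (x i) (x i.+1) w + itg (x i) (x i.+1) (fun t => w t * G i t))).
  by apply/funext => n; exact: kern_act.
apply: cvg_sumr => i _; apply: cvgM; first exact: cvg_cst.
have cwi : {within `[x i, x i.+1], continuous w}.
  apply: continuous_subspaceW cw; apply: subset_itvScc; rewrite ?bnd_simp.
    exact: elt_ge.
  exact: elt_le.
apply: cvgD; last exact: cvg_cst.
by apply: cvgD; apply: cvgM; (try exact: cvg_cst); apply: havg_cvg => //; exact: elt_lt.
Qed.

Let err (c : 'I_N -> R) (K : R) : R :=
  \sum_(i < N) `|c i| * (`|al i| + `|be i|) * Num.sqrt ((x i.+1 - x i) * K ^+ 2).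

Let bound_pieces c n K K0 W D : 0 <= K0 -> itb a b W -> @pieces R a b m s K K0 W D ->
  `|itg a b (fun t => W t * kern c n t)| <=
  gam * K0 * Num.sqrt (\sum_(i < N) c i ^+ 2) + Num.sqrt (lam n) * err c K.
Proof.
move=> K00 iW [D0 ch DK SK]; rewrite (kern_act _ _ iW).
have sq i := (DK i s (leqnn s)).1.
have step (i : 'I_N) : `|c i * (al i * havg (lam n) (y i) (x i) (x i.+1) W +
    be i * havg (lam n) (z i) (x i) (x i.+1) W + itg (x i) (x i.+1) (fun t => W t * G i t))| <=
    gam * (`|c i| * Num.sqrt (itg (x i) (x i.+1) (fun t => D i s t ^+ 2))) +
    Num.sqrt (lam n) * (`|c i| * (`|al i| + `|be i|) * Num.sqrt ((x i.+1 - x i) * K ^+ 2)).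
  have lt := elt_lt i; have i0 := chain_itb (ch i) s0 (leq0n s); have i1 := chain_itb (ch i) s0 s0.
  have [A hA] := weak_rep lt (ch i 0%N s0).
  pose Wc t := A + itg (x i) t (D i 1%N).
  have cWc : {within `[x i, x i.+1], continuous Wc}.
    by apply: within_add; [apply: continuous_subspaceT; exact: cont_cst|exact: itg_cont (ltW lt) i1].
  have VW : {ae mu, forall t, t \in `](x i), (x i.+1)[ -> W t = Wc t}.
    by apply: ae_S hA => t ht h; rewrite -(D0 i) ht.
  have iWi : itb (x i) (x i.+1) W by rewrite -(D0 i).
  have [d2 k2] := DK i 1%N s0.
  have osc t : t \in `[x i, x i.+1] -> `|havg (lam n) t (x i) (x i.+1) W - Wc t| <=
      Num.sqrt (lam n) * Num.sqrt ((x i.+1 - x i) * K ^+ 2).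
    move=> ht; apply: le_trans (havg_rep lt (lam_gt0 n) (lam_le1 n) ht iWi i1 d2 (fun _ _ => erefl) VW) _.
    rewrite -sqrtrM; last exact: ltW.
    rewrite -mulrA; apply: ler_wsqrtr; apply: ler_wpM2l; first exact: ltW.
    by apply: ler_wpM2l => //; rewrite subr_ge0 ltW.
  have hl : `|loc i Wc| <= gam * Num.sqrt (itg (x i) (x i.+1) (fun t => D i s t ^+ 2)).
    by apply: (@hloc i (D i)) => //; rewrite D0.
  have eG : itg (x i) (x i.+1) (fun t => W t * G i t) = itg (x i) (x i.+1) (fun t => Wc t * G i t).
    apply: itg_ae.
    - by apply: itb_meas; apply: itb_mulc => //; exact: continuous_subspaceT.
    - by apply: itb_meas; apply: itb_mulc; [exact: itb_cont|exact: continuous_subspaceT].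
    - by apply: ae_S VW => t ht h; rewrite ht.
  have o1 := osc _ (hy i); have o2 := osc _ (hz i).
  set h1 := havg _ _ _ _ _ in o1 *; set h2 := havg _ _ _ _ _ in o2 *.
  set q := Num.sqrt (lam n) * Num.sqrt _ in o1 o2.
  have -> : al i * h1 + be i * h2 + itg (x i) (x i.+1) (fun t => W t * G i t) =
      loc i Wc + (al i * (h1 - Wc (y i)) + be i * (h2 - Wc (z i))).
    by rewrite eG /loc; ring.
  rewrite normrM; apply: (@le_trans _ _ (`|c i| * (gam * Num.sqrt (itg (x i) (x i.+1) (fun t => D i s t ^+ 2)) +
     (`|al i| * q + `|be i| * q)))).
    apply: ler_wpM2l => //; apply: le_trans (ler_normD _ _) _; apply: lerD => //.
    apply: le_trans (ler_normD _ _) _; rewrite !normrM.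
    by apply: lerD; exact: ler_wpM2l.
  by apply: eq_lew; rewrite /q; ring.
apply: le_trans (ler_norm_sum _ _ _) _; apply: le_trans (ler_sum _ (fun i _ => step i)) _.
rewrite big_split /= -!mulr_sumr -/(err c K); apply: lerD => //.
rewrite -mulrA; apply: ler_wpM2l => //; rewrite mulrC.
apply: le_trans (sum_CS _ _) _; first by move=> i; apply: itg_ge0 => t _; exact: sqr_ge0.
apply: ler_wpM2l; first exact: sqrtr_ge0.
by rewrite -(ger0_norm K00) -sqrtr_sqr; apply: ler_wsqrtr.
Qed.

Let sqrt_lam_cvg : Num.sqrt (lam n) @[n --> \oo] --> (0 : R).
Proof.
apply/cvgrPdist_le => e e0; near=> n; rewrite sub0r normrN ger0_norm ?sqrtr_ge0 //.
rewrite -(ger0_norm (ltW e0)) -sqrtr_sqr; apply: ler_wsqrtr.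
rewrite invf_ple ?posrE ?exprn_gt0 //.
have : (e ^+ 2)^-1 <= n%:R by near: n; exact: nbhs_infty_ger.
by move/le_trans; apply; rewrite ler_nat.
Unshelve. all: by end_near. Qed.

Let selfbound (A : R) (f : 'I_N -> R) : 0 <= A ->
  (forall c : 'I_N -> R, `|\sum_(i < N) c i * f i| <= A * Num.sqrt (\sum_(i < N) c i ^+ 2)) ->
  \sum_(i < N) f i ^+ 2 <= A ^+ 2.
Proof.
move=> A0 /(_ f); have -> : \sum_(i < N) f i * f i = \sum_(i < N) f i ^+ 2 by [].
set S := \sum_(i < N) _; have S0 : 0 <= S by apply: sumr_ge0 => i _; exact: sqr_ge0.
rewrite ger0_norm // -{1 3}(sqr_sqrtr S0); have := sqrtr_ge0 S; set q := Num.sqrt S => q0 h.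
have [->|qn] := eqVneq q 0; first by rewrite expr0n sqr_ge0.
have qp : 0 < q by rewrite lt_neqAle eq_sym qn.
have : q <= A by rewrite -(ler_pM2r qp) -expr2.
by move=> qA; rewrite ler_sqr.
Qed.

Variables (r : nat) (K0 : R) (v : R -> R -> R) (V : nat -> R -> R -> R) (M : R).
Hypotheses (K00 : 0 <= K0) (reg : regular T m r s K0 v V)
  (hv : forall t, t \in `[0, T] -> {within `[a, b], continuous (v t)})
  (lip : forall s t x, s \in `[0, T] -> t \in `[0, T] -> x \in `[a, b] ->
    `|v s x - v t x| <= M * `|s - t|).

Let lip_with M1 : stbdd a b T M1 (V 1%N) -> exists2 M2, stbdd a b T M2 (V 1%N) &
  forall s t x, s \in `[0, T] -> t \in `[0, T] -> x \in `[a, b] ->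
    `|v s x - v t x| <= M2 * `|s - t|.
Proof.
move=> b1; exists (Num.max M M1); first by apply: stbdd_le b1; rewrite le_max lexx orbT.
move=> s1 t x1 h1 h2 h3; apply: le_trans (lip h1 h2 h3) _; apply: ler_wpM2r => //.
by rewrite le_max lexx.
Qed.

Let level c j : (j <= r)%N -> exists E, forall n, {ae mu, forall t, t \in `]0, T[ ->
  `|itg a b (fun t0 => V j t t0 * kern c n t0)| <=
     gam * K0 * Num.sqrt (\sum_(i < N) c i ^+ 2) + Num.sqrt (lam n) * E}.
Proof.
move=> jr; have [_ bV pV _] := reg; have [K hK] := pV j jr; have [M' hM'] := bV j jr.
exists (err c K) => n.
apply: ae_S2 (st_row_int hab hM') hK => t h1 h2 ht.
have [i1 _] := h1 ht; have [D hD] := h2 ht; exact: bound_pieces K00 i1 hD.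
Qed.

Let Ccvg (c : 'I_N -> R) (E : R) : (gam * K0 * Num.sqrt (\sum_(i < N) c i ^+ 2) + Num.sqrt (lam n) * E) @[n --> \oo] -->
  gam * K0 * Num.sqrt (\sum_(i < N) c i ^+ 2).
Proof.
rewrite -[X in _ --> X]addr0; apply: cvgD; first exact: cvg_cst.
by rewrite -(mul0r E); apply: cvgM => //; exact: cvg_cst.
Qed.

Let kb c : exists B : nat -> R, forall n, bker a b (B n) (kern c n).
Proof. by have [B hB] := choice (fun n => kern_bounded c n); exists B. Qed.

(** Point values are replaced by averages, so that the functionals act by bounded
    kernels at almost every time; the sum of squares is obtained by pairing with the
    values of the functionals themselves. *)
Lemma functionals_bound t : t \in `[0, T] -> \sum_(i < N) loc i (v t) ^+ 2 <= (gam * K0) ^+ 2.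
Proof.
move=> ht; have [V0 bV pV wV] := reg; apply: selfbound; first exact: mulr_ge0.
move=> c; have [E hE] := level c (leq0n r); have [B hB] := kb c; rewrite V0 in hE.
exact: (functional_bound (k_ := kern c) (L := fun w => \sum_(i < N) c i * loc i w) hab hT hv lip hB (@Ccvg c E) (@kern_cvg c) hE ht).
Qed.

Lemma functionals_lipschitz t t' : (0 < r)%N -> t \in `[0, T] -> t' \in `[0, T] ->
  \sum_(i < N) loc i (fun y => v t y - v t' y) ^+ 2 <= (gam * K0 * `|t - t'|) ^+ 2.
Proof.
move=> r0 ht ht'; have [V0 bV pV wV] := reg; apply: selfbound; first by rewrite !mulr_ge0.
move=> c; have [E hE] := level c r0; have [B hB] := kb c.
have bv : exists M0, stbdd a b T M0 v by have := bV 0%N (leq0n r); rewrite V0.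
have [M0 b0] := bV 1%N r0; have [M1 b1 lip1] := lip_with b0; have w1 := wV 0%N r0; rewrite V0 in w1.
have := functional_lipschitz (k_ := kern c) (L := fun w => \sum_(i < N) c i * loc i w) hab hT hv bv b1 w1 lip1 hB (@Ccvg c E) (@kern_cvg c) hE ht ht'.
by rewrite -!mulrA [Num.sqrt _ * _]mulrC.
Qed.

Lemma functionals_second_difference t t' e : (1 < r)%N ->
  0 <= t -> 0 <= t' -> 0 <= e -> t + e <= T -> t' + e <= T ->
  \sum_(i < N) loc i (fun y => v (t + e) y - v t y - (v (t' + e) y - v t' y)) ^+ 2 <=
    (gam * K0 * (`|t - t'| * e)) ^+ 2.
Proof.
move=> r1 t0 t0' e0 tT tT'; have [V0 bV pV wV] := reg.
apply: selfbound; first by rewrite mulr_ge0 ?mulr_ge0.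
move=> c; have [E hE] := level c r1; have [B hB] := kb c.
have bv : exists M0, stbdd a b T M0 v by have := bV 0%N (leq0n r); rewrite V0.
have [M0 b0] := bV 1%N (ltnW r1); have [M1 b1 lip1] := lip_with b0; have w1 := wV 0%N (ltnW r1); rewrite V0 in w1.
have := functional_second_difference (k_ := kern c) (L := fun w => \sum_(i < N) c i * loc i w) hab hT hv bv b1 w1 lip1 hB (@Ccvg c E) (@kern_cvg c)
  (bV 2%N r1) (wV 1%N r1) hE t0 t0' e0 tT tT'.
by move=> h; apply: le_trans h _; apply: eq_lew; ring.
Qed.

End Functionals.

(** * The L^2 projection on the elements *)

Section ElementProjection.
Context {R : realType}.
Local Notation mu := (@lebesgue_measure R).
Implicit Types (p q : {poly R}) (c d : R) (v w W : R -> R).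

(** A polynomial of the reference element [0, 1], seen on (c, d). *)
Definition el c d p (x : R) : R := p.[(x - c) / (d - c)].

Lemma el_der c d p (x : R) : is_derive x 1 (el c d p) ((d - c)^-1 * el c d p^`() x).
Proof.
have h : is_derive x 1 (fun x => (x - c) * (d - c)^-1) ((d - c)^-1).
  have h1 : is_derive x 1 (fun x => (d - c)^-1 * (x - c)) ((d - c)^-1 * (1 - 0)).
    exact: (derZ (d - c)^-1 (derB (is_derive_id x 1) (der_cst c x))).
  by move: h1; rewrite subr0 mulr1; congr is_derive; apply/funext => y; rewrite mulrC.
rewrite mulrC; apply: (@is_derive1_comp _ (horner p) (fun x => (x - c) * (d - c)^-1)).
Qed.

Lemma el_cont c d p : continuous (el c d p).
Proof. by apply: (scaled_continuous (f := horner p)); exact: poly_cont. Qed.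

Lemma el_within c d p : {within `[c, d], continuous (el c d p)}.
Proof. by apply: continuous_subspaceT; exact: el_cont. Qed.

Lemma el_itb c d p : itb c d (el c d p).
Proof. by apply: itb_cont; exact: el_within. Qed.

Lemma el_left c d p : el c d p c = p.[0].
Proof. by rewrite /el subrr mul0r. Qed.

Lemma el_right c d p : c < d -> el c d p d = p.[1].
Proof. by move=> cd; rewrite /el divff // subr_eq0 gt_eqF. Qed.

Lemma elM c d p q x : el c d (p * q) x = el c d p x * el c d q x.
Proof. exact: hornerM. Qed.

Lemma itg_el c d p : c < d -> itg c d (el c d p) = (d - c) * intp p.
Proof.
move=> cd; have h : d - c != 0 by rewrite subr_eq0 gt_eqF.
have dF (x : R) : is_derive x 1 (fun x => (d - c) * el c d (prim p) x) (el c d p x).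
  have := derZ (d - c) (el_der c d (prim p) x).
  by rewrite deriv_prim mulrA mulfV // mul1r.
rewrite (itg_ftc (ltW cd) dF (el_cont (p := p))).
by rewrite el_left el_right // -mulrBr prim_horner0 subr0.
Qed.

Lemma itg_elM c d p q : c < d -> itg c d (fun x => el c d p x * el c d q x) = (d - c) * dotp p q.
Proof. by move=> cd; rewrite -itg_el //; apply: itg_ext => x _; rewrite elM. Qed.

(** The L^2 projection onto the polynomials of degree less than K, in the reference
    element. *)
Definition prj K c d v : {poly R} :=
  \sum_(j < K) (itg c d (fun x => v x * el c d (@leg R j) x) / ((d - c) * @legnu R j)) *: @leg R j.

Lemma size_prj K c d v : (size (prj K c d v) <= K)%N.
Proof.
apply: (big_ind (fun p : {poly R} => (size p <= K)%N)); first by rewrite size_poly0.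
  by move=> p q hp hq; rewrite (leq_trans (size_polyD _ _)) // geq_max hp.
by move=> j _; rewrite (leq_trans (size_scale_leq _ _)) // (leq_trans (size_leg _)).
Qed.

Lemma itb_el c d v p : itb c d v -> itb c d (fun x => v x * el c d p x).
Proof. by move=> hv; apply: itb_mulc => //; exact: el_within. Qed.

Lemma el_sum c d I (r : seq I) (F : I -> {poly R}) (cf : I -> R) x :
  el c d (\sum_(i <- r) cf i *: F i) x = \sum_(i <- r) cf i * el c d (F i) x.
Proof. by rewrite /el horner_sum; apply: eq_bigr => i _; rewrite hornerZ. Qed.

Lemma itg_sum c d I (r : seq I) (F : I -> R -> R) : (forall i, itb c d (F i)) ->
  itb c d (fun x => \sum_(i <- r) F i x) /\
  itg c d (fun x => \sum_(i <- r) F i x) = \sum_(i <- r) itg c d (F i).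
Proof.
move=> hF; elim: r => [|i r [IH1 IH2]].
  rewrite big_nil (_ : (fun x => _) = (fun=> 0)); last by apply/funext => x; rewrite big_nil.
  split; first exact: itb_cst.
  have [cd|dc] := leP c d; first by rewrite itg_cst // mul0r.
  by rewrite itg_empty // ltW.
rewrite big_cons (_ : (fun x => _) = (fun x => F i x + \sum_(j <- r) F j x)); last first.
  by apply/funext => x; rewrite big_cons.
by split; [exact: itbD|rewrite itgD // IH2].
Qed.

Lemma prj_dot K c d v (w : {poly R}) : c < d -> itb c d v -> (size w <= K)%N ->
  itg c d (fun x => v x * el c d w x) = (d - c) * dotp (prj K c d v) w.
Proof.
move=> cd hv sw; have h : d - c != 0 by rewrite subr_eq0 gt_eqF.
rewrite dotp_suml mulr_sumr [in LHS](leg_expand sw).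
have -> : (fun x => v x * el c d (\sum_(j < K) legc j w *: @leg R j) x) =
    (fun x => \sum_(j < K) legc j w * (v x * el c d (@leg R j) x)).
  by apply/funext => x; rewrite el_sum mulr_sumr; apply: eq_bigr => j _; ring.
rewrite (itg_sum _ (fun j : 'I_K => itbZ (legc j w) (itb_el (@leg R j) hv))).2.
apply: eq_bigr => j _; rewrite itgZ; last exact: itb_el.
rewrite dotpZl -/(@legnu R j) [dotp (@leg R j) w]dotpC legcE.
by field; rewrite h legnu_neq0.
Qed.

Lemma prj_el K c d p : c < d -> (size p <= K)%N -> prj K c d (el c d p) = p.
Proof.
move=> cd sp; rewrite [RHS](leg_expand sp) /prj; apply: eq_bigr => j _; congr (_ *: _).
rewrite itg_elM // legcE; have h : d - c != 0 by rewrite subr_eq0 gt_eqF.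
by field; rewrite h legnu_neq0.
Qed.

Lemma prjB K c d v w : itb c d v -> itb c d w ->
  prj K c d (fun x => v x - w x) = prj K c d v - prj K c d w.
Proof.
move=> hv hw; rewrite /prj -sumrB; apply: eq_bigr => j _; rewrite -scalerBl -mulrBl.
rewrite -itgB; [|exact: itb_el|exact: itb_el].
by congr (_ / _ *: _); apply: itg_ext => x _; rewrite mulrBl.
Qed.

Lemma prjZ K c d r v : itb c d v -> prj K c d (fun x => r * v x) = r *: prj K c d v.
Proof.
move=> hv; rewrite /prj scaler_sumr; apply: eq_bigr => j _; rewrite scalerA mulrA.
rewrite -itgZ; last exact: itb_el.
by congr (_ / _ *: _); apply: itg_ext => x _; rewrite mulrA.
Qed.

(** Finitely many Legendre polynomials enter, and scaling makes the constant the
    same for all intervals. *)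
Lemma prj_bound K : exists2 C, 0 <= C & forall c d v t, c < d -> itb c d v -> 0 <= t <= 1 ->
  `|(prj K c d v).[t]| <= C * (itg c d (fun x => `|v x|) / (d - c)).
Proof.
have hB j := cid2 (horner_bounded (@leg R j)).
pose B j := s2val (hB j); have B0 j : 0 <= B j := s2valP (hB j).
have bB j x : 0 <= x <= 1 -> `|(@leg R j).[x]| <= B j := s2valP' (hB j) x.
exists (\sum_(j < K) B j ^+ 2 / @legnu R j).
  by apply: sumr_ge0 => j _; rewrite divr_ge0 ?sqr_ge0 // ltW // legnu_gt0.
move=> c d v t cd hv ht; rewrite horner_sum.
have h0 : 0 < d - c by rewrite subr_gt0.
apply: le_trans (ler_norm_sum _ _ _) _; rewrite mulr_suml; apply: ler_sum => j _.
rewrite hornerZ !normrM normfV normrM (gtr0_norm h0) (gtr0_norm (legnu_gt0 _)).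
have n0 := @legnu_gt0 R j; set I1 := itg c d _; set I2 := itg c d (fun x => `|v x|).
have I12 : `|I1| <= B j * I2.
  apply: le_trans (itg_norm (itb_el _ hv)) _; rewrite -itgZ; last exact: itb_abs.
  apply: itg_le; [exact/itb_abs/itb_el|exact/itbZ/itb_abs|].
  move=> x; rewrite in_itv /= => /andP[x1 x2]; rewrite normrM mulrC; apply: ler_wpM2r => //.
  apply: bB; rewrite divr_ge0 ?subr_ge0 ?(ltW x1) ?(ltW cd) //= ler_pdivrMr // mul1r; lra.
have -> : B j ^+ 2 / @legnu R j * (I2 / (d - c)) = B j * I2 / ((d - c) * @legnu R j) * B j.
  by field; rewrite !gt_eqF.
apply: ler_pM => //; [by rewrite divr_ge0 // mulr_ge0 // ltW| |exact: bB].
by apply: ler_wpM2r => //; rewrite invr_ge0 mulr_ge0 // ltW.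
Qed.

Definition prjC K : R := s2val (cid2 (prj_bound K)).
Lemma prjC_ge0 K : 0 <= prjC K. Proof. exact: s2valP (cid2 (prj_bound K)). Qed.
Lemma prj_le K c d v t : c < d -> itb c d v -> 0 <= t <= 1 ->
  `|(prj K c d v).[t]| <= prjC K * (itg c d (fun x => `|v x|) / (d - c)).
Proof. exact: (s2valP' (cid2 (prj_bound K))). Qed.

Lemma ref_coord c d y : c < d -> y \in `[c, d] -> 0 <= (y - c) / (d - c) <= 1.
Proof.
move=> cd; rewrite in_itv /= => /andP[y1 y2]; have h0 : 0 < d - c by rewrite subr_gt0.
rewrite divr_ge0 ?subr_ge0 ?(ltW cd) //= ler_pdivrMr // mul1r; lra.
Qed.

Lemma poly_el c d p : c < d -> p != 0 -> exists q : {poly R},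
  (size q <= size p)%N /\ forall x, p.[x] = el c d q x.
Proof.
move=> cd p0; exists (p \Po ((d - c) *: 'X + c%:P)); split.
  apply: leq_trans (size_comp_poly_leq _ _) _.
  have s2 : (size ((d - c) *: 'X + c%:P)%R <= 2)%N.
    rewrite (leq_trans (size_polyD _ _)) // geq_max (leq_trans (size_scale_leq _ _)) ?size_polyX //.
    by rewrite (leq_trans (size_polyC_leq1 _)).
  rewrite -[X in (_ <= X)%N]prednK ?size_poly_gt0 // ltnS.
  rewrite -[X in (_ <= X)%N]muln1 leq_mul2l; apply/orP; right.
  by case: (size _) s2 => [|[|[|]]].
move=> x; rewrite /el horner_comp hornerD hornerZ hornerX hornerC mulrC divfK ?subrK //.
by rewrite subr_eq0 gt_eqF.
Qed.

(** Best approximation of a function with n + 1 weak derivatives, in reference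
    coordinates. *)
Lemma taylor_el c d n D : c < d -> chain c d n.+1 D -> itb c d (fun t => D n.+1 t ^+ 2) ->
  exists q : {poly R}, (size q <= n.+1)%N /\ {ae mu, forall x, x \in `]c, d[ ->
    `|D 0%N x - el c d q x| <= (d - c) ^+ n * Num.sqrt ((d - c) * itg c d (fun t => D n.+1 t ^+ 2))}.
Proof.
move=> cd ch i2; have [Q [sQ hQ]] := taylor cd ch.
have [q [sq hq]] : exists q : {poly R}, (size q <= n.+1)%N /\ forall x, Q.[x] = el c d q x.
  have [->|Q0] := eqVneq Q 0; first by exists 0; rewrite size_poly0; split=> // x; rewrite /el !horner0.
  by have [q [sq hq]] := poly_el cd Q0; exists q; split=> //; exact: leq_trans sq sQ.
exists q; split=> //; apply: ae_S hQ => x hx h; rewrite -hq; apply: le_trans (hx h) _.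
apply: ler_wpM2l; first by rewrite exprn_ge0 // subr_ge0 ltW.
by apply: itg_L1_L2 => //; [exact: ltW|have [] := ch n (leqnn _)].
Qed.

(** The projection reproduces the Taylor polynomial and is stable in the supremum
    norm. *)
Lemma prj_point c d n D W y : c < d -> chain c d n.+1 D -> itb c d (fun t => D n.+1 t ^+ 2) ->
  {within `[c, d], continuous W} -> {ae mu, forall t, t \in `]c, d[ -> D 0%N t = W t} ->
  y \in `[c, d] ->
  `|W y - (prj n.+1 c d W).[(y - c) / (d - c)]| <=
    (1 + prjC n.+1) * ((d - c) ^+ n * Num.sqrt ((d - c) * itg c d (fun t => D n.+1 t ^+ 2))).
Proof.
move=> cd ch i2 cW DW hy; have [q [sq hq]] := taylor_el cd ch i2.
set e := _ ^+ n * _ in hq *.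
have cWq : {within `[c, d], continuous (fun x => W x - el c d q x)}.
  by apply: within_sub => //; exact: el_within.
have bnd x : x \in `[c, d] -> `|W x - el c d q x| <= e.
  apply: (ae_norm_within cd cWq); apply: ae_S2 DW hq => t h1 h2 ht.
  by rewrite -h1 // h2.
have -> : W y - (prj n.+1 c d W).[(y - c) / (d - c)] =
    (W y - el c d q y) - (prj n.+1 c d (fun x => W x - el c d q x)).[(y - c) / (d - c)].
  rewrite prjB ?prj_el //; [|exact: itb_cont|exact: el_itb].
  by rewrite hornerD hornerN /el; ring.
apply: le_trans (ler_normB _ _) _; rewrite [leRHS]mulrDl [1 * e]mul1r; apply: lerD; first exact: bnd.
apply: le_trans (@prj_le _ c d _ _ cd (itb_cont cWq) (ref_coord cd hy)) _.
apply: ler_wpM2l; first exact: prjC_ge0.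
rewrite ler_pdivrMr ?subr_gt0 // -itg_cst ?(ltW cd) //.
apply: itg_le; [exact/itb_abs/itb_cont|exact: itb_cst|].
by move=> x hx; apply: bnd; exact: subset_itv_oo_cc hx.
Qed.

(** The value of the projection at a point, as an integral. *)
Definition prjker K c d (t : R) : {poly R} :=
  \sum_(j < K) ((@leg R j).[t] / ((d - c) * @legnu R j)) *: @leg R j.

Lemma prjker_act K c d v t : itb c d v ->
  itg c d (fun x => v x * - el c d (prjker K c d t) x) = - (prj K c d v).[t].
Proof.
move=> hv; rewrite (itg_ext (g := fun x => - (v x * el c d (prjker K c d t) x))); last first.
  by move=> x _; rewrite mulrN.
rewrite itgN; last exact: itb_el; congr (- _).
have -> : (fun x => v x * el c d (prjker K c d t) x) =
    (fun x => \sum_(j < K) ((@leg R j).[t] / ((d - c) * @legnu R j)) * (v x * el c d (@leg R j) x)).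
  by apply/funext => x; rewrite el_sum mulr_sumr; apply: eq_bigr => j _; ring.
rewrite (itg_sum _ (fun j : 'I_K => itbZ _ (itb_el (@leg R j) hv))).2 horner_sum.
apply: eq_bigr => j _; rewrite itgZ; last exact: itb_el.
by rewrite hornerZ; ring.
Qed.

(** A smooth unit mass near the left end point. *)
Definition lbump c d (e x : R) : R := 1 - step ((x - c) / e).
Definition lmass c d (e : R) : R := itg c d (lbump c d e).
Definition rho c d e x : R := lbump c d e x / lmass c d e.

Lemma lbump_der c d (e x : R) : is_derive x 1 (lbump c d e) (- (tent ((x - c) / e) * e^-1)).
Proof.
have h : is_derive x 1 (fun y => step ((y - c) / e)) (tent ((x - c) / e) * e^-1).
  apply: is_derive_eq; first apply: is_derive1_comp.
    exact: step_der.
  by rewrite scaler0 add0r subr0 /GRing.scale /= mulr1.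
have := derB (der_cst 1 x) h; by rewrite sub0r.
Qed.

Lemma lbump_cont c d e : continuous (lbump c d e).
Proof. by apply: derivable_cont => x; exact: (@ex_derive _ _ _ _ _ _ _ (lbump_der c d e x)). Qed.

Lemma lbump_ge0 c d e x : 0 <= lbump c d e x.
Proof. by rewrite /lbump; have /andP[] := step_bnd ((x - c) / e); lra. Qed.

Lemma lmass_gt0 c d e : c < d -> 0 < e -> e <= d - c -> 0 < lmass c d e.
Proof.
move=> cd e0 ed; have iL : itb c d (lbump c d e).
  by apply: itb_cont; apply: continuous_subspaceT; exact: lbump_cont.
apply: (@lt_le_trans _ _ (itg c (c + e) (lbump c d e))); last first.
  by apply: itg_mono => //; [lra|lra|move=> x _; exact: lbump_ge0].
apply: (@lt_le_trans _ _ (itg c (c + e) (fun=> 2^-1))).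
  by rewrite itg_cst; [rewrite mulr_gt0 ?invr_gt0 //; lra|lra].
apply: itg_le; [exact: itb_cst|by apply: itb_sub iL; lra|].
move=> x; rewrite in_itv /= => /andP[x1 x2].
have : (x - c) / e <= 1 by rewrite ler_pdivrMr //; lra.
have : 0 <= (x - c) / e by rewrite divr_ge0 //; lra.
rewrite /lbump /step /plus2; set y := (x - c) / e => y0 y1.
have -> : Num.max 0 (y - 1) = 0 by apply/max_idPl; lra.
have -> : Num.max 0 (y - 2) = 0 by apply/max_idPl; lra.
by rewrite (max_r y0); nra.
Qed.

Lemma rho_der c d (e x : R) : is_derive x 1 (rho c d e) ((lmass c d e)^-1 * - (tent ((x - c) / e) * e^-1)).
Proof.
have := derZ (lmass c d e)^-1 (lbump_der c d e x).
by congr is_derive; apply/funext => y; rewrite /rho mulrC.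
Qed.

Lemma rho_der_cont c d e : continuous (fun x => (lmass c d e)^-1 * - (tent ((x - c) / e) * e^-1)).
Proof.
have -> : (fun x => (lmass c d e)^-1 * - (tent ((x - c) / e) * e^-1)) =
   (fun x => (- (lmass c d e)^-1 * e^-1) * tent ((x - c) / e)) by apply/funext => x; ring.
by apply: contM; [exact: cont_cst|apply: scaled_continuous; exact: tent_continuous].
Qed.

Lemma rho_itb c d e : itb c d (rho c d e).
Proof.
apply: itb_cont; apply: continuous_subspaceT; apply: derivable_cont => x.
exact: (@ex_derive _ _ _ _ _ _ _ (rho_der c d e x)).
Qed.

Lemma rho_ge0 c d e x : c < d -> 0 < e -> e <= d - c -> 0 <= rho c d e x.
Proof. by move=> cd e0 ed; rewrite divr_ge0 ?lbump_ge0 // ltW // lmass_gt0. Qed.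

Lemma rho_mass c d e : c < d -> 0 < e -> e <= d - c -> itg c d (rho c d e) = 1.
Proof.
move=> cd e0 ed; have iL : itb c d (lbump c d e).
  by apply: itb_cont; apply: continuous_subspaceT; exact: lbump_cont.
have -> : rho c d e = (fun x => (lmass c d e)^-1 * lbump c d e x).
  by apply/funext => x; rewrite /rho mulrC.
by rewrite itgZ // -/(lmass c d e) mulVf // gt_eqF // lmass_gt0.
Qed.

Lemma rho_cvg c d w : c < d -> {within `[c, d], continuous w} ->
  itg c d (fun x => w x * rho c d ((d - c) / n.+1%:R) x) @[n --> \oo] --> w c.
Proof.
move=> cd cw; have h0 : 0 < d - c by rewrite subr_gt0.
have hc : c \in `[c, d] by rewrite in_itv /= lexx ltW.
apply/cvgrPdist_le => e e0; have [r r0 hr] := within_cvg_itv cw hc e0.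
near=> n; set s := (d - c) / n.+1%:R.
have s0 : 0 < s by rewrite divr_gt0.
have sd : s <= d - c by rewrite ler_pdivrMr // ler_peMr ?(ltW h0) // ler1n.
have sr : 2 * s < r.
  rewrite /s mulrA [2 * _]mulrC ltr_pdivrMr // [r * _]mulrC -ltr_pdivrMr //.
  have : (d - c) * 2 / r <= n%:R by near: n; exact: nbhs_infty_ger.
  by move=> /le_lt_trans; apply; rewrite ltr_nat.
have iw := itb_cont cw; have ir := rho_itb c d s.
have cr : {within `[c, d], continuous (rho c d s)}.
  apply: continuous_subspaceT; apply: derivable_cont => x.
  exact: (@ex_derive _ _ _ _ _ _ _ (rho_der c d s x)).
have iwr : itb c d (fun x => w x * rho c d s x) by exact: itb_mulc.
have -> : w c - itg c d (fun x => w x * rho c d s x) =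
   - itg c d (fun x => (w x - w c) * rho c d s x).
  rewrite [X in _ = - X](itg_ext (g := fun x => w x * rho c d s x - w c * rho c d s x)); last first.
    by move=> x _; rewrite mulrBl.
  by rewrite itgB ?itgZ ?rho_mass ?mulr1 ?opprB //; exact: itbZ.
have iB : itb c d (fun x => (w x - w c) * rho c d s x).
  by apply: itb_mulc => //; apply: itbB => //; exact: itb_cst.
rewrite normrN; apply: le_trans (itg_norm iB) _.
apply: (@le_trans _ _ (itg c d (fun x => e * rho c d s x))); last first.
  by rewrite itgZ // rho_mass // mulr1.
apply: itg_le; [exact: itb_abs|exact: itbZ|].
move=> x; rewrite in_itv /= => /andP[x1 x2]; rewrite normrM (ger0_norm (rho_ge0 _ cd s0 sd)).
have [xs|xs] := ltP x (c + 2 * s); last first.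
  by rewrite /rho /lbump step1 ?subrr ?mul0r ?mulr0 // ler_pdivlMr //; lra.
apply: ler_wpM2r; first exact: rho_ge0.
rewrite distrC; apply: hr; first by rewrite in_itv /= !ltW.
by rewrite ltr_norml; apply/andP; split; lra.
Unshelve. all: by end_near. Qed.

End ElementProjection.

Section WeakSub.
Context {R : realType}.

Lemma itb_mul_continuous (c d : R) (f g : R -> R) : itb c d f -> continuous g ->
  itb c d (fun s => f s * g s).
Proof. by move=> h1 h2; have h3 := @continuous_subspaceT _ _ `[c, d]%classic g h2; exact: (itb_mulc h1 h3). Qed.

Lemma weak_sub (c d : R) (f f' g g' : R -> R) : weak_deriv c d f f' -> weak_deriv c d g g' ->
  weak_deriv c d (fun s => f s - g s) (fun s => f' s - g' s).
Proof.
move=> [h1 h2 h3] [g1 g2 g3]; split; [exact: itbB h1 g1|exact: itbB h2 g2|].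
move=> phi tp; have [p1 p2 _] := tp; have cp := derivable_cont p1.
have i1 := itb_mul_continuous h1 p2; have i2 := itb_mul_continuous g1 p2.
have i3 := itb_mul_continuous h2 cp; have i4 := itb_mul_continuous g2 cp.
have e1 := h3 _ tp; have e2 := g3 _ tp.
rewrite -!/(itg c d _) in e1 e2 *.
have -> : itg c d (fun s => (f s - g s) * derive1 phi s) =
    itg c d (fun s => f s * derive1 phi s - g s * derive1 phi s).
  by apply: itg_ext => s _; rewrite mulrBl.
have -> : itg c d (fun s => (f' s - g' s) * phi s) = itg c d (fun s => f' s * phi s - g' s * phi s).
  by apply: itg_ext => s _; rewrite mulrBl.
by rewrite (itgB i1 i2) (itgB i3 i4) e1 e2; ring.
Qed.

End WeakSub.

Section ProjectionInTime.
Context {R : realType} (a b T : R).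
Hypotheses (hab : a < b) (hT : 0 < T).
Local Notation mu := (@lebesgue_measure R).
Variables (m : mesh a b) (n : nat) (hm : R).
Local Notation N := (nelt m).
Local Notation x := (node m).
Local Notation h i := (x i.+1 - x i).
Hypotheses (hm0 : 0 < hm) (hle : forall i : 'I_N, h i <= hm).

Definition proj_error (i : 'I_N) (w : R -> R) (y : R) : R :=
  w y - (prj n.+2 (x i) (x i.+1) w).[(y - x i) / h i].

(** The power k + 1/2 of the mesh size, for degree k = n + 1: a point value costs
    half a power with respect to the L^2 norm. *)
Definition gam : R := (1 + prjC n.+2) * (hm ^+ n.+1 * Num.sqrt hm).

Lemma gam_ge0 : 0 <= gam.
Proof.
apply: mulr_ge0; first by rewrite addr_ge0 // prjC_ge0.
by apply: mulr_ge0; [rewrite exprn_ge0 // ltW|exact: sqrtr_ge0].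
Qed.

Let hp (i : 'I_N) : 0 < h i. Proof. by rewrite subr_gt0 elt_lt. Qed.

Let sub_within (w : R -> R) (i : 'I_N) : {within `[a, b], continuous w} ->
  {within `[x i, x i.+1], continuous w}.
Proof.
apply: continuous_subspaceW; apply: subset_itvScc; rewrite ?bnd_simp.
  exact: elt_ge.
exact: elt_le.
Qed.

Let gam_local (i : 'I_N) (I : R) : 0 <= I ->
  (1 + prjC n.+2) * (h i ^+ n.+1 * Num.sqrt (h i * I)) <= gam * Num.sqrt I.
Proof.
move=> I0; rewrite /gam -!mulrA; apply: ler_wpM2l; first by rewrite addr_ge0 // prjC_ge0.
rewrite sqrtrM ?(ltW (hp i)) // !mulrA; apply: ler_wpM2r; first exact: sqrtr_ge0.
apply: ler_pM; rewrite ?sqrtr_ge0 ?exprn_ge0 ?(ltW (hp i)) //; last exact: ler_wsqrtr.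
by rewrite lerXn2r ?nnegrE // ltW.
Qed.

Section Points.
Variables (y : 'I_N -> R).
Hypothesis hy : forall i : 'I_N, y i \in `[x i, x i.+1].

Let one (i : 'I_N) : R := 1.
Let zero (i : 'I_N) : R := 0.
Let G (i : 'I_N) (s : R) : R := - el (x i) (x i.+1) (prjker n.+2 (x i) (x i.+1) ((y i - x i) / h i)) s.

Let cG (i : 'I_N) : continuous (G i).
Proof.
rewrite /G => s; apply: cvgN; exact: el_cont.
Qed.

Let locE (i : 'I_N) (w : R -> R) : {within `[x i, x i.+1], continuous w} -> loc one zero y y G i w = proj_error i w (y i).
Proof.
move=> cw; rewrite /loc /one /zero mul1r mul0r addr0 /proj_error prjker_act //.
exact: itb_cont.
Qed.

Let hloc (i : 'I_N) (D : nat -> R -> R) (W : R -> R) : chain (x i) (x i.+1) n.+2 D ->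
  itb (x i) (x i.+1) (fun t => D n.+2 t ^+ 2) -> {within `[x i, x i.+1], continuous W} ->
  {ae mu, forall t, t \in `](x i), (x i.+1)[ -> D 0%N t = W t} ->
  `|loc one zero y y G i W| <= gam * Num.sqrt (itg (x i) (x i.+1) (fun t => D n.+2 t ^+ 2)).
Proof.
move=> ch i2 cW DW; rewrite locE //.
apply: le_trans (prj_point (elt_lt i) ch i2 cW DW (hy i)) _.
by apply: gam_local; apply: itg_ge0 => t _; exact: sqr_ge0.
Qed.

Variables (r : nat) (K0 : R) (v : R -> R -> R) (V : nat -> R -> R -> R) (M : R).
Hypotheses (K00 : 0 <= K0) (reg : regular T m r n.+2 K0 v V)
  (hv : forall t, t \in `[0, T] -> {within `[a, b], continuous (v t)})
  (lip : forall s t x, s \in `[0, T] -> t \in `[0, T] -> x \in `[a, b] ->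
    `|v s x - v t x| <= M * `|s - t|).

Lemma proj_error_bound t : t \in `[0, T] -> \sum_(i < N) proj_error i (v t) (y i) ^+ 2 <= (gam * K0) ^+ 2.
Proof.
move=> ht; have := functionals_bound hab hT hy hy cG (isT : (0 < n.+2)%N) gam_ge0 hloc K00 reg hv lip ht.
by apply: le_trans; apply: ler_sum => i _; rewrite locE //; apply: sub_within; exact: hv.
Qed.

Lemma proj_error_lipschitz t t' : (0 < r)%N -> t \in `[0, T] -> t' \in `[0, T] ->
  \sum_(i < N) proj_error i (fun s => v t s - v t' s) (y i) ^+ 2 <= (gam * K0 * `|t - t'|) ^+ 2.
Proof.
move=> r0 ht ht'.
have := functionals_lipschitz hab hT hy hy cG (isT : (0 < n.+2)%N) gam_ge0 hloc K00 reg hv lip r0 ht ht'.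
apply: le_trans; apply: ler_sum => i _; rewrite locE //; apply: sub_within.
by apply: within_sub; exact: hv.
Qed.

Lemma proj_error_second_difference t t' e : (1 < r)%N ->
  0 <= t -> 0 <= t' -> 0 <= e -> t + e <= T -> t' + e <= T ->
  \sum_(i < N) proj_error i (fun s => v (t + e) s - v t s - (v (t' + e) s - v t' s)) (y i) ^+ 2 <=
    (gam * K0 * (`|t - t'| * e)) ^+ 2.
Proof.
move=> r0 t0 t0' e0 tT tT'.
have := functionals_second_difference hab hT hy hy cG (isT : (0 < n.+2)%N) gam_ge0 hloc K00 reg hv lip r0 t0 t0' e0 tT tT'.
apply: le_trans; apply: ler_sum => i _; rewrite locE //; apply: sub_within.
by apply: within_sub; apply: within_sub; apply: hv; rewrite in_itv /=; lra.
Qed.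

End Points.

(** Pointwise bounds give bounds in L^2: evaluate at the worst points. *)
Lemma proj_error_L2 (w : R -> R) (B : R) : {within `[a, b], continuous w} ->
  (forall y : 'I_N -> R, (forall i : 'I_N, y i \in `[x i, x i.+1]) -> \sum_(i < N) proj_error i w (y i) ^+ 2 <= B) ->
  \sum_(i < N) itg (x i) (x i.+1) (fun s => proj_error i w s ^+ 2) <= hm * B.
Proof.
move=> cw hB.
have cp (i : 'I_N) : {within `[x i, x i.+1], continuous (fun s => proj_error i w s ^+ 2)}.
  have c1 : {within `[x i, x i.+1], continuous (proj_error i w)}.
    by apply: within_sub; [exact: sub_within|exact: el_within].
  by have c2 := c1; exact: (within_mul c1 c2).
have ex (i : 'I_N) : exists yi, yi \in `[x i, x i.+1] /\
    forall s, s \in `[x i, x i.+1] -> proj_error i w s ^+ 2 <= proj_error i w yi ^+ 2.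
  by have [yi h1 h2] := EVT_max (ltW (elt_lt i)) (cp i); exists yi.
have [y hy] := choice ex.
have := hB y (fun i => (hy i).1) => h1.
apply: (@le_trans _ _ (\sum_(i < N) hm * proj_error i w (y i) ^+ 2)); last first.
  by rewrite -mulr_sumr; apply: ler_wpM2l => //; exact: ltW.
apply: ler_sum => i _; apply: (@le_trans _ _ (proj_error i w (y i) ^+ 2 * h i)); last first.
  by rewrite mulrC; apply: ler_wpM2r => //; exact: sqr_ge0.
rewrite -itg_cst ?(ltW (elt_lt i)) //; apply: itg_le; [exact: itb_cont|exact: itb_cst|].
by move=> s hs; apply: (hy i).2; exact: subset_itv_oo_cc hs.
Qed.

Section Derivative.
Variables (K0 : R) (v dv : R -> R -> R) (V : nat -> R -> R -> R) (M : R).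
Hypotheses (K00 : 0 <= K0) (reg : regular T m 2 n.+2 K0 v V)
  (hv : forall t, t \in `[0, T] -> {within `[a, b], continuous (v t)})
  (hdv : forall t, t \in `[0, T] -> {within `[a, b], continuous (dv t)})
  (wdv : forall t, t \in `[0, T] -> weak_deriv a b (v t) (dv t))
  (lip : forall s t x, s \in `[0, T] -> t \in `[0, T] -> x \in `[a, b] ->
    `|v s x - v t x| <= M * `|s - t|).

Let e (j : nat) (i : 'I_N) : R := h i / j.+1%:R.
Let pi j (i : 'I_N) : {poly R} := prj n.+2 (x i) (x i.+1) (rho (x i) (x i.+1) (e j i)).
Let psi j (i : 'I_N) (s : R) : R := rho (x i) (x i.+1) (e j i) s - el (x i) (x i.+1) (pi j i) s.
Let dpsi j (i : 'I_N) (s : R) : R :=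
  (lmass (x i) (x i.+1) (e j i))^-1 * - (tent ((s - x i) / e j i) * (e j i)^-1) -
  (h i)^-1 * el (x i) (x i.+1) (pi j i)^`() s.
Let al j (i : 'I_N) : R := h i * psi j i (x i.+1).
Let be j (i : 'I_N) : R := - (h i * psi j i (x i)).
Let G j (i : 'I_N) (s : R) : R := - h i * dpsi j i s.

Let e_gt0 j (i : 'I_N) : 0 < e j i. Proof. by rewrite divr_gt0. Qed.
Let e_le j (i : 'I_N) : e j i <= h i.
Proof. by rewrite ler_pdivrMr // ler_peMr ?(ltW (hp i)) // ler1n. Qed.

Let psi_der j (i : 'I_N) (s : R) : is_derive s 1 (psi j i) (dpsi j i s).
Proof. exact: derB (rho_der _ _ _ _) (el_der _ _ _ _). Qed.

Let dpsi_cont j (i : 'I_N) : continuous (dpsi j i).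
Proof.
apply: contB; first exact: rho_der_cont.
by apply: contM; [exact: cont_cst|exact: el_cont].
Qed.

Let cG j (i : 'I_N) : continuous (G j i).
Proof. by apply: contM; [exact: cont_cst|exact: dpsi_cont]. Qed.

Let locE j (i : 'I_N) (w dw : R -> R) : {within `[x i, x i.+1], continuous w} ->
  weak_deriv (x i) (x i.+1) w dw ->
  loc (al j) (be j) (fun i => x i.+1) (fun i => x i) (G j) i w =
  h i * itg (x i) (x i.+1) (fun s => dw s * psi j i s).
Proof.
move=> cw wd; rewrite (weak_parts (elt_lt i) cw wd (psi_der j i) (dpsi_cont (j := j) (i := i))).
rewrite /loc /al /be /G (itg_ext (g := fun s => - h i * (w s * dpsi j i s))); last by move=> s _; ring.
rewrite itgZ; last by apply: itb_mulc; [exact: itb_cont|apply: continuous_subspaceT; exact: dpsi_cont].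
by ring.
Qed.

Let rho_within j (i : 'I_N) : {within `[x i, x i.+1], continuous (rho (x i) (x i.+1) (e j i))}.
Proof.
apply: continuous_subspaceT; apply: derivable_cont => s.
exact: (@ex_derive _ _ _ _ _ _ _ (rho_der _ _ _ s)).
Qed.

Let psi_within j (i : 'I_N) : {within `[x i, x i.+1], continuous (psi j i)}.
Proof. by apply: within_sub; [exact: rho_within|exact: el_within]. Qed.

Let psi_orth j (i : 'I_N) (q : {poly R}) : (size q <= n.+2)%N -> itg (x i) (x i.+1) (fun s => el (x i) (x i.+1) q s * psi j i s) = 0.
Proof.
move=> sq; rewrite (itg_ext (g := fun s => rho (x i) (x i.+1) (e j i) s * el (x i) (x i.+1) q s -
   el (x i) (x i.+1) (pi j i) s * el (x i) (x i.+1) q s)); last by move=> s _; rewrite /psi; ring.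
rewrite itgB; [|exact/itb_el/rho_itb|exact/itb_el/el_itb].
by rewrite (prj_dot (elt_lt i) (rho_itb _ _ _) sq) itg_elM ?elt_lt // subrr.
Qed.

Let psi_L1 j (i : 'I_N) : itg (x i) (x i.+1) (fun s => `|psi j i s|) <= 1 + prjC n.+2.
Proof.
have lt := elt_lt i; have ir := rho_itb (x i) (x i.+1) (e j i).
have r1 : itg (x i) (x i.+1) (fun s => `|rho (x i) (x i.+1) (e j i) s|) = 1.
  rewrite (itg_ext (g := rho (x i) (x i.+1) (e j i))) ?rho_mass // => s _.
  by rewrite ger0_norm // rho_ge0.
apply: (@le_trans _ _ (itg (x i) (x i.+1) (fun s => `|rho (x i) (x i.+1) (e j i) s| + prjC n.+2 / h i))).
  apply: itg_le; [exact/itb_abs/itb_cont|by apply: itbD; [exact: itb_abs|exact: itb_cst]|].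
  move=> s hs; apply: le_trans (ler_normB _ _) _; apply: lerD => //.
  apply: le_trans (@prj_le _ _ _ _ _ _ lt ir (ref_coord lt (subset_itv_oo_cc hs))) _.
  by rewrite r1 mul1r.
rewrite itgD ?r1; [|exact: itb_abs|exact: itb_cst].
by rewrite itg_cst ?(ltW lt) // divfK // gt_eqF.
Qed.

Let hloc j (i : 'I_N) (D : nat -> R -> R) (W : R -> R) : chain (x i) (x i.+1) n.+2 D ->
  itb (x i) (x i.+1) (fun t => D n.+2 t ^+ 2) -> {within `[x i, x i.+1], continuous W} ->
  {ae mu, forall t, t \in `](x i), (x i.+1)[ -> D 0%N t = W t} ->
  `|loc (al j) (be j) (fun i => x i.+1) (fun i => x i) (G j) i W| <=
     gam * Num.sqrt (itg (x i) (x i.+1) (fun t => D n.+2 t ^+ 2)).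
Proof.
move=> ch i2 cW DW; have lt := elt_lt i.
have wW : weak_deriv (x i) (x i.+1) W (D 1%N).
  exact: weak_deriv_ae (itb_meas (itb_cont cW)) DW (ch 0%N isT).
rewrite (locE j cW wW).
have ch1 : chain (x i) (x i.+1) n.+1 (fun j => D j.+1) by move=> l hl; apply: ch.
have [q [sq hq]] := taylor_el lt ch1 i2.
set S := Num.sqrt _ in hq *.
have [_ i1 _] := ch 0%N isT.
have -> : itg (x i) (x i.+1) (fun s => D 1%N s * psi j i s) =
    itg (x i) (x i.+1) (fun s => (D 1%N s - el (x i) (x i.+1) q s) * psi j i s).
  rewrite [RHS](itg_ext (g := fun s => D 1%N s * psi j i s - el (x i) (x i.+1) q s * psi j i s)); last first.
    by move=> s _; rewrite mulrBl.
  rewrite itgB; [|exact: itb_mulc|by apply: itb_mulc => //; exact: el_itb].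
  by rewrite psi_orth ?subr0 // (leq_trans sq).
have iB : itb (x i) (x i.+1) (fun s => (D 1%N s - el (x i) (x i.+1) q s) * psi j i s).
  by apply: itb_mulc => //; apply: itbB => //; exact: el_itb.
have hS : `|itg (x i) (x i.+1) (fun s => (D 1%N s - el (x i) (x i.+1) q s) * psi j i s)| <=
    h i ^+ n * S * (1 + prjC n.+2).
  apply: le_trans (itg_norm iB) _.
  apply: (@le_trans _ _ (itg (x i) (x i.+1) (fun s => h i ^+ n * S * `|psi j i s|))).
    apply: itg_ae_le; [exact: itb_abs|exact/itbZ/itb_abs/itb_cont|].
    by apply: ae_S hq => s hs h1; rewrite normrM; apply: ler_wpM2r => //; exact: hs.
  rewrite itgZ; last exact/itb_abs/itb_cont.
  by apply: ler_wpM2l => //; rewrite mulr_ge0 ?sqrtr_ge0 // exprn_ge0 // ltW.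
rewrite normrM (gtr0_norm (hp i)); apply: le_trans (ler_wpM2l (ltW (hp i)) hS) _.
have := @gam_local i _ (itg_ge0 (fun t _ => sqr_ge0 (D n.+2 t)) : 0 <= itg (x i) (x i.+1) (fun t => D n.+2 t ^+ 2)).
by rewrite -/S; apply: le_trans; apply: eq_lew; rewrite exprS; ring.
Qed.

(** The left trace of the projection error of dv is the limit of the integrals of dv
    against concentrating masses from which their projection is removed. Integrated
    by parts, these are functionals of v; the derivative of the mass costs the power
    of h that appears on the left. *)
Lemma proj_error_derivative t t' d : 0 <= t -> 0 <= t' -> 0 <= d -> t + d <= T -> t' + d <= T ->
  \sum_(i < N) h i ^+ 2 * proj_error i (fun s => dv (t + d) s - dv t s - (dv (t' + d) s - dv t' s)) (x i) ^+ 2 <=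
    (gam * K0 * (`|t - t'| * d)) ^+ 2.
Proof.
move=> t0 t0' d0 tT tT'.
have in0T s : 0 <= s -> s <= T -> s \in `[0, T] by move=> ? ?; rewrite in_itv /=; lra.
set w := (fun s => dv (t + d) s - dv t s - (dv (t' + d) s - dv t' s)).
pose W s := v (t + d) s - v t s - (v (t' + d) s - v t' s).
have cw : {within `[a, b], continuous w}.
  by apply: within_sub; apply: within_sub; apply: hdv; apply: in0T; lra.
have cW : {within `[a, b], continuous W}.
  by apply: within_sub; apply: within_sub; apply: hv; apply: in0T; lra.
have wW : weak_deriv a b W w.
  by apply: weak_sub; apply: weak_sub; apply: wdv; apply: in0T; lra.
have lE j i : loc (al j) (be j) (fun i => x i.+1) (fun i => x i) (G j) i W =
    h i * itg (x i) (x i.+1) (fun s => proj_error i w s * rho (x i) (x i.+1) (e j i) s).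
  have lt := elt_lt i; have iw : itb (x i) (x i.+1) w by apply: itb_cont; exact: sub_within.
  rewrite (locE j (sub_within cW) (weak_restrict (elt_ge i) lt (elt_le i) wW)); congr (_ * _).
  have ir := rho_itb (x i) (x i.+1) (e j i).
  rewrite (itg_ext (g := fun s => w s * rho (x i) (x i.+1) (e j i) s - w s * el (x i) (x i.+1) (pi j i) s)); last first.
    by move=> s _; rewrite /psi mulrBr.
  rewrite itgB; [|exact: itb_mulc|exact: itb_el].
  have e1 := prj_dot lt iw (size_prj n.+2 (x i) (x i.+1) (rho (x i) (x i.+1) (e j i))).
  have e2 := prj_dot lt ir (size_prj n.+2 (x i) (x i.+1) w).
  rewrite -/(pi j i) in e1 e2; rewrite e1 dotpC -e2.
  rewrite -itgB; [|exact: itb_mulc|exact: itb_el].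
  by apply: itg_ext => s _; rewrite /proj_error -/(el (x i) (x i.+1) _ s); ring.
have hb j : \sum_(i < N) (h i * itg (x i) (x i.+1) (fun s => proj_error i w s * rho (x i) (x i.+1) (e j i) s)) ^+ 2 <=
    (gam * K0 * (`|t - t'| * d)) ^+ 2.
  have hr (i : 'I_N) : x i.+1 \in `[x i, x i.+1] by rewrite in_itv /= lexx andbT ltW // elt_lt.
  have hl (i : 'I_N) : x i \in `[x i, x i.+1] by rewrite in_itv /= lexx ltW // elt_lt.
  have := functionals_second_difference hab hT hr hl (@cG j) (isT : (0 < n.+2)%N) gam_ge0 (@hloc j) K00 reg hv lip isT t0 t0' d0 tT tT'.
  by apply: le_trans; apply: ler_sum => i _; rewrite -lE.
have cv : \sum_(i < N) (h i * itg (x i) (x i.+1) (fun s => proj_error i w s * rho (x i) (x i.+1) (e j i) s)) ^+ 2 @[j --> \oo] -->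
    \sum_(i < N) h i ^+ 2 * proj_error i w (x i) ^+ 2.
  apply: cvg_sumr => i _; rewrite -exprMn.
  have cp : {within `[x i, x i.+1], continuous (proj_error i w)}.
    by apply: within_sub; [exact: sub_within|exact: el_within].
  have c1 : h i * itg (x i) (x i.+1) (fun s => proj_error i w s * rho (x i) (x i.+1) (e j i) s) @[j --> \oo] --> h i * proj_error i w (x i).
    by apply: cvgM; [exact: cvg_cst|exact: rho_cvg (elt_lt i) cp].
  by have c2 := c1; exact: (cvgM c1 c2).
by apply: (ler_cvg_to cv (cvg_cst _)); apply: nearW => j; exact: hb.
Qed.

End Derivative.
End ProjectionInTime.

(** * Time regularity of the exact solution *)

Section NullSets.
Context d (T : measurableType d) (R : realType) (m : {measure set T -> \bar R}).
Local Open Scope ereal_scope.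
Import HBNNSimple.

Let below (f : T -> \bar R) := [set sintegral m h | h in
  [set h : {nnsfun T >-> R} | forall x, (h x)%:E <= f x]].

Let below_le (f g : T -> \bar R) (A : set T) : measurable A -> m A = 0 ->
  (forall x, ~ A x -> f x = g x) -> (forall x, 0 <= g x) ->
  ereal_sup (below f) <= ereal_sup (below g).
Proof.
move=> mA A0 fg g0; apply/ge_ereal_sup => _ [h /= hf <-].
pose h' := proj_nnsfun h (measurableC mA).
have h'E x : h' x = (h x * \1_(~` A) x)%R by [].
have -> : sintegral m h = sintegral m h'.
  rewrite -!integralT_nnsfun; apply: ae_eq_integral => //; [exact/measurable_EFinP|exact/measurable_EFinP|].
  exists A; split=> // x /= H; apply: contrapT => nA; apply: H => _.
  by change ((h x)%:E = (h x * \1_(~` A) x)%:E); rewrite indicE mem_set //= mulr1.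
apply: ereal_sup_ubound; exists h' => // x.
change ((h x * \1_(~` A) x)%:E <= g x); rewrite indicE.
case: (pselect (A x)) => [Ax|nA]; first by rewrite memNset /= ?mulr0 //; apply: contrapT.
by rewrite mem_set //= mulr1 -fg.
Qed.

(** Nothing needs to be measurable: a simple function below f can be set to 0 on
    the exceptional set. *)
Lemma ae_eq_integral_any (D : set T) (f g : T -> \bar R) :
  {ae m, forall x, D x -> f x = g x} -> \int[m]_(x in D) f x = \int[m]_(x in D) g x.
Proof.
move=> [A [mA A0 sub]].
have fg x : ~ A x -> (f \_ D) x = (g \_ D) x.
  move=> nA; rewrite !patchE; case: ifPn => // /set_mem Dx.
  by apply: contrapT => ne; apply: nA; apply: sub => /= H; apply: ne; exact: H.
rewrite /integral; congr (_ - _); apply/eqP; rewrite eq_le; apply/andP; split;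
  apply: (below_le mA A0) => x; rewrite ?funepos_ge0 ?funeneg_ge0 // => nA;
  by rewrite ?funeposE ?funenegE fg.
Qed.

End NullSets.

Section ExactInTime.
Context {R : realType} (a b T : R).
Hypotheses (hab : a < b) (hT : 0 < T).
Local Notation mu := (@lebesgue_measure R).
Implicit Types (u q : R -> R -> R).

Lemma itg_ae_any c d (f g : R -> R) :
  {ae mu, forall x, x \in `]c, d[ -> f x = g x} -> itg c d f = itg c d g.
Proof.
move=> fg; rewrite /itg /Rintegral; congr fine; apply: ae_eq_integral_any.
by apply: ae_S fg => x h hx; congr (_%:E); apply: h.
Qed.

Lemma deriv_within_cont (f : R -> R) (A : set R) t l : deriv_within A f t l ->
  f s @[s --> within A t^'] --> f t.
Proof.
move=> h.
have s0 : s - t @[s --> within A t^'] --> (0 : R).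
  apply/cvgrPdist_le => e e0; apply/within_dnbhsP; exists e => // z tz _ _.
  by rewrite sub0r opprB ltW.
have FF : Filter (within A t^') by exact: within_filter.
have h2 : (f s - f t) / (s - t) * (s - t) + f t @[s --> within A t^'] --> l * 0 + f t.
  by apply: cvgD; [exact: cvgM|exact: cvg_cst].
rewrite mulr0 add0r in h2.
have e : (fun s => (f s - f t) / (s - t) * (s - t) + f t) = f; last by move: h2; rewrite e.
apply/funext => s; have [->|st] := eqVneq s t; first by rewrite !subrr mulr0 add0r.
by rewrite divfK ?subrK // subr_eq0.
Qed.

Lemma deriv_within_continuous (f g : R -> R) : (forall t, t \in `[0, T] -> deriv_within `[0, T] f t (g t)) ->
  {within `[0, T], continuous f}.
Proof. by move=> h; apply: within_by_dnbhs => t ht; apply: deriv_within_cont (h t ht). Qed.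

Lemma seq_within (A : set R) (t : R) (s_ : nat -> R) : (forall n, A (s_ n) /\ s_ n != t) ->
  s_ n @[n --> \oo] --> t -> s_ n @[n --> \oo] --> within A t^'.
Proof.
move=> hA /cvgrPdist_lt st P /within_dnbhsP[e e0 H].
have [n0 _ hn] := st _ e0; exists n0 => // n h0; have [h1 h2] := hA n.
exact: H (hn n h0) h2 h1.
Qed.

Section TimeDifferentiable.
Variables (u ut : R -> R -> R) (m : mesh a b) (r s : nat) (K0 : R) (U : nat -> R -> R -> R).
Hypotheses (hu : forall t, t \in `[0, T] -> {within `[a, b], continuous (u t)})
  (du : forall t x, t \in `[0, T] -> x \in `]a, b[ -> deriv_within `[0, T] (fun s => u s x) t (ut t x))
  (reg : regular T m r.+1 s K0 u U).

(** The function is bounded at almost every time, hence at every time since it is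
    continuous in time at each point; dominated convergence then gives the
    continuity that [lipschitz_in_time] needs. *)
Lemma lipschitz_of_derivative : exists M, forall s t x, s \in `[0, T] -> t \in `[0, T] ->
  x \in `[a, b] -> `|u s x - u t x| <= M * `|s - t|.
Proof.
have [U0 bU _ wU] := reg; have [M0 b0] := bU 0%N isT; have [M b1] := bU 1%N isT.
have w0 := wU 0%N isT; rewrite U0 in b0 w0.
exists M; apply: (lipschitz_in_time hab hT hu (ex_intro _ M0 b0) b1 w0) => al be h1 h2 h3.
have bnd t x : t \in `[0, T] -> x \in `]a, b[ -> `|u t x| <= M0.
  move=> ht hx; have [_ b0'] := b0.
  have cx : {within `[0, T], continuous (fun t => u t x)}.
    by apply: (deriv_within_continuous (g := fun t => ut t x)) => t' ht'; exact: du.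
  apply: (ae_norm_within hT cx _ ht); apply: ae_S b0' => t' h ht'.
  have ht2 : t' \in `[0, T] by exact: subset_itv_oo_cc ht'.
  by apply: (ae_norm_within hab (hu ht2) (h ht')); exact: subset_itv_oo_cc hx.
apply: within_by_dnbhs => t ht; apply: cvg_by_seq => t_ ht_ tt.
have sub x : x \in `]al, be[ -> x \in `]a, b[.
  by rewrite !in_itv /= => /andP[x1 x2]; rewrite (le_lt_trans h1 x1) (lt_le_trans x2 h3).
have iu t' : t' \in `[0, T] -> itb al be (u t').
  by move=> ht'; apply: (itb_sub h1 h3); apply: itb_cont; exact: hu.
have pw x : x \in `]al, be[ -> u (t_ n) x @[n --> \oo] --> u t x.
  by move=> hx; have := deriv_within_cont (du ht (sub x hx)); apply: cvg_comp; exact: seq_within ht_ tt.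
have bd n x : x \in `]al, be[ -> `|u (t_ n) x| <= M0 by move=> hx; exact: bnd (ht_ n).1 (sub x hx).
exact: (itg_dominated (fun n => itb_meas (iu _ (ht_ n).1)) pw (itb_cst al be M0) bd).2.
Qed.

End TimeDifferentiable.

(** The integrals of dv over subintervals are differences of values of v. *)
Lemma lipschitz_of_primitive (v dv : R -> R -> R) (m : mesh a b) r s K0 V M :
  (forall t, t \in `[0, T] -> {within `[a, b], continuous (v t)}) ->
  (forall t, t \in `[0, T] -> {within `[a, b], continuous (dv t)}) ->
  (forall t, t \in `[0, T] -> weak_deriv a b (v t) (dv t)) ->
  (forall s t x, s \in `[0, T] -> t \in `[0, T] -> x \in `[a, b] ->
    `|v s x - v t x| <= M * `|s - t|) ->
  regular T m r.+1 s K0 dv V ->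
  exists M', forall s t x, s \in `[0, T] -> t \in `[0, T] -> x \in `[a, b] ->
    `|dv s x - dv t x| <= M' * `|s - t|.
Proof.
move=> hv hdv wdv lip [V0 bV _ wV].
have [M0 b0] := bV 0%N isT; have [M1 b1] := bV 1%N isT; have w0 := wV 0%N isT.
rewrite V0 in b0 w0.
exists M1; apply: (lipschitz_in_time hab hT hdv (ex_intro _ M0 b0) b1 w0) => al be h1 h2 h3.
apply: (@within_lip _ _ _ _ (2 * M)) => s' t hs ht.
rewrite -(weak_ftc hab (hv _ hs) (wdv _ hs) h1 (ltW h2) h3).
rewrite -(weak_ftc hab (hv _ ht) (wdv _ ht) h1 (ltW h2) h3).
have ha : al \in `[a, b] by rewrite in_itv /=; lra.
have hb : be \in `[a, b] by rewrite in_itv /=; lra.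
have := lip _ _ _ hs ht ha; have := lip _ _ _ hs ht hb.
rewrite !ler_norml => /andP[a1 a2] /andP[a3 a4]; apply/andP; split; lra.
Qed.

Lemma approach t : t \in `[0, T] -> exists s_ : nat -> R,
  (forall n, `[0, T]%classic (s_ n) /\ s_ n != t) /\ s_ n @[n --> \oo] --> t.
Proof.
rewrite in_itv /= => /andP[t0 tT]; have hT' := hT.
pose c : R := if t == 0 then T else 0.
have ct : c - t != 0 by rewrite /c; case: (eqVneq t 0) => [->|nt]; rewrite ?subr0 ?sub0r ?oppr_eq0 // gt_eqF.
have c01 : 0 <= c <= T by rewrite /c; case: ifP; rewrite lexx ltW.
exists (fun n => t + (c - t) * n.+1%:R^-1); split=> [n|]; last first.
  have : t + (c - t) * n.+1%:R^-1 @[n --> \oo] --> t + (c - t) * 0.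
    by apply: cvgD; [exact: cvg_cst|apply: cvgM; [exact: cvg_cst|exact: cvg_harmonic]].
  by rewrite mulr0 addr0.
split; last by rewrite -subr_eq0 addrAC subrr add0r mulf_neq0 // invr_eq0 pnatr_eq0.
have l0 : 0 < n.+1%:R^-1 :> R by rewrite invr_gt0.
have l1 : n.+1%:R^-1 <= 1 :> R by rewrite invf_le1 // ler1n.
move: c01 => /andP[c0 cT]; rewrite /= in_itv /=; move: (n.+1%:R^-1 : R) l0 l1 => l l0 l1.
have -> : t + (c - t) * l = (1 - l) * t + l * c by ring.
have l1' : 0 <= 1 - l by rewrite subr_ge0.
rewrite addr_ge0 ?mulr_ge0 ?(ltW l0) //=.
have := ler_wpM2l l1' tT; have := ler_wpM2l (ltW l0) cT; lra.
Qed.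

End ExactInTime.

(** * From the method to the error equations *)

Section PolynomialLimits.
Context {R : realType}.
Let nd (i : nat) : R := i.+1%:R^-1.
Let nd_inj : injective nd.
Proof. by move=> i j /invr_inj /eqP; rewrite eqr_nat => /eqP[]. Qed.
Let nd01 i : 0 <= nd i <= 1.
Proof. by rewrite invr_ge0 ler0n invf_le1 ?ltr0n // ler1n. Qed.

Lemma interpolation K : exists L : 'I_K.+1 -> {poly R}, (forall i, (size (L i) <= K.+1)%N) /\
  forall p : {poly R}, (size p <= K.+1)%N -> p = \sum_(i < K.+1) p.[nd i] *: L i.
Proof.
exists (fun i => tnth (qpoly.lagrange K.+1 nd) i); split=> [i|p sp].
  by rewrite qpoly.size_lagrange_.
rewrite {1}(qpoly.lagrange_gen (isT : (0 < K.+1)%N) nd_inj sp).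
by apply: eq_bigr => i _; rewrite mul_polyC.
Qed.

(** Interpolation at fixed points passes to the limit. *)
Lemma poly_limit_size K (f : nat -> {poly R}) (p : {poly R}) :
  (forall n, (size (f n) <= K.+1)%N) ->
  (forall x, 0 <= x <= 1 -> (f n).[x] @[n --> \oo] --> p.[x]) -> (size p <= K.+1)%N.
Proof.
move=> sf fp; have [L [sL hL]] := interpolation K.
pose q := \sum_(i < K.+1) p.[nd i] *: L i.
have sq : (size q <= K.+1)%N.
  by apply: (leq_trans (size_sum _ _ _)); apply/bigmax_leqP => i _; exact: leq_trans (size_scale_leq _ _) (sL i).
suff -> : p = q by [].
have e x : 0 < x < 1 -> p.[x] = q.[x].
  move=> /andP[x0 x1]; have hx : 0 <= x <= 1 by rewrite !ltW.
  have c2 : (f n).[x] @[n --> \oo] --> q.[x].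
    have -> : (fun n => (f n).[x]) = (fun n => \sum_(i < K.+1) (f n).[nd i] * (L i).[x]).
      by apply/funext => n; rewrite {1}(hL _ (sf n)) horner_sum; apply: eq_bigr => i _; rewrite hornerZ.
    rewrite /q horner_sum; apply: cvg_sumr => i _; rewrite hornerZ.
    by apply: cvgM; [exact: fp|exact: cvg_cst].
  by apply: cvg_unique (fp x hx) c2.
apply/eqP; rewrite -subr_eq0; apply/eqP/dotp_eq0; rewrite -normp_sqr.
have le0 : normp (p - q) <= normp (0 : {poly R}).
  by apply: le_normp => x hx; rewrite hornerD hornerN e // subrr horner0.
have -> : normp (p - q) = 0 by apply/eqP; rewrite eq_le normp_ge0 andbT; apply: le_trans le0 _; rewrite normp0.
by rewrite expr0n.
Qed.

Lemma poly_limit_pcvg K (F : set_system R) {FF : Filter F} (f : R -> {poly R}) (p : {poly R}) :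
  (\forall s \near F, (size (f s) <= K.+1)%N) -> (size p <= K.+1)%N ->
  (forall x, 0 <= x <= 1 -> (f n).[x] @[n --> F] --> p.[x]) -> pcvg (F := F) f p.
Proof.
move=> sf sp fp; have [L [sL hL]] := interpolation K.
apply: (@pcvg_le _ _ _ _ _ _ (fun s => \sum_(i < K.+1) `|(f s).[nd i] - p.[nd i]| * normp (L i))).
  apply: filterS sf => s sfs; have -> : f s - p = \sum_(i < K.+1) ((f s).[nd i] - p.[nd i]) *: L i.
    rewrite {1}(hL _ sfs) {1}(hL _ sp) -sumrB; apply: eq_bigr => i _; by rewrite scalerBl.
  by apply: le_trans (normp_sum _ _ _) _; apply: ler_sum => i _; rewrite normpZ.
have e0 : \sum_(i < K.+1) (0 : R) = 0 by rewrite big1.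
rewrite -[X in _ --> X]e0.
apply: cvg_sumr => i _; rewrite -[0](mul0r (normp (L i))).
apply: cvgM; last exact: cvg_cst.
rewrite -(normr0 R) -(subrr p.[nd i]); apply: cvg_norm; apply: cvgB; [exact: fp|exact: cvg_cst].
Qed.

End PolynomialLimits.

Section Transplant.
Context {R : realType} (c d : R).
Hypothesis cd : c < d.
Implicit Types (p v : {poly R}).
Let h0 : d - c != 0. Proof. by rewrite subr_eq0 gt_eqF. Qed.

(** [pull] goes to the reference element and [push] comes from it. *)
Definition pull p := p \Po ((d - c) *: 'X + c%:P).
Definition push p := p \Po ((d - c)^-1 *: ('X - c%:P)).

Lemma el_pull p y : el c d (pull p) y = p.[y].
Proof. by rewrite /el /pull horner_comp hornerD hornerZ hornerX hornerC [_ * (_ / _)]mulrC divfK // subrK. Qed.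

Lemma pull_horner p (s : R) : (pull p).[s] = p.[(d - c) * s + c].
Proof. by rewrite horner_comp !hornerE. Qed.

Lemma push_horner p y : (push p).[y] = el c d p y.
Proof. by rewrite /el /push horner_comp hornerZ hornerD hornerX hornerN hornerC mulrC. Qed.

Lemma size_pull p : size (pull p) = size p.
Proof.
rewrite size_comp_poly2 // size_polyDl size_scale ?size_polyX //.
by rewrite ltnS size_polyC leq_b1.
Qed.

Lemma size_push p : size (push p) = size p.
Proof. by rewrite size_comp_poly2 // size_scale ?invr_eq0 // size_XsubC. Qed.

Lemma deriv_push p : (push p)^`() = (d - c)^-1 *: push p^`().
Proof. by rewrite deriv_comp derivZ derivB derivX derivC subr0 -scalerAr mulr1. Qed.

Lemma itg_pull_push p v : itg c d (fun y => p.[y] * (push v).[y]) = (d - c) * dotp (pull p) v.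
Proof.
rewrite -itg_elM //; apply: itg_ext => y _; by rewrite el_pull push_horner.
Qed.

Lemma itg_prj_push K (w : R -> R) v : itb c d w -> (size v <= K)%N ->
  itg c d (fun y => w y * (push v).[y]) = (d - c) * dotp (prj K c d w) v.
Proof.
by move=> iw sv; rewrite -prj_dot //; apply: itg_ext => y _; rewrite push_horner.
Qed.

(** The projections of a function and of its weak derivative satisfy the local
    equations of the method, with the values of the function as traces. *)
Lemma exact_parts K (w dw : R -> R) v : {within `[c, d], continuous w} -> weak_deriv c d w dw ->
  (size v <= K)%N -> (d - c) * dotp (prj K c d dw) v + dotp (prj K c d w) v^`() =
    w d * v.[1] - w c * v.[0].
Proof.
move=> cw wd sv; have [_ idw _] := wd.
have sv' : (size v^`() <= K)%N by apply: size_deriv_le (leqW sv).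
rewrite -prj_dot // (weak_parts cd cw wd (fun y => el_der c d v y)); last first.
  by apply: contM; [exact: cont_cst|exact: el_cont].
have -> : itg c d (fun y => w y * ((d - c)^-1 * el c d v^`() y)) = dotp (prj K c d w) v^`().
  rewrite (itg_ext (g := fun y => (d - c)^-1 * (w y * el c d v^`() y))); last by move=> y _; ring.
  rewrite itgZ; last exact/itb_el/itb_cont.
  by rewrite (prj_dot cd (itb_cont cw) sv') mulKf.
by rewrite el_left el_right // subrK.
Qed.

End Transplant.

Section LocalEquations.
Context {R : realType} {a b : R} (m : mesh a b).
Local Notation N := (nelt m).
Local Notation x := (node m).
Local Notation h i := (x i.+1 - x i).

Definition single (i : 'I_N) (p : {poly R}) (j : 'I_N) : {poly R} := if j == i then p else 0.

Lemma Wh_single k i (p : {poly R}) : (size p <= k.+1)%N -> Wh k (single i p).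
Proof. by move=> sp j; rewrite /single; case: ifP; rewrite ?size_poly0. Qed.

Lemma dpw_single i p : dpw (single i p) = single i p^`().
Proof. by apply/funext => j; rewrite /dpw /single; case: ifP; rewrite ?deriv0. Qed.

Lemma ip_single (phi : 'I_N -> R -> R) i p :
  ip phi (single i p) = itg (x i) (x i.+1) (fun y => phi i y * p.[y]).
Proof.
rewrite /ip (bigD1 i) //= big1 ?addr0 => [|j ji].
  by apply: itg_ext => y _; rewrite /single eqxx.
rewrite -/(itg _ _ _) (itg_ext (g := fun=> 0)) ?itg_cst ?mul0r ?(ltW (elt_lt j)) // => y _.
by rewrite /single (negbTE ji) horner0 mulr0.
Qed.

Lemma bip_single (F : 'I_N -> side -> R) i p :
  bip F (trace (single i p)) = F i Minus * p.[x i.+1] - F i Plus * p.[x i].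
Proof.
rewrite /bip (bigD1 i) //= big1 ?addr0 => [|j ji].
  by rewrite /trace /single eqxx /=; ring.
by rewrite /trace /single (negbTE ji) /= !horner0; ring.
Qed.

Lemma ipp_push (Z : 'I_N -> {poly R}) i v :
  ipp Z (single i (push (x i) (x i.+1) v)) = h i * dotp (pull (x i) (x i.+1) (Z i)) v.
Proof. by rewrite /ipp ip_single itg_pull_push // elt_lt. Qed.

Lemma ipp_dpush (Z : 'I_N -> {poly R}) i v :
  ipp Z (dpw (single i (push (x i) (x i.+1) v))) = dotp (pull (x i) (x i.+1) (Z i)) v^`().
Proof.
have lt := elt_lt i; rewrite /ipp dpw_single ip_single deriv_push.
rewrite (itg_ext (g := fun y => (h i)^-1 * ((Z i).[y] * (push (x i) (x i.+1) v^`()).[y]))); last first.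
  by move=> y _; rewrite hornerZ; ring.
rewrite itgZ ?itg_pull_push ?mulKf ?subr_eq0 ?gt_eqF //.
by apply: itb_cont; apply: within_mul; apply: continuous_subspaceT; exact: poly_cont.
Qed.

Lemma bip_push (F : 'I_N -> side -> R) i v :
  bip F (trace (single i (push (x i) (x i.+1) v))) = F i Minus * v.[1] - F i Plus * v.[0].
Proof. by have lt := elt_lt i; rewrite bip_single !push_horner el_left el_right. Qed.

(** Read from the left of each node, except at the first one. *)
Definition node_val (F : 'I_N -> side -> R) (j : nat) : R :=
  match j with
  | 0 => if insub 0%N is Some i then F i Plus else 0
  | j'.+1 => if insub j' is Some i then F i Minus else 0
  end.

Lemma node_valS F (i : 'I_N) : node_val F i.+1 = F i Minus.
Proof. by rewrite /node_val valK. Qed.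

Lemma node_valE F (i : 'I_N) :
  (forall (j : 'I_N) (hj : (j.+1 < N)%N), F j Minus = F (Ordinal hj) Plus) ->
  node_val F i = F i Plus.
Proof.
case: i => [[|j] hj] H; rewrite /node_val /=.
  by rewrite insubT; congr (F _ _); apply: val_inj.
by rewrite (insubT (fun j => j < N)%N (ltnW hj)) /= (H (Ordinal (ltnW hj)) hj); congr (F _ _); apply: val_inj.
Qed.

Lemma bip_jump (F : 'I_N -> side -> R) (j : 'I_N) (hj : (j.+1 < N)%N) :
  bip F (nodal (fun k => (k == j.+1)%:R)) = F j Minus - F (Ordinal hj) Plus.
Proof.
rewrite /bip big_split /=; congr (_ + _).
  rewrite (bigD1 j) //= big1 ?addr0 => [|i ij]; first by rewrite /nodal /= eqxx !mulr1.
  by rewrite /nodal /= eqSS (negbTE (_ : val i != val j)) ?mulr0 ?mul0r.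
rewrite (bigD1 (Ordinal hj)) //= big1 ?addr0 => [|i ij]; first by rewrite /nodal /= eqxx mulr1 mulrN1.
by rewrite /nodal /= (negbTE (_ : val i != j.+1)) ?mulr0 ?mul0r.
Qed.

Lemma bip_omit0_jump (F : 'I_N -> side -> R) (j : 'I_N) (hj : (j.+1 < N)%N) :
  bip_omit0 F (nodal (fun k => (k == j.+1)%:R)) = F j Minus - F (Ordinal hj) Plus.
Proof.
rewrite /bip_omit0; congr (_ + _).
  rewrite (bigD1 j) //= big1 ?addr0 => [|i ij]; first by rewrite /nodal /= eqxx !mulr1.
  by rewrite /nodal /= eqSS (negbTE (_ : val i != val j)) ?mulr0 ?mul0r.
rewrite (bigD1 (Ordinal hj)) //= big1 ?addr0 => [|i /andP[_ ij]]; first by rewrite /nodal /= eqxx mulr1 mulrN1.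
by rewrite /nodal /= (negbTE (_ : val i != j.+1)) ?mulr0 ?mul0r.
Qed.

Lemma bip_omit0_last (F : 'I_N -> side -> R) (j : 'I_N) : j.+1 = N ->
  bip_omit0 F (nodal (fun k => (k == N)%:R)) = F j Minus.
Proof.
move=> jN; rewrite /bip_omit0 [X in _ + X]big1 ?addr0 => [|i _]; last first.
  by rewrite /nodal /= ltn_eqF ?mulr0 ?mul0r.
rewrite (bigD1 j) //= big1 ?addr0 => [|i ij]; first by rewrite /nodal /= jN eqxx !mulr1.
rewrite /nodal /=; have -> : (i.+1 == N) = false; last by rewrite mulr0 mul0r.
by apply/negP => /eqP e; move/eqP: ij; apply; apply/val_inj/succn_inj; rewrite e jN.
Qed.

End LocalEquations.

Section ProjectedSolution.
Context {R : realType} (a b : R) (m : mesh a b) (n : nat).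
Hypothesis hab : a < b.
Local Notation mu := (@lebesgue_measure R).
Local Notation N := (nelt m).
Local Notation x := (node m).
Local Notation h i := (x i.+1 - x i).
Local Notation P i w := (prj n.+2 (x i) (x i.+1) w).
Local Notation pl i p := (pull (x i) (x i.+1) p).

Let h_neq0 (i : 'I_N) : h i != 0. Proof. by rewrite subr_eq0 gt_eqF // elt_lt. Qed.

Lemma elt_within (w : R -> R) (i : 'I_N) : {within `[a, b], continuous w} ->
  {within `[x i, x i.+1], continuous w}.
Proof.
apply: continuous_subspaceW; apply: subset_itvScc; rewrite bnd_simp; [exact: elt_ge|exact: elt_le].
Qed.

Lemma elt_sub (i : 'I_N) y : y \in `](x i), (x i.+1)[ -> y \in `]a, b[.
Proof.
rewrite !in_itv /= => /andP[y1 y2].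
by rewrite (le_lt_trans (elt_ge i) y1) (lt_le_trans y2 (elt_le i)).
Qed.

Lemma elt_itb (w : R -> R) (i : 'I_N) : itb a b w -> itb (x i) (x i.+1) w.
Proof. by apply: itb_sub; [exact: elt_ge|exact: elt_le]. Qed.

Lemma proj_error_left (i : 'I_N) (w : R -> R) : proj_error n i w (x i) = w (x i) - (P i w).[0].
Proof. by rewrite /proj_error subrr mul0r. Qed.

Lemma proj_error_right (i : 'I_N) (w : R -> R) : proj_error n i w (x i.+1) = w (x i.+1) - (P i w).[1].
Proof. by rewrite /proj_error divff. Qed.

Lemma proj_errorB (i : 'I_N) (w w' : R -> R) y : itb (x i) (x i.+1) w -> itb (x i) (x i.+1) w' ->
  proj_error n i (fun s => w s - w' s) y = proj_error n i w y - proj_error n i w' y.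
Proof. by move=> iw iw'; rewrite /proj_error prjB // hornerD hornerN; ring. Qed.

Lemma proj_errorZ (i : 'I_N) (w : R -> R) (c : R) y : itb (x i) (x i.+1) w ->
  proj_error n i (fun s => c * w s) y = c * proj_error n i w y.
Proof. by move=> iw; rewrite /proj_error prjZ // hornerZ; ring. Qed.

Lemma last_elt : exists j : 'I_N, j.+1 = N.
Proof.
have : (0 < N)%N.
  rewrite lt0n; apply/negP => /eqP N0; have e1 := node_last m; have e2 := node_first m.
  by move: e1; rewrite N0 e2 => e; move: hab; rewrite e ltxx.
by case: N => // j _; exists ord_max.
Qed.

Section FixedTime.
Variables (tau : stabilization R).
Hypotheses (sg_gt0 : 0 < tau_qu_m tau) (tau_prod : tau_qu_m tau * tau_qp_m tau = 1).
Variables (z : 'I_N -> {poly R}) (F uD : R -> R) (qN : R) (S : hdg_state R N).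
Variables (w0 w w1 w2 w3 : R -> R).
Hypotheses (eqs : hdg_equations n.+1 tau z F uD qN S)
  (sz : forall i, (size (z i) <= n.+2)%N)
  (cw : {within `[a, b], continuous w}) (cw1 : {within `[a, b], continuous w1})
  (cw2 : {within `[a, b], continuous w2})
  (d1 : weak_deriv a b w w1) (d2 : weak_deriv a b w1 w2) (d3 : weak_deriv a b w2 w3)
  (i0 : itb a b w0) (pde : {ae mu, forall y, y \in `]a, b[ -> w0 y + w3 y = F y})
  (bc : [/\ w a = uD a, w b = uD b & w1 b = qN]).

Let Q j := node_val (qhat tau S) j.
Let Ph j := node_val (phat tau S) j.

Let qhat_single (j : 'I_N) (hj : (j.+1 < N)%N) : qhat tau S j Minus = qhat tau S (Ordinal hj) Plus.
Proof.
have [_ _ _ _ [_ e4 _]] := eqs; have := e4 (fun k => (k == j.+1)%:R).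
rewrite (bip_omit0_jump (qhat tau S) hj) gt_eqF // mulr0.
by move/eqP; rewrite subr_eq0 => /eqP.
Qed.

Let phat_single (j : 'I_N) (hj : (j.+1 < N)%N) : phat tau S j Minus = phat tau S (Ordinal hj) Plus.
Proof.
have [_ _ _ _ [_ _ e5]] := eqs; have := e5 (fun k => (k == j.+1)%:R) erefl.
rewrite (bip_jump (phat tau S) hj) gt_eqF // => /(_ erefl).
by move/eqP; rewrite subr_eq0 => /eqP.
Qed.

Lemma fixed_time_boundary : [/\ w (x 0) - uhat S 0 = 0, w (x N) - uhat S N = 0 & w1 (x N) - Q N = 0].
Proof.
have [_ [u0 uN] _ _ [_ e4 _]] := eqs; have [b1 b2 b3] := bc.
rewrite node_first node_last b1 b2 b3 u0 uN !subrr; split=> //.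
have [j jN] := last_elt; have := e4 (fun k => (k == N)%:R).
rewrite (bip_omit0_last _ jN) eqxx mulr1 => <-; have -> : Q N = Q j.+1 by rewrite jN.
by rewrite /Q node_valS subrr.
Qed.

(** The equations of the method with test functions supported in one element,
    subtracted from those of the projections ([exact_parts]). *)
Lemma fixed_time_equations (i : 'I_N) :
  raw_eqs n (tau_qu_m tau) (tau_qu_p tau) (tau_pu_p tau) (hh x i)
    (P i w - pl i (uh S i)) (P i w1 - pl i (qh S i)) (P i w2 - pl i (ph S i)) (P i w0 - pl i (z i))
    (Traces (proj_error n i w (x i)) (proj_error n i w (x i.+1)) (proj_error n i w1 (x i)) (proj_error n i w1 (x i.+1))
       (proj_error n i w2 (x i)) (proj_error n i w2 (x i.+1)))
    (w (x i) - uhat S i) (w (x i.+1) - uhat S i.+1) (w1 (x i) - Q i) (w1 (x i.+1) - Q i.+1)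
    (w2 (x i) - Ph i) (w2 (x i.+1) - Ph i.+1).
Proof.
have [[su [sq sp]] _ e1 e2 [e3 _ _]] := eqs; have lt := elt_lt i.
have sB (f g : {poly R}) : (size f <= n.+2)%N -> (size g <= n.+2)%N -> (size (f - g)%R <= n.+2)%N.
  by move=> sf sg; rewrite (leq_trans (size_polyD _ _)) // geq_max size_polyN sf.
have Ql : Q i = qhat tau S i Plus by exact: node_valE qhat_single.
have Pl : Ph i = phat tau S i Plus by exact: node_valE phat_single.
have Qr : Q i.+1 = qhat tau S i Minus by exact: node_valS.
have Pr : Ph i.+1 = phat tau S i Minus by exact: node_valS.
have c1 := @elt_within _ i cw; have c2 := @elt_within _ i cw1; have c3 := @elt_within _ i cw2.
have f1 := weak_restrict (elt_ge i) lt (elt_le i) d1.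
have f2 := weak_restrict (elt_ge i) lt (elt_le i) d2.
have f3 := weak_restrict (elt_ge i) lt (elt_le i) d3.
rewrite /hh; split.
- by split; apply: sB; rewrite ?size_prj ?size_pull.
- move=> v sv; have g := exact_parts lt c1 f1 sv.
  have := e1 _ (Wh_single i (_ : (size (push (x i) (x i.+1) v) <= n.+2)%N)).
  rewrite size_push // => /(_ sv); rewrite ipp_push ipp_dpush bip_push /nodal /= => e.
  rewrite !dotpBl; lra.
- move=> v sv; have g := exact_parts lt c2 f2 sv.
  have := e2 _ (Wh_single i (_ : (size (push (x i) (x i.+1) v) <= n.+2)%N)).
  rewrite size_push // => /(_ sv); rewrite ipp_push ipp_dpush bip_push -Ql -Qr => e.
  rewrite !dotpBl; lra.
- move=> v sv; have g := exact_parts lt c3 f3 sv.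
  have := e3 _ (Wh_single i (_ : (size (push (x i) (x i.+1) v) <= n.+2)%N)).
  rewrite size_push // => /(_ sv); rewrite ipp_push ipp_dpush bip_push -Pl -Pr ip_single.
  have [_ i3 _] := f3; have iw0 := @elt_itb _ i i0.
  have cP : {within `[x i, x i.+1], continuous (fun y => (push (x i) (x i.+1) v).[y])}.
    by apply: continuous_subspaceT; exact: poly_cont.
  have -> : itg (x i) (x i.+1) (fun y => F y * (push (x i) (x i.+1) v).[y]) =
      h i * dotp (P i w0) v + h i * dotp (P i w3) v.
    have j0 := itb_mulc iw0 cP; have j3 := itb_mulc i3 cP.
    rewrite -!itg_prj_push // -(itgD j0 j3).
    apply: itg_ae_any; apply: ae_S pde => y hy hyi.
    by rewrite -hy ?mulrDl //; exact: elt_sub hyi.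
  move=> e; rewrite !dotpBl; lra.
have qp : tau_qp_m tau = (tau_qu_m tau)^-1.
  by apply: (mulfI (lt0r_neq0 sg_gt0)); rewrite tau_prod divff // lt0r_neq0.
rewrite Ql Pl Qr Pr /qhat /phat /trace /nodal /= qp !proj_error_left !proj_error_right.
rewrite !hornerD !hornerN !pull_horner !mulr0 !mulr1 !add0r !subrK.
split; [ring|ring|ring].
Qed.

End FixedTime.

Lemma ind_indic (al be y : R) : \1_(`]al, be[) y = ind al be y.
Proof.
rewrite indicE /ind; case: ifPn => hx; first by rewrite mem_set //= in_itv.
by rewrite memNset //= in_itv; exact/negP.
Qed.

Lemma pwfunE (f : 'I_N -> {poly R}) y : pwfun f y = \sum_(i < N) ind (x i) (x i.+1) y * (f i).[y].
Proof. by apply: eq_bigr => i _; rewrite ind_indic mulrC. Qed.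

(** On each element the error is a projection error plus a polynomial, which is the
    projected error. *)
Lemma error_norm (w : R -> R) (f : 'I_N -> {poly R}) (A B : R) : bounded_kernel a b w ->
  \sum_(i < N) itg (x i) (x i.+1) (fun y => proj_error n i w y ^+ 2) <= A ->
  wnorm x (fun i => P i w - pl i (f i)) <= B ->
  (L2norm a b (fun y => w y - pwfun f y)%R <= (Num.sqrt (2 * A + 2 * B))%:E)%E.
Proof.
move=> kw hA hB.
have bk_itb (g : R -> R) : bounded_kernel a b g -> itb a b g.
  by move=> [C [mg bg]]; exact: itb_bounded mg bg.
have kf : bounded_kernel a b (pwfun f).
  have -> : pwfun f = (fun y => \sum_(i < N) ind (x i) (x i.+1) y * (f i).[y]).
    by apply/funext => y; exact: pwfunE.
  by apply: bk_sum => i; apply: bkM; [exact: bk_ind|apply: bk_cont; exact: poly_cont].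
have kN (g : R -> R) : bounded_kernel a b g -> bounded_kernel a b (fun y => - g y).
  move=> kg; have -> : (fun y => - g y) = (fun y => -1 * g y) by apply/funext => y; rewrite mulN1r.
  by apply: bkM => //; apply: bk_cont; exact: cont_cst.
have ke : bounded_kernel a b (fun y => w y - pwfun f y) by apply: bkD => //; exact: kN.
have ie : itb a b (fun y => (w y - pwfun f y) ^+ 2) by apply: bk_itb; exact: bkM.
have kperr (i : 'I_N) : bounded_kernel a b (proj_error n i w).
  by apply: bkD => //; apply: kN; apply: bk_cont; exact: (@el_cont _ (x i) (x i.+1)).
have iperr (i : 'I_N) : itb a b (fun y => proj_error n i w y ^+ 2) by apply: bk_itb; exact: bkM.
pose D (i : 'I_N) := P i w - pl i (f i).
have hsum : itg a b (fun y => (w y - pwfun f y) ^+ 2) <= 2 * A + 2 * B.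
  rewrite (itg_mesh m ie).
  apply: (@le_trans _ _ (\sum_(i < N) (2 * itg (x i) (x i.+1) (fun y => proj_error n i w y ^+ 2) +
      2 * (hh x i * normp (D i) ^+ 2)))); last first.
    by rewrite big_split /= -!mulr_sumr; apply: lerD; rewrite ler_pM2l.
  apply: ler_sum => i _; have lt := elt_lt i.
  have ip := @elt_itb _ i (iperr i).
  have iD : itb (x i) (x i.+1) (fun y => el (x i) (x i.+1) (D i) y * el (x i) (x i.+1) (D i) y).
    by apply: itb_el; exact: el_itb.
  rewrite normp_sqr /hh -itg_elM // -(itgZ 2 ip) -(itgZ 2 iD) -(itgD (itbZ 2 ip) (itbZ 2 iD)).
  apply: itg_le; [exact: elt_itb|exact: itbD (itbZ 2 ip) (itbZ 2 iD)|].
  move=> y hy; rewrite pwfunE (sum_ind_elt (fun j => (f j).[y]) hy).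
  have -> : w y - (f i).[y] = proj_error n i w y + el (x i) (x i.+1) (D i) y.
    rewrite -(el_pull (elt_lt i) (f i) y) /proj_error /el /D hornerD hornerN; ring.
  exact: sqr2_le.
apply: itg_L2norm_le => //.
by rewrite sqr_sqrtr //; apply: le_trans hsum; apply: itg_ge0 => y _; exact: sqr_ge0.
Qed.

End ProjectedSolution.

Section InTime.
Context {R : realType} (a b T : R) (m : mesh a b) (n : nat).
Hypotheses (hab : a < b) (hT : 0 < T).
Local Notation mu := (@lebesgue_measure R).
Local Notation N := (nelt m).
Local Notation x := (node m).
Local Notation h i := (x i.+1 - x i).
Local Notation P i w := (prj n.+2 (x i) (x i.+1) w).
Local Notation pl i p := (pull (x i) (x i.+1) p).

Let in0T (t : R) : 0 <= t <= T -> t \in `[0, T]. Proof. by rewrite in_itv. Qed.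

Section DifferenceQuotients.
Variables (u ut : R -> R -> R) (M : R).
Hypotheses (hu : forall t, t \in `[0, T] -> {within `[a, b], continuous (u t)})
  (du : forall t x, t \in `[0, T] -> x \in `]a, b[ -> deriv_within `[0, T] (fun s => u s x) t (ut t x))
  (lip : forall s t x, s \in `[0, T] -> t \in `[0, T] -> x \in `[a, b] ->
    `|u s x - u t x| <= M * `|s - t|).

Definition slope (t s y : R) : R := (s - t)^-1 * (u s y - u t y).

Variables (t : R) (s_ : nat -> R).
Hypotheses (ht : t \in `[0, T]) (hs : forall k, `[0, T]%classic (s_ k) /\ s_ k != t)
  (st : s_ k @[k --> \oo] --> t).

Lemma slope_le k y : y \in `]a, b[ -> `|slope t (s_ k) y| <= M.
Proof.
move=> hy; have [h1 h2] := hs k; rewrite /slope mulrC normrM normfV.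
rewrite ler_pdivrMr ?normr_gt0 ?subr_eq0 //; apply: lip => //; exact: subset_itv_oo_cc hy.
Qed.

Lemma slope_within k : {within `[a, b], continuous (slope t (s_ k))}.
Proof.
have [h1 _] := hs k; apply: within_mul; first by apply: continuous_subspaceT; exact: cont_cst.
by apply: within_sub; exact: hu.
Qed.

Lemma slope_cvg y : y \in `]a, b[ -> slope t (s_ k) y @[k --> \oo] --> ut t y.
Proof.
move=> hy; have c0 := du ht hy; have c1 := seq_within hs st.
have := cvg_comp _ _ c1 c0; apply: cvg_trans; apply: near_eq_cvg; apply: nearW => k.
by rewrite /= /slope mulrC.
Qed.

Lemma time_derivative_le y : y \in `]a, b[ -> `|ut t y| <= M.
Proof.
move=> hy; have c : `|slope t (s_ k) y| @[k --> \oo] --> `|ut t y| by apply: cvg_norm; exact: slope_cvg.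
by apply: (ler_cvg_to c (cvg_cst M)); apply: nearW => k; exact: slope_le.
Qed.

Lemma time_derivative_itb : itb a b (ut t).
Proof.
have mk k := itb_meas (itb_cont (@slope_within k)).
exact: (itg_dominated mk slope_cvg (itb_cst a b M) (fun k y => @slope_le k y)).1.
Qed.

Lemma slope_itb k : itb a b (slope t (s_ k)). Proof. exact: itb_cont (@slope_within k). Qed.

Lemma slope_prj_cvg (i : 'I_N) y : (P i (slope t (s_ k))).[y] @[k --> \oo] --> (P i (ut t)).[y].
Proof.
have ik k := @elt_itb _ _ _ m _ i (@slope_itb k); have iu := @elt_itb _ _ _ m _ i time_derivative_itb.
pose G z := - el (x i) (x i.+1) (prjker n.+2 (x i) (x i.+1) y) z.
have cG : {within `[x i, x i.+1], continuous G}.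
  by apply: continuous_subspaceT => z; apply: cvgN; exact: el_cont.
have [B hB] := bounded_within cG.
have mk k : measurable_fun `](x i), (x i.+1)[ (fun z => slope t (s_ k) z * G z).
  exact: itb_meas (itb_mulc (ik k) cG).
have pw z : z \in `](x i), (x i.+1)[ -> slope t (s_ k) z * G z @[k --> \oo] --> ut t z * G z.
  by move=> hz; apply: cvgM; [exact: slope_cvg (elt_sub hz)|exact: cvg_cst].
have bd k z : z \in `](x i), (x i.+1)[ -> `|slope t (s_ k) z * G z| <= M * B.
  move=> hz; rewrite normrM; apply: ler_pM => //; first exact: slope_le (elt_sub hz).
  by apply: hB; exact: subset_itv_oo_cc hz.
have cv := (itg_dominated mk pw (itb_cst (x i) (x i.+1) (M * B)) bd).2.
have e1 : (fun k => itg (x i) (x i.+1) (fun z => slope t (s_ k) z * G z)) =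
    (fun k => - (P i (slope t (s_ k))).[y]).
  by apply/funext => k; exact: prjker_act (ik k).
have e2 : itg (x i) (x i.+1) (fun z => ut t z * G z) = - (P i (ut t)).[y] by exact: prjker_act iu.
rewrite e1 e2 in cv.
have -> : (fun k => (P i (slope t (s_ k))).[y]) = (fun k => - - (P i (slope t (s_ k))).[y]).
  by apply/funext => k; rewrite opprK.
by rewrite -[X in _ --> X]opprK; apply: cvgN.
Qed.

Lemma slope_perr_cvg (i : 'I_N) :
  itg (x i) (x i.+1) (fun y => proj_error n i (slope t (s_ k)) y ^+ 2) @[k --> \oo] -->
  itg (x i) (x i.+1) (fun y => proj_error n i (ut t) y ^+ 2).
Proof.
have lt := elt_lt i.
have ik k := @elt_itb _ _ _ m _ i (@slope_itb k).
have mk k : measurable_fun `](x i), (x i.+1)[ (fun y => proj_error n i (slope t (s_ k)) y ^+ 2).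
  apply: itb_meas; apply: itb_cont.
  have c1 : {within `[x i, x i.+1], continuous (proj_error n i (slope t (s_ k)))}.
    apply: within_sub; last exact: (@el_within _ (x i) (x i.+1)).
    by apply: elt_within; exact: slope_within.
  by have c2 := c1; exact: (within_mul c1 c2).
have pw y : y \in `](x i), (x i.+1)[ ->
    proj_error n i (slope t (s_ k)) y ^+ 2 @[k --> \oo] --> proj_error n i (ut t) y ^+ 2.
  move=> hy; have c1 : proj_error n i (slope t (s_ k)) y @[k --> \oo] --> proj_error n i (ut t) y.
    by apply: cvgB; [exact: slope_cvg (elt_sub hy)|exact: slope_prj_cvg].
  by have c2 := c1; exact: (cvgM c1 c2).
have bd k y : y \in `](x i), (x i.+1)[ -> `|proj_error n i (slope t (s_ k)) y ^+ 2| <= (M + prjC n.+2 * M) ^+ 2.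
  move=> hy; rewrite normrX; apply: lerXn2r; rewrite ?nnegrE //.
    have M0 : 0 <= M := le_trans (normr_ge0 _) (@slope_le k _ (elt_sub hy)).
    by rewrite addr_ge0 // mulr_ge0 // prjC_ge0.
  apply: le_trans (ler_normB _ _) _; apply: lerD; first exact: slope_le (elt_sub hy).
  apply: le_trans (@prj_le _ _ _ _ _ _ lt (ik k) (ref_coord lt (subset_itv_oo_cc hy))) _.
  apply: ler_wpM2l; first exact: prjC_ge0.
  rewrite ler_pdivrMr ?subr_gt0 // -itg_cst ?(ltW lt) //.
  apply: itg_le; [exact: itb_abs|exact: itb_cst|].
  by move=> z hz; exact: slope_le (elt_sub hz).
exact: (itg_dominated mk pw (itb_cst (x i) (x i.+1) _) bd).2.
Qed.

End DifferenceQuotients.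

Variables (tau : stabilization R).
Hypotheses (sg_gt0 : 0 < tau_qu_m tau) (tau_prod : tau_qu_m tau * tau_qp_m tau = 1).
Variables (f : R -> R -> R) (u0 : R -> R) (uD : R -> R -> R) (qN : R -> R) (u q p ut px : R -> R -> R).
Hypothesis ex : @exact_solution R a b T f u0 uD qN u q p ut px.
Variables (S : R -> hdg_state R N) (uht : R -> 'I_N -> {poly R}).
Hypothesis sol : hdg_solution n.+1 tau T f (fun x => u0 x + px 0 x) uD qN S uht.
Variable (M : R).
Hypothesis lip : forall s t x, s \in `[0, T] -> t \in `[0, T] -> x \in `[a, b] ->
    `|u s x - u t x| <= M * `|s - t|.

Let hu t : t \in `[0, T] -> {within `[a, b], continuous (u t)}.
Proof. by case: ex => H _ _ _ _ /H[]. Qed.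
Let hq t : t \in `[0, T] -> {within `[a, b], continuous (q t)}.
Proof. by case: ex => H _ _ _ _ /H[]. Qed.
Let hp t : t \in `[0, T] -> {within `[a, b], continuous (p t)}.
Proof. by case: ex => H _ _ _ _ /H[]. Qed.
Let du t x : t \in `[0, T] -> x \in `]a, b[ -> deriv_within `[0, T] (fun s => u s x) t (ut t x).
Proof. by case: ex => _ _ H _ _; exact: H. Qed.
Let sizes t : t \in `[0, T] -> [/\ Wh n.+1 (uh (S t)), Wh n.+1 (qh (S t)) & Wh n.+1 (ph (S t))].
Proof.
move=> ht; have [_ h1 h2] := sol; have [e|t0] := eqVneq t 0.
  by rewrite e; have [[? []]] := h2.
have ht' : t \in `]0, T] by move: ht; rewrite !in_itv /= lt_neqAle eq_sym t0.
by have [[? []]] := h1 _ ht'.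
Qed.

Definition errors : error_data R N := ErrorData
  (fun t i => Traces (proj_error n i (u t) (x i)) (proj_error n i (u t) (x i.+1)) (proj_error n i (q t) (x i))
     (proj_error n i (q t) (x i.+1)) (proj_error n i (p t) (x i)) (proj_error n i (p t) (x i.+1)))
  (fun t i => P i (u t) - pl i (uh (S t) i)) (fun t i => P i (q t) - pl i (qh (S t) i))
  (fun t i => P i (p t) - pl i (ph (S t) i)) (fun t i => P i (ut t) - pl i (uht t i))
  (fun t j => u t (x j) - uhat (S t) j) (fun t j => q t (x j) - node_val (qhat tau (S t)) j)
  (fun t j => p t (x j) - node_val (phat tau (S t)) j).

Let uh_slope t i y : t \in `[0, T] ->
  ((uh (S s) i).[y] - (uh (S t) i).[y]) / (s - t) @[s --> within `[0, T]%classic t^'] --> (uht t i).[y].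
Proof. by move=> ht; have [h1 _ _] := sol; exact: h1. Qed.

(** A limit of difference quotients of polynomials of bounded degree. *)
Lemma size_uht t i : t \in `[0, T] -> (size (uht t i) <= n.+2)%N.
Proof.
move=> ht; have [s_ [hs st]] := approach hT ht.
apply: (@poly_limit_size _ _ (fun k => (s_ k - t)^-1 *: (uh (S (s_ k)) i - uh (S t) i))) => [k|y _].
  have [h1 _] := hs k; have [w1 _ _] := sizes h1; have [w2 _ _] := sizes ht.
  by rewrite (leq_trans (size_scale_leq _ _)) // (leq_trans (size_polyD _ _)) // geq_max size_polyN w1 w2.
have := cvg_comp _ _ (seq_within hs st) (@uh_slope t i y ht).
apply: cvg_trans; apply: near_eq_cvg; apply: nearW => k.
by rewrite /= hornerZ hornerD hornerN mulrC.
Qed.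

Lemma errors_rate t (i : 'I_N) : t \in `[0, T] -> pcvg (F := within `[0, T]%classic t^')
  (fun s => (s - t)^-1 *: (ud errors s i - ud errors t i)) (gd errors t i).
Proof.
move=> ht; have sB (p1 p2 : {poly R}) : (size p1 <= n.+2)%N -> (size p2 <= n.+2)%N -> (size (p1 - p2)%R <= n.+2)%N.
  by move=> sf sg; rewrite (leq_trans (size_polyD _ _)) // geq_max size_polyN sf.
have sD t' : t' \in `[0, T] -> (size (ud errors t' i) <= n.+2)%N.
  by move=> ht'; have [w1 _ _] := sizes ht'; apply: sB; rewrite ?size_prj // size_pull ?w1 // elt_lt.
apply: (@poly_limit_pcvg _ n.+1).
- rewrite near_withinE; apply: nearW => s hs.
  by apply: leq_trans (size_scale_leq _ _) _; apply: sB; exact: sD.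
- by apply: sB; rewrite ?size_prj // size_pull ?elt_lt // size_uht.
move=> y _; apply: cvg_by_seq => s_ hs st /=.
pose Y := h i * y + x i.
have c1 : (P i (slope u t (s_ k))).[y] @[k --> \oo] --> (P i (ut t)).[y].
  by apply: slope_prj_cvg; [exact: hu|exact: du|exact: lip|exact: ht|exact: hs|exact: st].
have c2 := cvg_comp _ _ (seq_within hs st) (@uh_slope t i Y ht).
have c3 : (P i (slope u t (s_ k))).[y] - ((uh (S (s_ k)) i).[Y] - (uh (S t) i).[Y]) / (s_ k - t) @[k --> \oo] -->
    (P i (ut t)).[y] - (uht t i).[Y] by apply: cvgB; [exact: c1|exact: c2].
rewrite hornerD hornerN pull_horner -/Y; move: c3.
apply: cvg_trans; apply: near_eq_cvg; apply: nearW => k /=.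
have [h1 _] := hs k.
have i1 := @elt_itb _ _ _ m _ i (itb_cont (hu h1)); have i2 := @elt_itb _ _ _ m _ i (itb_cont (hu ht)).
rewrite /slope prjZ ?prjB //; last exact: itbB.
rewrite !hornerE !pull_horner -/Y; ring.
Qed.

Lemma errors_solve : solves n (tau_qu_m tau) (tau_qu_p tau) (tau_pu_p tau) T x errors.
Proof.
have [_ wd _ pde [ini bc]] := ex; have [_ e1 e0] := sol.
have eqs t : t \in `[0, T] -> exists z F w0, [/\ hdg_equations n.+1 tau z F (uD t) (qN t) (S t),
    forall i : 'I_N, (size (z i) <= n.+2)%N, itb a b w0,
    {ae mu, forall y, y \in `]a, b[ -> w0 y + px t y = F y} &
    forall i : 'I_N, P i w0 - pl i (z i) = if t == 0 then ud errors t i else gd errors t i].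
  move=> ht; have [e|t0] := eqVneq t 0.
    rewrite e; exists (uh (S 0)), (fun x => u0 x + px 0 x), (u 0).
    have h0 : (0 : R) \in `[0, T] by move: ht; rewrite e.
    have [w1 _ _] := sizes h0.
    split=> //; first exact: itb_cont (hu h0).
    by apply: ae_true => y hy; rewrite ini //; exact: subset_itv_oo_cc hy.
  have ht' : t \in `]0, T] by move: ht; rewrite !in_itv /= lt_neqAle eq_sym t0.
  have [s_ [hs st]] := approach hT ht.
  exists (uht t), (f t), (ut t); split=> //; first exact: e1.
  - by move=> i; exact: size_uht.
  - by have it := time_derivative_itb hu du lip ht hs st.
  - exact: pde.
split=> [t i /in0T ht|t /in0T ht|t i /in0T ht]; last exact: errors_rate.
- have [z [F [w0 [h1 h2 h3 h4 h5]]]] := eqs t ht; have [d1 d2 d3] := wd t ht.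
  rewrite -h5; exact: (fixed_time_equations sg_gt0 tau_prod h1 h2 (hu ht) (hq ht) (hp ht) d1 d2 d3 h3 h4 i).
have [z [F [w0 [h1 h2 h3 h4 h5]]]] := eqs t ht.
exact: (fixed_time_boundary hab h1 (bc t ht)).
Qed.

(** * The error estimate *)

Section Rates.
Variables (hm Ku Kq Kp Mq Mp : R) (U Q Pf : nat -> R -> R -> R).
Hypotheses (hm0 : 0 < hm) (hm1 : hm <= 1) (hle : forall i : 'I_N, h i <= hm)
  (Ku0 : 0 <= Ku) (Kq0 : 0 <= Kq) (Kp0 : 0 <= Kp)
  (ru : regular T m 2 n.+2 Ku u U) (rq : regular T m 1 n.+2 Kq q Q) (rp : regular T m 1 n.+2 Kp p Pf)
  (lipq : forall s t x, s \in `[0, T] -> t \in `[0, T] -> x \in `[a, b] ->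
    `|q s x - q t x| <= Mq * `|s - t|)
  (lipp : forall s t x, s \in `[0, T] -> t \in `[0, T] -> x \in `[a, b] ->
    `|p s x - p t x| <= Mp * `|s - t|).
Local Notation G := (gam n hm ^+ 2).

(** A bound for the squares of the trace data; the summand 1 keeps it positive. *)
Definition rate_const : R := 2 * G * (Ku ^+ 2 + Kq ^+ 2 + Kp ^+ 2 + 1).

Let inl (i : 'I_N) : x i \in `[x i, x i.+1].
Proof. by rewrite in_itv /= lexx ltW // elt_lt. Qed.
Let inr (i : 'I_N) : x i.+1 \in `[x i, x i.+1].
Proof. by rewrite in_itv /= lexx andbT ltW // elt_lt. Qed.

Let itbE (v : R -> R -> R) t (i : 'I_N) :
  (forall t, t \in `[0, T] -> {within `[a, b], continuous (v t)}) -> t \in `[0, T] ->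
  itb (x i) (x i.+1) (v t).
Proof. by move=> hv ht; apply: elt_itb; apply: itb_cont; exact: hv. Qed.

Let proj_error_lip (y : 'I_N -> R) r (K0 M' : R) (v : R -> R -> R) V : (forall i : 'I_N, y i \in `[x i, x i.+1]) ->
  0 <= K0 -> regular T m r.+1 n.+2 K0 v V ->
  (forall t, t \in `[0, T] -> {within `[a, b], continuous (v t)}) ->
  (forall s t x, s \in `[0, T] -> t \in `[0, T] -> x \in `[a, b] -> `|v s x - v t x| <= M' * `|s - t|) ->
  forall s t, s \in `[0, T] -> t \in `[0, T] ->
  \sum_(i < N) (proj_error n i (v s) (y i) - proj_error n i (v t) (y i)) ^+ 2 <= G * K0 ^+ 2 * (s - t) ^+ 2.
Proof.
move=> hy K00 reg hv lv s t hs ht.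
have := proj_error_lipschitz hab hT hm0 hle hy K00 reg hv lv isT hs ht.
rewrite !exprMn real_normK ?num_real //; apply: le_trans; apply: ler_sum => i _.
by rewrite proj_errorB //; exact: itbE.
Qed.

Let second (v : R -> R -> R) (i : 'I_N) y s t e :
  (forall t, t \in `[0, T] -> {within `[a, b], continuous (v t)}) ->
  0 <= s -> 0 <= t -> 0 <= e -> s + e <= T -> t + e <= T ->
  proj_error n i (fun z => v (s + e) z - v s z - (v (t + e) z - v t z)) y =
  proj_error n i (v (s + e)) y - proj_error n i (v s) y - (proj_error n i (v (t + e)) y - proj_error n i (v t) y).
Proof.
move=> hv s0 t0 e0 sT tT.
have i1 : itb (x i) (x i.+1) (v (s + e)) by apply: itbE => //; apply: in0T; lra.
have i2 : itb (x i) (x i.+1) (v s) by apply: itbE => //; apply: in0T; lra.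
have i3 : itb (x i) (x i.+1) (v (t + e)) by apply: itbE => //; apply: in0T; lra.
have i4 : itb (x i) (x i.+1) (v t) by apply: itbE => //; apply: in0T; lra.
by rewrite !proj_errorB //; exact: itbB.
Qed.

Lemma errors_bounds : trace_bounds T x rate_const errors.
Proof.
split=> [t /in0T ht|s t /in0T hs /in0T ht|s t e s0 t0 e0 sT tT].
- have b1 := proj_error_bound hab hT hm0 hle inl Ku0 ru hu lip ht.
  have b2 := proj_error_bound hab hT hm0 hle inr Ku0 ru hu lip ht.
  have b3 := proj_error_bound hab hT hm0 hle inl Kq0 rq hq lipq ht.
  have b4 := proj_error_bound hab hT hm0 hle inr Kq0 rq hq lipq ht.
  have b5 := proj_error_bound hab hT hm0 hle inl Kp0 rp hp lipp ht.
  have b6 := proj_error_bound hab hT hm0 hle inr Kp0 rp hp lipp ht.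
  move: b1 b2 b3 b4 b5 b6; rewrite /trsq /= !big_split /= /rate_const ![(gam n hm * _) ^+ 2]exprMn.
  have := sqr_ge0 (gam n hm); lra.
- have b1 := proj_error_lip inl Ku0 ru hu lip hs ht.
  have b2 := proj_error_lip inr Ku0 ru hu lip hs ht.
  have b3 := proj_error_lip inl Kq0 rq hq lipq hs ht.
  have b4 := proj_error_lip inr Kq0 rq hq lipq hs ht.
  have b5 := proj_error_lip inl Kp0 rp hp lipp hs ht.
  have b6 := proj_error_lip inr Kp0 rp hp lipp hs ht.
  move: b1 b2 b3 b4 b5 b6; rewrite /trsq /= !big_split /= /rate_const.
  have := mulr_ge0 (sqr_ge0 (gam n hm)) (sqr_ge0 (s - t)).
  move: (\sum_(i < N) _) => c1; move: (\sum_(i < N) _) => c2; move: (\sum_(i < N) _) => c3.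
  move: (\sum_(i < N) _) => c4; move: (\sum_(i < N) _) => c5; move: (\sum_(i < N) _) => c6.
  lra.
have b1 := proj_error_second_difference hab hT hm0 hle inl Ku0 ru hu lip isT s0 t0 e0 sT tT.
have wd t' : t' \in `[0, T] -> weak_deriv a b (u t') (q t').
  by move=> ht'; case: ex => _ H _ _ _; have [] := H _ ht'.
have b2 := proj_error_derivative hab hT hm0 hle Ku0 ru hu hq wd lip s0 t0 e0 sT tT.
have d0 : 0 <= G * ((s - t) ^+ 2 * e ^+ 2).
  by apply: mulr_ge0; [|apply: mulr_ge0]; exact: sqr_ge0.
apply: (@le_trans _ _ (2 * (gam n hm * Ku * (`|s - t| * e)) ^+ 2)).
  rewrite mulr2n mulrDl mul1r; apply: le_trans (lerD b1 b2).
  rewrite -big_split /=; apply: ler_sum => i _.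
  have hh0 : 0 < hh x i by rewrite subr_gt0 elt_lt.
  have hh1 : hh x i <= 1 := le_trans (hle i) hm1.
  rewrite mulrDr (second _ _ hu) // (second _ _ hq) //; apply: lerD; last exact: lexx.
  by rewrite ler_piMl ?sqr_ge0 // expr_le1 // ltW.
have -> : (gam n hm * Ku * (`|s - t| * e)) ^+ 2 = G * Ku ^+ 2 * ((s - t) ^+ 2 * e ^+ 2).
  by rewrite !exprMn real_normK ?num_real.
have q0 := mulr_ge0 d0 (sqr_ge0 Kq); have p0 := mulr_ge0 d0 (sqr_ge0 Kp).
by move: q0 p0 d0; rewrite /rate_const; lra.
Qed.

Let bk_within (w : R -> R) : {within `[a, b], continuous w} -> bounded_kernel a b w.
Proof.
move=> cw; have [B hB] := bounded_within cw; exists B; split; first exact: itb_meas (itb_cont cw).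
by move=> y hy; apply: hB; exact: subset_itv_oo_cc hy.
Qed.

Let K_le (K0 : R) : K0 ^+ 2 <= Ku ^+ 2 + Kq ^+ 2 + Kp ^+ 2 -> (gam n hm * K0) ^+ 2 <= rate_const.
Proof.
move=> h; rewrite exprMn /rate_const; have g0 := sqr_ge0 (gam n hm).
have := ler_wpM2l g0 h; have := mulr_ge0 g0 (addr_ge0 (addr_ge0 (sqr_ge0 Ku) (sqr_ge0 Kq)) (sqr_ge0 Kp)); lra.
Qed.

Let proj_error_norm r (K0 M' : R) (v : R -> R -> R) V : K0 ^+ 2 <= Ku ^+ 2 + Kq ^+ 2 + Kp ^+ 2 ->
  0 <= K0 -> regular T m r n.+2 K0 v V ->
  (forall t, t \in `[0, T] -> {within `[a, b], continuous (v t)}) ->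
  (forall s t x, s \in `[0, T] -> t \in `[0, T] -> x \in `[a, b] -> `|v s x - v t x| <= M' * `|s - t|) ->
  forall t, t \in `[0, T] ->
  \sum_(i < N) itg (x i) (x i.+1) (fun y => proj_error n i (v t) y ^+ 2) <= hm * rate_const.
Proof.
move=> hK K00 reg hv lv t ht; apply: (proj_error_L2 hm0 hle (hv _ ht)) => y hy.
by apply: le_trans (proj_error_bound hab hT hm0 hle hy K00 reg hv lv ht) _; exact: K_le.
Qed.

Variable (C : R).
Hypotheses (C0 : 0 <= C) (gr : grid (b - a) N x)
  (est : forall t, 0 <= t <= T ->
    wnorm x (ud errors t) + wnorm x (qd errors t) + wnorm x (pd errors t) <= C * (hm * rate_const))
  (est_diff : forall s t, 0 <= s <= T -> 0 <= t <= T ->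
    wnorm x (fun i => ud errors s i - ud errors t i) <= C * (hm * rate_const) * (s - t) ^+ 2).

Let bound := (Num.sqrt (2 * (hm * rate_const) + 2 * (C * (hm * rate_const)))).

(** The projection part and the discrete part are limits of those of the difference
    quotients of u, for which the Lipschitz bounds apply. *)
Lemma error_ut t : t \in `[0, T] -> (L2norm a b (fun x => ut t x - pwfun (uht t) x)%R <= bound%:E)%E.
Proof.
move=> ht; have [s_ [hs st]] := approach hT ht.
have ht' : 0 <= t <= T by move: ht; rewrite in_itv.
apply: error_norm.
- exists M; split; first exact: itb_meas (time_derivative_itb hu du lip ht hs st).
  by move=> y hy; exact: (time_derivative_le du lip ht hs st).
- have cv : \sum_(i < N) itg (x i) (x i.+1) (fun y => proj_error n i (slope u t (s_ k)) y ^+ 2) @[k --> \oo] -->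
      \sum_(i < N) itg (x i) (x i.+1) (fun y => proj_error n i (ut t) y ^+ 2).
    by apply: cvg_sumr => i _; apply: slope_perr_cvg; [exact: hu|exact: du|exact: lip|exact: ht|exact: hs|exact: st].
  apply: (ler_cvg_to cv (cvg_cst _)); apply: nearW => k; have [h1 h2] := hs k.
  have st0 : 0 < (s_ k - t) ^+ 2 by rewrite exprn_even_gt0 // subr_eq0.
  have le1 := proj_error_L2 hm0 hle (within_sub (hu h1) (hu ht))
    (fun y hy => proj_error_lipschitz hab hT hm0 hle hy Ku0 ru hu lip isT h1 ht).
  have -> : \sum_(i < N) itg (x i) (x i.+1) (fun y => proj_error n i (slope u t (s_ k)) y ^+ 2) =
      (s_ k - t) ^- 2 * \sum_(i < N) itg (x i) (x i.+1) (fun y => proj_error n i (fun z => u (s_ k) z - u t z) y ^+ 2).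
    rewrite mulr_sumr; apply: eq_bigr => i _.
    have id : itb (x i) (x i.+1) (fun z => u (s_ k) z - u t z) by apply: itbB; exact: itbE.
    rewrite -itgZ; last first.
      apply: itb_cont; have c1 : {within `[x i, x i.+1], continuous (proj_error n i (fun z => u (s_ k) z - u t z))}.
        apply: within_sub; last exact: (@el_within _ (x i) (x i.+1)).
        by apply: elt_within; apply: within_sub; exact: hu.
      by have c2 := c1; exact: (within_mul c1 c2).
    by apply: itg_ext => y _; rewrite /slope proj_errorZ // exprMn exprVn.
  rewrite mulrC ler_pdivrMr //; apply: le_trans le1 _.
  rewrite [(gam n hm * Ku * _) ^+ 2]exprMn real_normK ?num_real // mulrA ler_wpM2r ?sqr_ge0 //.
  apply: ler_wpM2l; first exact: ltW.
  by apply: K_le; have := sqr_ge0 Kq; have := sqr_ge0 Kp; lra.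
have pc (i : 'I_N) : pcvg (F := \oo) (fun k => (s_ k - t)^-1 *: (ud errors (s_ k) i - ud errors t i)) (gd errors t i).
  exact: (pcvg_comp (seq_within hs st) (errors_rate i ht)).
have cv := wnorm_cvg (x := x) eventually_filter pc.
apply: (ler_cvg_to cv (cvg_cst _)); apply: nearW => k; have [h1 h2] := hs k.
have st0 : 0 < (s_ k - t) ^+ 2 by rewrite exprn_even_gt0 // subr_eq0.
have h1' : 0 <= s_ k <= T by move: h1; rewrite /= in_itv.
rewrite wnorm_scale exprVn mulrC ler_pdivrMr //; exact: est_diff.
Qed.

Lemma error_uqp t : t \in `[0, T] ->
  [/\ (L2norm a b (fun x => u t x - pwfun (uh (S t)) x)%R <= bound%:E)%E,
      (L2norm a b (fun x => q t x - pwfun (qh (S t)) x)%R <= bound%:E)%E &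
      (L2norm a b (fun x => p t x - pwfun (ph (S t)) x)%R <= bound%:E)%E].
Proof.
move=> ht; have ht' : 0 <= t <= T by move: ht; rewrite in_itv.
have e := est ht'.
have n1 := wnorm_ge0 (ud errors t) gr; have n2 := wnorm_ge0 (qd errors t) gr.
have n3 := wnorm_ge0 (pd errors t) gr.
have su := sqr_ge0 Ku; have sq := sqr_ge0 Kq; have sp := sqr_ge0 Kp.
split; apply: error_norm.
- exact: bk_within (hu ht).
- by apply: (proj_error_norm _ Ku0 ru hu lip ht); lra.
- by apply: le_trans _ (_ : wnorm x (ud errors t) <= _); [exact: lexx|lra].
- exact: bk_within (hq ht).
- by apply: (proj_error_norm _ Kq0 rq hq lipq ht); lra.
- by apply: le_trans _ (_ : wnorm x (qd errors t) <= _); [exact: lexx|lra].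
- exact: bk_within (hp ht).
- by apply: (proj_error_norm _ Kp0 rp hp lipp ht); lra.
- by apply: le_trans _ (_ : wnorm x (pd errors t) <= _); [exact: lexx|lra].
Qed.

End Rates.

End InTime.

Lemma mesh_sizeP (R : realType) (a b : R) (m : mesh a b) (i : 'I_(nelt m)) :
  node m i.+1 - node m i <= mesh_size m.
Proof. exact: (le_bigmax _ (fun i : 'I_(nelt m) => node m i.+1 - node m i) i). Qed.

Theorem theorem2p4 (R : realType) (a b T : R) (hab : a < b) (hT : 0 < T)
    (k : nat) (hk : (0 < k)%N) (tau : stabilization R)
    (tau_qu_m_gt0 : 0 < tau_qu_m tau)
    (tau_m_prod : tau_qu_m tau * tau_qp_m tau = 1)
    (tau_qu_p_in : tau_qu_p tau \in `[0, 1])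
    (tau_pu_p_in : tau_pu_p tau \in
       `[- 1 - Num.sqrt (1 - tau_qu_p tau ^+ 2),
         - 2^-1 - 2^-1 * tau_qu_p tau ^+ 2]) :
  exists2 h0 : R, 0 < h0 &
  forall (f : R -> R -> R) (u0 : R -> R) (uD : R -> R -> R) (qN : R -> R)
    (u q p ut px : R -> R -> R),
  @exact_solution R a b T f u0 uD qN u q p ut px ->
  exists C : R,
  forall m : mesh a b, mesh_size m <= h0 ->
  bochner_Winfty m T 2 k.+1 u ->
  bochner_Winfty m T 1 k.+1 q ->
  bochner_Winfty m T 1 k.+1 p ->
  forall (S : R -> hdg_state R (nelt m)) (uht : R -> 'I_(nelt m) -> {poly R}),
  (* px 0 is the third derivative of u0, so the fourth argument is
     u0 + (u0)_xxx *)
  hdg_solution k tau T f (fun x => u0 x + px 0 x) uD qN S uht ->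
  forall t : R, t \in `[0, T] ->
  (L2norm a b (fun x => u t x - pwfun (uh (S t)) x)%R
   + L2norm a b (fun x => q t x - pwfun (qh (S t)) x)%R
   + L2norm a b (fun x => p t x - pwfun (ph (S t)) x)%R
   + L2norm a b (fun x => ut t x - pwfun (uht t) x)%R
   <= (C * mesh_size m ^+ k.+1)%:E)%E.
Proof.
case: k hk => // n _.
have tqu0 : 0 <= tau_qu_p tau by move: tau_qu_p_in; rewrite in_itv /= => /andP[].
have tpu1 : tau_pu_p tau <= - 2^-1 - 2^-1 * tau_qu_p tau ^+ 2.
  by move: tau_pu_p_in; rewrite in_itv /= => /andP[].
have ab0 : 0 < b - a by rewrite subr_gt0.
have [Cd Cd0 estimate] := discrete_error n tau_qu_m_gt0 tqu0 tpu1 ab0 hT.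
(* The stability estimates are for elements of length at most 1. *)
exists 1 => // f u0 uD qN u q p ut px ex.
have [Ku Ku0 regu] := uniform_regularity hab hT 2 u (isT : (0 < n.+2)%N).
have [Kq Kq0 regq] := uniform_regularity hab hT 1 q (isT : (0 < n.+2)%N).
have [Kp Kp0 regp] := uniform_regularity hab hT 1 p (isT : (0 < n.+2)%N).
pose c := (2 + 2 * Cd) * (2 * (1 + prjC n.+2 : R) ^+ 2 * (Ku ^+ 2 + Kq ^+ 2 + Kp ^+ 2 + 1)).
have K1 : 0 < Ku ^+ 2 + Kq ^+ 2 + Kp ^+ 2 + 1.
  by have := sqr_ge0 Ku; have := sqr_ge0 Kq; have := sqr_ge0 Kp; lra.
have P1 : 0 < 1 + prjC n.+2 :> R by rewrite ltr_pwDl // prjC_ge0.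
have c0 : 0 <= c.
  apply: mulr_ge0; first by rewrite addr_ge0 // mulr_ge0.
  by apply: mulr_ge0; [rewrite mulr_ge0 // sqr_ge0|exact: ltW].
exists (4 * Num.sqrt c) => m hm1 wu wq wp S uht sol t ht.
have [U ru] := regu m wu; have [Q rq] := regq m wq; have [Pf rp] := regp m wp.
have [j jN] := last_elt m hab.
have hm0 : 0 < mesh_size m.
  by apply: lt_le_trans (mesh_sizeP j); rewrite subr_gt0 elt_lt.
have [cx wd du _ _] := ex.
have hu t' : t' \in `[0, T] -> {within `[a, b], continuous (u t')} by move=> /cx[].
have hq t' : t' \in `[0, T] -> {within `[a, b], continuous (q t')} by move=> /cx[].
have hp t' : t' \in `[0, T] -> {within `[a, b], continuous (p t')} by move=> /cx[].
have w1 t' : t' \in `[0, T] -> weak_deriv a b (u t') (q t') by move=> /wd[].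
have w2 t' : t' \in `[0, T] -> weak_deriv a b (q t') (p t') by move=> /wd[].
have [Mu lipu] := lipschitz_of_derivative hab hT hu du ru.
have [Mq lipq] := lipschitz_of_primitive hab hT hu hq w1 lipu rq.
have [Mp lipp] := lipschitz_of_primitive hab hT hq hp w2 lipq rp.
have gr : grid (b - a) (nelt m) (node m).
  split=> [i hi|i|]; [exact: node_lt|exact: le_trans (mesh_sizeP i) hm1|].
  by rewrite node_first node_last.
have xl : node m (nelt m) - node m 0 = b - a by rewrite node_first node_last.
have tb : trace_bounds T (node m) (rate_const n (mesh_size m) Ku Kq Kp) (errors n tau u q p ut S uht).
  exact: (errors_bounds hab hT tau ex S uht lipu hm0 hm1 (@mesh_sizeP _ _ _ m) Ku0 Kq0 Kp0 ru rq rp lipq lipp).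
have so := errors_solve hab hT tau_qu_m_gt0 tau_m_prod ex sol lipu.
have B0 : 0 < rate_const n (mesh_size m) Ku Kq Kp.
  have g0 : 0 < gam n (mesh_size m).
    by apply: mulr_gt0 => //; apply: mulr_gt0; [exact: exprn_gt0|rewrite sqrtr_gt0].
  by apply: mulr_gt0 => //; apply: mulr_gt0 => //; exact: exprn_gt0.
have [e1 e2] := estimate _ _ _ _ _ gr xl (@mesh_sizeP _ _ _ m) hm0 B0 tb so.
have [n1 n2 n3] := error_uqp hab hT ex lipu hm0 (@mesh_sizeP _ _ _ m) Ku0 Kq0 Kp0 ru rq rp lipq lipp gr e1 ht.
have n4 := error_ut hab hT ex sol lipu hm0 (@mesh_sizeP _ _ _ m) Ku0 ru e2 ht.
(* hm * rate_const is a constant times the square of hm ^+ n.+2. *)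
have eB : Num.sqrt (2 * (mesh_size m * rate_const n (mesh_size m) Ku Kq Kp) +
    2 * (Cd * (mesh_size m * rate_const n (mesh_size m) Ku Kq Kp))) = Num.sqrt c * mesh_size m ^+ n.+2.
  have -> : 2 * (mesh_size m * rate_const n (mesh_size m) Ku Kq Kp) +
      2 * (Cd * (mesh_size m * rate_const n (mesh_size m) Ku Kq Kp)) = c * (mesh_size m ^+ n.+2) ^+ 2.
    have -> : mesh_size m ^+ n.+2 = mesh_size m * mesh_size m ^+ n.+1 by rewrite exprS.
    have eG : gam n (mesh_size m) ^+ 2 = (1 + prjC n.+2) ^+ 2 * ((mesh_size m ^+ n.+1) ^+ 2 * mesh_size m).
      by rewrite /gam exprMn [(_ * Num.sqrt _) ^+ 2]exprMn sqr_sqrtr // ltW.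
    rewrite /rate_const eG /c; move: (mesh_size m ^+ n.+1) => y; ring.
  by rewrite sqrtrM // sqrtr_sqr ger0_norm // exprn_ge0 // ltW.
rewrite eB in n1 n2 n3 n4.
apply: le_trans (leeD (leeD (leeD n1 n2) n3) n4) _.
by rewrite -!EFinD lee_fin; lra.
Qed.
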